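(* Let $a\in[\frac{2\pi}{5},\frac{\pi}{2})$ be fixed. For any sequences of complex numbers $\{\lambda_{n,1,1}\}_{n\in\mathbb{Z}}$ and $\{\lambda_{n,1,2}\}_{n\in\mathbb{Z}}$ to be the spectra of some boundary value problems $B_{1,1}(Q)$ and $B_{1,2}(Q)$ (with one and the same $Q$) with $q,p\in L_{2}(0,\pi)$, respectively, it is necessary and sufficient that the following two conditions be satisfied: (i) For $j=1,2$, the sequence $\{\lambda_{n,1,j}\}_{n\in\mathbb{Z}}$ has the form $$\lambda_{n,1,j}=n+\frac{1-j}{2}+\kappa_{n,1,j},\quad\{\kappa_{n,1,j}\}_{n\in\mathbb{Z}}\in l_2;$$ (ii) The exponential types of the functions $\Delta_{1,1}(\lambda)+\sin\lambda\pi$ and $\Delta_{1,2}(\lambda)-\cos\lambda\pi$ do not exceed $\pi-a$, where the functions $\Delta_{1,1}(\lambda)$ and $\Delta_{1,2}(\lambda)$ are determined by the formulae $$\Delta_{1,1}(\lambda)=\pi(\lambda_{0,1,1}-\lambda)\prod_{|n|\in\mathbb{N}}\frac{\lambda_{n,1,1}-\lambda}{n}\exp\left(\frac{\lambda}{n}\right),\qquad \Delta_{1,2}(\lambda)=\prod_{n\in\mathbb{Z}}\frac{\lambda_{n,1,2}-\lambda}{n-\frac12}\exp\left(\frac{\lambda}{n-\frac12}\right).$$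
   Context: Consider the Dirac-type system with constant delay $a$: $$By'(x)+Q(x)y(x-a)=\lambda y(x),\quad x\in(0,\pi),$$ where $$B=\begin{bmatrix} 0 & 1 \\ -1 & 0 \end{bmatrix},\quad Q(x)=\begin{bmatrix} q(x) & p(x) \\ p(x) & -q(x) \end{bmatrix},\quad y(x)=\begin{bmatrix} y_1(x) \\ y_2(x) \end{bmatrix},$$ $q,p$ are complex-valued functions in $L_2(0,\pi)$, and $Q(x)=0$ on $(0,a)$ (so the values of $y$ at negative arguments play no role). For $\nu,j\in\{1,2\}$, $B_{\nu,j}(Q)$ denotes the boundary value problem for this system with boundary conditions $y_\nu(0)=0$, $y_j(\pi)=0$. Let $Y(x,\lambda)=[y_{k,l}(x,\lambda)]_{k,l=1,2}$ be the fundamental matrix solution of the system with $Y(0,\lambda)$ equal to the identity matrix. The eigenvalues of $B_{\nu,j}(Q)$ are the zeros of its characteristic function, the entire function $y_{j,3-\nu}(\pi,\lambda)$. The spectrum of $B_{\nu,j}(Q)$ is the sequence $\{\lambda_{n,\nu,j}\}_{n\in\mathbb{Z}}$ of these zeros, counted with multiplicity and numbered so that $$\lambda_{n,\nu,j}=n+\frac{2-\nu-j}{2}+\kappa_{n,\nu,j},\quad\{\kappa_{n,\nu,j}\}_{n\in\mathbb{Z}}\in l_2$$ (such a numbering always exists). The product over $|n|\in\mathbb{N}$ is over all nonzero integers $n$. *)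

(* Defs.v *)
From HB Require Import structures.
From mathcomp Require Import all_boot all_order all_algebra.
From mathcomp Require Import all_classical all_reals all_analysis.
From mathcomp Require Import complex.

Set Implicit Arguments.
Unset Strict Implicit.
Unset Printing Implicit Defensive.

Import Order.TTheory GRing.Theory Num.Theory.
Import numFieldNormedType.Exports.
Import Normc.

Local Open Scope classical_set_scope.
Local Open Scope ring_scope.
Local Open Scope complex_scope.

Section ComplexFunctions.
Context {R : realType}.
Implicit Types (f : R[i] -> R[i]) (z : R[i]).

Definition cexp z : R[i] :=
  (expR (complex.Re z))%:C * (cos (complex.Im z) +i* sin (complex.Im z)).

Definition csin z : R[i] := (cexp ('i * z) - cexp (- ('i * z))) / (2 * 'i).

Definition ccos z : R[i] := (cexp ('i * z) + cexp (- ('i * z))) / 2.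

(* The infimum of all t with f(z) = O(exp(t|z|)). *)
Definition exponential_type f : \bar R :=
  ereal_inf [set t%:E | t in [set t : R |
    exists M : R, forall z, normc (f z) <= M * expR (t * normc z)]].

(* R[i]^o is R[i] as a normed space over itself, so the derivatives are complex
   ones; for m = 0, z is not a zero of f. *)
Definition zero_of_order f z (m : nat) : Prop :=
  (forall k, (k < m)%N -> derive1n k (f : R[i] -> R[i]^o) z = 0) /\
  derive1n m (f : R[i] -> R[i]^o) z != 0.

Definition zeros_with_multiplicity f (lam : int -> R[i]) : Prop :=
  forall z, exists m : nat,
    zero_of_order f z m /\ ([set n : int | lam n = z] #= `I_m)%card.

Definition in_l2 (kappa : int -> R[i]) : Prop :=
  (\esum_(n in [set: int]) ((normc (kappa n)) ^+ 2)%:E < +oo)%E.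

(* Products over nonzero integers and over all integers, as limits of the
   symmetric partial products over |n| <= N. The products used below converge
   absolutely, so the order of the factors is immaterial for them. *)
Definition prod_nonzero (u : int -> R[i]) : R[i] :=
  lim ((fun N : nat =>
    (\prod_(1 <= k < N.+1) (u k%:Z * u (- k%:Z)) : R[i]^o)) @ \oo).

Definition prod_int (u : int -> R[i]) : R[i] := u 0 * prod_nonzero u.

End ComplexFunctions.

Section RealVariable.
Context {R : realType}.
Implicit Types (f : R -> R[i]).

(* The space L_2(0, pi) of complex-valued functions, by Borel representatives. *)
Definition in_L2 f : Prop :=
  [/\ measurable_fun `]0%R, pi[%classic (fun x => complex.Re (f x)),
      measurable_fun `]0%R, pi[%classic (fun x => complex.Im (f x)) &
      (\int[@lebesgue_measure R]_(x in `]0%R, pi[) ((normc (f x)) ^+ 2)%:E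
         < +oo)%E].

Definition absolutely_continuous (a b : R) f : Prop :=
  forall e : R, 0 < e -> exists2 d : R, 0 < d &
    forall (n : nat) (u v : 'I_n -> R),
      (forall i, a <= u i /\ u i <= v i /\ v i <= b) ->
      trivIset [set: 'I_n] (fun i => `]u i, v i[%classic) ->
      \sum_(i < n) (v i - u i) < d ->
      \sum_(i < n) normc (f (v i) - f (u i)) < e.

Definition derivable_cplx f (x : R) : Prop :=
  derivable (fun t => complex.Re (f t)) x 1 /\
  derivable (fun t => complex.Im (f t)) x 1.

Definition derive_cplx f (x : R) : R[i] :=
  derive1 (fun t => complex.Re (f t)) x +i*
  derive1 (fun t => complex.Im (f t)) x.

End RealVariable.

Section DiracSystem.
Context {R : realType}.
Implicit Types (a : R) (q p : R -> R[i]) (nu j : nat) (lam : int -> R[i]).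

Definition mx2 (a11 a12 a21 a22 : R[i]) : 'M[R[i]]_2 :=
  \matrix_(k < 2, l < 2)
    if k == 0 then (if l == 0 then a11 else a12)
    else (if l == 0 then a21 else a22).

Definition Bmx : 'M[R[i]]_2 := mx2 0 1 (- 1) 0.

Definition Qmx q p (x : R) : 'M[R[i]]_2 := mx2 (q x) (p x) (p x) (- q x).

Definition potential a q p : Prop :=
  [/\ in_L2 q, in_L2 p &
      {ae @lebesgue_measure R, forall x,
         x \in `]0, a[ -> Qmx q p x = 0}].

Definition derive_mx (y : R -> 'M[R[i]]_2) (x : R) : 'M[R[i]]_2 :=
  \matrix_(k, l) derive_cplx (fun t => y t k l) x.

(* Solutions are in the sense of Caratheodory. The values of Y z at negative
   arguments are arbitrary: they only occur multiplied by Q(x) = 0. *)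
Definition fundamental_solution a q p (Y : R[i] -> R -> 'M[R[i]]_2) : Prop :=
  forall z : R[i],
    [/\ forall k l, absolutely_continuous 0 pi (fun x => Y z x k l),
        Y z 0 = 1%:M &
        {ae @lebesgue_measure R, forall x, x \in `]0, pi[ ->
           (forall k l, derivable_cplx (fun t => Y z t k l) x) /\
           Bmx *m derive_mx (Y z) x + Qmx q p x *m Y z (x - a)
             = z *: Y z x}].

(* The characteristic function y_{j,3-nu}(pi, z), for nu, j in {1, 2};
   matrix indices start at 0 here, hence the shift by one. *)
Definition char_fun (Y : R[i] -> R -> 'M[R[i]]_2) nu j (z : R[i]) : R[i] :=
  Y z pi (inord (j - 1)) (inord (3 - nu - 1)).

Definition asymptotic_form nu j lam : Prop :=
  exists2 kappa : int -> R[i], in_l2 kappa &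
    forall n : int, lam n = n%:~R + (2 - nu%:R - j%:R) / 2 + kappa n.

Definition is_spectrum a q p nu j lam : Prop :=
  exists2 Y, fundamental_solution a q p Y &
    zeros_with_multiplicity (char_fun Y nu j) lam /\ asymptotic_form nu j lam.

Definition Delta11 lam (z : R[i]) : R[i] :=
  pi%:C * (lam 0 - z) *
  prod_nonzero (fun n => (lam n - z) / n%:~R * cexp (z / n%:~R)).

Definition Delta12 lam (z : R[i]) : R[i] :=
  prod_int (fun n =>
    (lam n - z) / (n%:~R - 2^-1) * cexp (z / (n%:~R - 2^-1))).

End DiracSystem.

(* Main.v *)
(* Put f = p + i q, h = p - i q and E+ = y_2 + i y_1, E- = y_2 - i y_1.  The system becomes
   E+' = - i z E+ - f E-(x - a), E-' = i z E- - h E+(x - a), and since pi <= 3 a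
   two iterations from the free solution already solve it.  With y_1 (0) = 0 and
   y_2 (0) = 1 this gives E+ (pi) = exp (- i pi z) + int W+ (t) exp (i z (2 t - pi)) dt,
   W+ (t) = - f (t + a / 2) + 1_{t >= a} int f (t + s) h (s) ds, where W+ lives on
   [a / 2, pi - a / 2]; the formula for E- (pi) follows by exchanging f and h and
   replacing z by - z.

   Necessity.  The two characteristic functions are therefore - sin (pi z) and
   cos (pi z) plus transforms of exponential type at most pi - a.  A characteristic
   function and the canonical product with the same zeros differ by a bounded entire
   factor, which equals 1 because both functions behave like the sine along the
   imaginary axis.

   Sufficiency.  The partial fraction expansion of prod (1 + kappa_n / (n - z)) and
   the Riesz-Fischer theorem show that Delta11 + sin and Delta12 - cos are transforms
   of L2 functions on (0, pi), and the type condition confines these functions to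
   [a / 2, pi - a / 2].  It remains to solve for f and h given W+ and W-.  The
   correlation only contributes for a <= t <= pi - a, and because 5 a >= 2 pi it only
   involves f on [2 a, pi] and h on [a, pi - a], where f and h are determined by the
   linear terms alone; so it is known and can be subtracted. *)
Require Import Defs.
From mathcomp Require Import all_boot all_order all_algebra.
From mathcomp Require Import all_classical all_reals all_analysis.
From mathcomp Require Import measurable_realfun complex ring lra zify.
Set Implicit Arguments. Unset Strict Implicit. Unset Printing Implicit Defensive.
Import Order.TTheory GRing.Theory Num.Theory.
Import numFieldNormedType.Exports.
Import Normc.
Local Open Scope classical_set_scope.
Local Open Scope complex_scope.
Local Open Scope ring_scope.

(** * Modulus and limits in the complex numbers *)

Section ComplexNorm.
Context {R : realType}.
Local Notation C := R[i].
Implicit Types (z w : C) (x : R).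

(** The complex analysis is carried by polynomials and finite sums. An entire function is a uniform
    limit of polynomials on every disc, Cauchy's estimate is an average over roots of unity, the
    sine product is a limit of finite products over roots of unity, and Liouville's theorem is a
    quantitative bound on differences. Multiplicities are read off explicit families of derivatives,
    with the kernel differentiated under the integral.

    In the comparison with the canonical product, finitely many zeros may lie anywhere and be
    multiple. On a disc a finite polynomial carries all zeros of the product and can be divided out;
    on the circles of radius N + 1/2 the sine is bounded below.

    The constant 2 pi / 5 comes from the quadratic term: it alters the potentials only on
    [3 a / 2, pi - a / 2], but reads one of them beyond 2 a and the other below pi - a. The
    requirements pi - a / 2 <= 2 a and pi - a <= 3 a / 2 are the same inequality 5 a >= 2 pi.

    [Delta12] is reduced to [Delta11] by a shift of the argument by 1/2. *)

Lemma normcE z : `|z| = (normc z)%:C. Proof. by []. Qed.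

Lemma normc_ge0 z : 0 <= normc z.
Proof. by rewrite -ler0c -normcE. Qed.

Lemma normcR x : normc x%:C = `|x|.
Proof. by rewrite /normc /= expr0n /= addr0 sqrtr_sqr. Qed.

Lemma normc_i : normc ('i%R : C) = 1.
Proof. by rewrite -complexiE /normc /= expr0n /= add0r expr1n sqrtr1. Qed.

Lemma normcB z w : normc (z - w) = normc (w - z).
Proof. by rewrite -normcN opprB. Qed.

Lemma normcX z n : normc (z ^+ n) = normc z ^+ n.
Proof.
by elim: n => [|n IH]; rewrite ?expr0 ?normc1 // !exprS normcM IH.
Qed.

Lemma normc_nat n : normc (n%:R : C) = n%:R.
Proof. by rewrite -(rmorph_nat (real_complex R)) normcR ger0_norm. Qed.

Lemma normc_int (n : int) : normc (n%:~R : C) = `|n|%:~R.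
Proof. by rewrite -(rmorph_int (real_complex R)) normcR intr_norm. Qed.

Lemma normc_eq0 z : (normc z == 0) = (z == 0).
Proof. by apply/eqP/eqP => [/eq0_normc|->]; rewrite ?normc0. Qed.

Lemma normc_gt0 z : (0 < normc z) = (z != 0).
Proof. by rewrite lt_neqAle normc_ge0 andbT eq_sym normc_eq0. Qed.

Lemma normc_prod (I : Type) (r : seq I) (P : pred I) (F : I -> C) :
  normc (\prod_(i <- r | P i) F i) = \prod_(i <- r | P i) normc (F i).
Proof. by elim/big_rec2: _ => [|i y1 y2 _ <-]; rewrite ?normc1 ?normcM. Qed.

Lemma normc_sum (I : Type) (r : seq I) (P : pred I) (F : I -> C) :
  normc (\sum_(i <- r | P i) F i) <= \sum_(i <- r | P i) normc (F i).
Proof.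
elim/big_rec2: _ => [|i y1 y2 _ H]; first by rewrite normc0.
by apply: le_trans (le_normcD _ _) _; rewrite lerD2l.
Qed.

Lemma ler_normcB z w : normc z - normc w <= normc (z - w).
Proof. by rewrite lerBlDr -{1}(subrK w z) le_normcD. Qed.

Lemma ler_normc_dist z w : `|normc z - normc w| <= normc (z - w).
Proof.
by rewrite ler_norml ler_normcB andbT lerNl opprB normcB ler_normcB.
Qed.

Lemma le_Re_normc z : `|complex.Re z| <= normc z.
Proof. by rewrite -lecR -normcE normc_ge_Re. Qed.

Lemma le_Im_normc z : `|complex.Im z| <= normc z.
Proof.
by case: z => a b; rewrite /normc /= -sqrtr_sqr ler_wsqrtr // lerDr sqr_ge0.
Qed.

Lemma normc_le_ReIm z : normc z <= `|complex.Re z| + `|complex.Im z|.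
Proof.
rewrite {1}(complexE z) complexiE; apply: le_trans (le_normcD _ _) _.
by rewrite normcM normc_i mul1r !normcR.
Qed.

Lemma normc_sqr z : normc z ^+ 2 = complex.Re z ^+ 2 + complex.Im z ^+ 2.
Proof. by case: z => a b; rewrite /normc sqr_sqrtr // addr_ge0 ?sqr_ge0. Qed.

(** A positive element of [R[i]] is real, so the complex-valued tolerance of the norm topology can
    be replaced by a real one. *)
Lemma cvgcP (T : Type) (F : set_system T) (FF : Filter F) (u : T -> C) (l : C) :
  (u n : R[i]^o) @[n --> F] --> (l : R[i]^o) <->
  forall e : R, 0 < e -> \forall n \near F, normc (u n - l) < e.
Proof.
split.
- move=> /cvgrPdist_lt H e e0.
  have := H e%:C; rewrite ltcR => /(_ e0); apply: filterS => n.
  by rewrite distrC normcE ltcR.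
- move=> H; apply/cvgrPdist_lt => e e0.
  have er : e = (complex.Re e)%:C by rewrite RRe_real // gtr0_real.
  rewrite er ltcR in e0; have := H _ e0; apply: filterS => n.
  by rewrite er distrC normcE ltcR.
Qed.

Lemma cvgc_norm (T : Type) (F : set_system T) (FF : Filter F) (u : T -> C) (l : C) :
  (u n : R[i]^o) @[n --> F] --> (l : R[i]^o) <->
  normc (u n - l) @[n --> F] --> (0 : R).
Proof.
split.
- move/cvgcP => H; apply/cvgrPdist_lt => e e0; have := H e e0; apply: filterS => n.
  by rewrite sub0r normrN ger0_norm ?normc_ge0.
- move/cvgrPdist_lt => H; apply/cvgcP => e e0; have := H e e0; apply: filterS => n.
  by rewrite sub0r normrN ger0_norm ?normc_ge0.
Qed.

Lemma cvgc_squeeze (T : Type) (F : set_system T) (FF : Filter F) (u : T -> C)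
    (l : C) (b : T -> R) :
  (\forall n \near F, normc (u n - l) <= b n) ->
  b n @[n --> F] --> (0 : R) -> (u n : R[i]^o) @[n --> F] --> (l : R[i]^o).
Proof.
move=> H Hb; apply/cvgc_norm; apply: (squeeze_cvgr _ (cvg_cst 0) Hb).
by apply: filterS H => n ->; rewrite normc_ge0.
Qed.

Lemma nbhscP z (P : C -> Prop) :
  (\forall w \near (z : R[i]^o), P w) <->
  exists2 e : R, 0 < e & forall w, normc (w - z) < e -> P w.
Proof.
split.
- move=> /nbhs_normP[/= e e0 H].
  have er : e = (complex.Re e)%:C by rewrite RRe_real // gtr0_real.
  rewrite er ltcR in e0; exists (complex.Re e) => // w Hw; apply: H => /=.
  by rewrite er /ball_ distrC normcE ltcR.
- move=> [e e0 H]; apply/nbhs_normP; exists e%:C; rewrite /= ?ltcR //.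
  by move=> w; rewrite /ball_ /= distrC normcE ltcR => /H.
Qed.

Lemma cvgc_atP (f : C -> C) (z l : C) :
  (f w : R[i]^o) @[w --> (z : R[i]^o)] --> (l : R[i]^o) <->
  forall e : R, 0 < e -> exists2 d : R, 0 < d &
    forall w, normc (w - z) < d -> normc (f w - l) < e.
Proof.
have FF : Filter (nbhs (z : R[i]^o)) by exact: nbhs_filter.
split.
- by move=> /(@cvgcP C (nbhs (z : R[i]^o)) FF f l) H e /H /nbhscP.
- move=> H; apply/(@cvgcP C (nbhs (z : R[i]^o)) FF f l) => e /H ?.
  exact/nbhscP.
Qed.

Lemma cvgc_uniq (T : Type) (F : set_system T) (FF : ProperFilter F) (u : T -> C) (l l' : C) :
  (u n : R[i]^o) @[n --> F] --> (l : R[i]^o) ->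
  (u n : R[i]^o) @[n --> F] --> (l' : R[i]^o) -> l = l'.
Proof. by move=> H1 H2; apply: (cvg_unique _ H1 H2); exact: norm_hausdorff. Qed.

Lemma normc_cvg_le (T : Type) (F : set_system T) (FF : ProperFilter F) (u : T -> C)
  (l : C) (b : R) : (u n : R[i]^o) @[n --> F] --> (l : R[i]^o) ->
  (\forall n \near F, normc (u n) <= b) -> normc l <= b.
Proof.
move=> /cvgcP H Hb; apply/ler_addgt0Pr => e e0.
have [n [H1 H2]] := @filter_ex _ _ FF _ (@filterI _ _ FF _ _ (H e e0) Hb).
rewrite -(subKr (u n) l); apply: le_trans (le_normcD _ _) _.
by rewrite normcN lerD // ltW.
Qed.

Lemma derive1c_quad (f : C -> R[i]^o) z d (B : R) :
  (forall h : C, normc h <= 1 -> normc (f (h + z) - f z - h * d) <= B * normc h ^+ 2) ->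
  derive1 f z = d.
Proof.
move=> H; apply/cvg_lim; first exact: norm_hausdorff.
apply/cvgcP => e e0.
rewrite near_withinE; apply/nbhscP.
exists (Num.min 1 (e / (`|B| + 1))).
  by rewrite lt_min ltr01 divr_gt0 // ltr_wpDl.
move=> w; rewrite subr0 lt_min => /andP[w1 w2] w0.
have nw : 0 < normc w by rewrite normc_gt0.
have -> : w^-1 *: (f (w + z) - f z) - d = w^-1 * (f (w + z) - f z - w * d).
  by rewrite [RHS]mulrBr mulrA mulVf // mul1r.
rewrite normcM normcV ltr_pdivrMl //.
apply: le_lt_trans (H _ (ltW w1)) _.
rewrite expr2 mulrA mulrC ltr_pM2l //.
apply: (@le_lt_trans _ _ (`|B| * normc w)).
  by rewrite ler_wpM2r ?normc_ge0 // ler_norm.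
move: w2; rewrite ltr_pdivlMr; last by rewrite ltr_wpDl.
by move=> w2; apply: le_lt_trans w2; rewrite mulrC ler_wpM2l ?normc_ge0 // lerDl.
Qed.

End ComplexNorm.

(** * The complex exponential and its Taylor remainder *)

Section ComplexExp.
Context {R : realType}.
Local Notation C := R[i].
Implicit Types (z w : C) (x : R).

Lemma cexp0 : cexp (0 : C) = 1.
Proof. by rewrite /cexp /= expR0 cos0 sin0 mul1r. Qed.

Lemma cexpD z w : cexp (z + w) = cexp z * cexp w.
Proof.
case: z => a b; case: w => c d; rewrite /cexp /= expRD cosD sinD.
by apply/eqP; rewrite eq_complex /=; apply/andP; split; apply/eqP; ring.
Qed.

Lemma normc_cexp z : normc (cexp z) = expR (complex.Re z).
Proof.
rewrite /cexp normcM normcR (ger0_norm (expR_ge0 _)) /normc.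
by rewrite cos2Dsin2 sqrtr1 mulr1.
Qed.

Lemma cexp_neq0 z : cexp z != 0.
Proof. by rewrite -normc_eq0 normc_cexp expR_eq0. Qed.

Lemma cexpN z : cexp (- z) = (cexp z)^-1.
Proof.
by apply: (mulfI (cexp_neq0 z)); rewrite -cexpD subrr cexp0 mulfV // cexp_neq0.
Qed.

Lemma cexpMn z n : cexp (n%:R * z) = cexp z ^+ n.
Proof.
elim: n => [|n IH]; first by rewrite mul0r cexp0 expr0.
by rewrite -natr1 mulrDl mul1r cexpD IH exprSr.
Qed.

Lemma cexp_i x : cexp ('i * x%:C) = cos x +i* sin x.
Proof. by rewrite /cexp /= !(mul0r, mul1r, add0r, mulr0, oppr0, subr0) expR0 mul1r. Qed.

Lemma normc_cexp_i x : normc (cexp ('i * x%:C)) = 1.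
Proof. by rewrite cexp_i /normc cos2Dsin2 sqrtr1. Qed.

(** Derivative of a complex-valued function of a real variable, as a relation that carries both
    existence and value. *)
Definition cder (f : R -> C) (t : R) (d : C) : Prop :=
  is_derive t (1 : R) (fun s => complex.Re (f s)) (complex.Re d) /\
  is_derive t (1 : R) (fun s => complex.Im (f s)) (complex.Im d).

Lemma ReD z w : complex.Re (z + w) = complex.Re z + complex.Re w.
Proof. by case: z => ? ?; case: w. Qed.

Lemma ImD z w : complex.Im (z + w) = complex.Im z + complex.Im w.
Proof. by case: z => ? ?; case: w. Qed.

Lemma ReN z : complex.Re (- z) = - complex.Re z. Proof. by case: z. Qed.

Lemma ImN z : complex.Im (- z) = - complex.Im z. Proof. by case: z. Qed.

Lemma ReM z w : complex.Re (z * w) =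
  complex.Re z * complex.Re w - complex.Im z * complex.Im w.
Proof. by case: z => ? ?; case: w. Qed.

Lemma ImM z w : complex.Im (z * w) =
  complex.Re z * complex.Im w + complex.Im z * complex.Re w.
Proof. by case: z => ? ?; case: w. Qed.

Lemma cder_cst (c : C) t : cder (fun=> c) t 0.
Proof. by split; apply: is_derive_cst. Qed.

Lemma cderD f g t d e : cder f t d -> cder g t e -> cder (fun s => f s + g s) t (d + e).
Proof.
move=> [fr fi] [gr gi]; split.
- under eq_fun do rewrite ReD; rewrite ReD; exact: is_deriveD.
- under eq_fun do rewrite ImD; rewrite ImD; exact: is_deriveD.
Qed.

Lemma cderM f g t d e : cder f t d -> cder g t e ->
  cder (fun s => f s * g s) t (d * g t + f t * e).
Proof.
move=> [fr fi] [gr gi]; split.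
- under eq_fun do rewrite ReM.
  apply: (is_derive_eq (is_deriveB (is_deriveM fr gr) (is_deriveM fi gi))).
  rewrite /GRing.scale /= ReD !ReM; ring.
- under eq_fun do rewrite ImM.
  apply: (is_derive_eq (is_deriveD (is_deriveM fr gi) (is_deriveM fi gr))).
  rewrite /GRing.scale /= ImD !ImM; ring.
Qed.

Lemma cder_cexp z t : cder (fun s => cexp (s%:C * z)) t (z * cexp (t%:C * z)).
Proof.
case: z => a b; split.
- rewrite (_ : (fun s => _) = fun s => expR (s * a) * cos (s * b)); last first.
    by apply/funext => s; rewrite /cexp /= !(mul0r, subr0, addr0).
  apply: is_derive_eq; rewrite /cexp /= !(mul0r, subr0, addr0) /GRing.scale /= ?mulr1; ring.
- rewrite (_ : (fun s => _) = fun s => expR (s * a) * sin (s * b)); last first.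
    by apply/funext => s; rewrite /cexp /= !(mul0r, subr0, addr0).
  apply: is_derive_eq; rewrite /cexp /= !(mul0r, subr0, addr0) /GRing.scale /= ?mulr1; ring.
Qed.

Lemma cder_real t : cder (fun s => s%:C) t 1.
Proof. by split => /=; [exact: is_derive_id|exact: is_derive_cst]. Qed.

Lemma cderX t n : cder (fun s => s%:C ^+ n.+1) t (n.+1%:R * t%:C ^+ n).
Proof.
elim: n => [|n IH]; first by rewrite expr0 mulr1; exact: cder_real.
have := cderM (cder_real t) IH.
under [X in cder X]eq_fun do rewrite -exprS.
by congr cder; rewrite mulrCA -exprS mul1r -[in RHS]natr1 mulrDl mul1r addrC.
Qed.

Lemma cder_sum n (f : nat -> R -> C) t (d : nat -> C) :
  (forall i, (i < n)%N -> cder (f i) t (d i)) ->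
  cder (fun s => \sum_(i < n) f i s) t (\sum_(i < n) d i).
Proof.
elim: n => [|n IH] H.
  by under eq_fun do rewrite big_ord0; rewrite big_ord0; exact: cder_cst.
under eq_fun do rewrite big_ord_recr; rewrite big_ord_recr.
by apply: cderD; [apply: IH => i /ltnW; exact: H|exact: H].
Qed.

(** The mean value theorem holds only for real functions; it is applied to the component of [f] in
    the direction of its total increment [u], minus [normc u] times [g], which has a nonpositive
    derivative. *)
Lemma cder_mvt (f f' : R -> C) (g g' : R -> R) a b : a <= b ->
  (forall t, cder f t (f' t)) -> (forall t : R, is_derive t (1 : R) g (g' t)) ->
  (forall t, a <= t <= b -> normc (f' t) <= g' t) ->
  normc (f b - f a) <= g b - g a.
Proof.
rewrite le_eqVlt => /predU1P[->|ab] Hf Hg H; first by rewrite !subrr normc0.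
set u := f b - f a; set N := normc u.
pose r t := complex.Re u * complex.Re (f t) + complex.Im u * complex.Im (f t) - N * g t.
pose r' t := complex.Re u * complex.Re (f' t) + complex.Im u * complex.Im (f' t) - N * g' t.
have Hr t : is_derive t (1 : R) r (r' t).
  have [? ?] := Hf t; have ? := Hg t.
  by apply: is_derive_eq; rewrite /r' /GRing.scale /=; ring.
have cr : {within `[a, b], continuous r}.
  apply: continuous_subspaceT => t; apply/differentiable_continuous/derivable1_diffP.
  by case: (Hr t).
have [c] := MVT ab (fun t _ => Hr t) cr; rewrite in_itv /= => /andP[ac cb] E.
have le0 : r' c <= 0.
  rewrite /r' subr_le0; apply: le_trans (_ : N * normc (f' c) <= _).
    have := normcM u (conjc (f' c)); rewrite -/N.
    have -> : normc (conjc (f' c)) = normc (f' c) by case: (f' c) => x y; rewrite /normc /= sqrrN.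
    move=> <-; apply: le_trans (le_Re_normc _); rewrite ReM.
    by case: (f' c) => x y /=; rewrite mulrN opprK ler_norm.
  by rewrite ler_wpM2l ?normc_ge0 // H // !ltW.
have : r b - r a <= 0 by rewrite E pmulr_lle0 // subr_gt0.
have -> : r b - r a = N ^+ 2 - N * (g b - g a).
  by rewrite /r normc_sqr /u ReD ImD ReN ImN; ring.
rewrite subr_le0 expr2.
(* For a zero increment the factor [N] cannot be cancelled; then [g a <= g b] follows because [g']
   dominates a norm. *)
have [->|N0] := eqVneq N 0; last by rewrite ler_pM2l // lt_def N0 normc_ge0.
move=> _; have : r' a <= r' a by []. 
rewrite subr_ge0 -subr_ge0.
have crg : {within `[a, b], continuous g}.
  apply: continuous_subspaceT => t; apply/differentiable_continuous/derivable1_diffP.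
  by case: (Hg t).
have [c' + ->] := MVT ab (fun t _ => Hg t) crg; rewrite in_itv /= => /andP[ac' cb'] _.
rewrite mulr_ge0 ?subr_ge0 ?(ltW ab) //; apply: le_trans (normc_ge0 _) (H c' _).
by rewrite !ltW.
Qed.

Definition exp_poly n z : C := \sum_(k < n) z ^+ k / k`!%:R.

(** Along the segment from 0 to [z] the derivative of the remainder of order n + 1 is [z] times the
    remainder of order n. The induction therefore carries the factor t ^ n and integrates it with
    [cder_mvt]. *)
Lemma cexp_taylor n z :
  normc (cexp z - exp_poly n z) <= normc z ^+ n / n`!%:R * expR (normc z).
Proof.
suff H (t : R) : 0 <= t <= 1 -> normc (cexp (t%:C * z) - exp_poly n (t%:C * z)) <=
    normc z ^+ n / n`!%:R * expR (normc z) * t ^+ n.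
  by have := H 1; rewrite mul1r expr1n mulr1; apply; rewrite ler01 lexx.
elim: n t => [|n IH] t /andP[t0 t1].
  rewrite /exp_poly big_ord0 subr0 !expr0 fact0 divr1 mul1r mulr1 normc_cexp ler_expR.
  apply: le_trans (ler_norm _) _; apply: le_trans (le_Re_normc _) _.
  by rewrite normcM normcR ger0_norm // ler_piMl // normc_ge0.
pose f s := cexp (s%:C * z) + \sum_(k < n.+1) (- (z ^+ k / k`!%:R)) * s%:C ^+ k.
have fE s : f s = cexp (s%:C * z) - exp_poly n.+1 (s%:C * z).
  rewrite /f /exp_poly -sumrN; congr (_ + _); apply: eq_bigr => k _.
  by rewrite exprMn mulNr; congr (- _); rewrite mulrC mulrA.
pose K := normc z ^+ n.+1 / n.+1`!%:R * expR (normc z).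
pose f' s := z * (cexp (s%:C * z) - exp_poly n (s%:C * z)).
have f0 : f 0 = 0.
  rewrite fE mul0r cexp0 /exp_poly big_ord_recl expr0 fact0 divr1.
  by rewrite big1 ?addr0 ?subrr // => i _; rewrite exprS !mul0r.
have df s : cder f s (f' s).
  rewrite /f' mulrBr; apply: cderD; first exact: cder_cexp.
  have -> : - (z * exp_poly n (s%:C * z)) = \sum_(k < n.+1)
    (0 * s%:C ^+ k + (- (z ^+ k / k`!%:R)) * (k%:R * s%:C ^+ k.-1)).
    rewrite big_ord_recl /= !mul0r mulr0 !add0r /exp_poly mulr_sumr -sumrN.
    apply: eq_bigr => k _; rewrite mul0r add0r /bump /= add1n exprMn factS natrM.
    have k0 : k`!%:R != 0 :> C by rewrite pnatr_eq0 -lt0n fact_gt0.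
    have k1 : k.+1%:R != 0 :> C by rewrite pnatr_eq0.
    rewrite exprS add0n; move: (k`!%:R) (k.+1%:R) k0 k1 => A B A0 B0.
    by field; rewrite A0 B0.
  apply: (cder_sum (f := fun k s => - (z ^+ k / k`!%:R) * s%:C ^+ k)
    (d := fun k => 0 * s%:C ^+ k + - (z ^+ k / k`!%:R) * (k%:R * s%:C ^+ k.-1))) => k _.
  apply: cderM; first exact: cder_cst.
  case: k => [|k]; last exact: cderX.
  by rewrite mul0r; under eq_fun do rewrite expr0; exact: cder_cst.
have := @cder_mvt f f' (fun s => K * s ^+ n.+1) (fun s => K * (n.+1%:R * s ^+ n)) 0 t t0 df.
rewrite f0 subr0 -fE expr0n mulr0 subr0; apply.
  move=> s; have [H _] := cderX s n.
  have -> : (fun s => K * s ^+ n.+1) = K \*: (fun s : R => complex.Re (s%:C ^+ n.+1)).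
    by apply/funext => x /=; rewrite -[x%:C ^+ _]rmorphXn.
  apply: (is_derive_eq (is_deriveZ K H)).
  by rewrite -[s%:C ^+ _]rmorphXn -(rmorph_nat (real_complex R)) -rmorphM.
move=> s /andP[s0 st]; rewrite /f' normcM.
have s01 : 0 <= s <= 1 by rewrite s0 (le_trans st).
apply: le_trans (ler_wpM2l (normc_ge0 _) (IH s s01)) _.
rewrite le_eqVlt; apply/orP; left; apply/eqP; rewrite /K factS natrM exprS.
have k0 : n`!%:R != 0 :> R by rewrite pnatr_eq0 -lt0n fact_gt0.
have k1 : n.+1%:R != 0 :> R by rewrite pnatr_eq0.
move: (n`!%:R) (n.+1%:R) k0 k1 => A B A0 B0.
by field; rewrite A0 B0.
Qed.

End ComplexExp.

(** * Dominated convergence for sums and products *)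

Section Tannery.
Context {R : realType}.
Local Notation C := R[i].

Lemma cvgc_ReIm (T : Type) (F : set_system T) (FF : Filter F) (u : T -> C) (l : C) :
  complex.Re (u n) @[n --> F] --> complex.Re l ->
  complex.Im (u n) @[n --> F] --> complex.Im l ->
  (u n : R[i]^o) @[n --> F] --> (l : R[i]^o).
Proof.
move=> /cvgrPdist_lt Hr /cvgrPdist_lt Hi; apply/cvgcP => e e0.
have e2 : 0 < e / 2 by rewrite divr_gt0.
apply: filterS2 (Hr _ e2) (Hi _ e2) => n /= h1 h2.
apply: le_lt_trans (normc_le_ReIm _) _.
by rewrite ReD ImD ReN ImN (splitr e) ltrD // distrC.
Qed.

Lemma lim_cvgc (u : nat -> C) (l : C) :
  (u n : R[i]^o) @[n --> \oo] --> (l : R[i]^o) -> lim ((u : nat -> R[i]^o) @ \oo) = l.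
Proof. by move=> H; apply: cvg_lim => //; exact: norm_hausdorff. Qed.

Section Cvgc.
Context (T : Type) (F : set_system T) (FF : Filter F).
Implicit Types (u v : T -> C).
Local Notation "u ~~> l" := ((u t : R[i]^o) @[t --> F] --> (l : R[i]^o)) (at level 70).

Lemma cvgc_cst (c : C) : (fun=> c) ~~> c. Proof. exact: cvg_cst. Qed.

Lemma eq_cvgc u v l : u =1 v -> u ~~> l -> v ~~> l.
Proof. by move=> /funext ->. Qed.

Lemma cvgcD u v l m : u ~~> l -> v ~~> m -> (fun t => u t + v t) ~~> (l + m).
Proof. exact: cvgD. Qed.

Lemma cvgcN u l : u ~~> l -> (fun t => - u t) ~~> (- l).
Proof. exact: cvgN. Qed.

Lemma cvgcB u v l m : u ~~> l -> v ~~> m -> (fun t => u t - v t) ~~> (l - m).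
Proof. by move=> H1 H2; exact: (cvgcD H1 (cvgcN H2)). Qed.

Lemma cvgcM u v l m : u ~~> l -> v ~~> m -> (fun t => u t * v t) ~~> (l * m).
Proof. exact: cvgM. Qed.

Lemma cvgcV u l : l != 0 -> u ~~> l -> (fun t => (u t)^-1) ~~> l^-1.
Proof. exact: cvgV. Qed.

Lemma cvgcX u l n : u ~~> l -> (fun t => u t ^+ n) ~~> (l ^+ n).
Proof.
move=> H; elim: n => [|n IH].
  by rewrite (_ : (fun t => _) = fun=> 1); [exact: cvgc_cst|apply/funext => t; rewrite expr0].
rewrite (_ : (fun t => _) = fun t => u t * u t ^+ n); last by apply/funext => t; rewrite exprS.
by rewrite exprS; apply: cvgcM.
Qed.

Lemma cvgc_prod (u : T -> nat -> C) (v : nat -> C) n :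
  (forall j, (j < n)%N -> (fun t => u t j) ~~> v j) ->
  (fun t => \prod_(j < n) u t j) ~~> (\prod_(j < n) v j).
Proof.
elim: n => [|n IH] H.
  rewrite big_ord0 (_ : (fun t => _) = fun=> 1); first exact: cvgc_cst.
  by apply/funext => t; rewrite big_ord0.
rewrite big_ord_recr /= (_ : (fun t => _) = fun t => (\prod_(j < n) u t j) * u t n); last first.
  by apply/funext => t; rewrite big_ord_recr.
by apply: cvgcM; [apply: IH => j jn; apply: H; exact: ltnW|exact: H].
Qed.

Lemma cvgc_sum (u : T -> nat -> C) (v : nat -> C) n :
  (forall j, (j < n)%N -> (fun t => u t j) ~~> v j) ->
  (fun t => \sum_(j < n) u t j) ~~> (\sum_(j < n) v j).
Proof.
elim: n => [|n IH] H.
  rewrite big_ord0 (_ : (fun t => _) = fun=> 0); first exact: cvgc_cst.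
  by apply/funext => t; rewrite big_ord0.
rewrite big_ord_recr /= (_ : (fun t => _) = fun t => (\sum_(j < n) u t j) + u t n); last first.
  by apply/funext => t; rewrite big_ord_recr.
by apply: cvgcD; [apply: IH => j jn; apply: H; exact: ltnW|exact: H].
Qed.

End Cvgc.

Lemma ndbounded_tail (W : nat -> R) (B : R) :
  {homo W : m n / (m <= n)%N >-> m <= n} -> (forall n, W n <= B) ->
  forall e : R, 0 < e -> exists m : nat, forall n, W n <= W m + e.
Proof.
move=> Wnd WB e e0.
have cW : cvgn W.
  by apply: nondecreasing_is_cvgn => //; exists B => _ [n _ <-].
have /cvgrPdist_lt /(_ e e0) [m _ Hm] := cW.
exists m => n; apply: le_trans (nondecreasing_cvgn_le Wnd cW n) _.
have := Hm m (leqnn m); rewrite /= => /ltW; rewrite ler_norml => /andP[_].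
by rewrite lerBlDl addrC.
Qed.

(** The real and imaginary parts of [s] become nondecreasing and bounded once [W] is added to
    them. *)
Lemma dominated_cvgc (s : nat -> C) (W : nat -> R) (B : R) :
  (forall m n, (m <= n)%N -> normc (s n - s m) <= W n - W m) ->
  (forall n, W n <= B) ->
  exists l : C, (s n : R[i]^o) @[n --> \oo] --> (l : R[i]^o).
Proof.
move=> H WB.
have Wnd : {homo W : m n / (m <= n)%N >-> m <= n}.
  by move=> m n mn; rewrite -subr_ge0; apply: le_trans (normc_ge0 _) (H _ _ mn).
have cW : cvgn W by apply: nondecreasing_is_cvgn => //; exists B => _ [n _ <-].
have key (g : C -> R) : (forall z w, g z - g w = g (z - w)) ->
    (forall z, `|g z| <= normc z) -> cvgn (g \o s).
  move=> gB gn.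
  have -> : g \o s = (fun n => (g (s n) + W n) - W n) by apply/funext=> n; rewrite addrK.
  apply: is_cvgB => //; apply: nondecreasing_is_cvgn.
    move=> m n mn; rewrite -subr_ge0.
    have -> : g (s n) + W n - (g (s m) + W m) = g (s n - s m) + (W n - W m).
      by rewrite -gB; ring.
    rewrite -lerBlDr sub0r; have := le_trans (gn (s n - s m)) (H _ _ mn).
    by rewrite ler_norml => /andP[].
  exists (g (s 0) + normc 0 + (B - W 0) + B) => _ [n _ <-].
  have := le_trans (gn (s n - s 0)) (H _ _ (leq0n n)).
  rewrite -gB ler_norml => /andP[_]; rewrite normc0; have := WB n; lra.
have cr := key (@complex.Re R) (fun z w => ltac:(by rewrite ReD ReN)) le_Re_normc.
have ci := key (@complex.Im R) (fun z w => ltac:(by rewrite ImD ImN)) le_Im_normc.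
exists (limn (@complex.Re R \o s) +i* limn (@complex.Im R \o s)).
by apply: cvgc_ReIm.
Qed.

(** Tannery's theorem for sums and products at once: only increments of partial results are compared
    with those of [W]. The truncation index [N t] may move with the parameter, and the tail beyond a
    fixed index is small uniformly in [t]. *)
Lemma tannery (T : Type) (F : set_system T) (FF : Filter F) (S : T -> nat -> C)
    (s : nat -> C) (W : nat -> R) (B : R) (N : T -> nat) (l : C) :
  {homo W : m n / (m <= n)%N >-> m <= n} -> (forall n, W n <= B) ->
  (forall t m n, (m <= n)%N -> (n <= N t)%N -> normc (S t n - S t m) <= W n - W m) ->
  (forall m, (S t m : R[i]^o) @[t --> F] --> (s m : R[i]^o)) ->
  (forall m, \forall t \near F, (m <= N t)%N) ->
  (s n : R[i]^o) @[n --> \oo] --> (l : R[i]^o) ->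
  (S t (N t) : R[i]^o) @[t --> F] --> (l : R[i]^o).
Proof.
move=> Wnd WB H Ss FN sl; apply/cvgcP => e e0.
have e3 : 0 < e / 3 by rewrite divr_gt0.
have [m Hm] := ndbounded_tail Wnd WB e3.
have /cvgcP /(_ _ e3) [k _ Hk] := sl.
pose M := maxn m k.
have HW n : (M <= n)%N -> W n - W M <= e / 3.
  move=> _; rewrite lerBlDl; apply: le_trans (Hm n) _.
  by rewrite lerD2r Wnd // leq_maxl.
have /cvgcP /(_ _ e3) H1 := Ss M.
apply: filterS2 H1 (FN M) => t /= h1 h2.
have h3 := le_trans (H t M (N t) h2 (leqnn _)) (HW _ h2).
have h4 := Hk M (leq_maxr _ _).
have -> : S t (N t) - l = (S t (N t) - S t M) + (S t M - s M) + (s M - l) by ring.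
apply: le_lt_trans (le_normcD _ _) _.
apply: le_lt_trans (lerD (le_normcD _ _) (lexx _)) _.
by move: h1 h3 h4 => /=; lra.
Qed.

Lemma sum_dom (u : nat -> C) (U : nat -> R) m n : (m <= n)%N ->
  (forall j, (j < n)%N -> normc (u j) <= U j) ->
  normc (\sum_(j < n) u j - \sum_(j < m) u j) <= \sum_(j < n) U j - \sum_(j < m) U j.
Proof.
elim: n => [|n IH]; first by rewrite leqn0 => /eqP -> _; rewrite !subrr normc0.
rewrite leq_eqVlt => /predU1P[-> _|]; first by rewrite !subrr normc0.
rewrite ltnS => mn H; rewrite !big_ord_recr /= -!(addrAC _ (- _)).
apply: le_trans (le_normcD _ _) _; apply: lerD; last exact: H.
by apply: IH => // j jn; apply: H; rewrite ltnS ltnW.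
Qed.

(** The last increment is [u n] times the shorter product, and that product is bounded factor by
    factor by the majorant. *)
Lemma prod_dom (u : nat -> C) (U : nat -> R) m n : (m <= n)%N ->
  (forall j, (j < n)%N -> normc (u j) <= U j) ->
  normc (\prod_(j < n) (1 + u j) - \prod_(j < m) (1 + u j)) <=
  \prod_(j < n) (1 + U j) - \prod_(j < m) (1 + U j).
Proof.
elim: n => [|n IH]; first by rewrite leqn0 => /eqP -> _; rewrite !subrr normc0.
rewrite leq_eqVlt => /predU1P[-> _|]; first by rewrite !subrr normc0.
rewrite ltnS => mn H; rewrite !big_ord_recr /= !mulrDr !mulr1 -!(addrAC _ (- _)).
have Hn j : (j < n)%N -> normc (u j) <= U j by move=> jn; apply: H; rewrite ltnS ltnW.
apply: le_trans (le_normcD _ _) _; apply: lerD; first exact: IH.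
rewrite normcM; apply: ler_pM (normc_ge0 _) (normc_ge0 _) _ (H _ (leqnn _)).
rewrite normc_prod; apply: ler_prod => j _; rewrite normc_ge0 /=.
by apply: le_trans (le_normcD _ _) _; rewrite normc1 lerD2l Hn.
Qed.

Lemma prod1D_ge1 (U : nat -> R) m n : (m <= n)%N -> (forall j, 0 <= U j) ->
  \prod_(j < m) (1 + U j) <= \prod_(j < n) (1 + U j).
Proof.
move=> mn U0; have := @prod_dom (fun j => (U j)%:C) U m n mn.
have H j : normc (U j)%:C <= U j by rewrite normcR ger0_norm.
by move=> /(_ (fun j _ => H j)) /(le_trans (normc_ge0 _)); rewrite subr_ge0.
Qed.

Lemma prod1D_exp (U : nat -> R) (B : R) n : (forall j, 0 <= U j) ->
  \sum_(j < n) U j <= B -> \prod_(j < n) (1 + U j) <= expR B.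
Proof.
move=> U0 H; apply: le_trans (_ : expR (\sum_(j < n) U j) <= _); last by rewrite ler_expR.
elim: n {H} => [|n IH]; first by rewrite !big_ord0 expR0.
rewrite !big_ord_recr /= expRD ler_pM // ?addr_ge0 // ?prodr_ge0 // => *; rewrite ?addr_ge0 //.
exact: expR_ge1Dx.
Qed.

Lemma prod_near1 (u : nat -> C) (B : R) n : \sum_(j < n) normc (u j) <= B ->
  normc (\prod_(j < n) (1 + u j) - 1) <= expR B - 1.
Proof.
move=> H; have := @prod_dom u (fun j => normc (u j)) 0 n (leq0n n) (fun _ _ => lexx _).
rewrite !big_ord0 => /le_trans; apply; rewrite lerD2r.
by apply: (@prod1D_exp (fun j => normc (u j))) => // j; apply: normc_ge0.
Qed.

Lemma prod_bound (u : nat -> C) (B : R) n : \sum_(j < n) normc (u j) <= B ->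
  normc (\prod_(j < n) (1 + u j)) <= expR B.
Proof.
move=> H; rewrite -[\prod_(j < n) _](subrK 1); apply: le_trans (le_normcD _ _) _.
by rewrite normc1 -lerBrDr prod_near1.
Qed.

Lemma prod_cvgc (u : nat -> C) (B : R) :
  (forall n, \sum_(j < n) normc (u j) <= B) ->
  exists l : C, (\prod_(j < n) (1 + u j) : R[i]^o) @[n --> \oo] --> (l : R[i]^o).
Proof.
move=> H; apply: (@dominated_cvgc _ (fun n => \prod_(j < n) (1 + normc (u j))) (expR B)).
  by move=> m n mn; apply: (prod_dom (U := fun j => normc (u j))).
by move=> n; apply: (@prod1D_exp (fun j => normc (u j))) => // j; apply: normc_ge0.
Qed.

Lemma sum_cvgc (u : nat -> C) (B : R) :
  (forall n, \sum_(j < n) normc (u j) <= B) ->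
  exists l : C, (\sum_(j < n) u j : R[i]^o) @[n --> \oo] --> (l : R[i]^o).
Proof.
move=> H; apply: (@dominated_cvgc _ (fun n => \sum_(j < n) normc (u j)) B) => //.
by move=> m n mn; apply: (sum_dom (U := fun j => normc (u j))).
Qed.

Lemma prod_tannery (T : Type) (F : set_system T) (FF : Filter F) (u : T -> nat -> C)
    (v : nat -> C) (U : nat -> R) (B : R) (N : T -> nat) (l : C) :
  (forall j, 0 <= U j) -> (forall n, \sum_(j < n) U j <= B) ->
  (forall t j, (j < N t)%N -> normc (u t j) <= U j) ->
  (forall j, (u t j : R[i]^o) @[t --> F] --> (v j : R[i]^o)) ->
  (forall m, \forall t \near F, (m <= N t)%N) ->
  (\prod_(j < n) (1 + v j) : R[i]^o) @[n --> \oo] --> (l : R[i]^o) ->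
  (\prod_(j < N t) (1 + u t j) : R[i]^o) @[t --> F] --> (l : R[i]^o).
Proof.
move=> U0 UB uU uv FN vl.
apply: (@tannery T F FF (fun t n => \prod_(j < n) (1 + u t j))
  (fun n => \prod_(j < n) (1 + v j)) (fun n => \prod_(j < n) (1 + U j)) (expR B) N l _ _ _ _ FN vl).
- by move=> m n mn; apply: prod1D_ge1.
- by move=> n; apply: prod1D_exp.
- by move=> t m n mn nN; apply: prod_dom => // j jn; apply: uU; apply: leq_trans nN.
- move=> m; apply: (@cvgc_prod T F FF (fun t j => 1 + u t j) (fun j => 1 + v j) m) => j _.
  by apply: cvgcD; [exact: cvgc_cst|exact: uv].
Qed.

Lemma sum_tannery (T : Type) (F : set_system T) (FF : Filter F) (u : T -> nat -> C)
    (v : nat -> C) (U : nat -> R) (B : R) (N : T -> nat) (l : C) :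
  (forall j, 0 <= U j) -> (forall n, \sum_(j < n) U j <= B) ->
  (forall t j, (j < N t)%N -> normc (u t j) <= U j) ->
  (forall j, (u t j : R[i]^o) @[t --> F] --> (v j : R[i]^o)) ->
  (forall m, \forall t \near F, (m <= N t)%N) ->
  (\sum_(j < n) v j : R[i]^o) @[n --> \oo] --> (l : R[i]^o) ->
  (\sum_(j < N t) u t j : R[i]^o) @[t --> F] --> (l : R[i]^o).
Proof.
move=> U0 UB uU uv FN vl.
apply: (@tannery T F FF (fun t n => \sum_(j < n) u t j)
  (fun n => \sum_(j < n) v j) (fun n => \sum_(j < n) U j) B N l _ UB _ _ FN vl).
- move=> m n mn; rewrite -subr_ge0; apply: le_trans (normc_ge0 _) _; last first.
    apply: (@sum_dom (fun j => (U j)%:C)) => // j _.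
    by rewrite normcR ger0_norm.
- by move=> t m n mn nN; apply: sum_dom => // j jn; apply: uU; apply: leq_trans nN.
- by move=> m; apply: cvgc_sum => j _; exact: uv.
Qed.

End Tannery.

Arguments cvgc_cst {R T F FF} c.
Arguments cvgcD {R T F FF u v l m}.
Arguments cvgcB {R T F FF u v l m}.
Arguments cvgcN {R T F FF u l}.
Arguments cvgcM {R T F FF u v l m}.
Arguments cvgcV {R T F FF u l}.
Arguments cvgcX {R T F FF u l} n.
Arguments eq_cvgc {R T F u v l}.

(** * An enumeration of the integers *)

Section IntegerEnumeration.

(** The order is 0, 1, -1, 2, -2, ...: the first 2 N + 1 values are the integers of modulus at most
    N, so that sequences indexed by [nat] reproduce symmetric partial sums and products. *)
Definition zn (n : nat) : int := if odd n then (n.+1)./2%:Z else - (n./2%:Z).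

Definition znv (m : int) : nat :=
  match m with Posz k => if k is k'.+1 then k'.*2.+1 else 0 | Negz k => k.+1.*2 end.

Lemma zn_double k : zn k.*2 = - k%:Z.
Proof. by rewrite /zn odd_double doubleK. Qed.

Lemma zn_doubleS k : zn k.*2.+1 = k.+1%:Z.
Proof. by rewrite /zn /= odd_double /= doubleK. Qed.

Lemma znvK : cancel znv zn.
Proof. by case=> [[|k]|k]; rewrite /znv ?zn_doubleS // zn_double // NegzE. Qed.

Lemma znK : cancel zn znv.
Proof.
move=> n; rewrite /zn; case: ifPn => on.
  by rewrite -{2}(odd_double_half n) on /= uphalf_half on.
rewrite -{2}(odd_double_half n) (negbTE on) add0n.
by case: (n./2) => // k; rewrite -NegzE.
Qed.

Lemma zn_inj : injective zn. Proof. exact: can_inj znK. Qed.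

Lemma big_zn (T : Type) (idx : T) (op : Monoid.com_law idx) (F : int -> T) N :
  \big[op/idx]_(j < N.*2.+1) F (zn j) =
  op (F 0) (\big[op/idx]_(1 <= k < N.+1) op (F k%:Z) (F (- k%:Z))).
Proof.
elim: N => [|N IH].
  by rewrite big_geq // big_ord_recl big_ord0.
rewrite doubleS 2!big_ord_recr IH [in RHS]big_nat_recr //= -!Monoid.mulmA.
by rewrite zn_doubleS -doubleS zn_double.
Qed.

End IntegerEnumeration.

(** * Square-summable sequences and distances to the integers *)

Section SquareSums.
Context {R : realType}.
Local Notation C := R[i].

Definition zw (i : int) : R := (1 + `|i|%:R) ^- 2.

Lemma zw_ge0 i : 0 <= zw i.
Proof. by rewrite invr_ge0 exprn_ge0 // addr_ge0. Qed.

Lemma sum_uniq_le (f : nat -> R) (s : seq nat) M : (forall i, 0 <= f i) -> uniq s ->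
  (forall i, i \in s -> (i < M)%N) -> \sum_(i <- s) f i <= \sum_(i < M) f i.
Proof.
move=> f0 us sM; rewrite -(big_mkord xpredT f) [leRHS](bigID [in s]) /=.
rewrite -[X in _ <= X + _]big_filter.
rewrite (perm_big [seq i <- index_iota 0 M | i \in s]) /=.
  by rewrite lerDl sumr_ge0.
apply: uniq_perm => //; first by rewrite filter_uniq // iota_uniq.
move=> i; rewrite mem_filter mem_index_iota /=; case: (boolP (i \in s)) => //= /sM ->.
by [].
Qed.

Lemma sum_zw0 N : \sum_(j < N.*2.+1) zw (zn j) <= 3.
Proof.
rewrite (big_zn _ zw) /= /zw absz0 addr0 expr1n invr1.
(* Telescoping: (1 + k) ^ -2 is at most 1 / k - 1 / (k + 1), and each modulus occurs twice. *)
have : \sum_(1 <= k < N.+1) ((1 + `|k%:Z|%:R) ^- 2 + (1 + `|- k%:Z|%:R) ^- 2) <=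
    2 - 2 / N.+1%:R :> R.
  elim: N => [|N IH]; first by rewrite big_geq // divr1 subrr.
  rewrite big_nat_recr //= ?abszN ?absz_nat.
  apply: le_trans (lerD IH (lexx _)) _.
  have n0 : 0 < N.+1%:R :> R by [].
  rewrite -[N.+2%:R]natr1; move: (N.+1%:R) n0 => x x0.
  rewrite -subr_ge0.
  have -> : 2 - 2 / (x + 1) - (2 - 2 / x + ((1 + x) ^- 2 + (1 + x) ^- 2)) = 2 / (x * (1 + x) ^+ 2).
    by field; rewrite !gt_eqF // ?addr_gt0.
  by rewrite divr_ge0 // mulr_ge0 ?sqr_ge0 // ltW.
have : 0 < 2 / N.+1%:R :> R by rewrite divr_gt0.
move: (2 / N.+1%:R) => y y0 H; rewrite -lerBrDl; apply: le_trans H _; lra.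
Qed.

(** A translation is injective on the integers, so the sum centred at [m] is part of a longer sum
    centred at 0. *)
Lemma sum_zw m n : \sum_(j < n) zw (zn j - m) <= 3.
Proof.
pose s := [seq znv (zn j - m) | j <- iota 0 n].
have -> : \sum_(j < n) zw (zn j - m) = \sum_(i <- s) zw (zn i).
  rewrite big_map -(big_mkord xpredT (fun j => zw (zn j - m))) /index_iota subn0.
  by apply: eq_bigr => j _; rewrite znvK.
pose M := \max_(i <- s) i.
apply: le_trans (sum_zw0 M).
apply: (sum_uniq_le (f := fun i => zw (zn i))).
- by move=> i; apply: zw_ge0.
- rewrite map_inj_uniq ?iota_uniq // => i j /(can_inj znvK) /addIr.
  exact: zn_inj.
- move=> i si; rewrite ltnS -addnn; apply: leq_trans (leq_addr _ _).
  exact: (@leq_bigmax_seq _ s xpredT id i).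
Qed.

(** The weighted inequality between the means plays the role of Cauchy-Schwarz; the free weight [s]
    shifts the loss to either factor. *)
Lemma sum_amgm (x y : nat -> R) (s : R) n : 0 < s ->
  \sum_(j < n) x j * y j <=
  (s * (\sum_(j < n) x j ^+ 2) + s^-1 * (\sum_(j < n) y j ^+ 2)) / 2.
Proof.
move=> s0; rewrite !mulr_sumr -big_split mulr_suml; apply: ler_sum => j _ /=.
rewrite ler_pdivlMr // -subr_ge0.
have -> : s * x j ^+ 2 + s^-1 * y j ^+ 2 - x j * y j * 2 = s^-1 * (s * x j - y j) ^+ 2.
  by field; rewrite gt_eqF.
by rewrite mulr_ge0 ?sqr_ge0 // invr_ge0 ltW.
Qed.

(** With [m] the integer part of Re z, the hypothesis is enough for |n - m| <= 1. Beyond that the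
    real part gives |n - m| - 1, which is at least (|n - m| + 1) / 3. *)
Lemma int_dist_lb (z : C) (d : R) : 0 < d -> d <= 1 ->
  (forall n : int, d <= normc (n%:~R - z)) ->
  exists m : int, forall n : int, d / 3 * (1 + `|n - m|%:R) <= normc (n%:~R - z).
Proof.
move=> d0 d1 H; pose x := complex.Re z; exists (Num.floor x) => n.
have d3 : 0 < d / 3 by rewrite divr_gt0.
set m := Num.floor x; have /andP[mx xm] := floor_itv x.
rewrite -/m in mx xm.
have [le1|] := leP `|n - m|%N 1%N.
  apply: le_trans (H n).
  have : (`|n - m|%:R : R) <= 1 by rewrite (ler_nat _ _ 1).
  nra.
move=> gt1; have dist : (`|n - m|%:R : R) - 1 <= normc (n%:~R - z).
  apply: le_trans (le_Re_normc _); rewrite ReD ReN -/x.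
  have -> : complex.Re (n%:~R : C) = n%:~R by rewrite -(rmorph_int (real_complex R)).
  have -> : (`|n - m|%:R : R) = `|n%:~R - m%:~R|.
    by rewrite -rmorphB /= -intr_norm -abszE.
  have : `|n%:~R - m%:~R| <= `|n%:~R - x| + `|x - m%:~R| :> R by apply: ler_distD.
  have : `|x - m%:~R| <= 1.
    rewrite ger0_norm ?subr_ge0 //; move: xm; rewrite intrD; lra.
  lra.
apply: le_trans dist; have : (2 : R) <= `|n - m|%:R by rewrite ler_nat.
nra.
Qed.

Lemma sum_inv_sqr (z : C) (d : R) n : 0 < d -> d <= 1 ->
  (forall n : int, d <= normc (n%:~R - z)) ->
  \sum_(j < n) (normc ((zn j)%:~R - z))^-1 ^+ 2 <= 27 / d ^+ 2.
Proof.
move=> d0 d1 H; have [m Hm] := int_dist_lb d0 d1 H.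
apply: (@le_trans _ _ (\sum_(j < n) 9 / d ^+ 2 * zw (zn j - m))).
  apply: ler_sum => j _; rewrite /zw exprVn.
  have t0 : 0 < 1 + `|zn j - m|%:R :> R by rewrite ltr_pwDl.
  have := Hm (zn j); move: (1 + _) t0 => t t0 h.
  have -> : 9 / d ^+ 2 * t ^- 2 = ((d / 3 * t) ^+ 2)^-1.
    by field; rewrite !gt_eqF.
  have dt : 0 < d / 3 * t by rewrite mulr_gt0 ?divr_gt0.
  rewrite lef_pV2 ?posrE ?exprn_gt0 ?(lt_le_trans dt) //.
  by rewrite ler_sqr ?nnegrE ?normc_ge0 // ltW.
rewrite -mulr_sumr; apply: (@le_trans _ _ (9 / d ^+ 2 * 3)).
  by rewrite ler_wpM2l ?sum_zw // divr_ge0 ?sqr_ge0.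
by rewrite le_eqVlt; apply/orP; left; apply/eqP; field; rewrite gt_eqF.
Qed.

(** The integer nearest to [z] is one of the two that enclose its real part. *)
Lemma int_dist_gt0 (z : C) : (forall n : int, n%:~R != z) ->
  exists d : R, [/\ 0 < d, d <= 1 & forall n : int, d <= normc (n%:~R - z)].
Proof.
move=> H; pose x := complex.Re z; pose m := Num.floor x.
have Hn n : 0 < normc (n%:~R - z) by rewrite normc_gt0 subr_eq0.
exists (Num.min 1 (Num.min (normc (m%:~R - z)) (normc ((m + 1)%:~R - z)))).
split; [by rewrite !lt_min ltr01 !Hn|by rewrite ge_min lexx|].
have /andP[mx xm] := floor_itv x; rewrite -/m in mx xm.
have mono (p q : int) : `|p%:~R - x| <= `|q%:~R - x| -> normc (p%:~R - z) <= normc (q%:~R - z).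
  move=> pq; rewrite -ler_sqr ?nnegrE ?normc_ge0 // !normc_sqr !ReD !ImD !ReN -/x.
  rewrite -!(rmorph_int (real_complex R)) /= lerD2r.
  by rewrite -[leLHS]real_normK ?num_real // -[leRHS]real_normK ?num_real // ler_sqr ?nnegrE.
move=> n; have [nm|mn] := leP n m.
  rewrite !ge_min mono ?orbT // !ler0_norm ?subr_le0 //.
    by rewrite lerN2 lerD2r ler_int.
  by apply: le_trans mx; rewrite ler_int.
rewrite !ge_min [X in _ || (_ || X)]mono ?orbT // !ger0_norm ?subr_ge0 ?(ltW xm) //.
  by rewrite lerD2r ler_int lezD1.
by apply: le_trans (ltW xm) _; rewrite ler_int lezD1.
Qed.

Lemma l2_partial (kappa : int -> C) : in_l2 kappa ->
  exists2 A : R, 0 <= A & forall n, \sum_(j < n) normc (kappa (zn j)) ^+ 2 <= A.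
Proof.
rewrite /in_l2 => H.
have E : \esum_(n in [set: int]) ((normc (kappa n)) ^+ 2)%:E =
    (\esum_(n in [set: nat]) ((normc (kappa (zn n))) ^+ 2)%:E)%E.
  apply: (reindex_esum setT setT zn).
  split => //; first by move=> i j _ _ /zn_inj.
  by move=> m _ /=; exists (znv m) => //; rewrite znvK.
rewrite E -nneseries_esumT in H; last by move=> i; rewrite lee_fin sqr_ge0.
set S := limn _ in H.
have S0 : (0 <= S)%E by apply: nneseries_ge0 => n _ _; rewrite lee_fin sqr_ge0.
have Sf : S \is a fin_num by rewrite ge0_fin_numE.
exists (fine S); first exact: fine_ge0.
move=> n; rewrite -lee_fin fineK // -sumEFin -(big_mkord xpredT (fun j => (normc (kappa (zn j)) ^+ 2)%:E)).
by apply: nneseries_lim_ge => i _; rewrite lee_fin sqr_ge0.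
Qed.

End SquareSums.

(** * Euler's product for the sine *)

Section SineProduct.
Context {R : realType}.
Local Notation C := R[i].
Implicit Types (z w : C).

Let i0 : ('i%R : C) != 0. Proof. by rewrite -normc_eq0 normc_i oner_eq0. Qed.
Let two0 : (2 : C) != 0. Proof. by rewrite pnatr_eq0. Qed.
Let ii : ('i%R : C) * 'i = -1. Proof. by rewrite -expr2 sqrCi. Qed.

Lemma csinE z : 2 * 'i * csin z = cexp ('i * z) - cexp (- ('i * z)).
Proof. by rewrite /csin mulrC divfK // mulf_neq0. Qed.

Lemma cexp_iN (x : R) : cexp (- ('i * x%:C)) = cos x +i* - sin x.
Proof.
have -> : - ('i * x%:C) = 'i * (- x)%:C :> C.
  by apply/eqP; rewrite eq_complex /=; apply/andP; split; apply/eqP; ring.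
by rewrite cexp_i cosN sinN.
Qed.

Lemma csinR (x : R) : csin x%:C = (sin x)%:C.
Proof.
apply: (mulfI (mulf_neq0 two0 i0)); rewrite csinE cexp_iN cexp_i.
by apply/eqP; rewrite eq_complex /=; apply/andP; split; apply/eqP; ring.
Qed.

Lemma cexp_near1 z : normc (cexp z - 1) <= normc z * expR (normc z).
Proof.
have := cexp_taylor 1 z; rewrite /exp_poly big_ord1 expr0 fact0 divr1.
by rewrite expr1 divr1.
Qed.

Lemma cexp_near2 z : normc (cexp z - (1 + z)) <= normc z ^+ 2 / 2 * expR (normc z).
Proof.
by have := cexp_taylor 2 z; rewrite /exp_poly big_ord_recr big_ord1 expr0 fact0 divr1 expr1 divr1.
Qed.

Lemma csin_near z : normc (csin z - z) <= normc z ^+ 2 * expR (normc z).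
Proof.
have h1 := cexp_near2 ('i * z); have h2 := cexp_near2 (- ('i * z)).
rewrite normcN normcM normc_i mul1r in h1 h2.
have -> : csin z - z = ((cexp ('i * z) - (1 + 'i * z)) - (cexp (- ('i * z)) - (1 - 'i * z))) / (2 * 'i).
  by rewrite /csin; field; rewrite i0.
rewrite normcM normcV normcM normc_i normc_nat mulr1.
rewrite ler_pdivrMr //; apply: le_trans (le_normcD _ _) _; rewrite normcN.
have := lerD h1 h2; rewrite -/(1 - 'i * z) => /le_trans; apply.
have := mulr_ge0 (sqr_ge0 (normc z)) (expR_ge0 (normc z)).
move: (normc z ^+ 2) (expR _) => x y xy.
by have -> : x / 2 * y + x / 2 * y = x * y :> R; [by field|lra].
Qed.

Lemma csin_le z : normc (csin z) <= normc z * expR (normc z).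
Proof.
have h1 := cexp_near1 ('i * z); have h2 := cexp_near1 (- ('i * z)).
rewrite normcN normcM normc_i mul1r in h1 h2.
have -> : csin z = ((cexp ('i * z) - 1) - (cexp (- ('i * z)) - 1)) / (2 * 'i).
  by rewrite /csin; field; rewrite i0.
rewrite normcM normcV normcM normc_i normc_nat mulr1.
rewrite ler_pdivrMr //; apply: le_trans (le_normcD _ _) _; rewrite normcN.
by rewrite mulr_natr mulr2n lerD.
Qed.

(** From y cos y <= sin y at the half angle, sin x = 2 cos (x / 2) sin (x / 2) >= x cos (x / 2) ^ 2
    = x (1 + cos x) / 2, and cos x >= 0. *)
Lemma sin_ge_half (x : R) : 0 <= x -> x <= pi / 2 -> x / 2 <= sin x.
Proof.
move=> x0 xpi; have pi0 := pi_gt0 R.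
have key (y : R) : 0 <= y -> y <= pi / 2 -> y * cos y <= sin y.
  rewrite le_eqVlt => /predU1P[<- _|y0 ypi]; first by rewrite mul0r sin0.
  have cs : {within `[0, y], continuous (@sin R)}.
    by apply: continuous_subspaceT => t; exact: continuous_sin.
  have [c] := MVT y0 (fun t _ => is_derive_sin t) cs; rewrite in_itv /= => /andP[c0 cy].
  rewrite sin0 !subr0 => ->; rewrite mulrC ler_pM2r //.
  have [->//|] := eqVneq c y => cny.
  rewrite le_eqVlt; apply/orP; right; rewrite ltr_cos ?in_itv /= ?(ltW y0) ?(ltW c0) //=; lra.
have h := key (x / 2) ltac:(lra) ltac:(lra).
have xx : x = (x / 2) *+ 2 by rewrite -mulr_natr divfK.
have -> : sin x = 2 * (cos (x / 2) * sin (x / 2)) by rewrite {1}xx sin_mulr2n mulr_natl.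
have c0 : 0 <= cos x by apply: cos_ge0_pihalf; lra.
have c2 : cos x = 2 * cos (x / 2) ^+ 2 - 1 by rewrite {1}xx cos_mulr2n mulr_natl.
have c3 : 0 <= cos (x / 2) by apply: cos_ge0_pihalf; lra.
move: (sin (x / 2)) (cos (x / 2)) h c2 c3 => s c h c2 c3.
have : c * (x / 2 * c) <= c * s by rewrite ler_wpM2l.
have : x * (1 / 2) <= x * c ^+ 2 by rewrite ler_wpM2l //; nra.
lra.
Qed.

Definition omega (m : nat) : C := cexp ('i * (2 * pi / m%:R)%:C).

Lemma omegaX m k : omega m ^+ k = cexp ('i * (2 * pi * k%:R / m%:R)%:C).
Proof.
rewrite -cexpMn; congr cexp; rewrite mulrCA; congr (_ * _).
by rewrite -(rmorph_nat (real_complex R)) -rmorphM; congr (_%:C); ring.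
Qed.

Lemma normc_omega m k : normc (omega m ^+ k) = 1.
Proof. by rewrite omegaX normc_cexp_i. Qed.

Lemma omega_prim m : (0 < m)%N -> m.-primitive_root (omega m).
Proof.
move=> m0; have m0' : (0 : R) < m%:R by rewrite ltr0n.
apply/andP; split => //; apply/forallP => k; apply/eqP; rewrite unity_rootE omegaX.
have [->|km] := eqVneq k.+1 m.
  rewrite mulfK; last by rewrite gt_eqF.
  by rewrite cexp_i mulr_natl cos2pi sin2pi eqxx.
apply/negbTE/eqP => H.
have km' : (k.+1 < m)%N by rewrite ltn_neqAle km ltn_ord.
have pi0 := pi_gt0 R.
have t0 : 0 < sin (pi * k.+1%:R / m%:R : R).
  apply: sin_gt0_pi; rewrite divr_gt0 ?mulr_gt0 //= ltr_pdivrMr // ltr_pM2l // ltr_nat //.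
move: H; rewrite cexp_i => /(congr1 (@complex.Re R)) /=.
have -> : 2 * pi * k.+1%:R / m%:R = (pi * k.+1%:R / m%:R) *+ 2 :> R by rewrite -mulr_natl; ring.
rewrite cos_mulr2n cos2sin2 => H.
have : sin (pi * k.+1%:R / m%:R : R) ^+ 2 = 0 by move: H; rewrite -mulr_natl; lra.
by move/eqP; rewrite sqrf_eq0 gt_eqF.
Qed.

Lemma prod_omega (u v : C) m : (0 < m)%N -> v != 0 ->
  u ^+ m - v ^+ m = (u - v) * \prod_(1 <= k < m) (u - omega m ^+ k * v).
Proof.
move=> m0 v0.
have H : \prod_(0 <= k < m) (u / v - omega m ^+ k) = (u / v) ^+ m - 1.
  transitivity ((\prod_(0 <= k < m) ('X - (omega m ^+ k)%:P)).[u / v]).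
    by rewrite horner_prod; apply: eq_bigr => k _; rewrite hornerXsubC.
  by rewrite (factor_Xn_sub_1 (omega_prim m0)) hornerD hornerN hornerXn -polyC1 hornerC.
rewrite (big_ltn m0) expr0 in H.
have -> : u ^+ m - v ^+ m = v ^+ m * ((u / v) ^+ m - 1).
  by rewrite expr_div_n mulrBr mulr1 mulrCA divff ?mulr1 // expf_neq0.
rewrite -H; case: m m0 {H} => // m _.
rewrite exprS mulrACA; congr (_ * _).
  by rewrite mulrBr mulr1 mulrCA divff ?mulr1.
rewrite !big_add1 /= -[X in v ^+ X]subn0 -prodr_const_nat -big_split.
apply: eq_bigr => k _; rewrite /= mulrBr mulrCA divff // mulr1.
by rewrite [v * _]mulrC.
Qed.

(** The value at 1 of (X ^ m - 1) / (X - 1), written once as a product and once as a sum of m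
    powers. *)
Lemma prod_omega1 m : (0 < m)%N -> \prod_(1 <= k < m) (1 - omega m ^+ k) = m%:R.
Proof.
move=> m0; have H := factor_Xn_sub_1 (omega_prim m0).
have : ('X - 1) * \prod_(1 <= k < m) ('X - (omega m ^+ k)%:P) =
       ('X - 1) * (\sum_(i < m) 'X^i) :> {poly C}.
  rewrite -subrX1 -[RHS]H [RHS]big_ltn //.
have n0 : ('X - 1 : {poly C}) != 0 by rewrite polyXsubC_eq0.
move/(mulfI n0)/(congr1 (fun p => p.[1])).
rewrite horner_prod horner_sum => H'.
under eq_bigr do rewrite -[1](hornerX (1 : C)) -[_ ^+ _](hornerC _ (1 : C)) -hornerN -hornerD.
rewrite H'; under eq_bigr do rewrite hornerXn expr1n.
by rewrite sumr_const card_ord.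
Qed.

(** Pairs the indices k and 2 n + 1 - k, which carry mutually inverse roots of unity of odd order 2
    n + 1. *)
Lemma big_fold_half (F : nat -> C) n :
  \prod_(1 <= k < n.*2.+1) F k = \prod_(j < n) (F j.+1 * F (n.*2 - j)%N).
Proof.
rewrite (@big_cat_nat _ _ _ n.+1) //=; last by rewrite ltnS -addnn leq_addr.
rewrite big_split /=; congr (_ * _).
  by rewrite big_add1 big_mkord.
rewrite -(big_mkord xpredT (fun j => F (n.*2 - j)%N)) [RHS]big_nat_rev /=.
rewrite -{1}[n.+1]add0n big_addn.
have -> : (n.*2.+1 - n.+1)%N = n by rewrite subSS -addnn addnK.
apply: eq_big_nat => j /andP[_ jn]; congr F; rewrite add0n -addnn; lia.
Qed.

(** With u = exp (i z / m) and v = 1 / u, the difference u ^ m - v ^ m factors over the m-th roots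
    of unity. A pair of inverse roots W, 1 / W contributes (u - v) ^ 2 + 2 - W - 1 / W, where 2 - W
    - 1 / W = 4 sin ^ 2; dividing by the same product at u = v = 1 gives the factors and the
    constant m. *)
Lemma csin_finite_prod z n : let m := n.*2.+1 in
  csin z = m%:R * csin (z / m%:R) *
    \prod_(j < n) (1 - (csin (z / m%:R) / (sin (pi * j.+1%:R / m%:R))%:C) ^+ 2).
Proof.
move=> m; have m0 : (0 < m)%N by [].
have mC : (m%:R : C) != 0 by rewrite pnatr_eq0.
set w := z / m%:R; pose u := cexp ('i * w); pose v := cexp (- ('i * w)).
have uv : u * v = 1 by rewrite -cexpD subrr cexp0.
have um : u ^+ m = cexp ('i * z) by rewrite -cexpMn mulrCA /w [m%:R * _]mulrC divfK.
have vm : v ^+ m = cexp (- ('i * z)) by rewrite -cexpMn mulrN mulrCA /w [m%:R * _]mulrC divfK.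
have uvs : u - v = 2 * 'i * csin w by rewrite csinE.
apply: (mulfI (mulf_neq0 two0 i0)); rewrite csinE -um -vm prod_omega ?cexp_neq0 // uvs.
rewrite (_ : \prod_(1 <= k < m) _ = m%:R *
  \prod_(j < n) (1 - (csin w / (sin (pi * j.+1%:R / m%:R))%:C) ^+ 2)); first by ring.
rewrite -(prod_omega1 m0) /m !big_fold_half -big_split; apply: eq_bigr => j _ /=.
rewrite -/m; have jn := ltn_ord j.
have pi0 := pi_gt0 R; have m0' : (0 : R) < m%:R by rewrite ltr0n.
set t := pi * j.+1%:R / m%:R.
have s0 : (sin t)%:C != 0 :> C.
  rewrite -normc_eq0 normcR normr_eq0 gt_eqF //; apply: sin_gt0_pi.
  rewrite /t divr_gt0 ?mulr_gt0 //= ltr_pdivrMr // ltr_pM2l // ltr_nat /m -addnn; lia.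
pose W := omega m ^+ j.+1.
have WV : omega m ^+ (n.*2 - j) = W^-1.
  apply: (mulfI (_ : W != 0)); first by rewrite -normc_eq0 normc_omega oner_eq0.
  rewrite mulfV -?normc_eq0 ?normc_omega ?oner_eq0 // -exprD.
  have -> : (j.+1 + (n.*2 - j))%N = m by rewrite /m -addnn; lia.
  exact: prim_expr_order (omega_prim m0).
have W0 : W != 0 by rewrite -normc_eq0 normc_omega oner_eq0.
have WW : W + W^-1 = 2 - 4 * (sin t)%:C ^+ 2.
  rewrite /W omegaX -cexpN cexp_iN cexp_i.
  have -> : 2 * pi * j.+1%:R / m%:R = t *+ 2 :> R by rewrite /t -mulr_natl; ring.
  rewrite cos_mulr2n cos2sin2 -mulr_natl.
  by apply/eqP; rewrite eq_complex expr2 /=; apply/andP; split; apply/eqP; ring.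
rewrite WV -/W.
have -> : (u - W * v) * (u - W^-1 * v) = (u - v) ^+ 2 + u * v * (2 - (W + W^-1)).
  by field.
have -> : (1 - W) * (1 - W^-1) = 2 - (W + W^-1) by field.
rewrite uv WW uvs.
have -> : (2 * 'i * csin w) ^+ 2 = - 4 * csin w ^+ 2.
  by rewrite !exprMn sqrCi; ring.
by field.
Qed.

Lemma cvg_odd_inv (c : R) : c / n.*2.+1%:R @[n --> \oo] --> (0 : R).
Proof.
rewrite -[X in _ --> X](mulr0 c); apply: cvgM; first exact: cvg_cst.
apply: (@squeeze_cvgr _ _ _ _ (fun=> 0) (@harmonic R)); last 2 first.
- exact: cvg_cst.
- exact: cvg_harmonic.
apply: nearW => n; rewrite invr_ge0 ler0n /= /harmonic lef_pV2 ?posrE //.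
by rewrite ler_nat ltnS -addnn leq_addr.
Qed.

Lemma csin_scaled_cvg z :
  (n.*2.+1%:R * csin (z / n.*2.+1%:R) : R[i]^o) @[n --> \oo] --> (z : R[i]^o).
Proof.
apply: (@cvgc_squeeze _ _ _ _ _ _ (fun n => normc z ^+ 2 * expR (normc z) / n.*2.+1%:R)).
  apply: nearW => n; have m1 : (1 : R) <= n.*2.+1%:R by rewrite ler1n.
  have m0 : (n.*2.+1%:R : C) != 0 by rewrite pnatr_eq0.
  move: (n.*2.+1) m1 m0 => m m1 m0.
  have -> : m%:R * csin (z / m%:R) - z = m%:R * (csin (z / m%:R) - z / m%:R) by field.
  rewrite normcM normc_nat.
  have mp : 0 < (m%:R : R) by rewrite (lt_le_trans ltr01).
  have := ler_wpM2l (ltW mp) (csin_near (z / m%:R)).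
  move/le_trans; apply; rewrite normcM normcV normc_nat.
  set x := normc z; have x0 : 0 <= x by apply: normc_ge0.
  have h : expR (x / m%:R) <= expR x by rewrite ler_expR ler_pdivrMr // ler_peMr.
  have -> : m%:R * ((x / m%:R) ^+ 2 * expR (x / m%:R)) = x ^+ 2 * expR (x / m%:R) / m%:R.
    by field; rewrite gt_eqF.
  by rewrite ler_pM2r ?invr_gt0 // ler_wpM2l ?sqr_ge0.
exact: cvg_odd_inv.
Qed.

Lemma sum_inv_sq_le (n : nat) : \sum_(j < n) (j.+1%:R ^- 2 : R) <= 2.
Proof.
case: n => [|n]; first by rewrite big_ord0.
have : \sum_(j < n.+1) (j.+1%:R ^- 2 : R) <= 2 - n.+1%:R^-1.
  elim: n => [|n IH]; first by rewrite big_ord1 expr1n invr1; lra.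
  rewrite big_ord_recr /=; apply: le_trans (lerD IH (lexx _)) _.
  have n0 : 0 < n.+1%:R :> R by [].
  rewrite -[n.+2%:R]natr1; move: (n.+1%:R) n0 => x x0.
  rewrite -subr_ge0.
  have -> : 2 - (x + 1)^-1 - (2 - x^-1 + (x + 1) ^- 2) = (x * (x + 1) ^+ 2)^-1.
    by field; rewrite !gt_eqF // ?addr_gt0.
  by rewrite invr_ge0 mulr_ge0 ?sqr_ge0 // ltW.
by move/le_trans; apply; rewrite gerBl invr_ge0.
Qed.

(** Passage to the limit in [csin_finite_prod]. The order 2 n + 1 keeps the angles below pi / 2,
    where [sin_ge_half] and pi >= 2 give sin (pi j / m) >= j / m; the factors then differ from 1 by
    at most K / j ^ 2, uniformly in n. *)
Theorem csin_prod z :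
  (pi%:C * z * \prod_(j < n) (1 - (z / j.+1%:R) ^+ 2) : R[i]^o) @[n --> \oo]
    --> (csin (pi%:C * z) : R[i]^o).
Proof.
set y := pi%:C * z; have pi0 := pi_gt0 R.
pose v j := - (z / j.+1%:R) ^+ 2.
pose u n j := - (csin (y / n.*2.+1%:R) / (sin (pi * j.+1%:R / n.*2.+1%:R))%:C) ^+ 2.
pose K := normc y ^+ 2 * expR (normc y) ^+ 2.
have K0 : 0 <= K by rewrite mulr_ge0 ?sqr_ge0.
have vb n : \sum_(j < n) normc (v j) <= normc z ^+ 2 * 2.
  rewrite (eq_bigr (fun j : 'I_n => normc z ^+ 2 * j.+1%:R ^- 2)).
    by rewrite -mulr_sumr ler_wpM2l ?sqr_ge0 // sum_inv_sq_le.
  by move=> j _; rewrite /v normcN normcX normcM normcV normc_nat exprMn exprVn.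
have [l Hl] := prod_cvgc vb.
have H1 : (\prod_(j < n) (1 + u n j) : R[i]^o) @[n --> \oo] --> (l : R[i]^o).
  apply: (@prod_tannery R nat \oo _ u v (fun j => K * j.+1%:R ^- 2) (K * 2) id l) Hl.
  - by move=> j; rewrite mulr_ge0 // invr_ge0 exprn_ge0.
  - by move=> n; rewrite -mulr_sumr ler_wpM2l // sum_inv_sq_le.
  - move=> n j jn; rewrite /u normcN normcX normcM normcV normcR.
    set m := n.*2.+1; have m0 : (0 : R) < m%:R by rewrite ltr0n.
    have m1 : (1 : R) <= m%:R by rewrite ler1n.
    have j0 : (0 : R) < j.+1%:R by rewrite ltr0n.
    have jm : 2 * (j.+1%:R : R) <= m%:R by rewrite -natrM ler_nat /m -muln2; lia.
    have t0 : 0 <= pi * j.+1%:R / m%:R :> R by rewrite divr_ge0 ?mulr_ge0 // ltW.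
    have sl : pi * j.+1%:R / m%:R / 2 <= sin (pi * j.+1%:R / m%:R) :> R.
      apply: sin_ge_half => //; rewrite ler_pdivrMr //.
      have : 2 * j.+1%:R * pi <= m%:R * pi :> R by rewrite ler_pM2r.
      lra.
    have jms : j.+1%:R / m%:R <= sin (pi * j.+1%:R / m%:R) :> R.
      apply: le_trans sl; have p2 : 2 <= pi :> R := pi_ge2 R.
      have : 0 < j.+1%:R / m%:R :> R by rewrite divr_gt0.
      have -> : pi * j.+1%:R / m%:R / 2 = pi / 2 * (j.+1%:R / m%:R) :> R by ring.
      nra.
    have s0 : 0 < sin (pi * j.+1%:R / m%:R) :> R by apply: lt_le_trans jms; rewrite divr_gt0.
    rewrite (ger0_norm (ltW s0)) /K -exprMn -exprVn -exprMn.
    apply: lerXn2r; rewrite ?nnegrE.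
    + by rewrite divr_ge0 ?normc_ge0 ?(ltW s0).
    + by rewrite mulr_ge0 ?invr_ge0 ?(ltW j0) ?mulr_ge0 ?normc_ge0 ?expR_ge0.
    rewrite ler_pdivrMr //.
    apply: (@le_trans _ _ (normc y * expR (normc y) / j.+1%:R * (j.+1%:R / m%:R))); last first.
      by rewrite ler_wpM2l // divr_ge0 ?mulr_ge0 ?normc_ge0 ?expR_ge0 ?(ltW j0).
    rewrite mulrA divfK ?gt_eqF //; apply: le_trans (csin_le _) _.
    rewrite normcM normcV normc_nat mulrAC ler_pM2r ?invr_gt0 // ler_wpM2l ?normc_ge0 //.
    by rewrite ler_expR ler_pdivrMr // ler_peMr ?normc_ge0.
  - move=> j; rewrite /u /v.
    have E n : - (csin (y / n.*2.+1%:R) / (sin (pi * j.+1%:R / n.*2.+1%:R))%:C) ^+ 2 =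
      - ((n.*2.+1%:R * csin (y / n.*2.+1%:R)) *
        (n.*2.+1%:R * csin ((pi * j.+1%:R)%:C / n.*2.+1%:R))^-1) ^+ 2.
      rewrite -csinR rmorphM fmorphV /= rmorph_nat.
      have m0 : (n.*2.+1%:R : C) != 0 by rewrite pnatr_eq0.
      by rewrite (_ : forall A B : C, n.*2.+1%:R * A / (n.*2.+1%:R * B) = A / B) // => A B;
        rewrite -mulf_div mulfV // mul1r.
    under eq_fun do rewrite E.
    have pj0 : (pi * j.+1%:R)%:C != 0 :> C.
      by rewrite -normc_eq0 normcR normr_eq0 mulf_neq0 // gt_eqF.
    have -> : z / j.+1%:R = y / (pi * j.+1%:R)%:C.
      have p0 : pi%:C != 0 :> C by rewrite -normc_eq0 normcR normr_eq0 gt_eqF.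
      by rewrite rmorphM /= rmorph_nat /y -mulf_div mulfV // mul1r.
    apply: cvgcN; apply: cvgcX; apply: cvgcM; first exact: csin_scaled_cvg.
    by apply: cvgcV => //; apply: csin_scaled_cvg.
  - by move=> m; exists m.
have H2 : (fun n => csin y) @ \oo --> (y * l : R[i]^o).
  have E : (fun n => csin y) = (fun n => (n.*2.+1%:R * csin (y / n.*2.+1%:R)) * \prod_(j < n) (1 + u n j)).
    by apply/funext => n; rewrite {1}(csin_finite_prod y n).
  rewrite E; apply: cvgcM H1; exact: csin_scaled_cvg.
rewrite (@cvgc_uniq R nat \oo _ (fun=> csin y) _ _ (@cvgc_cst R nat \oo _ (csin y)) H2).
by apply: cvgcM; [exact: cvgc_cst|exact: Hl].
Qed.

End SineProduct.

(** * Partial fractions of a finite product; nonvanishing of infinite products *)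

Section PartialFractions.
Context {R : realType}.
Local Notation C := R[i].

(* The factor j = i is 1 because 1 / 0 = 0. *)
Definition pf_coef (a k : nat -> C) n i : C :=
  k i * \prod_(j < n) (1 + k j / (a j - a i)).

(** Induction on n: the new factor multiplies the old expansion and every product of two simple
    poles is split. The coefficient at the new pole is [k n] times the old product taken at [a n],
    which the induction hypothesis expands as well. *)
Lemma partial_fractions (a k : nat -> C) n z : injective a ->
  (forall j, (j < n)%N -> a j != z) ->
  \prod_(j < n) (1 + k j / (a j - z)) = 1 + \sum_(i < n) pf_coef a k n i / (a i - z).
Proof.
move=> ainj; elim: n z => [|n IH] z az; first by rewrite !big_ord0 addr0.
rewrite !big_ord_recr /= IH; last by move=> j /ltnW; apply: az.
have y0 : a n - z != 0 by rewrite subr_eq0 az.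
have -> : pf_coef a k n.+1 n = k n * (1 + \sum_(i < n) pf_coef a k n i / (a i - a n)).
  rewrite /pf_coef big_ord_recr /= subrr invr0 mulr0 addr0 mulr1 IH // => j jn.
  by rewrite (inj_eq ainj) ltn_eqF.
have -> : \sum_(i < n) pf_coef a k n.+1 i / (a i - z) =
    \sum_(i < n) (pf_coef a k n i / (a i - z) * (1 + k n / (a n - z)) -
      k n / (a n - z) * (pf_coef a k n i / (a i - a n))).
  apply: eq_bigr => i _; rewrite {1}/pf_coef big_ord_recr /= mulrA -/(pf_coef a k n i).
  have x0 : a i - z != 0 by rewrite subr_eq0 az // ltnS ltnW.
  have d0 : a i - a n != 0 by rewrite subr_eq0 (inj_eq ainj) ltn_eqF.
  have d1 : a n - a i != 0 by rewrite subr_eq0 (inj_eq ainj) gtn_eqF.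
  by field; rewrite x0 y0 d0 d1.
rewrite sumrB -mulr_suml -mulr_sumr; move: (\sum_(i < n) _) (\sum_(i < n) _) => S T.
by field.
Qed.

(** Beyond some index the deviations sum to at most 1/3, and exp (1/3) <= 3/2 keeps the remaining
    product within 1/2 of 1; so the partial products stay above half of a nonzero head. *)
Lemma prod_limit_neq0 (u : nat -> C) (B : R) (l : C) :
  (forall n, \sum_(j < n) normc (u j) <= B) -> (forall j, 1 + u j != 0) ->
  (\prod_(j < n) (1 + u j) : R[i]^o) @[n --> \oo] --> (l : R[i]^o) -> l != 0.
Proof.
move=> uB u0 ul; pose W n := \sum_(j < n) normc (u j).
have Wnd : {homo W : m n / (m <= n)%N >-> m <= n}.
  move=> m n mn; rewrite /W -(big_mkord xpredT (fun j => normc (u j))).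
  rewrite -(big_mkord xpredT (fun j => normc (u j))) [leRHS](@big_cat_nat _ _ _ m) //=.
  by rewrite lerDl sumr_ge0 // => j _; apply: normc_ge0.
have e0 : (0 : R) < 3^-1 by [].
have [m Hm] := ndbounded_tail Wnd uB e0.
have c0 : 0 < normc (\prod_(j < m) (1 + u j)).
  rewrite normc_gt0; apply/prodf_neq0 => j _; exact: u0.
have lb n : (m <= n)%N ->
    normc (\prod_(j < m) (1 + u j)) / 2 <= normc (\prod_(j < n) (1 + u j)).
  move=> mn; rewrite -[in leRHS](subnKC mn) big_split_ord /= normcM ler_pM2l //.
  have := @prod_near1 R (fun j => u (m + j)%N) 3^-1 (n - m) _.
  have Hs : \sum_(j < n - m) normc (u (m + j)%N) <= 3^-1.
    have := Hm n; rewrite /W -[in X in X -> _](subnKC mn) big_split_ord /=.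
    by rewrite lerD2l.
  move=> /(_ Hs) H; have e3 : expR (3^-1 : R) <= 3 / 2.
    have := expR_ge1Dx (- 3^-1 : R); rewrite expRN => h.
    rewrite -[expR _]invrK -[3 / 2]invrK lef_pV2 ?posrE ?invr_gt0 ?expR_gt0 //.
    by apply: le_trans h; rewrite invf_div; lra.
  move: H; set P := \prod_(_ < _) _ => H.
  have := ler_normcB 1 (1 - P); rewrite normc1 subKr normcB; lra.
apply/negP => /eqP l0; move: ul; rewrite l0 => /cvgcP.
move=> /(_ _ (divr_gt0 c0 (ltr0Sn _ 1))) [n _ Hn].
have := Hn (maxn m n) (leq_maxr _ _); rewrite /= subr0 ltNge.
by rewrite lb // leq_maxl.
Qed.

End PartialFractions.

(** * The product of the factors 1 + kappa_n / (n - z) *)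

Section CanonicalProduct.
Context {R : realType}.
Local Notation C := R[i].
Variables (kap : int -> C) (A : R).
Hypothesis A0 : 0 <= A.
Hypothesis HA : forall n, \sum_(j < n) normc (kap (zn j)) ^+ 2 <= A.

Let a j : C := (zn j)%:~R.
Let k j : C := kap (zn j).
Let lam (n : int) : C := n%:~R + kap n.

Let a_inj : injective a.
Proof. by move=> i j /intr_inj /zn_inj. Qed.

Lemma sum_kap_inv (z : C) (d : R) n : 0 < d -> d <= 1 ->
  (forall m : int, d <= normc (m%:~R - z)) ->
  \sum_(j < n) normc (k j / (a j - z)) <= (A + 27 / d ^+ 2) / 2.
Proof.
move=> d0 d1 H.
under eq_bigr do rewrite normcM normcV.
apply: le_trans (sum_amgm (fun j => normc (k j)) (fun j => (normc (a j - z))^-1) n ltr01) _.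
by rewrite ler_pM2r ?invr_gt0 // invr1 !mul1r lerD // sum_inv_sqr.
Qed.

(** The term [j = i] is 0 because 1 / 0 = 0. Otherwise the distance x is at least 1, so that x ^ -2
    <= 4 (1 + x) ^ -2; hence the constant 12 = 4 * 3 from [sum_zw]. *)
Lemma sum_kap_int i n :
  \sum_(j < n) normc (k j / (a j - a i)) <= (A + 12) / 2.
Proof.
under eq_bigr do rewrite normcM normcV.
apply: le_trans (sum_amgm (fun j => normc (k j)) (fun j => (normc (a j - a i))^-1) n ltr01) _.
rewrite ler_pM2r ?invr_gt0 // invr1 !mul1r lerD //.
apply: (@le_trans _ _ (\sum_(j < n) 4 * zw (zn j - zn i))); last first.
  by rewrite -mulr_sumr (_ : 12 = 4 * 3) ?ler_wpM2l ?sum_zw //; ring.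
apply: ler_sum => j _; rewrite /a -rmorphB /=; have [->|ij] := eqVneq (zn j) (zn i).
  by rewrite subrr normc0 invr0 expr0n /= mulr_ge0 // zw_ge0.
rewrite normc_int /zw natr_absz.
have x1 : 1 <= `|(zn j - zn i)|%:~R :> R.
  by rewrite (ler_int _ 1) -gtz0_ge1 normr_gt0 subr_eq0.
move: (`|(zn j - zn i)|%:~R : R) x1 => x x1.
have -> : 4 * (1 + x) ^- 2 = ((1 + x) / 2)^-1 ^+ 2.
  by field; rewrite gt_eqF //; lra.
by rewrite ler_sqr ?nnegrE ?invr_ge0 ?lef_pV2 ?posrE; lra.
Qed.

Lemma pf_coef_bound n i : normc (pf_coef a k n i) <= normc (k i) * expR ((A + 12) / 2).
Proof.
rewrite normcM ler_wpM2l ?normc_ge0 //.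
by apply: (prod_bound (u := fun j => k j / (a j - a i))); apply: sum_kap_int.
Qed.

(** The coefficients of the finite expansions converge and are bounded by a constant times the
    perturbation, which dominates the sums. The same bound makes [r] square-summable, so that it can
    serve as a sequence of Fourier coefficients. *)
Theorem canonical_partial_fractions : exists r : nat -> C,
  (forall i, normc (r i) <= normc (k i) * expR ((A + 12) / 2)) /\
  forall z : C, (forall n : int, n%:~R != z) -> exists P : C,
  (\prod_(j < n) (1 + k j / (a j - z)) : R[i]^o) @[n --> \oo] --> (P : R[i]^o) /\
  (\sum_(i < n) r i / (a i - z) : R[i]^o) @[n --> \oo] --> (P - 1 : R[i]^o).
Proof.
have rlim i : exists l : C, (pf_coef a k n i : R[i]^o) @[n --> \oo] --> (l : R[i]^o).
  have [l Hl] := @prod_cvgc R (fun j => k j / (a j - a i)) _ (sum_kap_int i).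
  exists (k i * l); exact: (cvgcM (cvgc_cst (k i)) Hl).
pose r i := projT1 (cid (rlim i)).
have Hr i : (pf_coef a k n i : R[i]^o) @[n --> \oo] --> (r i : R[i]^o).
  by rewrite /r; case: cid.
have rb i : normc (r i) <= normc (k i) * expR ((A + 12) / 2).
  by apply: (normc_cvg_le _ (Hr i)); apply: nearW => n; apply: pf_coef_bound.
exists r; split=> // z zZ.
have [d [d0 d1 Hd]] := int_dist_gt0 zZ.
pose U i := normc (k i / (a i - z)) * expR ((A + 12) / 2).
pose B := (A + 27 / d ^+ 2) / 2 * expR ((A + 12) / 2).
have UB n : \sum_(i < n) U i <= B.
  by rewrite -mulr_suml ler_wpM2r ?expR_ge0 // sum_kap_inv.
have bd (c : C) i : normc c <= normc (k i) * expR ((A + 12) / 2) -> normc (c / (a i - z)) <= U i.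
  move=> h; rewrite /U !normcM mulrAC ler_wpM2r // normcV invr_ge0; exact: normc_ge0.
have vB n : \sum_(i < n) normc (r i / (a i - z)) <= B.
  by apply: le_trans (UB n); apply: ler_sum => i _; apply: bd.
have [l Hl] := @sum_cvgc R (fun i => r i / (a i - z)) _ vB; exists (1 + l).
have -> : 1 + l - 1 = l by ring.
split; last exact: Hl.
have -> : (fun n => \prod_(j < n) (1 + k j / (a j - z))) =
    fun n => 1 + \sum_(i < n) pf_coef a k n i / (a i - z).
  by apply/funext => n; rewrite partial_fractions // => j _; apply: zZ.
apply: (cvgcD (cvgc_cst 1)).
apply: (@sum_tannery R nat \oo _ (fun n i => pf_coef a k n i / (a i - z))
  (fun i => r i / (a i - z)) U B id l) Hl.
- by move=> i; rewrite mulr_ge0 ?normc_ge0 ?expR_ge0.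
- exact: UB.
- by move=> n i _; apply: bd; apply: pf_coef_bound.
- by move=> i; apply: (cvgcM (Hr i) (cvgc_cst _)).
- by move=> m; exists m.
Qed.

(** The tail of the perturbation is small in l2 and is paired with inverse distances of bounded l2
    norm; the finitely many other terms decay as [z] moves away from their poles. *)
Lemma sum_kap_small (e : R) : 0 < e -> exists rho : R, forall z : C,
  rho <= normc z -> (forall m : int, 2^-1 <= normc (m%:~R - z)) ->
  forall n, \sum_(j < n) normc (k j / (a j - z)) <= e.
Proof.
move=> e0; pose W n := \sum_(j < n) normc (k j) ^+ 2.
have Wnd : {homo W : m n / (m <= n)%N >-> m <= n}.
  move=> m n mn; rewrite /W -(big_mkord xpredT (fun j => normc (k j) ^+ 2)).
  rewrite -(big_mkord xpredT (fun j => normc (k j) ^+ 2)) [leRHS](@big_cat_nat _ _ _ m) //=.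
  by rewrite lerDl sumr_ge0 // => j _; apply: sqr_ge0.
(* At distance 1/2 from the integers the inverse squares sum to at most 27 * 4 = 108 <= 216; the
   weight 432 / e makes 216 / s equal to e / 2. *)
have [s [s0 sE]] : exists s : R, 0 < s /\ s = 432 / e.
  by exists (432 / e); split; [apply: divr_gt0; [rewrite ltr0n|exact: e0]|].
have es0 : 0 < e / 2 / s by rewrite !divr_gt0.
have [K HK] := ndbounded_tail Wnd HA es0.
pose M := \sum_(j < K) normc (k j); pose L := \sum_(j < K) normc (a j).
have M0 : 0 <= M by apply: sumr_ge0 => *; apply: normc_ge0.
exists (L + 2 * M / e + 1) => z zr zd n.
have tail m : (K <= m)%N -> \sum_(K <= j < m) normc (k j / (a j - z)) <= e / 2.
  move=> Km; rewrite -[K]add0n big_addn big_mkord.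
  under eq_bigr do rewrite normcM normcV.
  apply: le_trans (sum_amgm (fun j => normc (k (j + K)%N))
    (fun j => (normc (a (j + K)%N - z))^-1) _ s0) _.
  have h1 : \sum_(j < m - K) normc (k (j + K)%N) ^+ 2 <= e / 2 / s.
    have := HK m; rewrite /W -(big_mkord xpredT (fun j => normc (k j) ^+ 2)).
    rewrite -(big_mkord xpredT (fun j => normc (k j) ^+ 2)) (@big_cat_nat _ _ _ K) //=.
    by rewrite lerD2l -{1}[K]add0n big_addn big_mkord.
  have h2 : \sum_(j < m - K) (normc (a (j + K)%N - z))^-1 ^+ 2 <= 108.
    have := @sum_inv_sqr R z 2^-1 m ltac:(by rewrite invr_gt0) ltac:(lra) zd.
    rewrite -(big_mkord xpredT (fun j => (normc (a j - z))^-1 ^+ 2)) (@big_cat_nat _ _ _ K) //=.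
    rewrite -{2}[K]add0n big_addn [in X in _ + X]big_mkord => h.
    apply: (@le_trans _ _ (27 / 2^-1 ^+ 2)); last by rewrite exprVn invrK; lra.
    by apply: le_trans h; rewrite lerDr sumr_ge0 // => j _; apply: sqr_ge0.
  have -> : e / 2 = (s * (e / 2 / s) + s^-1 * 216) / 2.
    by rewrite sE; field; rewrite gt_eqF.
  have si0 : 0 < s^-1 by rewrite invr_gt0.
  rewrite ler_pM2r ?invr_gt0 //; apply: lerD; first by rewrite ler_pM2l.
  by rewrite ler_pM2l //; apply: le_trans h2 _; lra.
have head : \sum_(j < K) normc (k j / (a j - z)) <= e / 2.
  apply: (@le_trans _ _ (\sum_(j < K) normc (k j) * (e / (2 * M + e)))).
    apply: ler_sum => j _; rewrite normcM ler_wpM2l ?normc_ge0 // normcV.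
    have Me : 0 < 2 * M + e by lra.
    rewrite -[e / _]invf_div lef_pV2 ?posrE ?divr_gt0 //; last first.
      apply: lt_le_trans (zd _); lra.
    have : normc (a j) <= L.
      rewrite /L (bigD1 j) //= lerDl sumr_ge0 // => *; exact: normc_ge0.
    have := ler_normcB z (a j); rewrite normcB.
    have -> : (2 * M + e) / e = 2 * M / e + 1 by field; rewrite gt_eqF.
    lra.
  rewrite -mulr_suml -/M; have Me : 0 < 2 * M + e by lra.
  by rewrite mulrA ler_pdivrMr //; nra.
have mono : \sum_(j < n) normc (k j / (a j - z)) <= \sum_(j < maxn n K) normc (k j / (a j - z)).
  rewrite -(big_mkord xpredT (fun j => normc (k j / (a j - z)))).
  rewrite -[leRHS](big_mkord xpredT (fun j => normc (k j / (a j - z)))).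
  rewrite [leRHS](@big_cat_nat _ _ _ n) //= ?leq_maxl //.
  by rewrite lerDl sumr_ge0 // => j _; apply: normc_ge0.
apply: le_trans mono _.
rewrite -(big_mkord xpredT (fun j => normc (k j / (a j - z)))).
rewrite (@big_cat_nat _ _ _ K) //= ?leq_maxr // big_mkord (splitr e).
by apply: lerD => //; apply: tail; rewrite leq_maxr.
Qed.

End CanonicalProduct.

(** * The canonical product [Delta11] *)

Section CanonicalDelta.
Context {R : realType}.
Local Notation C := R[i].
Implicit Types z w : C.

Lemma cvgc_subseq (u : nat -> C) (l : C) (phi : nat -> nat) : (forall n, (n <= phi n)%N) ->
  (u n : R[i]^o) @[n --> \oo] --> (l : R[i]^o) ->
  (u (phi n) : R[i]^o) @[n --> \oo] --> (l : R[i]^o).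
Proof.
move=> Hphi /cvgcP H; apply/cvgcP => e /H [N _ HN]; exists N => // n /= Nn.
by apply: HN => /=; apply: leq_trans (Hphi n).
Qed.

(** The factors of [Delta11] of indices j + 1 and - (j + 1), multiplied together, minus 1. In the
    pair the exponentials cancel, and so do the terms of order z / j, which leaves a summable
    deviation. *)
Definition pair_dev (lam : int -> C) (j : nat) z : C :=
  (lam j.+1%:Z - z) * (lam (- j.+1%:Z) - z) / - (j.+1%:R ^+ 2) - 1.

Variables (kap : int -> C) (A : R) (lam : int -> C).
Hypothesis HA : forall n, \sum_(j < n) normc (kap (zn j)) ^+ 2 <= A.
Hypothesis lamE : forall n, lam n = n%:~R + kap n.

Definition pair_bound (rho : R) (j : nat) : R :=
  (normc (kap j.+1%:Z) ^+ 2 + normc (kap (- j.+1%:Z)) ^+ 2) +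
  (1 + (1 + A + rho) ^+ 2) * j.+1%:R ^- 2.

Lemma kap_bound n : normc (kap n) <= 1 + A.
Proof.
have : normc (kap n) ^+ 2 <= A.
  apply: le_trans (HA (znv n).+1); rewrite big_ord_recr /= znvK lerDr.
  by apply: sumr_ge0 => *; apply: sqr_ge0.
have := normc_ge0 (kap n); move: (normc _) => x x0 xA.
have : 0 <= (x - 1) ^+ 2 by apply: sqr_ge0.
nra.
Qed.

Lemma pair_bound_ge0 rho j : 0 <= pair_bound rho j.
Proof.
rewrite addr_ge0 ?addr_ge0 ?sqr_ge0 // mulr_ge0 ?addr_ge0 ?sqr_ge0 //.
Qed.

Lemma sum_pair_bound rho n : \sum_(j < n) pair_bound rho j <= A + (1 + (1 + A + rho) ^+ 2) * 2.
Proof.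
rewrite big_split /= lerD //; last first.
  by rewrite -mulr_sumr ler_wpM2l ?sum_inv_sq_le // addr_ge0 ?sqr_ge0.
apply: le_trans (HA n.*2.+1).
rewrite (big_zn _ (fun m => normc (kap m) ^+ 2)) /= big_add1 big_mkord lerDr.
exact: sqr_ge0.
Qed.

Lemma pair_dev_bound rho z j : normc z <= rho -> normc (pair_dev lam j z) <= pair_bound rho j.
Proof.
move=> zr; rewrite /pair_dev !lamE mulrNz -pmulrn.
have k0 : (0 : R) < j.+1%:R by rewrite ltr0n.
have kC : (j.+1%:R : C) != 0 by rewrite pnatr_eq0.
have -> : (j.+1%:R + kap j.+1%:Z - z) * (- j.+1%:R + kap (- j.+1%:Z) - z) / - (j.+1%:R ^+ 2) - 1 =
    (kap j.+1%:Z / j.+1%:R - kap (- j.+1%:Z) / j.+1%:R) -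
    (kap j.+1%:Z - z) * (kap (- j.+1%:Z) - z) / j.+1%:R ^+ 2.
  by move: (j.+1%:R) kC => x x0; field.
rewrite /pair_bound; move: (kap_bound j.+1%:Z) (kap_bound (- j.+1%:Z)).
move: (kap j.+1%:Z) (kap (- j.+1%:Z)) => p q pb qb.
apply: le_trans (le_normcD _ _) _; rewrite normcN.
have h1 : normc (p / j.+1%:R - q / j.+1%:R) <= normc p ^+ 2 + normc q ^+ 2 + j.+1%:R ^- 2.
  apply: le_trans (le_normcD _ _) _; rewrite normcN !normcM normcV normc_nat.
  rewrite -exprVn; move: (j.+1%:R^-1) (normc p) (normc q) => x s t.
  have : 0 <= (s - x) ^+ 2 by apply: sqr_ge0.
  have : 0 <= (t - x) ^+ 2 by apply: sqr_ge0.
  have : 0 <= s ^+ 2 by apply: sqr_ge0.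
  have : 0 <= t ^+ 2 by apply: sqr_ge0.
  nra.
have h2 : normc ((p - z) * (q - z) / j.+1%:R ^+ 2) <= (1 + A + rho) ^+ 2 * j.+1%:R ^- 2.
  rewrite !normcM normcV normcX normc_nat ler_pM2r ?invr_gt0 ?exprn_gt0 // expr2.
  apply: ler_pM; rewrite ?normc_ge0 //; apply: le_trans (le_normcD _ _) _; rewrite normcN lerD //.
by apply: le_trans (lerD h1 h2) _; rewrite mulrDl mul1r !addrA.
Qed.

Lemma sum_pair_dev M z n : \sum_(j < n) normc (pair_dev lam (M + j) z) <=
  A + (1 + (1 + A + normc z) ^+ 2) * 2.
Proof.
apply: le_trans (sum_pair_bound (normc z) (M + n)).
rewrite big_split_ord /=; apply: (@le_trans _ _ (\sum_(j < n) pair_bound (normc z) (M + j)%N)).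
  by apply: ler_sum => j _; apply: pair_dev_bound.
by rewrite lerDr sumr_ge0 // => j _; apply: pair_bound_ge0.
Qed.

(** The canonical product without its factors of index |n| <= M. Once M is large it has no zeros on
    a given disc, so the zeros there all belong to a polynomial. *)
Definition tail_prod M z : C :=
  lim ((\prod_(j < n) (1 + pair_dev lam (M + j) z) : R[i]^o) @[n --> \oo]).

Lemma tail_prod_cvg M z :
  (\prod_(j < n) (1 + pair_dev lam (M + j) z) : R[i]^o) @[n --> \oo] -->
  (tail_prod M z : R[i]^o).
Proof.
have [l Hl] := @prod_cvgc R (fun j => pair_dev lam (M + j) z) _ (sum_pair_dev M z).
rewrite /tail_prod; have -> : lim ((\prod_(j < n) (1 + pair_dev lam (M + j) z) : R[i]^o) @[n --> \oo]) = l.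
  by apply: cvg_lim => //; exact: norm_hausdorff.
exact: Hl.
Qed.

Arguments tail_prod_cvg : clear implicits.

Lemma tail_prodS M z : tail_prod 0 z = \prod_(j < M) (1 + pair_dev lam j z) * tail_prod M z.
Proof.
pose proof (cvgcM (cvgc_cst (\prod_(j < M) (1 + pair_dev lam j z))) (tail_prod_cvg M z)) as H.
apply: (cvgc_uniq _ _ H) => /=.
apply: (eq_cvgc _ (cvgc_subseq (phi := fun n => (M + n)%N) (leq_addl M) (tail_prod_cvg 0 z))) => n /=.
by rewrite big_split_ord.
Qed.

Lemma Delta11E z : Delta11 lam z = pi%:C * (lam 0 - z) * tail_prod 0 z.
Proof.
rewrite /Delta11 /prod_nonzero; congr (_ * _); apply: lim_cvgc.
apply: (eq_cvgc _ (tail_prod_cvg 0 z)) => N /=; symmetry; rewrite big_add1 /= big_mkord; apply: eq_bigr => j _.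
rewrite /pair_dev mulrNz -pmulrn add0n.
rewrite mulrACA -cexpD [z / - _]mulrC invrN mulNr [_^-1 * z]mulrC subrr cexp0 mulr1.
have j0 : (j.+1%:R : C) != 0 by rewrite pnatr_eq0.
by move: (j.+1%:R) j0 => x x0; field.
Qed.

Lemma Delta11_cvg z :
  (pi%:C * (lam 0 - z) * \prod_(j < n) (1 + pair_dev lam j z) : R[i]^o) @[n --> \oo] -->
  (Delta11 lam z : R[i]^o).
Proof. rewrite Delta11E; exact: (cvgcM (cvgc_cst _) (tail_prod_cvg 0 z)). Qed.

Arguments Delta11_cvg : clear implicits.

(** The majorant [pair_bound] depends on [z] only through the radius, hence the uniformity;
    continuity and polynomial approximation of the product rest on it. *)
Lemma tail_prod_near M rho (e : R) : 0 < e -> exists m : nat, forall z, normc z <= rho ->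
  normc (tail_prod M z - \prod_(j < m) (1 + pair_dev lam (M + j) z)) <= e.
Proof.
move=> e0; pose V j := pair_bound rho (M + j)%N.
have V0 j : 0 <= V j by apply: pair_bound_ge0.
have VB n : \sum_(j < n) V j <= A + (1 + (1 + A + rho) ^+ 2) * 2.
  apply: le_trans (sum_pair_bound rho (M + n)).
  by rewrite big_split_ord /= lerDr sumr_ge0 // => j _; apply: pair_bound_ge0.
have [m Hm] := ndbounded_tail (W := fun n => \prod_(j < n) (1 + V j))
  (fun m n mn => prod1D_ge1 mn V0) (fun n => prod1D_exp V0 (VB n)) e0.
exists m => z zr.
pose proof (cvgcB (tail_prod_cvg M z) (cvgc_cst (\prod_(j < m) (1 + pair_dev lam (M + j) z)))) as H.
apply: (normc_cvg_le _ H); exists m => // n /= mn.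
have := @prod_dom R (fun j => pair_dev lam (M + j) z) V m n mn
  (fun j _ => pair_dev_bound _ zr).
move/le_trans; apply; rewrite lerBlDl; exact: Hm.
Qed.

Lemma pair_dev_continuous j z0 :
  (pair_dev lam j z : R[i]^o) @[z --> (z0 : R[i]^o)] --> (pair_dev lam j z0 : R[i]^o).
Proof.
have Hz : (z : R[i]^o) @[z --> (z0 : R[i]^o)] --> (z0 : R[i]^o) by exact: cvg_id.
have H1 n : ((lam n - z) : R[i]^o) @[z --> (z0 : R[i]^o)] --> (lam n - z0 : R[i]^o).
  exact: (cvgcB (cvgc_cst (lam n)) Hz).
exact: (cvgcB (cvgcM (cvgcM (H1 _) (H1 _)) (cvgc_cst (- (j.+1%:R ^+ 2))^-1)) (cvgc_cst 1)).
Qed.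

Arguments pair_dev_continuous : clear implicits.

Lemma tail_prod_continuous M z0 :
  (tail_prod M z : R[i]^o) @[z --> (z0 : R[i]^o)] --> (tail_prod M z0 : R[i]^o).
Proof.
apply/cvgc_atP => e e0; have e3 : 0 < e / 3 by rewrite divr_gt0.
have [m Hm] := tail_prod_near M (normc z0 + 1) e3.
have Hc : (\prod_(j < m) (1 + pair_dev lam (M + j) z) : R[i]^o) @[z --> (z0 : R[i]^o)] -->
    (\prod_(j < m) (1 + pair_dev lam (M + j) z0) : R[i]^o).
  apply: (@cvgc_prod R C (nbhs (z0 : R[i]^o)) (nbhs_filter (z0 : R[i]^o)) (fun z j => 1 + pair_dev lam (M + j) z)
    (fun j => 1 + pair_dev lam (M + j) z0) m) => j _.
  exact: (cvgcD (cvgc_cst 1) (pair_dev_continuous (M + j)%N z0)).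
have [d d0 Hd] := (cvgc_atP _ _ _).1 Hc _ e3.
exists (Num.min d 1); first by rewrite lt_min d0 ltr01.
move=> z; rewrite lt_min => /andP[/Hd h1 w1].
have h2 : normc z <= normc z0 + 1.
  by rewrite -lerBlDl; apply: le_trans (ltW w1); exact: ler_normcB.
have h3 := Hm z h2; have h4 := Hm z0 ltac:(by rewrite lerDl).
move: h1 h3 h4; set P := \prod_(_ < _) _; set Q := \prod_(_ < _) _ => h1 h3 h4.
have -> : tail_prod M z - tail_prod M z0 =
    (tail_prod M z - P) + (P - Q) - (tail_prod M z0 - Q) by ring.
apply: le_lt_trans (le_normcD _ _) _; rewrite normcN.
apply: le_lt_trans (lerD (le_normcD _ _) (lexx _)) _; lra.
Qed.

Arguments tail_prod_continuous : clear implicits.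

Lemma tail_prod_neq0 M z :
  (forall k, (M < k)%N -> lam k%:Z != z /\ lam (- k%:Z) != z) -> tail_prod M z != 0.
Proof.
move=> H; apply: (@prod_limit_neq0 R (fun j => pair_dev lam (M + j) z) _ _
  (sum_pair_dev M z) _ (tail_prod_cvg M z)) => j.
rewrite /pair_dev addrCA subrr addr0.
have [h1 h2] := H (M + j).+1 ltac:(by rewrite ltnS leq_addr).
by rewrite mulf_neq0 // mulf_neq0 // subr_eq0.
Qed.

Lemma Delta11_continuous z0 :
  (Delta11 lam z : R[i]^o) @[z --> (z0 : R[i]^o)] --> (Delta11 lam z0 : R[i]^o).
Proof.
rewrite (funext Delta11E) /=; have Hz : (z : R[i]^o) @[z --> (z0 : R[i]^o)] --> (z0 : R[i]^o) by exact: cvg_id.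
exact: (cvgcM (cvgcM (cvgc_cst pi%:C) (cvgcB (cvgc_cst (lam 0)) Hz)) (tail_prod_continuous 0 z0)).
Qed.

Arguments Delta11_continuous : clear implicits.

(** Off the integers lam n - z = (n - z) (1 + kap n / (n - z)), and the factors n - z rebuild
    Euler's product. The two sides are compared along the partial products of 2 N + 1 factors. *)
Lemma Delta11_sin z (P : C) : (forall n : int, n%:~R != z) ->
  (\prod_(j < n) (1 + kap (zn j) / ((zn j)%:~R - z)) : R[i]^o) @[n --> \oo] --> (P : R[i]^o) ->
  Delta11 lam z = - csin (z * pi%:C) * P.
Proof.
move=> zZ HP.
pose proof (cvgcN (csin_prod (z := z))) as H1.
have le_odd n : (n <= n.*2.+1)%N by rewrite -addnn; lia.
pose proof (cvgc_subseq (phi := fun n => n.*2.+1) le_odd HP) as H2.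
apply: (cvgc_uniq _ (Delta11_cvg z)).
rewrite [z * _]mulrC; apply: (eq_cvgc _ (cvgcM H1 H2)) => N /=.
rewrite (big_zn _ (fun n => 1 + kap n / (n%:~R - z))) /= big_add1 big_mkord.
have z0 : z != 0 by rewrite eq_sym -(mulr0z 1) zZ.
rewrite mulrA; have -> : - (pi%:C * z * \prod_(j < N) (1 - (z / j.+1%:R) ^+ 2)) *
  (1 + kap 0 / (0%:~R - z)) = pi%:C * (lam 0 - z) * \prod_(j < N) (1 - (z / j.+1%:R) ^+ 2).
  by rewrite lamE !mulr0z sub0r; field.
rewrite -mulrA -big_split /=; congr (_ * _); apply: eq_bigr => j _.
rewrite /pair_dev addrCA subrr addr0 !lamE.
have := zZ j.+1%:Z; have := zZ (- j.+1%:Z); rewrite mulrNz -pmulrn.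
rewrite -subr_eq0 => h1; rewrite -subr_eq0 => h2.
have j0 : (j.+1%:R : C) != 0 by rewrite pnatr_eq0.
move: (j.+1%:R) j0 h1 h2 => x x0 h1 h2; field; rewrite h1 h2 x0 //.
Qed.

Lemma Delta11_eq0 z : Delta11 lam z = 0 -> exists n, z = lam n.
Proof.
move=> D0; have [//|] := pselect (exists n, z = lam n) => /forallNP H.
have H' n : lam n != z by apply/eqP => E; apply: (H n).
have := D0; rewrite Delta11E => /eqP; rewrite !mulf_eq0 subr_eq0 (negbTE (H' _)) orbF.
rewrite (negbTE (tail_prod_neq0 (fun k _ => conj (H' _) (H' _)))) orbF.
by rewrite -normc_eq0 normcR normr_eq0 gt_eqF // pi_gt0.
Qed.

End CanonicalDelta.

Arguments tail_prod_cvg {R kap A lam} HA lamE M z.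
Arguments Delta11_cvg {R kap A lam} HA lamE z.
Arguments tail_prod_continuous {R kap A lam} HA lamE M z0.
Arguments Delta11_continuous {R kap A lam} HA lamE z0.

(** * Reduction of [Delta12] to [Delta11] *)

Section HalfShift.
Context {R : realType}.
Local Notation C := R[i].

(** Both sides have the same linear factors. The denominators differ by the product of 1 - (1 / (2
    j)) ^ 2, which tends to 2 / pi by Euler's product at 1/2, and the exponentials must be shown to
    cancel. *)
Lemma Delta12_shift (kap : int -> C) (A : R) (lam : int -> C) (z : C) :
  (forall n, \sum_(j < n) normc (kap (zn j)) ^+ 2 <= A) ->
  (forall n, lam n = n%:~R - 2^-1 + kap n) ->
  Delta12 lam z = - Delta11 (fun n => lam n + 2^-1) (z + 2^-1).
Proof.
move=> HA lamE; pose lam' n := lam n + 2^-1; pose w := z + 2^-1.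
have lamE' n : lam' n = n%:~R + kap n by rewrite /lam' lamE addrAC subrK.
have HT := tail_prod_cvg HA lamE' 0 w.
pose q n := \prod_(j < n) (1 - (2^-1 / j.+1%:R) ^+ 2 : C).
have pi0 : pi%:C != 0 :> C by rewrite -normc_eq0 normcR normr_eq0 gt_eqF // pi_gt0.
have Hq : (q n : R[i]^o) @[n --> \oo] --> (2 / pi%:C : R[i]^o).
  have : csin (pi%:C / 2) = 1 :> C.
    have -> : pi%:C / 2 = (pi / 2)%:C :> C by rewrite rmorphM fmorphV /= rmorph_nat.
    by rewrite csinR sin_pihalf.
  move=> Hs; have -> : 2 / pi%:C = 2 / pi%:C * csin (pi%:C / 2) :> C by rewrite Hs mulr1.
  apply: (eq_cvgc _ (cvgcM (cvgc_cst (2 / pi%:C)) (csin_prod (z := (2^-1 : C))))) => n /=.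
  rewrite -/(q n) mulrA mulf_div [pi%:C * 2]mulrC divff ?mul1r //.
  by rewrite mulf_neq0 // pnatr_eq0.
have He : (cexp (- (z / (n%:R + 2^-1))) : R[i]^o) @[n --> \oo] --> (1 : R[i]^o).
  apply: (@cvgc_squeeze _ _ _ _ _ _ (fun n => normc z * expR (normc z * 2) * 2 / n.*2.+1%:R)).
    apply: nearW => n; apply: le_trans (cexp_near1 _) _; rewrite normcN normcM normcV.
    have -> : normc (n%:R + 2^-1 : C) = n.*2.+1%:R / 2.
      have -> : n%:R + 2^-1 = (n.*2.+1%:R / 2)%:C :> C.
        rewrite rmorphM fmorphV /= !rmorph_nat.
        have -> : n.*2.+1%:R = n%:R * 2 + 1 :> C by rewrite -natr1 -muln2 natrM.
        by field.
      by rewrite normcR ger0_norm ?divr_ge0.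
    rewrite invf_div; have m1 : (1 : R) <= n.*2.+1%:R by rewrite ler1n.
    move: (n.*2.+1%:R : R) m1 => m m1; have m0 : 0 < m by lra.
    have h : expR (normc z * (2 / m)) <= expR (normc z * 2).
      rewrite ler_expR ler_wpM2l ?normc_ge0 // ler_pdivrMr // ler_peMr //.
    have -> : normc z * expR (normc z * 2) * 2 / m = normc z * (2 / m) * expR (normc z * 2) by ring.
    by rewrite ler_wpM2l // mulr_ge0 ?normc_ge0 // divr_ge0 // ltW.
  exact: cvg_odd_inv.
have q0 : (2 / pi%:C : C) != 0 by rewrite mulf_neq0 ?invr_eq0 // pnatr_eq0.
pose proof (cvgcM (cvgcM HT (cvgcV q0 Hq)) (cvgcM (cvgc_cst (cexp (2 * z))) He)) as HV.
rewrite /Delta12 /prod_int (Delta11E HA lamE').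
have -> : prod_nonzero (fun n => (lam n - z) / (n%:~R - 2^-1) * cexp (z / (n%:~R - 2^-1))) =
    tail_prod lam' 0 w * (2 / pi%:C)^-1 * (cexp (2 * z) * 1).
  apply: lim_cvgc; apply: (eq_cvgc _ HV); elim=> [|n IH].
    rewrite /q !big_ord0 big_geq // invr1 !mul1r -cexpD.
    by rewrite (_ : 2 * z - z / (0%:R + 2^-1) = 0) ?cexp0 //; field.
  rewrite big_nat_recr //= -IH /q !big_ord_recr /= -/(q n) -[in RHS]mulrA.
  rewrite add0n /pair_dev addrCA subrr addr0 mulrNz -pmulrn.
  have qn0 : q n != 0.
    apply/prodf_neq0 => j _; rewrite subr_eq0 eq_sym sqrf_eq1; apply/norP.
    have jj : (1 : R) <= j.+1%:R by rewrite ler1n.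
    by split; apply/eqP => /(congr1 (@normc R)); rewrite ?normcN normcM !normcV !normc_nat normc1;
      move/eqP; rewrite lt_eqF // -invfM invf_lt1; lra.
  (* The exponents of the pair telescope: z / (n + 1/2) - z / (n + 3/2). Starting from the value 2
     z, the product of the first pairs is exp (2 z) times a factor that tends to 1. *)
  have E : cexp (- (z / (n.+1%:R + 2^-1))) = cexp (- (z / (n%:R + 2^-1))) *
      (cexp (z / (n.+1%:R - 2^-1)) * cexp (z / (- n.+1%:R - 2^-1))).
    rewrite -!cexpD; congr cexp.
    have h1 : (n.+1%:R + 2^-1 : C) != 0.
      have -> : n.+1%:R + 2^-1 = (n.+1%:R + 2^-1)%:C :> C by rewrite rmorphD fmorphV /= !rmorph_nat.
      by rewrite -normc_eq0 normcR normr_eq0 gt_eqF // ltr_wpDl.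
    have h2 : (n%:R + 2^-1 : C) != 0.
      have -> : n%:R + 2^-1 = (n%:R + 2^-1)%:C :> C by rewrite rmorphD fmorphV /= !rmorph_nat.
      by rewrite -normc_eq0 normcR normr_eq0 gt_eqF // ltr_wpDl.
    rewrite -opprD invrN mulrN.
    rewrite (_ : n.+1%:R - 2^-1 = n%:R + 2^-1 :> C); last by rewrite -natr1; field.
    by ring.
  rewrite E /lam' /w; move: (cexp (- _)) (cexp (_ / _)) (cexp (_ / _)) (cexp _) => e1 e2 e3 e4.
  set P := \prod_(_ < _) _; move: (q n) qn0 => Q Q0.
  have x0 : (n.+1%:R : C) != 0 by rewrite pnatr_eq0.
  have x1 : 2 * n.+1%:R - 1 != 0 :> C.
    by rewrite -(natrM _ 2) subr_eq0 -[1]/(1%:R) eqr_nat; lia.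
  have x2 : 2 * n.+1%:R + 1 != 0 :> C by rewrite -(natrM _ 2) natr1 pnatr_eq0.
  move: (n.+1%:R) x0 x1 x2 => x x0 x1 x2.
  have -> : 1 - (2^-1 / x) ^+ 2 = (2 * x - 1) * (2 * x + 1) / (4 * x ^+ 2) by field.
  have -> : x - 2^-1 = (2 * x - 1) / 2 by field.
  have -> : - x - 2^-1 = - (2 * x + 1) / 2 by field.
  by field; rewrite ?x0 ?x1 ?x2 ?Q0 //.
rewrite mulr1 invf_div; rewrite /lam' /w.
(* The factor of index 0 supplies exp (- 2 z), which removes the limit of the telescoping
   exponentials. *)
have -> : cexp (z / (0%:~R - 2^-1)) = (cexp (2 * z))^-1.
  by rewrite -cexpN; congr cexp; rewrite mulr0z; field.
have := cexp_neq0 (2 * z); move: (cexp _) (tail_prod _ _ _) => e T e0.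
by rewrite mulr0z; field; rewrite ?e0 ?pi0 //.
Qed.

End HalfShift.

(** * Integration of complex-valued functions *)

Section ComplexIntegral.
Context {R : realType} d (T : measurableType d).
Local Notation C := R[i].
Implicit Types (f g : T -> C).

Definition cmeas f : Prop :=
  measurable_fun setT (fun x => complex.Re (f x)) /\
  measurable_fun setT (fun x => complex.Im (f x)).

Lemma cmeas_cst (c : C) : cmeas (fun=> c).
Proof. by split; exact: measurable_cst. Qed.

Lemma cmeas_real (f : T -> R) : measurable_fun setT f -> cmeas (fun x => (f x)%:C).
Proof. by move=> mf; split => //=; exact: measurable_cst. Qed.

Lemma cmeasD f g : cmeas f -> cmeas g -> cmeas (fun x => f x + g x).
Proof.
move=> [fr fi] [gr gi]; split.
- by under eq_fun do rewrite ReD; exact: measurable_funD.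
- by under eq_fun do rewrite ImD; exact: measurable_funD.
Qed.

Lemma cmeasN f : cmeas f -> cmeas (fun x => - f x).
Proof.
move=> [fr fi]; split.
- by under eq_fun do rewrite ReN; exact: measurableT_comp.
- by under eq_fun do rewrite ImN; exact: measurableT_comp.
Qed.

Lemma cmeasB f g : cmeas f -> cmeas g -> cmeas (fun x => f x - g x).
Proof. by move=> mf mg; apply: cmeasD => //; exact: cmeasN. Qed.

Lemma cmeasM f g : cmeas f -> cmeas g -> cmeas (fun x => f x * g x).
Proof.
move=> [fr fi] [gr gi]; split.
- by under eq_fun do rewrite ReM; apply: measurable_funB; exact: measurable_funM.
- by under eq_fun do rewrite ImM; apply: measurable_funD; exact: measurable_funM.
Qed.

Lemma cmeas_sum n (F : nat -> T -> C) : (forall i, cmeas (F i)) ->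
  cmeas (fun x => \sum_(i < n) F i x).
Proof.
move=> H; elim: n => [|n IH].
  by under eq_fun do rewrite big_ord0; exact: cmeas_cst.
by under eq_fun do rewrite big_ord_recr; exact: cmeasD.
Qed.

Lemma cmeas_norm f : cmeas f -> measurable_fun setT (fun x => normc (f x)).
Proof.
move=> [fr fi].
rewrite (_ : (fun x => _) = fun x => Num.sqrt (complex.Re (f x) ^+ 2 + complex.Im (f x) ^+ 2)).
  apply: measurableT_comp; first by apply: continuous_measurable_fun; exact: sqrt_continuous.
  by apply: measurable_funD; exact: measurable_funX.
by apply/funext => x; case: (f x).
Qed.

Variable mu : {measure set T -> \bar R}.

Definition cL1 f : Prop :=
  cmeas f /\ mu.-integrable setT (fun x => (normc (f x))%:E).

Definition cI f : C :=
  (\int[mu]_x complex.Re (f x)) +i* (\int[mu]_x complex.Im (f x)).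

Definition nI f : R := \int[mu]_x normc (f x).

Lemma aeS (P Q : T -> Prop) : (forall x, P x -> Q x) ->
  {ae mu, forall x, P x} -> {ae mu, forall x, Q x}.
Proof. by move=> PQ; apply: filterS. Qed.

Lemma aeI (P Q : T -> Prop) : {ae mu, forall x, P x} -> {ae mu, forall x, Q x} ->
  {ae mu, forall x, P x /\ Q x}.
Proof. by move=> HP HQ; apply: filterS2 HP HQ. Qed.

Lemma cL1_meas f : cL1 f -> cmeas f. Proof. by case. Qed.

Lemma cL1_Re f : cL1 f -> mu.-integrable setT (fun x => (complex.Re (f x))%:E).
Proof.
move=> [[mr mi] Hi]; apply: le_integrable Hi => //; first exact/measurable_EFinP.
by move=> x _ /=; rewrite lee_fin [leRHS]ger0_norm ?normc_ge0 // le_Re_normc.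
Qed.

Lemma cL1_Im f : cL1 f -> mu.-integrable setT (fun x => (complex.Im (f x))%:E).
Proof.
move=> [[mr mi] Hi]; apply: le_integrable Hi => //; first exact/measurable_EFinP.
by move=> x _ /=; rewrite lee_fin [leRHS]ger0_norm ?normc_ge0 // le_Im_normc.
Qed.

Lemma cL1_dom f (g : T -> R) : cmeas f -> mu.-integrable setT (fun x => (g x)%:E) ->
  (forall x, normc (f x) <= g x) -> cL1 f.
Proof.
move=> mf Hg fg; split=> //; apply: le_integrable Hg => //.
  by apply/measurable_EFinP; exact: cmeas_norm.
by move=> x _ /=; rewrite lee_fin ger0_norm ?normc_ge0 // (le_trans (fg x)) // ler_norm.
Qed.

Lemma cL1_norm f : cL1 f -> mu.-integrable setT (fun x => (normc (f x))%:E).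
Proof. by case. Qed.

Lemma integrable_realZ (c : R) (g : T -> R) :
  mu.-integrable setT (fun x => (g x)%:E) -> mu.-integrable setT (fun x => (c * g x)%:E).
Proof.
move=> H; have := integrableZl measurableT c H.
by apply: eq_integrable => // x _ /=; rewrite EFinM.
Qed.

Lemma integrable_realD (g h : T -> R) :
  mu.-integrable setT (fun x => (g x)%:E) -> mu.-integrable setT (fun x => (h x)%:E) ->
  mu.-integrable setT (fun x => (g x + h x)%:E).
Proof.
move=> H1 H2; have := integrableD measurableT H1 H2.
by apply: eq_integrable => // x _ /=; rewrite EFinD.
Qed.

Lemma cL1D f g : cL1 f -> cL1 g -> cL1 (fun x => f x + g x).
Proof.
move=> [mf Hf] [mg Hg]; apply: (cL1_dom (g := fun x => normc (f x) + normc (g x))).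
- exact: cmeasD.
- exact: integrable_realD.
- by move=> x; exact: le_normcD.
Qed.

Lemma cL1M (b : T -> C) f (B : R) : cmeas b -> (forall x, normc (b x) <= B) -> cL1 f ->
  cL1 (fun x => b x * f x).
Proof.
move=> mb bB [mf Hf]; apply: (cL1_dom (g := fun x => B * normc (f x))).
- exact: cmeasM.
- exact: integrable_realZ.
- by move=> x; rewrite normcM ler_wpM2r ?normc_ge0.
Qed.

Lemma cL1Z (c : C) f : cL1 f -> cL1 (fun x => c * f x).
Proof. by apply: (@cL1M (fun=> c) f (normc c)) => //; exact: cmeas_cst. Qed.

Lemma cL1N f : cL1 f -> cL1 (fun x => - f x).
Proof. by move=> /(cL1Z (- 1)); under eq_fun do rewrite mulN1r. Qed.

Lemma cL1B f g : cL1 f -> cL1 g -> cL1 (fun x => f x - g x).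
Proof. by move=> Hf Hg; apply: cL1D => //; exact: cL1N. Qed.

Lemma cID f g : cL1 f -> cL1 g -> cI (fun x => f x + g x) = cI f + cI g.
Proof.
move=> Hf Hg; apply/eqP; rewrite eq_complex /=.
under eq_Rintegral do rewrite ReD.
under [X in _ && (X == _)]eq_Rintegral do rewrite ImD.
by rewrite !RintegralD ?eqxx //; by [exact: cL1_Re|exact: cL1_Im].
Qed.

Lemma cIZ (c : C) f : cL1 f -> cI (fun x => c * f x) = c * cI f.
Proof.
move=> Hf; have Hr := cL1_Re Hf; have Hi := cL1_Im Hf.
case: c => a b; apply/eqP; rewrite eq_complex /=.
under eq_Rintegral do rewrite ReM /=.
under [X in _ && (X == _)]eq_Rintegral do rewrite ImM /=.
rewrite RintegralB // ?RintegralD //; try exact: integrable_realZ.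
by rewrite !RintegralZl // !eqxx.
Qed.

Lemma cIN f : cL1 f -> cI (fun x => - f x) = - cI f.
Proof.
by move=> Hf; under eq_fun do rewrite -mulN1r; rewrite cIZ // mulN1r.
Qed.

Lemma cIB f g : cL1 f -> cL1 g -> cI (fun x => f x - g x) = cI f - cI g.
Proof. by move=> Hf Hg; rewrite cID ?cIN //; exact: cL1N. Qed.

Lemma cL1_0 : cL1 (fun=> 0).
Proof.
split; first exact: cmeas_cst.
by under eq_fun do rewrite normc0; exact: integrable0.
Qed.

Lemma cI0 : cI (fun=> 0) = 0.
Proof. by rewrite /cI /= /Rintegral integral0. Qed.

Lemma cL1_sum n (F : nat -> T -> C) : (forall i, cL1 (F i)) ->
  cL1 (fun x => \sum_(i < n) F i x).
Proof.
move=> H; elim: n => [|n IH].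
  by under eq_fun do rewrite big_ord0; exact: cL1_0.
by under eq_fun do rewrite big_ord_recr; exact: cL1D.
Qed.

Lemma cI_sum n (F : nat -> T -> C) : (forall i, cL1 (F i)) ->
  cI (fun x => \sum_(i < n) F i x) = \sum_(i < n) cI (F i).
Proof.
move=> H; elim: n => [|n IH].
  by under eq_fun do rewrite big_ord0; rewrite big_ord0 cI0.
under eq_fun do rewrite big_ord_recr; rewrite big_ord_recr /= -IH cID //.
exact: cL1_sum.
Qed.

Lemma nI_ge0 f : 0 <= nI f.
Proof. by apply: Rintegral_ge0 => x _; exact: normc_ge0. Qed.

(** Multiplication by the conjugate of the integral makes the integral real; the real part of the
    integrand is then dominated by its modulus. *)
Lemma cI_norm f : cL1 f -> normc (cI f) <= nI f.
Proof.
move=> Hf; have [->|I0] := eqVneq (cI f) 0; first by rewrite normc0 nI_ge0.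
have N0 : 0 < normc (cI f) by rewrite normc_gt0.
pose c := conjc (cI f).
have nc : normc c = normc (cI f) by rewrite /c; case: (cI f) => a b; rewrite /normc /= sqrrN.
have E : normc (cI f) ^+ 2 = complex.Re (cI (fun x => c * f x)).
  by rewrite cIZ // normc_sqr ReM /c; case: (cI f) => a b /=; rewrite mulNr opprK !expr2.
rewrite -(ler_pM2l N0) -expr2 E /= /nI -RintegralZl //; last by case: Hf.
apply: le_Rintegral => //.
- exact: cL1_Re (cL1Z c Hf).
- by apply: integrable_realZ; case: Hf.
- move=> x _; apply: le_trans (ler_norm _) _; apply: le_trans (le_Re_normc _) _.
  by rewrite normcM nc.
Qed.

Lemma nI_le f (g : T -> R) : cL1 f -> mu.-integrable setT (fun x => (g x)%:E) ->
  (forall x, normc (f x) <= g x) -> nI f <= \int[mu]_x g x.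
Proof. by move=> [_ Hf] Hg H; apply: le_Rintegral. Qed.

Lemma cI_ae f g : cmeas f -> cmeas g -> {ae mu, forall x, f x = g x} -> cI f = cI g.
Proof.
move=> [fr fi] [gr gi] H; rewrite /cI; congr (_ +i* _); congr fine;
  apply: ae_eq_integral => //; try exact/measurable_EFinP.
- by apply: filterS H => x /= -> _.
- by apply: filterS H => x /= -> _.
Qed.

Lemma cI_dct (f_ : nat -> T -> C) f (g : T -> R) :
  (forall n, cmeas (f_ n)) -> cmeas f -> mu.-integrable setT (fun x => (g x)%:E) ->
  (forall n x, normc (f_ n x) <= g x) ->
  {ae mu, forall x, (f_ n x : R[i]^o) @[n --> \oo] --> (f x : R[i]^o)} ->
  (cI (f_ n) : R[i]^o) @[n --> \oo] --> (cI f : R[i]^o).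
Proof.
move=> mf_ mf Hg fg H.
have key (p : C -> R) : (forall z w, p z - p w = p (z - w)) ->
    (forall z, `|p z| <= normc z) ->
    (forall n, measurable_fun setT (fun x => p (f_ n x))) ->
    measurable_fun setT (fun x => p (f x)) ->
    (\int[mu]_x p (f_ n x)) @[n --> \oo] --> \int[mu]_x p (f x).
  move=> pB pn mpf_ mpf.
  have [] := @dominated_convergence _ _ _ mu setT measurableT
    (fun n x => (p (f_ n x))%:E) (fun x => (p (f x))%:E) (fun x => (g x)%:E).
  - by move=> n; apply/measurable_EFinP.
  - exact/measurable_EFinP.
  - apply: filterS H => x Hx _; apply: cvg_EFin; first exact: nearW.
    apply/cvgrPdist_lt => e e0; have /cvgcP/(_ _ e0) := Hx.
    apply: filterS => n /= h; rewrite distrC pB; exact: le_lt_trans (pn _) h.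
  - exact: Hg.
  - apply: aeW => x n _ /=; rewrite lee_fin; exact: le_trans (pn _) (fg _ _).
  - move=> If _ Hc; apply: fine_cvg; rewrite fineK; last exact: integrable_fin_num.
    exact: Hc.
case: mf => mr mi; apply: cvgc_ReIm => /=.
- apply: key => //; [by move=> z w; rewrite ReD ReN|exact: le_Re_normc|by move=> n; case: (mf_ n)].
- apply: key => //; [by move=> z w; rewrite ImD ImN|exact: le_Im_normc|by move=> n; case: (mf_ n)].
Qed.

End ComplexIntegral.

(** * Invariance of the integral under translations and reflections *)

Section AffineInvariance.
Context {R : realType}.
Local Notation C := R[i].
Local Notation mu := (@lebesgue_measure R).
Local Notation rmeas := (@cmeas R _ (measurableTypeR R)).
Variables (s c : R).
Hypothesis s1 : s = 1 \/ s = -1.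
Let aff : measurableTypeR R -> measurableTypeR R := fun x => s * x + c.

Let maff : measurable_fun setT aff.
Proof. by apply: measurable_funD => //; apply: measurable_funM. Qed.

(** By uniqueness of Lebesgue measure it is enough to compare half-open intervals; a reflection
    exchanges the closed and the open end, which does not change the length. *)
Lemma lebesgue_aff (A : set R) : measurable A -> mu (aff @^-1` A) = mu A.
Proof.
move=> mA; rewrite -[LHS]/(pushforward mu aff A).
apply/esym/lebesgue_measure_unique => // _ [[a b] /= _ <-]; rewrite /pushforward.
case: s1 => sE.
- have -> : aff @^-1` `]a, b] = `](a - c), (b - c)]%classic.
    by apply/seteqP; split => x /=; rewrite !in_itv /= /aff sE mul1r ltrBlDr lerBrDr.
  rewrite !lebesgue_measure_itv /= !lte_fin ltrD2r; case: ifP => // _.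
  by rewrite -!EFinB; congr EFin; ring.
- have -> : aff @^-1` `]a, b] = `[(c - b), (c - a)[%classic.
    apply/seteqP; split => x /=; rewrite !in_itv /= /aff sE mulN1r => /andP[h1 h2];
    by apply/andP; split; lra.
  rewrite !lebesgue_measure_itv /= !lte_fin ltrD2l ltrN2; case: ifP => // _.
  by rewrite -!EFinB; congr EFin; ring.
Qed.

Lemma ge0_integral_aff (f : R -> \bar R) : measurable_fun setT f -> (forall x, (0 <= f x)%E) ->
  (\int[mu]_x f (aff x) = \int[mu]_x f x)%E.
Proof.
move=> mf f0; have := @ge0_integral_pushforward _ _ _ _ _ aff maff mu setT f measurableT mf (fun x _ => f0 x).
rewrite preimage_setT => <-.
by apply: eq_measure_integral => A mA _; exact: lebesgue_aff.
Qed.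

Lemma integral_aff (f : R -> R) : mu.-integrable setT (fun x => (f x)%:E) ->
  mu.-integrable setT (fun x => (f (aff x))%:E) /\
  (\int[mu]_x f (aff x) = \int[mu]_x f x).
Proof.
move=> If; have mf : measurable_fun setT (fun x => (f x)%:E) by apply: measurable_int If.
have Ia : mu.-integrable setT (fun x => (f (aff x))%:E).
  apply/integrableP; split; first exact: (measurableT_comp mf maff).
  rewrite (ge0_integral_aff (f := fun x => `|(f x)%:E|%E)) //; first by case/integrableP: If.
  exact: measurableT_comp.
split=> //; rewrite /Rintegral; congr fine.
have := @integral_pushforward _ _ _ _ _ aff maff mu setT (fun x => (f x)%:E) mf.
rewrite preimage_setT => /(_ Ia measurableT) <-.
by apply: eq_measure_integral => A mA _; exact: lebesgue_aff.
Qed.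

Lemma cmeas_aff (f : R -> C) : rmeas f -> rmeas (fun x => f (aff x)).
Proof. by move=> [fr fi]; split; [exact: (measurableT_comp fr)|exact: (measurableT_comp fi)]. Qed.

Lemma cL1_aff (f : R -> C) : cL1 mu f -> cL1 mu (fun x => f (aff x)).
Proof.
move=> [mf If]; split; first exact: cmeas_aff.
exact: (integral_aff If).1.
Qed.

Lemma cI_aff (f : R -> C) : cL1 mu f -> cI mu (fun x => f (aff x)) = cI mu f.
Proof.
move=> Hf; rewrite /cI.
by rewrite (integral_aff (cL1_Re Hf)).2 (integral_aff (cL1_Im Hf)).2.
Qed.

End AffineInvariance.

(** * Fubini's theorem for complex-valued functions *)

Section ComplexFubini.
Context {R : realType} d1 d2 (T1 : measurableType d1) (T2 : measurableType d2).
Local Notation C := R[i].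
Variable m1 : {sigma_finite_measure set T1 -> \bar R}.
Variable m2 : {sigma_finite_measure set T2 -> \bar R}.

(** Every slice, not merely almost every one, is integrable here, so that the finite-valued inner
    integrals agree everywhere with the extended ones of the real theorem. *)
Lemma cfubini (F : T1 * T2 -> C) : cmeas F ->
  (forall x, cL1 m2 (fun y => F (x, y))) -> (forall y, cL1 m1 (fun x => F (x, y))) ->
  (\int[m1]_x \int[m2]_y (normc (F (x, y)))%:E < +oo)%E ->
  [/\ cmeas (fun x => cI m2 (fun y => F (x, y))),
      cmeas (fun y => cI m1 (fun x => F (x, y))),
      cL1 m2 (fun y => cI m1 (fun x => F (x, y))) &
      cI m1 (fun x => cI m2 (fun y => F (x, y))) = cI m2 (fun y => cI m1 (fun x => F (x, y)))].
Proof.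
move=> [mr mi] H1 H2 Hlt.
have mn : measurable_fun setT (fun z => (normc (F z))%:E) by apply/measurable_EFinP; exact: cmeas_norm.
have In : (m1 \x m2)%E.-integrable setT (fun z => (normc (F z))%:E).
  apply: (proj2 (integrable12ltyP m1 m2 mn));
    under eq_integral do under eq_integral do rewrite gee0_abs ?lee_fin ?normc_ge0 //.
  exact: Hlt.
have Ir : (m1 \x m2)%E.-integrable setT (fun z => (complex.Re (F z))%:E).
  apply: le_integrable In => //; first exact/measurable_EFinP.
  by move=> z _ /=; rewrite lee_fin [leRHS]ger0_norm ?normc_ge0 // le_Re_normc.
have Ii : (m1 \x m2)%E.-integrable setT (fun z => (complex.Im (F z))%:E).
  apply: le_integrable In => //; first exact/measurable_EFinP.
  by move=> z _ /=; rewrite lee_fin [leRHS]ger0_norm ?normc_ge0 // le_Im_normc.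
have xr x : (\int[m2]_y (complex.Re (F (x, y))))%:E = (\int[m2]_y (complex.Re (F (x, y)))%:E)%E.
  by rewrite fineK //; apply: integrable_fin_num => //; exact: cL1_Re (H1 x).
have xi x : (\int[m2]_y (complex.Im (F (x, y))))%:E = (\int[m2]_y (complex.Im (F (x, y)))%:E)%E.
  by rewrite fineK //; apply: integrable_fin_num => //; exact: cL1_Im (H1 x).
have yr y : (\int[m1]_x (complex.Re (F (x, y))))%:E = (\int[m1]_x (complex.Re (F (x, y)))%:E)%E.
  by rewrite fineK //; apply: integrable_fin_num => //; exact: cL1_Re (H2 y).
have yi y : (\int[m1]_x (complex.Im (F (x, y))))%:E = (\int[m1]_x (complex.Im (F (x, y)))%:E)%E.
  by rewrite fineK //; apply: integrable_fin_num => //; exact: cL1_Im (H2 y).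
have M1 : cmeas (fun x => cI m2 (fun y => F (x, y))).
  split => /=; apply/measurable_EFinP => /=.
  - by rewrite (_ : _ \o _ = fun x => (\int[m2]_y (complex.Re (F (x, y)))%:E)%E);
      [exact: measurable_fubini_F Ir|exact/funext].
  - by rewrite (_ : _ \o _ = fun x => (\int[m2]_y (complex.Im (F (x, y)))%:E)%E);
      [exact: measurable_fubini_F Ii|exact/funext].
have M2 : cmeas (fun y => cI m1 (fun x => F (x, y))).
  split => /=; apply/measurable_EFinP => /=.
  - by rewrite (_ : _ \o _ = fun y => (\int[m1]_x (complex.Re (F (x, y)))%:E)%E);
      [exact: measurable_fubini_G Ir|exact/funext].
  - by rewrite (_ : _ \o _ = fun y => (\int[m1]_x (complex.Im (F (x, y)))%:E)%E);
      [exact: measurable_fubini_G Ii|exact/funext].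
split=> //.
- have IG : m2.-integrable setT (fubini_G m1 (fun z => (normc (F z))%:E)).
    apply/integrableP; split; first exact: measurable_fubini_G In.
    have := proj1 (integrable21ltyP m1 m2 mn) In; apply: le_lt_trans.
    rewrite le_eqVlt; apply/orP; left; apply/eqP; apply: eq_integral => y _.
    rewrite /fubini_G gee0_abs; last by apply: integral_ge0 => x _; rewrite lee_fin normc_ge0.
    by apply: eq_integral => x _; rewrite gee0_abs // lee_fin normc_ge0.
  apply: (cL1_dom (g := fun y => nI m1 (fun x => F (x, y)))) => //; last first.
    by move=> y; apply: cI_norm.
  apply: eq_integrable IG => // y _ /=; rewrite /fubini_G /nI /Rintegral fineK //.
  by apply: integrable_fin_num => //; case: (H2 y).
- rewrite /cI /=; congr (_ +i* _); rewrite /Rintegral; congr fine.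
  + by rewrite (eq_integral _ _ (fun x _ => xr x)) (eq_integral _ _ (fun y _ => yr y)) (Fubini Ir).
  + by rewrite (eq_integral _ _ (fun x _ => xi x)) (eq_integral _ _ (fun y _ => yi y)) (Fubini Ii).
Qed.

End ComplexFubini.

(** * Restriction to sets and square-integrable functions *)

Section Cut.
Context {R : realType}.
Local Notation C := R[i].
Local Notation mu := (@lebesgue_measure R).
Local Notation rmeas := (@cmeas R _ (measurableTypeR R)).

(** All integrals run over the whole line; restriction to a set is multiplication by its
    indicator. *)
Definition cut (A : set R) (f : R -> C) (x : R) : C := (\1_A x)%:C * f x.

Lemma cutE A f x : cut A f x = if x \in A then f x else 0.
Proof. by rewrite /cut indicE; case: (x \in A); rewrite ?mul1r ?mul0r. Qed.

Lemma cmeas_indic (A : set R) : measurable A -> rmeas (fun x => (\1_A x)%:C : C).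
Proof. by move=> mA; apply: cmeas_real. Qed.

Lemma cmeas_cut A f : measurable A -> rmeas f -> rmeas (cut A f).
Proof. by move=> mA mf; apply: cmeasM => //; exact: cmeas_indic. Qed.

Lemma normc_cut_le A f x : normc (cut A f x) <= normc (f x).
Proof. by rewrite cutE; case: ifP; rewrite ?normc0 ?normc_ge0. Qed.

Lemma normc_indic_le1 (A : set R) x : normc ((\1_A x)%:C : C) <= 1.
Proof. by rewrite indicE; case: (_ \in _); rewrite ?normc0 ?normc1. Qed.

Lemma cL1_cut A f : measurable A -> cL1 mu f -> cL1 mu (cut A f).
Proof.
move=> mA; apply: (@cL1M _ _ _ _ _ _ 1); first exact: cmeas_indic.
exact: normc_indic_le1.
Qed.

Definition cL2 (f : R -> C) : Prop :=
  rmeas f /\ mu.-integrable setT (fun x => (normc (f x) ^+ 2)%:E).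

Lemma cL2_dom f (g : R -> R) : rmeas f -> mu.-integrable setT (fun x => (g x)%:E) ->
  (forall x, normc (f x) ^+ 2 <= g x) -> cL2 f.
Proof.
move=> mf Hg fg; split=> //; apply: le_integrable Hg => //.
  by apply/measurable_EFinP; apply: measurable_funX; exact: cmeas_norm.
by move=> x _ /=; rewrite lee_fin ger0_norm ?sqr_ge0 // (le_trans (fg x)) // ler_norm.
Qed.

Lemma cL2D f g : cL2 f -> cL2 g -> cL2 (fun x => f x + g x).
Proof.
move=> [mf Hf] [mg Hg].
apply: (cL2_dom (g := fun x => 2 * (normc (f x) ^+ 2 + normc (g x) ^+ 2))).
- exact: cmeasD.
- exact/integrable_realZ/integrable_realD.
- move=> x; have := le_normcD (f x) (g x); have := normc_ge0 (f x + g x).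
  have := normc_ge0 (f x); have := normc_ge0 (g x).
  move: (normc (f x + g x)) (normc (f x)) (normc (g x)) => r p q q0 p0 r0 h.
  have : 0 <= (p - q) ^+ 2 by apply: sqr_ge0.
  have : r ^+ 2 <= (p + q) ^+ 2 by rewrite ler_sqr ?nnegrE ?addr_ge0.
  nra.
Qed.

Lemma cL2M (b f : R -> C) (B : R) : rmeas b -> (forall x, normc (b x) <= B) -> cL2 f ->
  cL2 (fun x => b x * f x).
Proof.
move=> mb bB [mf Hf]; apply: (cL2_dom (g := fun x => B ^+ 2 * normc (f x) ^+ 2)).
- exact: cmeasM.
- exact: integrable_realZ.
- move=> x; rewrite normcM exprMn ler_wpM2r ?sqr_ge0 // ler_sqr ?nnegrE ?normc_ge0 //.
  exact: le_trans (normc_ge0 _) (bB x).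
Qed.

Lemma cL2Z (c : C) f : cL2 f -> cL2 (fun x => c * f x).
Proof. by apply: (@cL2M (fun=> c) f (normc c)) => //; exact: cmeas_cst. Qed.

Lemma cL2_cut A f : measurable A -> cL2 f -> cL2 (cut A f).
Proof.
move=> mA; apply: (@cL2M _ _ 1); first exact: cmeas_indic.
exact: normc_indic_le1.
Qed.

Lemma cL2_aff (s c : R) f : s = 1 \/ s = -1 -> cL2 f -> cL2 (fun x => f (s * x + c)).
Proof.
move=> s1 [mf Hf]; split; first exact: cmeas_aff.
exact: (integral_aff c s1 Hf).1.
Qed.

Lemma integrable_indic_bnd (a b : R) : mu.-integrable setT (fun x => (\1_`[a, b]%classic x)%:E : \bar R).
Proof. exact: integrable_indic_itv. Qed.

Lemma cL2_bounded (a b B : R) f : rmeas f -> (forall x, normc (f x) <= B) ->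
  cL2 (cut `[a, b]%classic f).
Proof.
move=> mf fB; apply: (cL2_dom (g := fun x => B ^+ 2 * \1_`[a, b]%classic x)).
- exact: cmeas_cut.
- exact/integrable_realZ/integrable_indic_bnd.
- move=> x; rewrite cutE indicE; case: (x \in _); rewrite ?normc0 ?expr0n ?mulr0 //= mulr1.
  by rewrite ler_sqr ?nnegrE ?normc_ge0 //; exact: le_trans (normc_ge0 _) (fB x).
Qed.

Lemma cL1_bounded (a b B : R) f : rmeas f -> (forall x, normc (f x) <= B) ->
  cL1 mu (cut `[a, b]%classic f).
Proof.
move=> mf fB; apply: (@cL1_dom R _ _ mu _ (fun x => B * \1_`[a, b]%classic x)).
- exact: cmeas_cut.
- exact/integrable_realZ/integrable_indic_bnd.
- by move=> x; rewrite cutE indicE; case: (x \in _); rewrite ?normc0 ?mulr0 //= mulr1.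
Qed.

(** On a bounded interval |f| <= 1 + |f| ^ 2. *)
Lemma cL2_cL1 (a b : R) f : cL2 f -> (forall x, x \notin `[a, b] -> f x = 0) -> cL1 mu f.
Proof.
move=> [mf Hf] f0.
apply: (@cL1_dom R _ _ mu _ (fun x => \1_`[a, b]%classic x + normc (f x) ^+ 2)) => //.
  exact: integrable_realD (integrable_indic_bnd a b) Hf.
move=> x; rewrite indicE; have [xab|xab] := boolP (x \in `[a, b]).
  rewrite mem_set //=; have : 0 <= (normc (f x) - 1) ^+ 2 by apply: sqr_ge0.
  have := normc_ge0 (f x); nra.
by rewrite f0 // normc0 expr0n addr0.
Qed.

Lemma cL2_prod f g : cL2 f -> cL2 g -> cL1 mu (fun x => f x * g x) /\
  nI mu (fun x => f x * g x) <=
    \int[mu]_x (normc (f x) ^+ 2) + \int[mu]_x (normc (g x) ^+ 2).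
Proof.
move=> [mf Hf] [mg Hg].
have le x : normc (f x * g x) <= normc (f x) ^+ 2 + normc (g x) ^+ 2.
  rewrite normcM; have := normc_ge0 (f x); have := normc_ge0 (g x).
  move: (normc (f x)) (normc (g x)) => p q p0 q0; have : 0 <= (p - q) ^+ 2 by apply: sqr_ge0.
  nra.
have Hfg : mu.-integrable setT (fun x => (normc (f x) ^+ 2 + normc (g x) ^+ 2)%:E).
  exact: integrable_realD.
have H : cL1 mu (fun x => f x * g x) by apply: (cL1_dom (cmeasM mf mg) Hfg).
split=> //; apply: le_trans (nI_le H Hfg le) _.
by rewrite RintegralD.
Qed.

Lemma in_L2_cL2 f : in_L2 f -> cL2 (cut `]0, pi[%classic f).
Proof.
move=> [mr mi Hf]; set D := `]0, pi[%classic.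
have mD : measurable D by exact: measurable_itv.
have mc : rmeas (cut D f).
  split.
  - rewrite (_ : (fun x => _) = (fun x => complex.Re (f x)) \_ D).
      exact/(measurable_restrictT _ mD).
    by apply/funext => x; rewrite cutE patchE; case: ifP.
  - rewrite (_ : (fun x => _) = (fun x => complex.Im (f x)) \_ D).
      exact/(measurable_restrictT _ mD).
    by apply/funext => x; rewrite cutE patchE; case: ifP.
split=> //; apply/integrableP; split.
  by apply/measurable_EFinP; apply: measurable_funX; exact: cmeas_norm.
move: Hf; rewrite integral_mkcond; apply: le_lt_trans.
rewrite le_eqVlt; apply/orP; left; apply/eqP; apply: eq_integral => x _.
rewrite cutE patchE -/D; case: ifP => _; rewrite gee0_abs ?lee_fin ?sqr_ge0 //.
by rewrite normc0 expr0n.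
Qed.

Lemma cL2_in_L2 f : cL2 f -> in_L2 f.
Proof.
move=> [[mr mi] /integrableP[m Hf]]; split.
- exact: measurable_funTS.
- exact: measurable_funTS.
- apply: le_lt_trans Hf; under [leRHS]eq_integral do rewrite gee0_abs ?lee_fin ?sqr_ge0 //.
  apply: ge0_subset_integral => //; last by move=> x _; rewrite lee_fin sqr_ge0.
Qed.

End Cut.

(** * Entire functions given together with their derivatives *)

Section TaylorFamily.
Context {R : realType}.
Local Notation C := R[i].
Implicit Types (D : nat -> C -> C).

(* D k plays the role of the k-th derivative of D 0, an entire function of
   exponential type at most pi. *)
Definition taylor_family D : Prop := forall k z, exists B : R, forall n h,
  normc (D k (h + z) - \sum_(j < n) D (k + j)%N z / j`!%:R * h ^+ j) <=
  B * ((pi * normc h) ^+ n / n`!%:R * expR (pi * normc h)).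

Lemma taylor_familyD D1 D2 : taylor_family D1 -> taylor_family D2 ->
  taylor_family (fun k z => D1 k z + D2 k z).
Proof.
move=> H1 H2 k z; have [B1 h1] := H1 k z; have [B2 h2] := H2 k z.
exists (B1 + B2) => n h; rewrite mulrDl; apply: le_trans (lerD (h1 n h) (h2 n h)).
apply: le_trans (le_normcD _ _); rewrite le_eqVlt; apply/orP; left; apply/eqP.
congr normc; rewrite addrACA -opprD -big_split; congr (_ - _).
by apply: eq_bigr => j _; rewrite /= !mulrDl.
Qed.

Lemma taylor_familyZ c D : taylor_family D -> taylor_family (fun k z => c * D k z).
Proof.
move=> H k z; have [B hB] := H k z; exists (normc c * B) => n h.
rewrite -[leRHS]mulrA; apply: le_trans (ler_wpM2l (normc_ge0 c) (hB n h)).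
rewrite -normcM le_eqVlt; apply/orP; left; apply/eqP; congr normc.
rewrite mulrBr mulr_sumr; congr (_ - _).
by apply: eq_bigr => j _; rewrite !mulrA.
Qed.

Lemma cexp_taylor_le (w : C) (b : R) n : normc w <= b ->
  normc (cexp w - \sum_(j < n) w ^+ j / j`!%:R) <= b ^+ n / n`!%:R * expR b.
Proof.
move=> wb; apply: le_trans (cexp_taylor n w) _.
apply: ler_pM; rewrite ?expR_ge0 ?ler_expR //.
  by rewrite mulr_ge0 ?exprn_ge0 ?normc_ge0.
by rewrite ler_wpM2r // lerXn2r ?nnegrE ?normc_ge0 // (le_trans (normc_ge0 w)).
Qed.

Lemma taylor_family_cexp c : normc c <= pi ->
  taylor_family (fun k z => c ^+ k * cexp (c * z)).
Proof.
move=> cpi k z; exists (normc (c ^+ k * cexp (c * z))) => n h.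
rewrite mulrDr cexpD.
have -> : c ^+ k * (cexp (c * h) * cexp (c * z)) -
    \sum_(j < n) c ^+ (k + j) * cexp (c * z) / j`!%:R * h ^+ j =
    c ^+ k * cexp (c * z) * (cexp (c * h) - \sum_(j < n) (c * h) ^+ j / j`!%:R).
  rewrite mulrBr mulr_sumr; congr (_ - _); first by ring.
  by apply: eq_bigr => j _; rewrite exprMn exprD; ring.
rewrite normcM ler_wpM2l ?normc_ge0 //; apply: cexp_taylor_le.
by rewrite normcM ler_wpM2r ?normc_ge0.
Qed.

Lemma taylor_family_derive1 D k z : taylor_family D ->
  derive1 (D k : C -> R[i]^o) z = D k.+1 z.
Proof.
move=> H; have [B hB] := H k z.
apply: (@derive1c_quad R _ _ _ (`|B| * (pi ^+ 2 * expR pi))) => h h1.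
have := hB 2 h; rewrite big_ord_recr big_ord1 /= addn0 addn1 !expr0 expr1 !divr1 mulr1.
rewrite [D k.+1 z * h]mulrC opprD addrA => /le_trans; apply.
have pi0 := pi_gt0 R; have n0 := normc_ge0 h.
apply: (@le_trans _ _ (`|B| * ((pi * normc h) ^+ 2 / 2`!%:R * expR (pi * normc h)))).
  rewrite ler_wpM2r ?ler_norm // mulr_ge0 ?expR_ge0 // divr_ge0 ?sqr_ge0 //.
rewrite -[leRHS]mulrA ler_wpM2l //.
have -> : pi ^+ 2 * expR pi * normc h ^+ 2 = (pi * normc h) ^+ 2 * expR pi by ring.
apply: ler_pM; rewrite ?expR_ge0 ?divr_ge0 ?sqr_ge0 //.
  by rewrite ler_piMr ?sqr_ge0 // invf_le1 ?ltr0n ?ler1n.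
by rewrite ler_expR ler_piMr // ltW.
Qed.

Lemma taylor_family_derive1n D m z : taylor_family D ->
  derive1n m (D 0 : C -> R[i]^o) z = D m z.
Proof.
move=> H; elim: m z => [|m IH] z //.
rewrite derive1nS (funext IH).
exact: taylor_family_derive1.
Qed.

Lemma punctured_unique (q : C -> C) (z A B : C) :
  (forall e : R, 0 < e -> exists2 d : R, 0 < d & forall w, w != z -> normc (w - z) < d ->
    normc (q w - A) <= e) ->
  (forall e : R, 0 < e -> exists2 d : R, 0 < d & forall w, w != z -> normc (w - z) < d ->
    normc (q w - B) <= e) -> A = B.
Proof.
move=> HA HB; apply/eqP; rewrite -subr_eq0 -normc_eq0 eq_le normc_ge0 andbT.
apply/ler_addgt0Pr => e e0; rewrite add0r.
have e2 : 0 < e / 2 by rewrite divr_gt0.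
have [d1 d10 h1] := HA _ e2; have [d2 d20 h2] := HB _ e2.
pose x := Num.min d1 d2 / 2; have x0 : 0 < x by rewrite divr_gt0 // lt_min d10.
have nx : normc (x%:C + z - z) = x by rewrite addrK normcR gtr0_norm.
have xm : x < Num.min d1 d2 by rewrite /x ltr_pdivrMr // ltr_pMr ?ltr1n // lt_min d10.
have wz : x%:C + z != z by rewrite -subr_eq0 -normc_eq0 nx gt_eqF.
have k1 := h1 _ wz; have k2 := h2 _ wz.
rewrite nx in k1 k2; have := xm; rewrite lt_min => /andP[/k1 + /k2].
move: (q _) => Q l1 l2.
have -> : A - B = (Q - B) - (Q - A) by ring.
apply: le_trans (le_normcD _ _) _; rewrite normcN; lra.
Qed.

Lemma taylor_family_bound D z m : taylor_family D ->
  (forall k, (k < m)%N -> D k z = 0) ->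
  exists2 K : R, 0 <= K & forall w, normc (w - z) <= 1 ->
    normc (D 0 w) <= K * normc (w - z) ^+ m /\
    normc (D 0 w - D m z / m`!%:R * (w - z) ^+ m) <= K * normc (w - z) ^+ m.+1.
Proof.
move=> H Dz; have [B hB] := H 0 z; have pi0 := pi_gt0 R.
have key n : exists2 K : R, 0 <= K & forall w, normc (w - z) <= 1 ->
    normc (D 0 w - \sum_(j < n) D j z / j`!%:R * (w - z) ^+ j) <= K * normc (w - z) ^+ n.
  exists (`|B| * (pi ^+ n / n`!%:R * expR pi)).
    by rewrite mulr_ge0 // mulr_ge0 ?expR_ge0 // divr_ge0 ?exprn_ge0 // ltW.
  move=> w w1; have := hB n (w - z); rewrite subrK => /le_trans; apply.
  have n0 := normc_ge0 (w - z).
  apply: (@le_trans _ _ (`|B| * ((pi * normc (w - z)) ^+ n / n`!%:R * expR (pi * normc (w - z))))).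
    rewrite ler_wpM2r ?ler_norm // mulr_ge0 ?expR_ge0 // divr_ge0 ?exprn_ge0 // mulr_ge0 // ltW //.
  rewrite -[leRHS]mulrA ler_wpM2l //.
  have -> : pi ^+ n / n`!%:R * expR pi * normc (w - z) ^+ n =
    (pi * normc (w - z)) ^+ n / n`!%:R * expR pi by rewrite exprMn; ring.
  rewrite ler_wpM2l //; last by rewrite ler_expR ler_piMr // ltW.
  by rewrite divr_ge0 // exprn_ge0 // mulr_ge0 // ltW.
have sum0 n (w : C) : (n <= m)%N -> \sum_(j < n) D j z / j`!%:R * (w - z) ^+ j = 0.
  move=> nm; apply: big1 => j _; rewrite Dz ?mul0r //.
  exact: leq_trans (ltn_ord j) nm.
have [K1 K10 h1] := key m; have [K2 K20 h2] := key m.+1.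
exists (K1 + K2); first exact: addr_ge0.
move=> w w1; split.
  have := h1 w w1; rewrite sum0 // subr0 => /le_trans; apply.
  by rewrite ler_wpM2r ?exprn_ge0 ?normc_ge0 // lerDl.
have := h2 w w1; rewrite big_ord_recr /= sum0 // add0r => /le_trans; apply.
by rewrite ler_wpM2r ?exprn_ge0 ?normc_ge0 // lerDr.
Qed.

(** As long as the lower coefficients vanish, D k z / k! is the limit of D 0 w / (w - z) ^ k at z.
    By the factorisation this limit is 0 for k < m and [g0] for k = m. *)
Lemma taylor_family_order D z m (g : C -> C) (g0 : C) : taylor_family D ->
  (forall w, D 0 w = (w - z) ^+ m * g w) ->
  (g w : R[i]^o) @[w --> (z : R[i]^o)] --> (g0 : R[i]^o) -> g0 != 0 ->
  (forall k, (k < m)%N -> D k z = 0) /\ D m z != 0.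
Proof.
move=> H Dg /cvgc_atP gg g00.
have fact0' k : (k`!%:R : C) != 0 by rewrite pnatr_eq0 -lt0n fact_gt0.
have gb : exists2 d : R, 0 < d & forall w, normc (w - z) < d -> normc (g w) <= normc g0 + 1.
  have [d d0 hd] := gg 1 ltr01; exists d => // w /hd wd.
  rewrite -[g w](subrK g0); apply: le_trans (le_normcD _ _) _.
  by rewrite addrC lerD2l ltW.
have key k : (forall j, (j < k)%N -> D j z = 0) -> forall e : R, 0 < e ->
    exists2 d : R, 0 < d & forall w, w != z -> normc (w - z) < d ->
    normc (D 0 w / (w - z) ^+ k - D k z / k`!%:R) <= e.
  move=> Dz e e0; have [K K0 hK] := taylor_family_bound H Dz.
  exists (Num.min 1 (e / (K + 1))).
    by rewrite lt_min ltr01 divr_gt0 // ltr_wpDl.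
  move=> w wz; rewrite lt_min => /andP[w1 w2].
  have [_] := hK w (ltW w1); have n0 : 0 < normc (w - z) by rewrite normc_gt0 subr_eq0.
  have wk : (w - z) ^+ k != 0 by rewrite expf_neq0 // subr_eq0.
  have -> : D 0 w / (w - z) ^+ k - D k z / k`!%:R =
     (D 0 w - D k z / k`!%:R * (w - z) ^+ k) / (w - z) ^+ k.
    by rewrite mulrBl mulfK.
  rewrite normcM normcV normcX ler_pdivrMr ?exprn_gt0 // exprSr mulrA => /le_trans; apply.
  rewrite -mulrA [_ ^+ k * _]mulrC mulrA ler_wpM2r ?exprn_ge0 ?normc_ge0 //.
  move: w2; rewrite ltr_pdivlMr; last by rewrite ltr_wpDl.
  rewrite mulrDr mulr1 mulrC; lra.
have Dlow k : (k < m)%N -> D k z = 0.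
  elim/ltn_ind: k => k IH km.
  have : D k z / k`!%:R = 0.
    apply: (punctured_unique (q := fun w => D 0 w / (w - z) ^+ k) (z := z)).
      by apply: key => j jk; apply: IH => //; exact: ltn_trans km.
    move=> e e0; have [d d0 hd] := gb; pose M := normc g0 + 1.
    have M0 : 0 < M by rewrite ltr_wpDl ?normc_ge0.
    exists (Num.min d (Num.min 1 (e / M))).
      by rewrite !lt_min d0 ltr01 divr_gt0.
    move=> w wz; rewrite !lt_min => /andP[/hd wd /andP[w1 w2]].
    have nz : w - z != 0 by rewrite subr_eq0.
    have mk : m = (k + (m - k).-1.+1)%N by rewrite prednK ?subn_gt0 // subnKC // ltnW.
    have -> : D 0 w / (w - z) ^+ k = (w - z) ^+ (m - k).-1.+1 * g w.
      have Em : (w - z) ^+ m = (w - z) ^+ k * (w - z) ^+ (m - k).-1.+1 by rewrite -exprD -mk.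
      by rewrite Dg Em -[_ * _ * g w]mulrA [X in X / _]mulrC mulfK // expf_neq0.
    have n0 := normc_ge0 (w - z); rewrite subr0 normcM normcX exprS -mulrA.
    apply: (@le_trans _ _ (normc (w - z) * M)).
      rewrite ler_wpM2l // -[leRHS]mul1r; apply: ler_pM; rewrite ?exprn_ge0 ?normc_ge0 //.
      by rewrite exprn_ile1 // ltW.
    by rewrite -ler_pdivlMr // ltW.
  by move/eqP; rewrite mulf_eq0 invr_eq0 (negbTE (fact0' _)) orbF => /eqP.
split=> //.
have E : D m z / m`!%:R = g0.
  apply: (punctured_unique (q := fun w => D 0 w / (w - z) ^+ m) (z := z)).
    exact: key.
  move=> e e0; have [d d0 hd] := gg e e0; exists d => // w wz /hd /ltW.
  by rewrite Dg mulrAC mulfV ?mul1r // expf_neq0 // subr_eq0.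
by apply/eqP => D0; move: g00; rewrite -E D0 mul0r eqxx.
Qed.

End TaylorFamily.

(** * Fourier transforms of densities on [0, pi] *)

Section Transform.
Context {R : realType}.
Local Notation C := R[i].
Local Notation mu := (@lebesgue_measure R).
Local Notation rmeas := (@cmeas R _ (measurableTypeR R)).
Implicit Types (V X : R -> C) (z : C).

Lemma cder_rmeas (f : R -> C) (f' : R -> C) : (forall t, cder f t (f' t)) -> rmeas f.
Proof.
move=> H; split; apply: continuous_measurable_fun => t;
  apply/differentiable_continuous/derivable1_diffP; have [[? _] [? _]] := H t; done.
Qed.

Lemma rmeas_cexp z : rmeas (fun t => cexp (t%:C * z)).
Proof. exact: (cder_rmeas (f' := fun t => z * cexp (t%:C * z)) (cder_cexp z)). Qed.

Lemma rmeas_id : rmeas (fun t : R => t%:C).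
Proof. exact: (cder_rmeas (f' := fun=> 1) (@cder_real R)). Qed.

(* The frequency variable x = 2t - pi runs through [-pi, pi] for t in [0, pi]. *)
Definition freq (t : R) : C := (2 * t - pi)%:C.

Lemma rmeas_freq : rmeas freq.
Proof.
rewrite (_ : freq = fun t => 2 * t%:C - pi%:C).
  apply: cmeasB; last exact: cmeas_cst.
  by apply: cmeasM; [exact: cmeas_cst|exact: rmeas_id].
by apply/funext => t; rewrite /freq rmorphB rmorphM /= rmorph_nat.
Qed.

Lemma rmeas_freqX n : rmeas (fun t => freq t ^+ n).
Proof.
elim: n => [|n IH]; first by under eq_fun do rewrite expr0; exact: cmeas_cst.
by under eq_fun do rewrite exprS; apply: cmeasM => //; exact: rmeas_freq.
Qed.

Definition kern z t : C := cexp ('i * z * freq t).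

Lemma kernD z h t : kern (h + z) t = kern z t * cexp ('i * h * freq t).
Proof. by rewrite /kern -cexpD; congr cexp; ring. Qed.

Lemma rmeas_kern z : rmeas (kern z).
Proof.
rewrite (_ : kern z = fun t => cexp (t%:C * (2 * 'i * z)) * cexp (- ('i * z * pi%:C))).
  by apply: cmeasM; [exact: rmeas_cexp|exact: cmeas_cst].
apply/funext => t; rewrite -cexpD; congr cexp.
by rewrite /freq rmorphB rmorphM /= rmorph_nat; ring.
Qed.

Lemma normc_freq t : normc (freq t) = `|2 * t - pi|. Proof. exact: normcR. Qed.

Lemma normc_kern z t (r : R) : `|2 * t - pi| <= r -> normc (kern z t) <= expR (r * `|complex.Im z|).
Proof.
move=> tr; rewrite /kern normc_cexp ler_expR.
have -> : complex.Re ('i * z * freq t) = - complex.Im z * (2 * t - pi).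
  by case: z => a b; rewrite /freq /=; ring.
apply: le_trans (ler_norm _) _; rewrite normrM normrN mulrC.
by rewrite ler_wpM2r.
Qed.

(** Support condition in the frequency variable: a density in the band of half-width r has a
    transform of exponential type at most r. *)
Definition band V (r : R) := forall t, V t != 0 -> `|2 * t - pi| <= r.

Lemma band_le V (r r' : R) : r <= r' -> band V r -> band V r'.
Proof. by move=> rr H t /H /le_trans; apply. Qed.

Lemma band_L1 V X (r B : R) : cL1 mu V -> band V r -> rmeas X ->
  (forall t, `|2 * t - pi| <= r -> normc (X t) <= B) ->
  cL1 mu (fun t => V t * X t) /\ nI mu (fun t => V t * X t) <= B * nI mu V.
Proof.
move=> HV bV mX XB.
have le t : normc (V t * X t) <= B * normc (V t).
  have [->|V0] := eqVneq (V t) 0; first by rewrite mul0r normc0 mulr0.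
  by rewrite normcM mulrC ler_wpM2r ?normc_ge0 // XB // bV.
have Hg : mu.-integrable setT (fun t => (B * normc (V t))%:E).
  by apply: integrable_realZ; case: HV.
have H : cL1 mu (fun t => V t * X t) by apply: (cL1_dom (cmeasM (cL1_meas HV) mX) Hg).
split=> //; apply: le_trans (nI_le H Hg le) _.
by rewrite RintegralZl //; case: HV.
Qed.

Definition FT V z : C := cI mu (fun t => V t * kern z t).

Definition DFT V (k : nat) z : C := cI mu (fun t => V t * (kern z t * ('i * freq t) ^+ k)).

Lemma DFT0 V : DFT V 0 = FT V.
Proof. by apply/funext => z; rewrite /DFT /FT; under eq_fun do rewrite expr0 mulr1. Qed.

Lemma rmeas_dkern z k : rmeas (fun t => kern z t * ('i * freq t) ^+ k).
Proof.
apply: cmeasM; first exact: rmeas_kern.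
under eq_fun do rewrite exprMn; apply: cmeasM; [exact: cmeas_cst|exact: rmeas_freqX].
Qed.

Lemma normc_dkern z k t (r : R) : `|2 * t - pi| <= r ->
  normc (kern z t * ('i * freq t) ^+ k) <= expR (r * `|complex.Im z|) * r ^+ k.
Proof.
move=> tr; rewrite normcM normcX ['i * _]mulrC [normc (freq t * _)]normcM normc_i mulr1 normc_freq.
by apply: ler_pM; rewrite ?normc_ge0 ?exprn_ge0 ?normc_kern // lerXn2r ?nnegrE // (le_trans _ tr).
Qed.

Lemma FT_bound V (r : R) z : cL1 mu V -> band V r ->
  normc (FT V z) <= nI mu V * expR (r * `|complex.Im z|).
Proof.
move=> HV bV.
have [H1 H2] := band_L1 HV bV (rmeas_kern z) (fun t tp => normc_kern z tp).
by apply: le_trans (cI_norm H1) _; rewrite mulrC.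
Qed.

(** The Taylor remainder of the exponential is uniform over the band, so it may be integrated
    against the density. *)
Lemma taylor_family_FT V : cL1 mu V -> band V pi -> taylor_family (DFT V).
Proof.
move=> HV bV k z; pose B := expR (pi * `|complex.Im z|) * pi ^+ k; exists (nI mu V * B) => n h.
have L1 m : cL1 mu (fun t => V t * (kern z t * ('i * freq t) ^+ m)).
  exact: (band_L1 HV bV (rmeas_dkern z m) (fun t tp => normc_dkern z m tp)).1.
have L1h m : cL1 mu (fun t => V t * (kern (h + z) t * ('i * freq t) ^+ m)).
  exact: (band_L1 HV bV (rmeas_dkern (h + z) m) (fun t tp => normc_dkern (h + z) m tp)).1.
pose X t := kern z t * ('i * freq t) ^+ k *
   (cexp ('i * h * freq t) - \sum_(j < n) ('i * h * freq t) ^+ j / j`!%:R).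
have E : DFT V k (h + z) - \sum_(j < n) DFT V (k + j) z / j`!%:R * h ^+ j =
    cI mu (fun t => V t * X t).
  pose F j (t : measurableTypeR R) : C :=
    (h ^+ j / j`!%:R) * (V t * (kern z t * ('i * freq t) ^+ (k + j))).
  have LF j : cL1 mu (F j) by apply: cL1Z.
  have -> : \sum_(j < n) DFT V (k + j) z / j`!%:R * h ^+ j =
      cI mu (fun t => \sum_(j < n) F j t).
    by rewrite cI_sum //; apply: eq_bigr => j _; rewrite /F cIZ // /DFT; ring.
  rewrite /DFT -cIB //; last exact: cL1_sum.
  rewrite /F.
  congr cI; apply/funext => t; rewrite /X mulrBr mulrBr kernD; congr (_ - _); first by ring.
  rewrite !mulr_sumr; apply: eq_bigr => j _; rewrite exprD !exprMn; ring.
have mX : rmeas X.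
  apply: cmeasM; first exact: rmeas_dkern.
  apply: cmeasB.
    rewrite (_ : (fun t => _) = kern h); first exact: rmeas_kern.
    by apply/funext.
  apply: (cmeas_sum n (F := fun j t => ('i * h * freq t) ^+ j / j`!%:R)) => j.
  under eq_fun do rewrite exprMn mulrC mulrA.
  by apply: cmeasM; [exact: cmeas_cst|exact: rmeas_freqX].
have XB t : `|2 * t - pi| <= pi ->
    normc (X t) <= B * ((pi * normc h) ^+ n / n`!%:R * expR (pi * normc h)).
  move=> tp; rewrite normcM; apply: ler_pM; rewrite ?normc_ge0 //; first exact: normc_dkern.
  apply: cexp_taylor_le; rewrite !normcM normc_i mul1r normc_freq mulrC.
  by rewrite ler_wpM2r ?normc_ge0.
have [H1 H2] := band_L1 HV bV mX XB.
rewrite E; apply: le_trans (cI_norm H1) _; apply: le_trans H2 _.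
by rewrite -[nI mu V * B * _]mulrA [nI mu V * (B * _)]mulrC.
Qed.

(* The k-th derivative of z |-> c1 exp (i pi z) + c2 exp (- i pi z) + FT V z. *)
Definition char_like (c1 c2 : C) V (k : nat) z : C :=
  c1 * (('i * pi%:C) ^+ k * cexp ('i * pi%:C * z)) +
  c2 * ((- ('i * pi%:C)) ^+ k * cexp (- ('i * pi%:C) * z)) + DFT V k z.

Lemma taylor_family_char_like c1 c2 V : cL1 mu V -> band V pi ->
  taylor_family (char_like c1 c2 V).
Proof.
move=> HV bV; have np : normc ('i * pi%:C : C) <= pi.
  by rewrite normcM normc_i mul1r normcR ger0_norm // pi_ge0.
apply: taylor_familyD; last exact: taylor_family_FT.
apply: taylor_familyD; apply: taylor_familyZ; apply: taylor_family_cexp => //.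
by rewrite normcN.
Qed.

Lemma char_like0 c1 c2 V z : char_like c1 c2 V 0 z =
  c1 * cexp ('i * pi%:C * z) + c2 * cexp (- ('i * pi%:C) * z) + FT V z.
Proof. by rewrite /char_like !expr0 !mul1r DFT0. Qed.

Lemma char_like_sin V z :
  char_like (- (2 * 'i)^-1) (2 * 'i)^-1 V 0 z = - csin (z * pi%:C) + FT V z.
Proof.
rewrite char_like0; congr (_ + _); rewrite /csin.
have -> : - ('i * pi%:C) * z = - ('i * (z * pi%:C)) by ring.
have -> : 'i * pi%:C * z = 'i * (z * pi%:C) by ring.
by move: (cexp _) (cexp _) => x y; ring.
Qed.

Lemma char_like_cos V z :
  char_like 2^-1 2^-1 V 0 z = ccos (z * pi%:C) + FT V z.
Proof.
rewrite char_like0; congr (_ + _); rewrite /ccos.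
have -> : - ('i * pi%:C) * z = - ('i * (z * pi%:C)) by ring.
have -> : 'i * pi%:C * z = 'i * (z * pi%:C) by ring.
by move: (cexp _) (cexp _) => x y; ring.
Qed.

Lemma FT_add V W z : cL1 mu V -> cL1 mu W -> band V pi -> band W pi ->
  FT (fun t => V t + W t) z = FT V z + FT W z.
Proof.
move=> HV HW bV bW.
have H1 := (band_L1 HV bV (rmeas_kern z) (fun t tp => normc_kern z tp)).1.
have H2 := (band_L1 HW bW (rmeas_kern z) (fun t tp => normc_kern z tp)).1.
by rewrite /FT -cID //; congr cI; apply/funext => t; rewrite mulrDl.
Qed.

Lemma FT_scale c V z : cL1 mu V -> band V pi -> FT (fun t => c * V t) z = c * FT V z.
Proof.
move=> HV bV.
have H1 := (band_L1 HV bV (rmeas_kern z) (fun t tp => normc_kern z tp)).1.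
by rewrite /FT -cIZ //; congr cI; apply/funext => t; rewrite mulrA.
Qed.

Lemma FT_ae V W z : cL1 mu V -> cL1 mu W -> {ae mu, forall t, V t = W t} -> FT V z = FT W z.
Proof.
move=> HV HW H; apply: cI_ae; last by apply: aeS H => t ->.
- by apply: cmeasM (cL1_meas HV) (rmeas_kern z).
- by apply: cmeasM (cL1_meas HW) (rmeas_kern z).
Qed.

End Transform.

(** * The Riesz-Fischer theorem on [0, pi] *)

Section RieszFischer.
Context {R : realType}.
Local Notation C := R[i].
Local Notation mu := (@lebesgue_measure R).
Local Notation rmeas := (@cmeas R _ (measurableTypeR R)).

Lemma cvgc_Re (u : nat -> C) (l : C) : (u n : R[i]^o) @[n --> \oo] --> (l : R[i]^o) ->
  complex.Re (u n) @[n --> \oo] --> complex.Re l.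
Proof.
move=> /cvgcP H; apply/cvgrPdist_lt => e e0; have := H e e0; apply: filterS => n Hn.
by apply: le_lt_trans Hn; rewrite -ReN -ReD normcB; apply: le_Re_normc.
Qed.

Lemma cvgc_Im (u : nat -> C) (l : C) : (u n : R[i]^o) @[n --> \oo] --> (l : R[i]^o) ->
  complex.Im (u n) @[n --> \oo] --> complex.Im l.
Proof.
move=> /cvgcP H; apply/cvgrPdist_lt => e e0; have := H e e0; apply: filterS => n Hn.
by apply: le_lt_trans Hn; rewrite -ImN -ImD normcB; apply: le_Im_normc.
Qed.

Lemma sum_geo_le (B q : R) n : 0 <= B -> 0 <= q <= 2^-1 -> \sum_(k < n) B * q ^+ k <= 2 * B.
Proof.
move=> B0 /andP[q0 q2].
have H : (\sum_(k < n) B * q ^+ k) * (1 - q) = B * (1 - q ^+ n).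
  elim: n => [|n IH]; first by rewrite big_ord0 mul0r expr0 subrr mulr0.
  by rewrite big_ord_recr /= mulrDl IH exprS; ring.
have q1 : 0 < 1 - q by lra.
rewrite -(ler_pM2r q1) H.
have : 0 <= q ^+ n by apply: exprn_ge0.
nra.
Qed.

(** By monotone convergence the sum is integrable, hence finite off a null set; [A] is the set where
    it is finite. *)
Lemma integrable_sum_bounded (f : nat -> R -> R) (B : R) :
  (forall k, mu.-integrable setT (fun x => (f k x)%:E)) -> (forall k x, 0 <= f k x) ->
  (forall n, \sum_(k < n) \int[mu]_x f k x <= B) ->
  exists g : R -> R, exists A : set R, [/\ measurable A,
    mu.-integrable setT (fun x => (g x)%:E), (forall x, 0 <= g x),
    {ae mu, forall x, A x} & forall n x, A x -> \sum_(k < n) f k x <= g x].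
Proof.
move=> If f0 HB.
have mf k : measurable_fun setT (fun x => (f k x)%:E) by exact: measurable_int (If k).
pose G (x : R) := (\sum_(0 <= k <oo) (f k x)%:E)%E.
have mG : measurable_fun setT G.
  by apply: (@ge0_emeasurable_sum _ _ R setT (fun k x => (f k x)%:E) xpredT) => // k x _ _; rewrite lee_fin.
have G0 x : (0 <= G x)%E by apply: nneseries_ge0 => k _ _; rewrite lee_fin.
have IG : (\int[mu]_x G x <= B%:E)%E.
  rewrite integral_nneseries //; last by move=> k x _; rewrite lee_fin.
  apply: lime_le.
    by apply: is_cvg_nneseries => k _ _; apply: integral_ge0 => x _; rewrite lee_fin.
  near=> n; rewrite big_mkord.
  rewrite (_ : (\sum_(i < n) _)%E = (\sum_(k < n) \int[mu]_x f k x)%:E) ?lee_fin //.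
  by rewrite -sumEFin; apply: eq_bigr => k _; rewrite fineK // (integrable_fin_num measurableT (If k)).
have iG : mu.-integrable setT G.
  apply/integrableP; split=> //; under eq_integral do rewrite gee0_abs //.
  by apply: le_lt_trans IG _; rewrite ltry.
exists (fun x => fine (G x)); exists [set x | (G x < +oo)%E]; split.
- have := emeasurable_fun_infty_o measurableT mG +oo%E; by rewrite setTI.
- apply: le_integrable iG => //.
    by apply/measurable_EFinP; apply: measurableT_comp.
  by move=> x _; move: (G0 x); case: (G x) => [r| |] //= r0; rewrite normr0 leey.
- by move=> x; exact: fine_ge0.
- have := integrable_ae measurableT iG; apply: filterS => x /(_ I) /=.
  by rewrite ge0_fin_numE.
- move=> n x /= Gx; rewrite -lee_fin fineK ?ge0_fin_numE // -sumEFin.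
  rewrite -(big_mkord xpredT (fun k => (f k x)%:E)).
  by apply: nneseries_lim_ge => k _ _; rewrite lee_fin.
Unshelve. all: by end_near.
Qed.

(** Since 4 / 8 = 1 / 2, the weighted squares 4 ^ k |d k| ^ 2 have a summable integral. Writing |d
    k| = 2 ^ -k (2 ^ k |d k|), their sum [g] dominates both the series of moduli and its square, so
    the series converges almost everywhere and under the integral. *)
Lemma cL2_series (d : nat -> R -> C) (a b B : R) :
  (forall k, cL2 (d k)) -> (forall k x, x \notin `[a, b] -> d k x = 0) ->
  (forall k, \int[mu]_x (normc (d k x) ^+ 2) <= B * 8^-1 ^+ k) ->
  exists V, [/\ cL2 V, (forall x, x \notin `[a, b] -> V x = 0) &
    forall (X : R -> C) (M : R), rmeas X -> (forall x, x \in `[a, b] -> normc (X x) <= M) ->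
    (cI mu (fun x => (\sum_(j < n) d j x) * X x) : R[i]^o) @[n --> \oo] -->
      (cI mu (fun x => V x * X x) : R[i]^o)].
Proof.
move=> Hd d0 dB.
have B0 : 0 <= B.
  by have := dB 0%N; rewrite expr0 mulr1; apply: le_trans; apply: Rintegral_ge0 => x _; apply: sqr_ge0.
have If k : mu.-integrable setT (fun x => (4 ^+ k * normc (d k x) ^+ 2)%:E).
  by apply: integrable_realZ; case: (Hd k).
have f0 k x : 0 <= 4 ^+ k * normc (d k x) ^+ 2 by apply: mulr_ge0; [exact: exprn_ge0|exact: sqr_ge0].
have Hs n : \sum_(k < n) \int[mu]_x (4 ^+ k * normc (d k x) ^+ 2) <= 2 * B.
  apply: (@le_trans _ _ (\sum_(k < n) B * 2^-1 ^+ k)).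
    apply: ler_sum => k _; rewrite RintegralZl //; last by case: (Hd k).
    have -> : B * 2^-1 ^+ k = 4 ^+ k * (B * 8^-1 ^+ k).
      by rewrite mulrCA -exprMn; congr (_ * _ ^+ _); lra.
    by rewrite ler_wpM2l ?exprn_ge0.
  by apply: sum_geo_le => //; rewrite invr_ge0 ler0n lexx.
have [g [A [mA Ig g0 Aae Ag]]] := integrable_sum_bounded If f0 Hs.
have am n x s : 0 < s -> A x -> \sum_(k < n) normc (d k x) <= s + s^-1 * g x / 2.
  move=> s0 Ax.
  have -> : \sum_(k < n) normc (d k x) = \sum_(k < n) 2^-1 ^+ k * (2 ^+ k * normc (d k x)).
    by apply: eq_bigr => k _; rewrite mulrA -exprMn mulVf ?expr1n ?mul1r.
  apply: le_trans (sum_amgm (fun k => 2^-1 ^+ k) (fun k => 2 ^+ k * normc (d k x)) n s0) _.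
  have h1 : \sum_(k < n) (2^-1 ^+ k) ^+ 2 <= 2 :> R.
    under eq_bigr do rewrite exprAC -[_ ^+ _]mul1r.
    by rewrite -[leRHS]mulr1; apply: sum_geo_le => //; apply/andP; split; lra.
  have h2 : \sum_(k < n) (2 ^+ k * normc (d k x)) ^+ 2 <= g x.
    apply: le_trans (Ag n x Ax); apply: ler_sum => k _.
    by rewrite exprMn exprAC (_ : 2 ^+ 2 = 4) //; lra.
  have := invr_gt0 s; rewrite s0 => si; nra.
have bd1 n x : A x -> \sum_(k < n) normc (d k x) <= 1 + g x.
  move=> Ax; have := am n x 1 ltr01 Ax; rewrite invr1 mul1r; have := g0 x; lra.
have bd2 n x : A x -> (\sum_(k < n) normc (d k x)) ^+ 2 <= 2 * g x.
  move=> Ax; set S := \sum_(k < n) _.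
  have S0 : 0 <= S by apply: sumr_ge0 => k _; apply: normc_ge0.
  have [->|Sn] := eqVneq S 0; first by rewrite expr0n mulr_ge0.
  have Sp : 0 < S by rewrite lt_neqAle eq_sym Sn.
  (* With weight S / 2 the bound reads S <= S / 2 + g / S, that is S ^ 2 <= 2 g. *)
  have S2 : 0 < S / 2 by lra.
  have := am n x (S / 2) S2 Ax.
  rewrite -/S -(ler_pM2l Sp) (_ : S * (S / 2 + _) = S ^+ 2 / 2 + g x).
    by rewrite -expr2; lra.
  by field.
pose f n := cut A (fun x => \sum_(j < n) d j x).
have mf n : rmeas (f n).
  by apply: cmeas_cut mA _; apply: (@cmeas_sum R _ (measurableTypeR R) n d) => k; case: (Hd k).
have fn n x : normc (f n x) <= \sum_(k < n) normc (d k x).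
  by rewrite (le_trans (normc_cut_le _ _ _)) // normc_sum.
have fnA n x : ~ A x -> f n x = 0 by move=> nA; rewrite /f cutE memNset.
have /choice[V HV] (x : R) : exists l : C, (f n x : R[i]^o) @[n --> \oo] --> (l : R[i]^o).
  have [Ax|nA] := pselect (A x).
    have [l Hl] := sum_cvgc (u := fun k => d k x) (fun n => bd1 n x Ax); exists l.
    by apply: eq_cvgc Hl => n; rewrite /f cutE mem_set.
  by exists 0; apply: eq_cvgc (cvgc_cst 0) => n; rewrite fnA.
have mV : rmeas V.
  split.
  - apply: (@measurable_fun_cvg _ _ R setT (fun n x => complex.Re (f n x))) => [n|x _].
      by case: (mf n).
    exact: (cvgc_Re (HV x)).
  - apply: (@measurable_fun_cvg _ _ R setT (fun n x => complex.Im (f n x))) => [n|x _].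
      by case: (mf n).
    exact: (cvgc_Im (HV x)).
have f2 n x : normc (f n x) ^+ 2 <= 2 * g x.
  have [Ax|nA] := pselect (A x); last by rewrite fnA // normc0 expr0n mulr_ge0.
  apply: le_trans (bd2 n x Ax); rewrite ler_sqr ?nnegrE ?normc_ge0 ?(le_trans _ (fn n x)) ?normc_ge0 //.
have f1 n x : normc (f n x) <= 1 + g x.
  have := f2 n x; have := g0 x; have := normc_ge0 (f n x); have := sqr_ge0 (normc (f n x) - 1); nra.
have V2 x : normc (V x) ^+ 2 <= 2 * g x.
  have G : 0 <= 2 * g x by rewrite mulr_ge0.
  rewrite -(sqr_sqrtr G) ler_sqr ?nnegrE ?normc_ge0 ?sqrtr_ge0 //.
  apply: (normc_cvg_le _ (HV x)); near=> n.
  by rewrite -[normc _]ger0_norm ?normc_ge0 // -sqrtr_sqr ler_wsqrtr.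
have fab n x : x \notin `[a, b] -> f n x = 0.
  by move=> xab; rewrite /f cutE; case: ifP => // _; rewrite big1 // => k _; exact: d0.
have V0 x : x \notin `[a, b] -> V x = 0.
  move=> xab; apply: (cvgc_uniq _ (HV x)); apply: eq_cvgc (cvgc_cst 0) => n.
  by rewrite fab.
exists V; split=> //; first exact: (cL2_dom mV (integrable_realZ 2 Ig)).
move=> X M mX XM.
have fE n : cI mu (fun x => (\sum_(j < n) d j x) * X x) = cI mu (fun x => f n x * X x).
  apply: cI_ae.
  - apply: cmeasM mX; apply: (@cmeas_sum R _ (measurableTypeR R) n d) => k; by case: (Hd k).
  - exact: cmeasM.
  - by apply: aeS Aae => x Ax; rewrite /f cutE mem_set.
under eq_fun do rewrite fE.
apply: (@cI_dct _ _ _ mu (fun n x => f n x * X x) _ (fun x => `|M| * (\1_`[a, b]%classic x + g x))).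
- by move=> n; exact: cmeasM.
- exact: cmeasM.
- exact/integrable_realZ/integrable_realD/Ig/integrable_indic_bnd.
- move=> n x; rewrite indicE; have [xab|xab] := boolP (x \in `[a, b]).
    rewrite mem_set //= normcM mulrC; apply: ler_pM; rewrite ?normc_ge0 ?f1 //.
    by apply: le_trans (XM x xab) (ler_norm _).
  by rewrite fab // mul0r normc0 mulr_ge0 // addr_ge0.
- by apply/aeW => x; exact: (cvgcM (HV x) (cvgc_cst (X x))).
Unshelve. all: by end_near.
Qed.

Lemma cI_ftc (F f f' : R -> C) (a b : R) : a < b ->
  (forall t, cder F t (f t)) -> (forall t, cder f t (f' t)) ->
  cI mu (cut `[a, b]%classic f) = F b - F a.
Proof.
move=> ab HF Hf; pose D : set R := `[a, b]%classic.
have key (G g : R -> R) : (forall t, is_derive t (1 : R) G (g t)) -> (forall t, derivable g t 1) ->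
    \int[mu]_x (\1_D x * g x) = G b - G a.
  move=> HG Hg.
  have Gd t : derivable G t 1 by case: (HG t).
  have cg t : {for t, continuous g} by apply/differentiable_continuous/derivable1_diffP.
  have cG t : {for t, continuous G} by apply/differentiable_continuous/derivable1_diffP.
  have := @continuous_FTC2 R g G a b ab; rewrite -EFinB => H.
  rewrite /Rintegral -[RHS]/(fine (G b - G a)%:E) -H.
  - congr fine; rewrite [in RHS]integral_mkcond; apply: eq_integral => x _.
    by rewrite patchE indicE; case: (x \in D); rewrite ?mul1r ?mul0r.
  - exact: continuous_subspaceT.
  - split; first by move=> x _; exact: Gd.
    + by apply: cvg_at_right_filter; exact: cG.
    + by apply: cvg_at_left_filter; exact: cG.
  - by move=> x _; rewrite derive1E; case: (HG x).
apply/eqP; rewrite eq_complex /cI /=; apply/andP; split; apply/eqP.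
- rewrite ReD ReN; transitivity (\int[mu]_x (\1_D x * complex.Re (f x))).
    by congr fine; apply: eq_integral => x _; rewrite ReM /= mul0r subr0.
  apply: (key (fun t => complex.Re (F t))); first by move=> t; case: (HF t).
  by move=> t; case: (Hf t) => -[].
- rewrite ImD ImN; transitivity (\int[mu]_x (\1_D x * complex.Im (f x))).
    by congr fine; apply: eq_integral => x _; rewrite ImM /= mul0r addr0.
  apply: (key (fun t => complex.Im (F t))); first by move=> t; case: (HF t).
  by move=> t; case: (Hf t) => _ [].
Qed.

Lemma cI_cexp (w : C) : cI mu (cut `[0, pi]%classic (fun t => cexp (t%:C * w))) =
  if w == 0 then pi%:C else (cexp (pi%:C * w) - 1) / w.
Proof.
have [->|w0] := eqVneq w 0.
  rewrite (cI_ftc (F := fun t => t%:C) (f' := fun=> 0) (pi_gt0 R)) ?subr0 //.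
  - by move=> t; rewrite mulr0 cexp0; exact: cder_real.
  - by move=> t; under [X in cder X]eq_fun do rewrite mulr0 cexp0; exact: cder_cst.
rewrite (cI_ftc (F := fun t => w^-1 * cexp (t%:C * w)) (f' := fun t => w * cexp (t%:C * w)) (pi_gt0 R)).
- by rewrite mul0r cexp0 -mulrBr mulrC.
- move=> t; have := cderM (cder_cst w^-1 t) (cder_cexp w t).
  by rewrite mul0r add0r mulrA mulVf // mul1r.
- by move=> t; exact: cder_cexp.
Qed.

(** The functions exp (- 2 i m t), orthogonal on [0, pi] with squared norm pi. *)
Definition expo (m : int) (t : R) : C := cexp (t%:C * (- (2 * 'i * m%:~R))).

Lemma normc_expo m t : normc (expo m t) = 1.
Proof.
have -> : expo m t = cexp ('i * (- (2 * t * m%:~R))%:C); last exact: normc_cexp_i.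
by rewrite /expo; congr cexp; rewrite rmorphN !rmorphM /= rmorph_nat rmorph_int; ring.
Qed.

Lemma cexp_2pi_int (m : int) : cexp (pi%:C * (2 * 'i * m%:~R)) = 1 :> C.
Proof.
have nat_case (n : nat) : cexp (pi%:C * (2 * 'i * n%:R)) = 1 :> C.
  have -> : pi%:C * (2 * 'i * n%:R) = n%:R * ('i * (pi *+ 2)%:C) :> C.
    by rewrite rmorphMn /= -mulr_natl; ring.
  by rewrite cexpMn cexp_i cos2pi sin2pi expr1n.
case: m => n; first exact: nat_case.
rewrite NegzE mulrNz -pmulrn !mulrN cexpN; have := nat_case n.+1 => ->.
by rewrite invr1.
Qed.

Lemma conjc_expo m t : conjc (expo m t) = expo (- m) t.
Proof.
have nz : expo m t != 0 by rewrite /expo cexp_neq0.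
have E : expo m t * expo (- m) t = 1.
  rewrite /expo -cexpD.
  have -> : t%:C * - (2 * 'i * m%:~R) + t%:C * - (2 * 'i * (- m)%:~R) = 0 :> C by rewrite mulrNz; ring.
  exact: cexp0.
apply: (mulfI nz); rewrite E; have := normc_sqr (expo m t); rewrite normc_expo expr1n.
move: (expo m t) => -[x y] /= H; apply/eqP; rewrite eq_complex /=; apply/andP; split; apply/eqP.
  by rewrite H; ring.
by ring.
Qed.

Lemma expo_orth m n : cI mu (cut `[0, pi]%classic (fun t => expo m t * conjc (expo n t))) =
  if m == n then pi%:C else 0.
Proof.
rewrite (_ : (fun t => _) = fun t => cexp (t%:C * (2 * 'i * (n - m)%:~R))); last first.
  by apply/funext => t; rewrite conjc_expo /expo -cexpD; congr cexp; rewrite intrB mulrNz; ring.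
rewrite cI_cexp cexp_2pi_int subrr mul0r !mulf_eq0 intr_eq0 subr_eq0 [m == n]eq_sym.
by rewrite pnatr_eq0 /= (negbTE (neq0Ci _)).
Qed.

Lemma cI_real (g : R -> R) : cI mu (fun x => (g x)%:C) = (\int[mu]_x g x)%:C.
Proof. by rewrite /cI /= [X in _ +i* X]/Rintegral integral0. Qed.

Lemma bessel_eq (r : nat -> C) (a : nat -> int) n : injective a ->
  \int[mu]_x (normc (\sum_(i < n) cut `[0, pi]%classic (fun t => r i * expo (a i) t) x) ^+ 2) =
  pi * \sum_(i < n) normc (r i) ^+ 2.
Proof.
move=> ia; pose D : set R := `[0, pi]%classic.
have mexpo m : rmeas (expo m) by exact: rmeas_cexp.
have mexpoc m : rmeas (fun t => conjc (expo m t)).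
  by under eq_fun do rewrite conjc_expo; exact: mexpo.
pose P i j := cut D (fun t => expo (a i) t * conjc (expo (a j) t)).
have LP i j : cL1 mu (P i j).
  apply: (@cL1_bounded _ 0 pi 1); first by apply: cmeasM; [exact: mexpo|exact: mexpoc].
  by move=> x; rewrite conjc_expo normcM !normc_expo mulr1.
pose S i (t : measurableTypeR R) : C := \sum_(j < n) r i * conjc (r j) * P i j t.
have LS i : cL1 mu (S i).
  by apply: (@cL1_sum _ _ _ mu n (fun j t => r i * conjc (r j) * P i j t)) => j; exact: cL1Z.
have E x : (normc (\sum_(i < n) cut D (fun t => r i * expo (a i) t) x) ^+ 2)%:C =
    \sum_(i < n) S i x.
  have -> (z : C) : (normc z ^+ 2)%:C = z * conjc z.
    rewrite normc_sqr; case: z => u v; apply/eqP; rewrite eq_complex /=.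
    by apply/andP; split; apply/eqP; ring.
  rewrite rmorph_sum big_distrlr /=; apply: eq_bigr => i _; rewrite /S.
  apply: eq_bigr => j _; rewrite /P !cutE; case: (x \in D); last by rewrite mul0r mulr0.
  by rewrite rmorphM /=; ring.
apply: complexI; transitivity (cI mu (fun x => \sum_(i < n) S i x)).
  by rewrite -cI_real; congr cI; apply/funext => x; exact: E.
rewrite cI_sum // rmorphM rmorph_sum mulr_sumr; apply: eq_bigr => i _.
rewrite /S (@cI_sum _ _ _ mu n (fun j t => r i * conjc (r j) * P i j t)); last by move=> j; exact: cL1Z.
rewrite (bigD1 i) //= big1 ?addr0 => [|j ji]; rewrite cIZ // /P expo_orth.
  rewrite eqxx mulrC; congr (_ * _).
  rewrite normc_sqr; case: (r i) => u v; apply/eqP; rewrite eq_complex /=.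
  by apply/andP; split; apply/eqP; ring.
case: eqP => [/ia H|]; last by rewrite mulr0.
by case/eqP: ji; apply/val_inj.
Qed.

(** Partial sums are grouped into blocks whose squared norms decay like 8 ^ -k, and the blocks are
    summed by [cL2_series]. The convergence along the subsequence [phi] is enough, since the scalar
    series to which it is applied converge. *)
Theorem riesz_fischer (r : nat -> C) (A : R) : (forall n, \sum_(i < n) normc (r i) ^+ 2 <= A) ->
  exists V : R -> C, [/\ cL2 V, (forall x, x \notin `[0, pi] -> V x = 0) &
    exists2 phi : nat -> nat, (forall n, (n <= phi n)%N) &
    forall (X : R -> C) (M : R), rmeas X -> (forall x, x \in `[0, pi] -> normc (X x) <= M) ->
    (\sum_(i < phi n) r i * cI mu (fun t => cut `[0, pi]%classic (expo (zn i)) t * X t) : R[i]^o)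
       @[n --> \oo] --> (cI mu (fun x => V x * X x) : R[i]^o)].
Proof.
move=> rA; pose W n := \sum_(i < n) normc (r i) ^+ 2.
have W_mono : {homo W : m n / (m <= n)%N >-> m <= n}.
  move=> m n mn; rewrite /W -(subnKC mn) big_split_ord /= lerDl.
  by apply: sumr_ge0 => i _; apply: sqr_ge0.
have A0 : 0 <= A by apply: le_trans (rA 0%N); rewrite big_ord0.
have e0 k : (0 : R) < 8^-1 ^+ k by rewrite exprn_gt0 // invr_gt0.
pose M k := projT1 (cid (ndbounded_tail W_mono rA (e0 k))).
have HM k n : W n <= W (M k) + 8^-1 ^+ k by rewrite /M; case: cid.
(* Adding [(M j.+1).+1] terms in each block makes [phi] pass both the required index [M] and its own
   argument. *)
pose phi k := (\sum_(j < k) (M j.+1).+1)%N.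
have phiS k : phi k.+1 = (phi k + (M k.+1).+1)%N by rewrite /phi big_ord_recr.
have phi_id n : (n <= phi n)%N.
  elim: n => // n IH; rewrite phiS addnS ltnS; exact: leq_trans IH (leq_addr _ _).
have phi_M k : (M k.+1 <= phi k.+1)%N by rewrite phiS addnS -addSn leq_addl.
pose term i := cut `[0, pi]%classic (fun t => r i * expo (zn i) t).
have mexpo m : rmeas (expo m) by exact: rmeas_cexp.
have mterm i : rmeas (fun t => r i * expo (zn i) t).
  by apply: cmeasM; [exact: cmeas_cst|exact: mexpo].
have normc_term i t : normc (r i * expo (zn i) t) <= normc (r i).
  by rewrite normcM normc_expo mulr1.
have L2t i : cL2 (term i) by apply: cL2_bounded (normc_term i).
have L1t i : cL1 mu (term i) by apply: cL1_bounded (normc_term i).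
pose d k (t : R) : C := \sum_(j < (M k.+1).+1) term (phi k + j)%N t.
have L2sum (f : nat -> R -> C) n : (forall j, cL2 (f j)) -> cL2 (fun t => \sum_(j < n) f j t).
  move=> Hf; elim: n => [|n IH].
    under eq_fun do rewrite big_ord0.
    have := cL2Z 0 (L2t 0%N); under eq_fun do rewrite mul0r; exact.
  by under eq_fun do rewrite big_ord_recr; exact: cL2D.
have L2d k : cL2 (d k).
  by apply: (L2sum (fun j => term (phi k + j)%N)) => j; exact: L2t.
have d0 k x : x \notin `[0, pi] -> d k x = 0.
  move=> xab; rewrite /d big1 // => j _; rewrite /term cutE; case: ifP => // /set_mem /= xin.
  by rewrite xin in xab.
have dB k : \int[mu]_x (normc (d k x) ^+ 2) <= pi * (A + 1) * 8^-1 ^+ k.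
  have -> : \int[mu]_x (normc (d k x) ^+ 2) = pi * (W (phi k.+1) - W (phi k)).
    rewrite (@bessel_eq (fun j => r (phi k + j)%N) (fun j => zn (phi k + j)%N)); last first.
      by move=> i j /zn_inj/addnI.
    congr (_ * _); rewrite /W phiS big_split_ord /=; ring.
  rewrite -mulrA ler_wpM2l ?pi_ge0 //.
  (* The initial block starts at 0, where no tail is small; it accounts for the constant A + 1. *)
  case: k => [|k].
    rewrite expr0 mulr1 /phi big_ord0 /W big_ord0 subr0.
    by apply: le_trans (rA _) _; rewrite lerDl.
  have h1 := HM k.+1 (phi k.+2); have h2 := W_mono _ _ (phi_M k).
  have := e0 k.+1; nra.
have [V [LV V0 HV]] := cL2_series L2d d0 dB; exists V; split=> //; exists phi => // X B mX XB.
have sumd n t : \sum_(k < n) d k t = \sum_(i < phi n) term i t.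
  elim: n => [|n IH]; first by rewrite /phi !big_ord0.
  by rewrite big_ord_recr IH phiS big_split_ord.
have := HV X B mX XB; apply: eq_cvgc => n.
under eq_fun do rewrite sumd mulr_suml.
have L1X i : cL1 mu (fun t => cut `[0, pi]%classic (expo (zn i)) t * X t).
  apply: (@cL1_dom _ _ _ mu _ (fun x => `|B| * \1_`[0, pi]%classic x)).
  - by apply: cmeasM mX; apply: cmeas_cut.
  - exact/integrable_realZ/integrable_indic_bnd.
  - move=> x; rewrite cutE indicE; have [xD|xD] := boolP (x \in `[0, pi]%classic); last first.
      by rewrite mul0r normc0 mulr0.
    rewrite normcM normc_expo mul1r mulr1; apply: le_trans (ler_norm B).
    by apply: XB; move/set_mem: xD.
rewrite (@cI_sum _ _ _ mu (phi n) (fun i t => term i t * X t)).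
  apply: eq_bigr => i _; rewrite -cIZ //; congr cI; apply/funext => t.
  by rewrite /term !cutE; case: (t \in _); rewrite ?mul0r ?mulr0 ?mulrA.
move=> i; have := cL1Z (r i) (L1X i); congr cL1; apply/funext => t.
by rewrite /term !cutE; case: (t \in _); rewrite ?mul0r ?mulr0 ?mulrA.
Qed.

Lemma band_cut (f : R -> C) : band (cut `[0, pi]%classic f) pi.
Proof.
move=> t; rewrite cutE; case: ifPn => [/set_mem /=|]; last by rewrite eqxx.
by rewrite in_itv /= => /andP[t0 tp] _; rewrite ler_norml; apply/andP; split; lra.
Qed.

(** These transforms are, up to sign, the simple fractions of the canonical product multiplied by
    the sine; they turn the partial fraction expansion into a Fourier series. *)
Lemma FT_expo (m : int) (z : C) : (forall n : int, n%:~R != z) ->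
  cI mu (fun t => cut `[0, pi]%classic (expo m) t * kern z t) = csin (z * pi%:C) / (z - m%:~R).
Proof.
move=> zn; have zm : z - m%:~R != 0 by rewrite subr_eq0 eq_sym.
pose w : C := 2 * 'i * (z - m%:~R).
have w0 : w != 0 by rewrite !mulf_neq0 // ?neq0Ci // pnatr_eq0.
pose c : C := cexp (- ('i * z * pi%:C)).
have c0 : c != 0 by rewrite /c cexp_neq0.
have LD : cL1 mu (cut `[0, pi]%classic (expo m)).
  by apply: (@cL1_bounded _ 0 pi 1) => [|x]; [exact: rmeas_cexp|rewrite normc_expo].
have [L1 _] := band_L1 LD (@band_cut (expo m)) (rmeas_kern z) (fun t tp => normc_kern z tp).
have E := cIZ c^-1 L1.
have E2 : (fun t => c^-1 * (cut `[0, pi]%classic (expo m) t * kern z t)) =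
    cut `[0, pi]%classic (fun t => cexp (t%:C * w)).
  apply/funext => t; rewrite !cutE; case: (t \in _); last by rewrite mul0r mulr0.
  rewrite /expo /kern /c -cexpN -!cexpD; congr cexp.
  by rewrite /freq /w rmorphB rmorphM /= rmorph_nat; ring.
apply: (mulfI (invr_neq0 c0)); rewrite -E E2 cI_cexp (negbTE w0).
have -> : csin (z * pi%:C) / (z - m%:~R) = (2 * 'i * csin (z * pi%:C)) / w.
  by rewrite /w -mulf_div divff ?mul1r // mulf_neq0 // ?neq0Ci // pnatr_eq0.
rewrite [RHS]mulrA; congr (_ / _); rewrite csinE mulrBr /c -cexpN -!cexpD.
have -> : - - ('i * z * pi%:C) + - ('i * (z * pi%:C)) = 0 by ring.
rewrite cexp0; congr (_ - _).
have -> : pi%:C * w = (- - ('i * z * pi%:C) + 'i * (z * pi%:C)) - pi%:C * (2 * 'i * m%:~R).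
  by rewrite /w; ring.
by rewrite [LHS]cexpD [cexp (- (pi%:C * _))]cexpN cexp_2pi_int invr1 mulr1.
Qed.
Lemma taylor_family_continuous (D : nat -> C -> C) k z : taylor_family D ->
  (D k w : R[i]^o) @[w --> (z : R[i]^o)] --> (D k z : R[i]^o).
Proof.
move=> HD; have [B HB] := HD k z; apply/cvgc_atP => e e0.
pose K : R := `|B| * (pi * expR pi) + 1.
have pi0 := pi_gt0 R; have K0 : 0 < K by rewrite ltr_wpDl // mulr_ge0 // mulr_ge0 ?ltW // expR_gt0.
exists (Num.min 1 (e / K)) => [|w]; first by rewrite lt_min ltr01 divr_gt0.
rewrite lt_min => /andP[w1 we]; have := HB 1%N (w - z).
rewrite big_ord1 addn0 fact0 expr0 mulr1 divr1 subrK.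
move/le_lt_trans; apply; rewrite (_ : 1`!%:R = 1) // divr1 expr1.
apply: (@le_lt_trans _ _ (K * normc (w - z))); last by rewrite mulrC -ltr_pdivlMr.
have n0 := normc_ge0 (w - z); have B0 := normr_ge0 B; have BB := ler_norm B.
have h : expR (pi * normc (w - z)) <= expR pi.
  by rewrite ler_expR -[leRHS]mulr1 ler_pM2l // ltW.
have h0 : 0 <= expR (pi * normc (w - z)) by apply: expR_ge0.
apply: (@le_trans _ _ (`|B| * (pi * normc (w - z) * expR pi))).
  apply: (@le_trans _ _ (`|B| * (pi * normc (w - z) * expR (pi * normc (w - z))))).
    by apply: ler_wpM2r BB; rewrite mulr_ge0 // mulr_ge0 // ltW.
  by apply: ler_wpM2l => //; apply: ler_wpM2l => //; rewrite mulr_ge0 // ltW.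
rewrite -subr_ge0 (_ : _ - _ = normc (w - z)) //; rewrite /K; ring.
Qed.

Arguments taylor_family_continuous : clear implicits.

Lemma csin_half (z : C) : csin ((z + 2^-1) * pi%:C) = ccos (z * pi%:C).
Proof.
have h : cexp ('i * (pi / 2)%:C) = 'i :> C by rewrite cexp_i cos_pihalf sin_pihalf complexiE.
have E : 'i * ((z + 2^-1) * pi%:C) = 'i * (z * pi%:C) + 'i * (pi / 2)%:C :> C.
  by rewrite rmorphM fmorphV rmorph_nat; ring.
rewrite /csin /ccos E cexpN cexpD [cexp (- ('i * (z * pi%:C)))]cexpN h.
move: (cexp_neq0 ('i * (z * pi%:C))); move: (cexp _) => x x0.
have i0 : 'i != 0 :> C by rewrite neq0Ci.
have i2 : 'i * 'i = -1 :> C by rewrite -expr2 sqrCi.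
apply: (mulfI x0); apply: (mulfI i0).
have -> : 'i * (x * ((x * 'i - (x * 'i)^-1) / (2 * 'i))) = (x ^+ 2 * ('i * 'i) - 1) / (2 * 'i).
  by field; rewrite i0.
have -> : 'i * (x * ((x + x^-1) / 2)) = ((x ^+ 2 + 1) * ('i * 'i)) / (2 * 'i).
  by field; rewrite i0.
by rewrite i2; congr (_ / _); ring.
Qed.

(** Extends identities that hold off the integers to the integers themselves. *)
Lemma continuous_eq (f g : C -> C) (z : C) (e : R) : 0 < e ->
  (f w : R[i]^o) @[w --> (z : R[i]^o)] --> (f z : R[i]^o) ->
  (g w : R[i]^o) @[w --> (z : R[i]^o)] --> (g z : R[i]^o) ->
  (forall w, normc (w - z) < e -> w != z -> f w = g w) -> f z = g z.
Proof.
move=> e0 /cvgc_atP Hf /cvgc_atP Hg fg.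
apply: (@punctured_unique R f z) => d d0.
  by have [r r0 H] := Hf d d0; exists r => // w _ /H /ltW.
have [r r0 H] := Hg d d0; exists (Num.min e r) => [|w wz]; first by rewrite lt_min e0.
by rewrite lt_min => /andP[we /H /ltW]; rewrite fg.
Qed.

Lemma normc_dist_int (z : C) (n : int) (e : R) : 0 < e -> e <= 1 -> normc (z - n%:~R) < e ->
  z != n%:~R -> forall m : int, m%:~R != z.
Proof.
move=> e0 e1 zn znn m; apply/eqP => E; subst z.
have mn : m - n != 0 by apply: contra znn; rewrite subr_eq0 => /eqP ->.
move: zn; rewrite -intrB normc_int => /lt_le_trans /(_ e1); rewrite ltrz1.
by move: mn; rewrite -normr_gt0; lia.
Qed.

Lemma band_supp (V : R -> C) : (forall x, x \notin `[0, pi] -> V x = 0) -> band V pi.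
Proof.
move=> V0 t Vt; have : t \in `[0, pi] by apply: contraNT Vt => /V0 ->.
by rewrite in_itv /= => /andP[t0 tp]; rewrite ler_norml; apply/andP; split; lra.
Qed.

(** * Canonical products as trigonometric functions plus transforms *)

Section DeltaTransform.
Variables (kap lam : int -> C) (A : R).
Hypothesis HA : forall n, \sum_(j < n) normc (kap (zn j)) ^+ 2 <= A.
Hypothesis lamE : forall n, lam n = n%:~R + kap n.

(** Off the integers [Delta11] is - sin (pi z) P, and - sin (pi z) (P - 1) is the sum of the terms r
    i sin (pi z) / (z - n), which are transforms of exponentials. The integers follow by
    continuity. *)
Theorem Delta11_FT : exists V : R -> C, [/\ cL2 V, (forall x, x \notin `[0, pi] -> V x = 0) &
  forall z, Delta11 lam z = char_like (- (2 * 'i)^-1) (2 * 'i)^-1 V 0 z].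
Proof.
have A0 : 0 <= A by have := HA 0; rewrite big_ord0.
have [r [rB Hr]] := canonical_partial_fractions HA.
have [|V [LV V0 [phi phi_id HV]]] := @riesz_fischer r (expR ((A + 12) / 2) ^+ 2 * A).
  move=> n; apply: (@le_trans _ _ (\sum_(i < n) expR ((A + 12) / 2) ^+ 2 * normc (kap (zn i)) ^+ 2)).
    by apply: ler_sum => i _; rewrite -exprMn mulrC ler_sqr ?nnegrE ?normc_ge0 // mulr_ge0 ?normc_ge0 ?expR_ge0.
  by rewrite -mulr_sumr ler_wpM2l ?sqr_ge0.
exists V; split=> //.
have LV1 : cL1 mu V by apply: cL2_cL1 LV V0.
have bV := band_supp V0.
have main z : (forall n : int, n%:~R != z) ->
    Delta11 lam z = char_like (- (2 * 'i)^-1) (2 * 'i)^-1 V 0 z.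
  move=> Hz; have [P [HP HS]] := Hr z Hz; rewrite (Delta11_sin HA lamE Hz HP) char_like_sin.
  have H1 := HV (kern z) (expR (pi * `|complex.Im z|)) (rmeas_kern z).
  pose proof (cvgc_subseq phi_id HS) as H2.
  pose proof (cvgcM (cvgc_cst (- csin (z * pi%:C))) H2) as H3.
  rewrite (_ : - csin (z * pi%:C) * P = - csin (z * pi%:C) + - csin (z * pi%:C) * (P - 1)); last by ring.
  congr (_ + _); apply: (cvgc_uniq _ H3); apply: eq_cvgc (H1 _) => [n|x]; last first.
    by rewrite in_itv /= => /andP[t0 tp]; apply: normc_kern; rewrite ler_norml; apply/andP; split; lra.
  rewrite mulr_sumr; apply: eq_bigr => i _; rewrite FT_expo // -[z - _]opprB invrN; ring.
move=> z; have [/main //|] := pselect (forall n : int, n%:~R != z).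
move=> /existsNP[n /negP/negPn/eqP zn]; subst z.
apply: (@continuous_eq (Delta11 lam) (char_like (- (2 * 'i)^-1) (2 * 'i)^-1 V 0) n%:~R 1) => //.
- exact: (Delta11_continuous HA lamE).
- exact: (taylor_family_continuous _ 0 n%:~R (taylor_family_char_like (- (2 * 'i)^-1) (2 * 'i)^-1 LV1 bV)).
- by move=> w w1 wn; apply: main; apply: (@normc_dist_int _ n 1).
Qed.

End DeltaTransform.

(** Shifting the argument by 1/2 multiplies the density by a unimodular exponential and turns the
    sine into the cosine. *)
Theorem Delta12_FT (kap lam : int -> C) (A : R) :
  (forall n, \sum_(j < n) normc (kap (zn j)) ^+ 2 <= A) ->
  (forall n, lam n = n%:~R - 2^-1 + kap n) ->
  exists V : R -> C, [/\ cL2 V, (forall x, x \notin `[0, pi] -> V x = 0) &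
  forall z, Delta12 lam z = char_like 2^-1 2^-1 V 0 z].
Proof.
move=> HA lamE.
have [|V [LV V0 HV]] := @Delta11_FT kap (fun n => lam n + 2^-1) A HA.
  by move=> n; rewrite lamE; ring.
pose W t := - cexp ('i * 2^-1 * freq t) * V t.
have nW t : normc (- cexp ('i * 2^-1 * freq t)) = 1.
  rewrite normcN (_ : 'i * 2^-1 * freq t = 'i * (2^-1 * (2 * t - pi))%:C) ?normc_cexp_i //.
  by rewrite /freq [in RHS]rmorphM fmorphV rmorph_nat mulrA.
exists W; split.
- apply: (@cL2M _ _ _ 1) LV; last by move=> x; rewrite nW.
  by apply: cmeasN; exact: (rmeas_kern 2^-1).
- by move=> x /V0; rewrite /W => ->; rewrite mulr0.
- move=> z; rewrite (Delta12_shift z HA lamE) HV char_like_sin char_like_cos csin_half opprD opprK.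
  congr (_ + _); rewrite /FT -cIN; last first.
    have [H _] := band_L1 (cL2_cL1 LV V0) (band_supp V0) (rmeas_kern (z + 2^-1)) (fun t tp => normc_kern _ tp).
    exact: H.
  by congr cI; apply/funext => t; rewrite kernD /W /kern; ring.
Qed.

End RieszFischer.
Arguments taylor_family_continuous {R} D k z _.

(** * Primitives of integrable functions *)

Section Primitive.
Context {R : realType}.
Local Notation C := R[i].
Local Notation mu := (@lebesgue_measure R).
Local Notation rmeas := (@cmeas R _ (measurableTypeR R)).

Definition prim (f : R -> C) (x : R) : C := cI mu (cut `]-oo, x]%classic f).

Lemma prim_cder_ae (f : R -> C) : cL1 mu f -> {ae mu, forall x, cder (prim f) x (f x)}.
Proof.
move=> Hf.
have key (g : R -> R) : mu.-integrable setT (fun x => (g x)%:E) ->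
    {ae mu, forall x, is_derive x (1 : R) (fun y => \int[mu]_t (\1_`]-oo, y]%classic t * g t)) (g x)}.
  move=> Ig.
  have loc : locally_integrable [set: R] g.
    by have := integrable_locally measurableT Ig; rewrite patch_setT.
  have IS (y : R) : mu.-integrable `]-oo, y] (EFin \o g).
    by apply: integrableS Ig => //; exact: measurable_itv.
  have := FTC1Ny IS loc.
  apply: aeS => x; rewrite /Rintegral => -[d1 d2].
  suff -> : (fun y => \int[mu]_t (\1_`]-oo, y]%classic t * g t)) =
      (fun x0 => fine (\int[mu]_(t in `]-oo, x0]) (g t)%:E)%E).
    by apply: (DeriveDef d1); rewrite -derive1E; exact: d2.
  apply/funext => y; congr fine; rewrite [RHS]integral_mkcond; apply: eq_integral => t _.
  by rewrite patchE indicE; case: (t \in _); rewrite ?mul1r ?mul0r.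
have := aeI (key _ (cL1_Re Hf)) (key _ (cL1_Im Hf)); apply: aeS => x [h1 h2].
split.
- rewrite (_ : (fun s => _) = fun y => \int[mu]_t (\1_`]-oo, y]%classic t * complex.Re (f t))) //.
  by apply/funext => y; congr fine; apply: eq_integral => t _; rewrite ReM /= mul0r subr0.
- rewrite (_ : (fun s => _) = fun y => \int[mu]_t (\1_`]-oo, y]%classic t * complex.Im (f t))) //.
  by apply/funext => y; congr fine; apply: eq_integral => t _; rewrite ImM /= mul0r addr0.
Qed.

Lemma cder_uniq (f : R -> C) t d e : cder f t d -> cder f t e -> d = e.
Proof.
move=> [[_ r1] [_ i1]] [[_ r2] [_ i2]].
by apply/eqP; rewrite eq_complex -r1 -i1 -r2 -i2 !eqxx.
Qed.

Lemma cder_near (f g : R -> C) t d : (\forall s \near t, f s = g s) -> cder f t d -> cder g t d.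
Proof.
move=> fg [hr hi]; split.
- apply: (near_eq_is_derive _ hr).
  by apply: filterS fg => s ->.
- apply: (near_eq_is_derive _ hi).
  by apply: filterS fg => s ->.
Qed.

(** Beyond [u] the primitive is constant, and almost everywhere its derivative is [f]. *)
Lemma upper_tail_ae0 (f : R -> C) (u : R) : cL1 mu f ->
  (forall v, u < v -> cI mu (cut `]v, +oo[%classic f) = 0) ->
  {ae mu, forall x, u < x -> f x = 0}.
Proof.
move=> Hf H0; have := prim_cder_ae Hf; apply: aeS => x Hx ux.
apply: (cder_uniq Hx); apply: (cder_near _ (cder_cst (cI mu f) x)).
near=> s; have us : u < s by near: s; exact: lt_nbhsr.
rewrite /prim -[RHS]addr0 -(H0 s us) -cID; [|exact: cL1_cut|exact: cL1_cut].
congr cI; apply/funext => t; rewrite !cutE !mem_setE !in_itv /= andbT ltNge.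
by case: (t <= s); rewrite ?addr0 ?add0r.
Unshelve. all: by end_near.
Qed.

End Primitive.

(** * A Paley-Wiener theorem from moment estimates *)

Section PaleyWiener.
Context {R : realType}.
Local Notation C := R[i].
Local Notation mu := (@lebesgue_measure R).
Local Notation rmeas := (@cmeas R _ (measurableTypeR R)).
Implicit Types (V X : R -> C) (z : C).

Lemma fact_small (x e : R) : 0 < e -> exists n0 : nat, forall n, (n0 <= n)%N -> x ^+ n / n`!%:R <= e.
Proof.
move=> e0; have := cvg_series_cvg_0 (is_cvg_series_exp_coeff x).
move/cvgrPdist_le => /(_ e e0) [n0 _ H]; exists n0 => n nn.
by have := H n nn; rewrite sub0r normrN => /(le_trans (ler_norm _)).
Qed.

(** A crude Stirling bound. The induction step is e n ^ (n + 1) <= (n + 1) ^ (n + 1), the power n +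
    1 of 1 - 1 / (n + 1) <= exp (- 1 / (n + 1)). *)
Lemma fact_stirling (k : nat) : (0 < k)%N ->
  k`!%:R * expR k%:R <= expR 1 * k%:R * k%:R ^+ k :> R.
Proof.
case: k => // k _; elim: k => [|k IH]; first by rewrite (_ : 1`!%:R = 1) // mul1r expr1 !mulr1.
have k1 : (0 : R) < k.+1%:R by rewrite ltr0n.
have k2 : (0 : R) < k.+2%:R by rewrite ltr0n.
have h : expR 1 * k.+1%:R ^+ k.+2 <= k.+2%:R ^+ k.+2 :> R.
  have : expR (- k.+2%:R^-1) >= k.+1%:R / k.+2%:R :> R.
    apply: le_trans (expR_ge1Dx _); rewrite ler_pdivrMr // mulrDl mul1r mulNr mulVf ?gt_eqF //.
    by rewrite -[in leRHS]natr1 addrK.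
  move=> H; have : (k.+1%:R / k.+2%:R) ^+ k.+2 <= expR (- k.+2%:R^-1) ^+ k.+2 :> R.
    by rewrite lerXn2r ?nnegrE ?expR_ge0 ?divr_ge0.
  rewrite -expRM_natl mulrN mulfV ?gt_eqF // expRN expr_div_n ler_pdivrMr ?exprn_gt0 //.
  by rewrite mulrC ler_pdivlMr ?expR_gt0 // mulrC.
have E : expR k.+2%:R = expR k.+1%:R * expR 1 :> R by rewrite -natr1 expRD.
rewrite factS natrM E exprS in h *; have e0 := expR_ge0 (1 : R).
move: IH h; set f := (k.+1)`!%:R; set a := expR k.+1%:R.
have -> : k.+2%:R * f * (a * expR 1) = k.+2%:R * expR 1 * (f * a) by ring.
have -> : expR 1 * k.+2%:R * k.+2%:R ^+ k.+2 = k.+2%:R * expR 1 * k.+2%:R ^+ k.+2 :> R by ring.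
move=> h1 h2; rewrite ler_pM2l ?mulr_gt0 ?expR_gt0 //; apply: le_trans h1 _.
by apply: le_trans h2; rewrite mulrA.
Qed.

Lemma sum_omega n m : (0 < n)%N ->
  \sum_(l < n) omega n ^+ (l * m) = if (n %| m)%N then n%:R else 0 :> C.
Proof.
move=> n0; have Pn := omega_prim (R := R) n0.
case: ifPn => [nm|nm].
  rewrite (eq_bigr (fun=> 1)) ?sumr_const ?card_ord // => l _.
  by apply/eqP; rewrite -(prim_order_dvd Pn) dvdn_mull.
have x1 : omega n ^+ m != 1 :> C by rewrite -(prim_order_dvd Pn).
have : (omega n ^+ m) ^+ n - 1 = 0 :> C by rewrite exprAC (prim_expr_order Pn) expr1n subrr.
rewrite subrX1 => /eqP; rewrite mulf_eq0 subr_eq0 (negbTE x1) /= => /eqP E.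
by rewrite -[RHS]E; apply: eq_bigr => l _; rewrite mulnC exprM.
Qed.

(* Cauchy's estimate for the coefficients, with the contour integral replaced by
   a finite sum over roots of unity. *)
Lemma poly_coef_bound (p : {poly C}) (s M : R) k : 0 <= s ->
  (forall z, normc z = s -> normc p.[z] <= M) -> normc p`_k * s ^+ k <= M.
Proof.
move=> s0 Hp.
have M0 : 0 <= M by apply: le_trans (Hp s%:C _); rewrite ?normc_ge0 // normcR ger0_norm.
have [kp|pk] := leqP (size p) k; first by rewrite nth_default // normc0 mul0r.
have n0 : (0 < size p)%N by apply: leq_ltn_trans pk.
set n := size p in n0 pk.
(* The weight of exponent n - k isolates one coefficient: for j < n, the order n divides j + (n - k)
   only if j = k. *)
have E : \sum_(l < n) p.[s%:C * omega n ^+ l] * omega n ^+ (l * (n - k)) = n%:R * (p`_k * s%:C ^+ k).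
  transitivity (\sum_(j < n) p`_j * s%:C ^+ j * \sum_(l < n) omega n ^+ (l * (j + (n - k)))).
    under [RHS]eq_bigr do rewrite mulr_sumr; rewrite [RHS]exchange_big; apply: eq_bigr => l _.
    rewrite horner_coef mulr_suml; apply: eq_bigr => j _.
    by rewrite exprMn -exprM -!mulrA -exprD -mulnDr.
  rewrite (bigD1 (Ordinal pk)) //= sum_omega // subnKC ?(ltnW pk) // dvdnn mulrC big1 ?addr0 // => j jk.
  rewrite sum_omega //; case: ifPn; rewrite ?mulr0 // => /dvdnP[c Ec].
  case/eqP: jk; apply/val_inj => /=; have := ltn_ord j; move: Ec pk.
  by case: c => [|[|c]]; rewrite ?mul0n ?mul1n ?mulSn; lia.
have : normc (n%:R * (p`_k * s%:C ^+ k)) <= n%:R * M.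
  rewrite -E; apply: le_trans (normc_sum _ _ _) _.
  apply: (@le_trans _ _ (\sum_(l < n) M)); last by rewrite sumr_const card_ord mulr_natl.
  apply: ler_sum => l _; rewrite normcM normc_omega mulr1; apply: Hp.
  by rewrite normcM normc_omega mulr1 normcR ger0_norm.
rewrite normcM normc_nat ler_pM2l ?ltr0n // normcM normcX normcR ger0_norm //.
Qed.

(** Up to i ^ k / k!, the Taylor coefficients at 0 of FT V z exp (i pi z). The extra exponential
    moves the frequencies to [0, 2 pi], where the growth of the moments detects the right end of the
    support. *)
Definition mom V k : C := cI mu (fun t => V t * (2 * t)%:C ^+ k).

Lemma rmeas_X2 k : rmeas (fun t : R => (2 * t)%:C ^+ k).
Proof.
elim: k => [|k IH]; first by under eq_fun do rewrite expr0; exact: cmeas_cst.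
under eq_fun do rewrite exprS; apply: cmeasM => //.
by apply: cmeas_real; exact: measurable_funM.
Qed.

Lemma normc_X2 (t : R) k : `|2 * t - pi| <= pi -> normc ((2 * t)%:C ^+ k) <= (2 * pi) ^+ k.
Proof.
rewrite ler_norml => /andP[t0 tp]; have pi0 := pi_gt0 R.
rewrite normcX normcR lerXn2r ?nnegrE //; first lra.
by rewrite ler_norml; apply/andP; split; lra.
Qed.

(** Cauchy's estimate on the circle of radius s, applied to a Taylor polynomial so long that its
    error is below e; then e tends to 0. *)
Lemma mom_bound V (M tau : R) k (s : R) : cL1 mu V -> band V pi -> 0 < s ->
  (forall z, normc (FT V z) * normc (cexp ('i * z * pi%:C)) <= M * expR (tau * normc z)) ->
  normc (mom V k) * s ^+ k <= k`!%:R * (M * expR (tau * s)).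
Proof.
move=> LV bV s0 Hf; have pi0 := pi_gt0 R.
have L1m j : cL1 mu (fun t => V t * (2 * t)%:C ^+ j).
  exact: (band_L1 LV bV (rmeas_X2 j) (fun t tp => normc_X2 j tp)).1.
have [V0 B0] : 0 <= nI mu V /\ 0 <= expR (2 * pi * s) by rewrite nI_ge0 expR_ge0.
rewrite -[_%:R * _]mulrC -ler_pdivrMr ?ltr0n ?fact_gt0 //.
apply/ler_addgt0Pr => e e0.
have [n0 Hn0] := fact_small (2 * pi * s) (e := e / (nI mu V * expR (2 * pi * s) + 1))
    ltac:(by rewrite divr_gt0 // ltr_wpDl // mulr_ge0).
pose n := maxn n0 k.+1.
pose p : {poly C} := \poly_(j < n) ('i ^+ j * mom V j / j`!%:R).
have kn : (k < n)%N by rewrite /n leq_max ltnSn orbT.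
have := @poly_coef_bound p s (M * expR (tau * s) + e) k (ltW s0).
rewrite coef_poly kn normcM normcM normcX normc_i expr1n mul1r normcV normc_nat.
have -> : normc (mom V k) / k`!%:R * s ^+ k = normc (mom V k) * s ^+ k / k`!%:R by ring.
apply => z zs; rewrite horner_poly.
have E : FT V z * cexp ('i * z * pi%:C) - \sum_(j < n) 'i ^+ j * mom V j / j`!%:R * z ^+ j =
    cI mu (fun t => V t * (cexp ('i * z * (2 * t)%:C) - \sum_(j < n) ('i * z * (2 * t)%:C) ^+ j / j`!%:R)).
  pose F j (t : measurableTypeR R) : C := ('i ^+ j / j`!%:R * z ^+ j) * (V t * (2 * t)%:C ^+ j).
  have LF j : cL1 mu (F j) by apply: cL1Z.
  have -> : \sum_(j < n) 'i ^+ j * mom V j / j`!%:R * z ^+ j = cI mu (fun t => \sum_(j < n) F j t).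
    by rewrite cI_sum //; apply: eq_bigr => j _; rewrite /F cIZ // /mom; ring.
  have Lk := (band_L1 LV bV (rmeas_kern z) (fun t tp => normc_kern z tp)).1.
  rewrite mulrC -cIZ // -cIB; [|exact: cL1Z|exact: cL1_sum].
  congr cI; apply/funext => t; rewrite mulrBr; congr (_ - _).
    rewrite mulrCA; congr (_ * _); rewrite /kern -cexpD; congr cexp.
    by rewrite /freq rmorphB; ring.
  by rewrite mulr_sumr; apply: eq_bigr => j _; rewrite /F !exprMn; ring.
pose X t : C := cexp ('i * z * (2 * t)%:C) - \sum_(j < n) ('i * z * (2 * t)%:C) ^+ j / j`!%:R.
have mX : rmeas X.
  apply: cmeasB.
    rewrite (_ : (fun t => _) = fun t : R => cexp (t%:C * (2 * 'i * z))); first exact: rmeas_cexp.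
    by apply/funext => t; congr cexp; rewrite rmorphM /= rmorph_nat; ring.
  apply: (@cmeas_sum _ _ (measurableTypeR R) n (fun j t => ('i * z * (2 * t)%:C) ^+ j / j`!%:R)) => j.
  under eq_fun do rewrite exprMn mulrC mulrA.
  by apply: cmeasM; [exact: cmeas_cst|exact: rmeas_X2].
have XB (t : R) : `|2 * t - pi| <= pi ->
    normc (X t) <= (2 * pi * s) ^+ n / n`!%:R * expR (2 * pi * s).
  move=> tp; apply: cexp_taylor_le; rewrite !normcM normc_i mul1r zs mulrC ler_wpM2r ?(ltW s0) //.
  by have := normc_X2 1 tp; rewrite !expr1.
have [LX nX] := band_L1 LV bV mX XB.
have Hp : normc (\sum_(j < n) 'i ^+ j * mom V j / j`!%:R * z ^+ j) <=
    normc (FT V z * cexp ('i * z * pi%:C)) + nI mu (fun t => V t * X t).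
  rewrite -[X in normc X](subKr (FT V z * cexp ('i * z * pi%:C))).
  by apply: le_trans (le_normcD _ _) _; rewrite lerD2l normcN E; exact: cI_norm.
apply: le_trans Hp _; apply: lerD.
  by rewrite [normc (FT V z * _)]normcM; have := Hf z; rewrite zs.
apply: le_trans nX _.
have := Hn0 n (leq_maxl _ _); rewrite ler_pdivlMr; last by rewrite ltr_wpDl // mulr_ge0.
set g := _ / _; rewrite mulrDr mulr1 => Hg.
have g0 : 0 <= g by rewrite divr_ge0 // exprn_ge0 // mulr_ge0 ?(ltW s0) // mulr_ge0 // ltW.
apply: le_trans Hg; rewrite (_ : g * expR (2 * pi * s) * nI mu V = g * (nI mu V * expR (2 * pi * s))) ?lerDl //.
by ring.
Qed.

(** The radius s = k / tau is optimal. By [fact_stirling] it leaves a spurious factor k, which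
    Bernoulli's inequality absorbs into (tau' / tau) ^ k. The summand [expR tau] of the constant
    serves k = 0, where s = 1. *)
Lemma mom_geo V (tau tau' : R) (M : R) : cL1 mu V -> band V pi -> 0 < tau -> tau < tau' ->
  (forall z, normc (FT V z) * normc (cexp ('i * z * pi%:C)) <= M * expR (tau * normc z)) ->
  exists2 K : R, 0 <= K & forall k, normc (mom V k) <= K * tau' ^+ k.
Proof.
move=> LV bV t0 tt' Hf.
have M0 : 0 <= M.
  by have := Hf 0; rewrite normc0 [tau * 0]mulr0 expR0 mulr1; apply: le_trans; rewrite mulr_ge0 ?normc_ge0.
pose d := tau' / tau - 1.
have d0 : 0 < d by rewrite subr_gt0 ltr_pdivlMr // mul1r.
have t'0 : 0 < tau' by apply: lt_trans tt'.
exists (M * (expR tau + expR 1 / d)) => [|k].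
  by rewrite mulr_ge0 // addr_ge0 ?expR_ge0 // divr_ge0 ?expR_ge0 // ltW.
case: k => [|k].
  have := mom_bound 0 LV bV ltr01 Hf; rewrite !expr0 !mulr1 mul1r => /le_trans; apply.
  by rewrite ler_wpM2l // lerDl divr_ge0 ?expR_ge0 // ltW.
have k0 : (0 : R) < k.+1%:R by rewrite ltr0n.
have s0 : 0 < k.+1%:R / tau by rewrite divr_gt0.
have := mom_bound k.+1 LV bV s0 Hf.
rewrite [tau * (_ / tau)]mulrC divfK ?gt_eqF // => H.
have St := @fact_stirling k.+1 isT.
have be : k.+1%:R * d <= (1 + d) ^+ k.+1.
  have bern n : 1 + n%:R * d <= (1 + d) ^+ n.
    elim: n => [|n IH]; first by rewrite mul0r addr0 expr0.
    rewrite exprS -natr1; have := mulr_ge0 (ler0n R n) (sqr_ge0 d); nra.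
  by apply: le_trans (bern _); rewrite lerDr.
have td : tau' = tau * (1 + d) by rewrite /d addrC subrK mulrC divfK ?gt_eqF.
have s1 : 0 < (k.+1%:R / tau) ^+ k.+1 by rewrite exprn_gt0.
rewrite -(ler_pM2r s1); apply: le_trans H _.
have -> : M * (expR tau + expR 1 / d) * tau' ^+ k.+1 * (k.+1%:R / tau) ^+ k.+1 =
    M * ((expR tau + expR 1 / d) * (1 + d) ^+ k.+1 * k.+1%:R ^+ k.+1).
  rewrite td exprMn expr_div_n; have := expf_neq0 k.+1 (lt0r_neq0 t0).
  by move: (tau ^+ _) (k.+1%:R ^+ _) ((1 + d) ^+ _) => x y w x0; field; rewrite x0 gt_eqF.
rewrite mulrCA ler_wpM2l //; apply: le_trans St _.
rewrite ler_wpM2r ?exprn_ge0 //.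
apply: (@le_trans _ _ (expR 1 / d * (1 + d) ^+ k.+1)).
  by rewrite -!mulrA ler_wpM2l ?expR_ge0 // mulrC ler_pdivlMr.
apply: ler_wpM2r; last by rewrite lerDr expR_ge0.
by rewrite exprn_ge0 // addr_ge0 // ltW.
Qed.

(* The tested functions 1 - exp (- (2 t / T) ^ m) tend to the indicator of
   ]T / 2, +oo[, and their expansion in powers of (2 t) ^ m has small integral. *)
Lemma mom_tail V (tau T K : R) : cL1 mu V -> (forall x, x \notin `[0, pi] -> V x = 0) ->
  0 <= K -> 0 < tau -> tau < T -> (forall k, normc (mom V k) <= K * tau ^+ k) ->
  cI mu (cut `](T / 2), +oo[%classic V) = 0.
Proof.
move=> LV V0 K0 t0 tT HK; have bV := band_supp V0.
have T0 : 0 < T by apply: lt_trans tT.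
pose q := tau / T; have q0 : 0 <= q by rewrite divr_ge0 // ltW.
have q1 : q < 1 by rewrite ltr_pdivrMr // mul1r.
pose y m (t : R) := (2 * t / T) ^+ m.
pose phi m (t : R) : C := 1 - cexp (- (y m t)%:C).
have band_ge t : V t != 0 -> 0 <= t /\ t <= pi.
  by move=> Vt; have : t \in `[0, pi]; [apply: contraNT Vt => /V0 ->|rewrite in_itv => /andP[]].
have my m : rmeas (fun t => (y m t)%:C).
  rewrite (_ : (fun t => _) = fun t => T%:C^-1 ^+ m * (2 * t)%:C ^+ m).
    by apply: cmeasM; [exact: cmeas_cst|exact: rmeas_X2].
  by apply/funext => t; rewrite /y expr_div_n rmorphM fmorphV !rmorphXn mulrC exprVn.
have mphi m : rmeas (phi m).
  apply: cmeasB; first exact: cmeas_cst.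
  have [+ _] := my m => /= mr.
  rewrite (_ : (fun t => _) = fun t => (expR (- y m t))%:C); last first.
    by apply/funext => t; rewrite /cexp /= oppr0 cos0 sin0 mulr1.
  by apply: cmeas_real; apply: measurableT_comp => //; apply: measurableT_comp.
have L1m j : cL1 mu (fun t => V t * (2 * t)%:C ^+ j).
  exact: (band_L1 LV bV (rmeas_X2 j) (fun t tp => normc_X2 j tp)).1.
(* Term j of the expansion is at most K (q ^ m) ^ j for j >= 1, a geometric series of ratio at most
   1/2; only the Taylor remainder has to be made small separately. *)
have small m : q ^+ m <= 2^-1 -> normc (cI mu (fun t => V t * phi m t)) <= 2 * (K * q ^+ m).
  move=> qm; apply/ler_addgt0Pr => e e0; pose Y : R := (2 * pi / T) ^+ m.
  have Y0 : 0 <= Y by rewrite exprn_ge0 // divr_ge0 ?(ltW T0) // mulr_ge0 // pi_ge0.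
  have B0 : 0 <= nI mu V * expR Y by rewrite mulr_ge0 ?expR_ge0 ?nI_ge0.
  have [n0 Hn0] := fact_small Y (e := e / (nI mu V * expR Y + 1)) ltac:(by rewrite divr_gt0 // ltr_wpDl).
  pose n := n0.+1.
  pose X t : C := cexp (- (y m t)%:C) - \sum_(j < n) (- (y m t)%:C) ^+ j / j`!%:R.
  have yE j t : (- (y m t)%:C) ^+ j = (- T%:C^-1 ^+ m) ^+ j * (2 * t)%:C ^+ (m * j) :> C.
    rewrite exprNn [in RHS]exprNn -mulrA; congr (_ * _); rewrite /y expr_div_n rmorphM fmorphV !rmorphXn /=.
    by rewrite exprMn exprM -!exprVn; exact: mulrC.
  have mX : rmeas X.
    apply: cmeasB.
      rewrite (_ : (fun t => _) = fun t => 1 - phi m t).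
        by apply: cmeasB; [exact: cmeas_cst|exact: mphi].
      by apply/funext => t; rewrite /phi subKr.
    apply: (@cmeas_sum _ _ (measurableTypeR R) n (fun j t => (- (y m t)%:C) ^+ j / j`!%:R)) => j.
    under eq_fun do rewrite yE mulrC mulrA.
    by apply: cmeasM; [exact: cmeas_cst|exact: rmeas_X2].
  have XB (t : R) : `|2 * t - pi| <= pi -> normc (X t) <= Y ^+ n / n`!%:R * expR Y.
    rewrite ler_norml => /andP[h1 h2]; apply: cexp_taylor_le; rewrite normcN normcR /y /Y.
    have t00 : 0 <= 2 * t by lra.
    have t2p : 2 * t <= 2 * pi by lra.
    rewrite ger0_norm ?exprn_ge0 ?divr_ge0 ?(ltW T0) // lerXn2r ?nnegrE ?divr_ge0 ?(ltW T0) //.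
      exact: le_trans t2p.
    by rewrite ler_pM2r // invr_gt0.
  have [LX nX] := band_L1 LV bV mX XB.
  pose F j (t : measurableTypeR R) : C :=
    ((- T%:C^-1 ^+ m) ^+ j.+1 / j.+1`!%:R) * (V t * (2 * t)%:C ^+ (m * j.+1)).
  have LF j : cL1 mu (F j) by apply: cL1Z.
  have E : cI mu (fun t => V t * phi m t) =
      - (\sum_(j < n0) (- T%:C^-1 ^+ m) ^+ j.+1 / j.+1`!%:R * mom V (m * j.+1)) - cI mu (fun t => V t * X t).
    rewrite -opprD (eq_bigr (fun j : 'I_n0 => cI mu (F j))) => [|j _]; last by rewrite /F cIZ.
    rewrite -cI_sum // -cID; [|exact: cL1_sum|done].
    rewrite -cIN; last by apply: cL1D => //; exact: cL1_sum.
    congr cI; apply/funext => t; rewrite /phi /X /n.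
    rewrite -(big_mkord xpredT (fun j => (- (y m t)%:C) ^+ j / j`!%:R)) big_nat_recl // big_mkord expr0 fact0 divr1.
    have -> : \sum_(j < n0) F j t = V t * \sum_(j < n0) (- (y m t)%:C) ^+ j.+1 / j.+1`!%:R.
      by rewrite mulr_sumr; apply: eq_bigr => j _; rewrite /F yE; ring.
    by move: (cexp _) (\sum_(_ < _) _) => u v; ring.
  rewrite E; apply: le_trans (le_normcD _ _) _; rewrite !normcN; apply: lerD.
    apply: le_trans (normc_sum _ _ _) _.
    apply: (@le_trans _ _ (\sum_(j < n0) (K * q ^+ m) * (q ^+ m) ^+ j)); last first.
      by apply: sum_geo_le; [rewrite mulr_ge0 // exprn_ge0|rewrite exprn_ge0].
    apply: ler_sum => j _; rewrite normcM normcM normcX normcN normcX normcV normcR gtr0_norm // normcV normc_nat.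
    have -> : K * q ^+ m * (q ^+ m) ^+ j = (T^-1 ^+ m) ^+ j.+1 * (K * tau ^+ (m * j.+1)).
      by rewrite -mulrA -exprS /q -!exprM expr_div_n exprVn; ring.
    apply: ler_pM; rewrite ?normc_ge0 ?HK // ?mulr_ge0 ?exprn_ge0 ?invr_ge0 ?(ltW T0) //.
    by rewrite ler_piMr ?exprn_ge0 ?invr_ge0 ?(ltW T0) // invf_le1 ?ltr0n ?fact_gt0 // ler1n fact_gt0.
  apply: le_trans (cI_norm LX) _; apply: le_trans nX _.
  have := Hn0 n (leqnSn _); rewrite ler_pdivlMr; last by rewrite ltr_wpDl.
  set g := _ / _; rewrite mulrDr mulr1 => Hg.
  have g0 : 0 <= g by rewrite divr_ge0 // exprn_ge0.
  apply: le_trans Hg; rewrite (_ : g * expR Y * nI mu V = g * (nI mu V * expR Y)) ?lerDl //.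
  by ring.
have geo (x : R) : 0 <= x -> x < 1 -> x ^+ m @[m --> \oo] --> (0 : R).
  by move=> x0 x1; apply: cvg_expr; rewrite ger0_norm.
have lim0 : (cI mu (fun t => V t * phi m t) : R[i]^o) @[m --> \oo] --> (0 : R[i]^o).
  apply: (@cvgc_squeeze _ _ _ _ _ _ (fun m => 2 * K * q ^+ m)).
    have : \forall m \near \oo, q ^+ m <= 2^-1.
      by move/cvgrPdist_le: (geo q q0 q1) => /(_ 2^-1 ltac:(by [])); apply: filterS => m;
        rewrite sub0r normrN ger0_norm // exprn_ge0.
    by apply: filterS => m qm; rewrite subr0 -mulrA; apply: small.
  by rewrite -[X in _ --> X](mulr0 (2 * K)); apply: cvgM; [exact: cvg_cst|exact: geo].
have lim1 : (cI mu (fun t => V t * phi m t) : R[i]^o) @[m --> \oo] -->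
    (cI mu (cut `](T / 2), +oo[%classic V) : R[i]^o).
  apply: (@cI_dct _ _ _ mu (fun m t => V t * phi m t) _ (fun x => 2 * normc (V x))).
  - by move=> m; apply: cmeasM (cL1_meas LV) (mphi m).
  - by apply: cmeas_cut; [exact: measurable_itv|exact: cL1_meas LV].
  - by apply: integrable_realZ; exact: cL1_norm.
  - move=> m t; have [->|Vt] := eqVneq (V t) 0; first by rewrite mul0r normc0 mulr0.
    have [t00 _] := band_ge t Vt.
    rewrite normcM mulrC ler_wpM2r ?normc_ge0 //; apply: le_trans (le_normcD _ _) _.
    rewrite normcN normc1 (_ : 2 = 1 + 1) // lerD2l [normc (cexp _)]normc_cexp /= -expR0 ler_expR oppr_le0.
    by rewrite exprn_ge0 // divr_ge0 ?(ltW T0) // mulr_ge0.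
  (* At t = T / 2 the powers stay equal to 1 and the tested functions tend to 1 - 1 / e, so this
     point is discarded. *)
  - have : {ae mu, forall t, t != T / 2}.
      exists [set T / 2]; split; [exact: measurable_set1|exact: lebesgue_measure_set1|].
      by move=> t /= /negP/negPn/eqP.
    apply: aeS => t tT2; have [Vt|Vt] := eqVneq (V t) 0.
      rewrite cutE Vt if_same; apply: (@eq_cvgc _ _ _ (fun=> 0)); last exact: cvgc_cst.
      by move=> m; rewrite mul0r.
    have [t00 _] := band_ge t Vt.
    pose x := 2 * t / T; have x0 : 0 <= x by rewrite divr_ge0 ?(ltW T0) // mulr_ge0.
    have y0 m : 0 <= y m t by rewrite exprn_ge0.
    have cE m : cexp (- (y m t)%:C) = (expR (- y m t))%:C.
      by rewrite /cexp /= oppr0 cos0 sin0 mulr1.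
    rewrite cutE; case: ifPn => [/set_mem /=|/negP]; rewrite ?mem_setE in_itv /= andbT.
      move=> h0; have h : T < 2 * t by move: h0; rewrite ltr_pdivrMr // mulrC.
      have x1 : 1 < x by rewrite ltr_pdivlMr // mul1r.
      have xi1 : x^-1 < 1 by rewrite invf_lt1 // (lt_trans ltr01).
      apply: (@cvgc_squeeze _ _ _ _ _ _ (fun m => normc (V t) * x^-1 ^+ m)).
        apply: nearW => m; rewrite /phi cE -[X in _ - X]mulr1 -mulrBr normcM ler_wpM2l ?normc_ge0 //.
        rewrite addrAC subrr add0r normcN normcR ger0_norm ?expR_ge0 // expRN exprVn.
        have xm : 0 < x ^+ m by rewrite exprn_gt0 // (lt_trans ltr01).
        rewrite lef_pV2 ?posrE ?expR_gt0 //; apply: le_trans (expR_ge1Dx _).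
        by rewrite -/x lerDr.
      rewrite -[X in _ --> X](mulr0 (normc (V t))); apply: cvgM; first exact: cvg_cst.
      by apply: geo => //; rewrite invr_ge0.
    move=> /negP; rewrite -leNgt le_eqVlt (negbTE tT2) orFb => h0.
    have h : 2 * t < T by move: h0; rewrite ltr_pdivlMr // mulrC.
    have x1 : x < 1 by rewrite ltr_pdivrMr // mul1r.
    apply: (@cvgc_squeeze _ _ _ _ _ _ (fun m => normc (V t) * x ^+ m)).
      apply: nearW => m; rewrite subr0 normcM ler_wpM2l ?normc_ge0 // /phi cE.
      rewrite -[1]/(1%:C) -rmorphB normcR ger0_norm; last by rewrite subr_ge0 -expR0 ler_expR oppr_le0.
      by have := expR_ge1Dx (- y m t); rewrite /y -/x; lra.
    rewrite -[X in _ --> X](mulr0 (normc (V t))); apply: cvgM; first exact: cvg_cst.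
    exact: geo.
exact: (cvgc_uniq _ lim1 lim0).
Qed.

Lemma ae_aff (c s1 : R) (P : R -> Prop) : s1 = 1 \/ s1 = -1 ->
  {ae mu, forall x, P x} -> {ae mu, forall x, P (s1 * x + c)}.
Proof.
move=> s1E [A [mA A0 PA]]; exists ((fun x => s1 * x + c) @^-1` A); split.
- rewrite -[X in measurable X]setTI.
  have m : measurable_fun setT (fun x : R => s1 * x + c).
    by apply: measurable_funD => //; exact: measurable_funM.
  exact: m.
- by rewrite lebesgue_aff.
- by move=> x /= /PA.
Qed.

Lemma exponential_type_bound (f : C -> C) (rho t : R) : (exponential_type f <= rho%:E)%E -> rho < t ->
  exists2 M : R, 0 <= M & forall z, normc (f z) <= M * expR (t * normc z).
Proof.
move=> Hf rt; have : (exponential_type f < t%:E)%E by apply: le_lt_trans Hf _; rewrite lte_fin.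
move=> /ereal_inf_lt[_ [s [M HM] <-]]; rewrite lte_fin => st; exists `|M| => // z.
apply: le_trans (HM z) _; apply: le_trans (ler_wpM2r (expR_ge0 _) (ler_norm M)) _.
by rewrite ler_wpM2l // ler_expR ler_wpM2r ?normc_ge0 // ltW.
Qed.

(** Moments control the upper end of the support only; the lower end is the upper end of the density
    reflected at pi / 2. *)
Theorem paley_wiener V (rho : R) : cL1 mu V -> (forall x, x \notin `[0, pi] -> V x = 0) ->
  0 <= rho -> (exponential_type (FT V) <= rho%:E)%E ->
  {ae mu, forall t, rho < `|2 * t - pi| -> V t = 0}.
Proof.
move=> LV V0 r0 HV; have pi0 := pi_gt0 R.
have one V1 : cL1 mu V1 -> (forall x, x \notin `[0, pi] -> V1 x = 0) ->
    (forall t, rho < t -> exists2 M : R, 0 <= M & forall z, normc (FT V1 z) <= M * expR (t * normc z)) ->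
    {ae mu, forall t, (pi + rho) / 2 < t -> V1 t = 0}.
  move=> LV1 V10 HV1; apply: upper_tail_ae0 => // u hu.
  (* A third of the slack is spent at each strict step: from the type to a growth exponent, from tau
     to tau' in [mom_geo], and from tau' to T = 2 u in [mom_tail]. *)
  pose d := (2 * u - pi - rho) / 3; have d0 : 0 < d by rewrite /d; lra.
  have [M M0 HM] := HV1 (rho + d) ltac:(lra).
  have H z : normc (FT V1 z) * normc (cexp ('i * z * pi%:C)) <= M * expR ((rho + d + pi) * normc z).
    rewrite [(_ + _ + _) * _]mulrDl expRD mulrA; apply: ler_pM; rewrite ?normc_ge0 //.
    rewrite [normc (cexp _)]normc_cexp ler_expR.
    have -> : complex.Re ('i * z * pi%:C) = - complex.Im z * pi by case: z => a b /=; ring.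
    rewrite mulrC ler_wpM2l ?(ltW pi0) //; apply: le_trans (le_Im_normc z).
    by rewrite -normrN ler_norm.
  have [K K0 HK] := mom_geo LV1 (band_supp V10) (ltac:(lra) : 0 < rho + d + pi)
    (ltac:(lra) : rho + d + pi < rho + d + pi + d) H.
  have -> : u = (2 * u) / 2 by field.
  by apply: (mom_tail LV1 V10 K0 _ _ HK); rewrite /d; lra.
have h1 := one V LV V0 (fun t => exponential_type_bound HV).
pose W t := V (-1 * t + pi).
have LW : cL1 mu W by apply: cL1_aff => //; right.
have W0 x : x \notin `[0, pi] -> W x = 0.
  by move=> xn; apply: V0; apply: contra xn; rewrite !in_itv /= => /andP[? ?]; apply/andP; split; lra.
have WE z : FT W z = FT V (- z).
  have Lk := (band_L1 LV (band_supp V0) (rmeas_kern (- z)) (fun t tp => normc_kern (- z) tp)).1.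
  rewrite /FT -(cI_aff pi (or_intror (erefl (-1))) Lk); congr cI; apply/funext => t.
  rewrite /W /kern /freq (_ : 2 * (-1 * t + pi) - pi = - (2 * t - pi)); last by ring.
  by rewrite rmorphN; congr (_ * cexp _); ring.
have HW t : rho < t -> exists2 M : R, 0 <= M & forall z, normc (FT W z) <= M * expR (t * normc z).
  by move=> /(exponential_type_bound HV)[M M0 HM]; exists M => // z; rewrite WE -[normc z]normcN.
have h2 := ae_aff pi (or_intror (erefl (-1))) (one W LW W0 HW).
have := aeI h1 h2; apply: aeS => t [k1 k2]; rewrite ltr_normr => /orP[h|h]; first by apply: k1; lra.
have := k2 ltac:(lra); rewrite /W (_ : -1 * (-1 * t + pi) + pi = t) //.
by ring.
Qed.

End PaleyWiener.

(** * Entire functions as limits of polynomials on discs *)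

Section PolynomialApproximation.
Context {R : realType}.
Local Notation C := R[i].
Implicit Types (f g : C -> C) (z w l : C) (rho : R) (p q : {poly C}).

(** Takes the place of holomorphy on a disc: polynomials satisfy Cauchy's estimate by
    [poly_coef_bound], and such estimates survive uniform limits. *)
Definition apx rho f : Prop := forall e : R, 0 < e -> exists p : {poly C},
  forall z, normc z <= rho -> normc (f z - p.[z]) <= e.

Lemma apx_poly p rho : apx rho (horner p).
Proof. by move=> e e0; exists p => z _; rewrite subrr normc0 ltW. Qed.

Lemma apx_eq rho f g : (forall z, normc z <= rho -> f z = g z) -> apx rho f -> apx rho g.
Proof. by move=> fg H e /H[p Hp]; exists p => z zr; rewrite -fg // Hp. Qed.

Lemma apx_lim rho f : (forall e : R, 0 < e -> exists2 g, apx rho g &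
  forall z, normc z <= rho -> normc (f z - g z) <= e) -> apx rho f.
Proof.
move=> H e e0; have e2 : 0 < e / 2 by rewrite divr_gt0.
have [g Hg fg] := H _ e2; have [p Hp] := Hg _ e2; exists p => z zr.
have -> : f z - p.[z] = (f z - g z) + (g z - p.[z]) by ring.
apply: le_trans (le_normcD _ _) _; have := fg z zr; have := Hp z zr; lra.
Qed.

Lemma poly_bounded p rho : exists2 B : R, 0 <= B & forall z, normc z <= rho -> normc p.[z] <= B.
Proof.
exists (\sum_(k < size p) normc p`_k * `|rho| ^+ k).
  by apply: sumr_ge0 => k _; rewrite mulr_ge0 ?normc_ge0 // exprn_ge0.
move=> z zr; rewrite horner_coef; apply: le_trans (normc_sum _ _ _) _.
apply: ler_sum => k _; rewrite normcM normcX ler_wpM2l ?normc_ge0 //.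
by rewrite lerXn2r ?nnegrE ?normc_ge0 // (le_trans zr) // ler_norm.
Qed.

Lemma apx_bounded rho f : apx rho f -> exists2 B : R, 0 <= B & forall z, normc z <= rho -> normc (f z) <= B.
Proof.
move=> /(_ 1 ltr01)[p Hp]; have [B B0 HB] := poly_bounded p rho.
exists (1 + B) => [|z zr]; first by rewrite addr_ge0.
rewrite -[f z](subrK p.[z]); apply: le_trans (le_normcD _ _) _.
by apply: lerD; [exact: Hp|exact: HB].
Qed.

Lemma apxM rho f g : apx rho f -> apx rho g -> apx rho (fun z => f z * g z).
Proof.
move=> Hf Hg; have [A A0 fA] := apx_bounded Hf; have [B B0 gB] := apx_bounded Hg.
move=> e e0; have d0 : 0 < Num.min 1 (e / (A + B + 1)).
  by rewrite lt_min ltr01 divr_gt0 // ltr_wpDl // addr_ge0.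
have [p Hp] := Hf _ d0; have [q Hq] := Hg _ d0; exists (p * q) => z zr; rewrite hornerM.
have h1 := Hp z zr; have h2 := Hq z zr; move: h1 h2; rewrite !le_min => /andP[p1 pe] /andP[q1 qe].
have -> : f z * g z - p.[z] * q.[z] =
    (f z - p.[z]) * g z + f z * (g z - q.[z]) - (f z - p.[z]) * (g z - q.[z]) by ring.
apply: le_trans (le_normcD _ _) _; rewrite normcN.
apply: le_trans (lerD (le_normcD _ _) (lexx _)) _; rewrite !normcM.
have := fA z zr; have := gB z zr.
move: pe qe; rewrite !ler_pdivlMr ?ltr_wpDl ?addr_ge0 //.
have := normc_ge0 (f z - p.[z]); have := normc_ge0 (g z - q.[z]).
have := normc_ge0 (f z); have := normc_ge0 (g z).
move: p1 q1; move: (normc (f z - _)) (normc (g z - _)) (normc (f z)) (normc (g z)) => x y u v.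
move=> x1 y1 v0 u0 y0 x0 xe ye vB uA.
have h1 : x * v <= x * B by rewrite ler_wpM2l.
have h2 : u * y <= A * y by rewrite ler_wpM2r.
have h3 : x * y <= x by rewrite ler_piMr.
have E0 : (A + B + 1) * (x * B + A * y + x) <= (A + B + 1) * e.
  have a1 : x * (A + B + 1) * B <= e * B by rewrite ler_wpM2r.
  have a2 : y * (A + B + 1) * A <= e * A by rewrite ler_wpM2r.
  have -> : (A + B + 1) * (x * B + A * y + x) =
    x * (A + B + 1) * B + y * (A + B + 1) * A + x * (A + B + 1) by ring.
  have -> : (A + B + 1) * e = e * B + e * A + e by ring.
  by rewrite !lerD.
have AB : 0 < A + B + 1 by rewrite ltr_wpDl // addr_ge0.
rewrite (ler_pM2l AB) in E0; lra.
Qed.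

Lemma apx_prod rho (u : nat -> C -> C) n : (forall j, apx rho (u j)) ->
  apx rho (fun z => \prod_(j < n) u j z).
Proof.
move=> H; elim: n => [|n IH].
  by apply: apx_eq (apx_poly 1 rho) => z _; rewrite hornerC big_ord0.
by apply: apx_eq (apxM IH (H n)) => z _; rewrite big_ord_recr.
Qed.

Lemma apx_inv_linear rho l : 0 <= rho -> rho < normc l -> apx rho (fun z => (l - z)^-1).
Proof.
move=> r0 rl e e0; have l0 : 0 < normc l by apply: le_lt_trans rl.
have q0 : 0 <= rho / normc l by rewrite divr_ge0 // ltW.
have q1 : rho / normc l < 1 by rewrite ltr_pdivrMr // mul1r.
have d0 : 0 < normc l - rho by rewrite subr_gt0.
have : (fun n => (rho / normc l) ^+ n) @ \oo --> (0 : R) by apply: cvg_expr; rewrite ger0_norm.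
move/cvgrPdist_le => /(_ (e * (normc l - rho)) (mulr_gt0 e0 d0)) [n _ /(_ n (leqnn n))].
rewrite sub0r normrN ger0_norm ?exprn_ge0 // => Hn.
exists (\poly_(k < n) l^-1 ^+ k.+1) => z zr.
have lz : 0 < normc (l - z) by apply: lt_le_trans d0 _; have := ler_normcB l z; lra.
have lz0 : l - z != 0 by rewrite -normc_gt0.
have ln0 : l != 0 by rewrite -normc_gt0.
have E : (l - z)^-1 - (\poly_(k < n) l^-1 ^+ k.+1).[z] = (z / l) ^+ n / (l - z).
  apply: (mulIf lz0); rewrite mulrBl mulVf // divfK // horner_poly mulr_suml.
  elim: n {Hn} => [|n IH]; first by rewrite big_ord0 subr0 expr0.
  rewrite big_ord_recr /= opprD addrA IH !exprSr !exprMn.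
  by field.
rewrite E normcM normcV ler_pdivrMr // normcX normcM normcV.
apply: (@le_trans _ _ ((rho / normc l) ^+ n)).
  rewrite lerXn2r ?nnegrE ?divr_ge0 ?normc_ge0 //; last by rewrite ler_wpM2r // invr_ge0 ltW.
apply: le_trans Hn _; rewrite ler_wpM2l ?(ltW e0) //; have := ler_normcB l z; lra.
Qed.

(** A quantitative Liouville theorem. By Cauchy's estimate the nonconstant terms at the two points
    add up to at most 2 M (r / rho) ^ k for each k >= 1, and the ratio is at most 1/2. *)
Lemma apx_diff rho (r M : R) f z1 z2 : 0 <= r -> 0 < rho -> r * 2 <= rho -> apx rho f ->
  (forall z, normc z = rho -> normc (f z) <= M) -> normc z1 <= r -> normc z2 <= r ->
  normc (f z1 - f z2) <= 4 * M * (r / rho).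
Proof.
move=> r0 rho0 r2 Hf HM h1 h2; apply/ler_addgt0Pr => e e0.
have e4 : 0 < e / 4 by rewrite divr_gt0.
have [p Hp] := Hf _ e4.
have q0 : 0 <= r / rho by rewrite divr_ge0 // ltW.
have q2 : r / rho <= 2^-1 by rewrite ler_pdivrMr // mulrC ler_pdivlMr.
have Hc k : normc p`_k * rho ^+ k <= M + e / 4.
  apply: poly_coef_bound; first exact: ltW.
  move=> z zr; rewrite -[p.[z]](subKr (f z)); apply: le_trans (le_normcD _ _) _.
  by rewrite normcN; apply: lerD; [exact: HM|apply: Hp; rewrite zr].
have M0 : 0 <= M + e / 4.
  by apply: le_trans (Hc 0%N); rewrite mulr_ge0 ?normc_ge0 ?exprn_ge0 // ltW.
have coefr k (z : C) : normc z <= r -> normc (p`_k * z ^+ k) <= (M + e / 4) * (r / rho) ^+ k.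
  move=> zr; rewrite normcM normcX expr_div_n mulrA ler_pdivlMr ?exprn_gt0 // mulrAC.
  apply: ler_pM; rewrite ?exprn_ge0 ?normc_ge0 ?mulr_ge0 ?exprn_ge0 ?normc_ge0 ?(ltW rho0) //.
  by rewrite lerXn2r ?nnegrE ?normc_ge0.
have pd : normc (p.[z1] - p.[z2]) <= 4 * (M + e / 4) * (r / rho).
  rewrite !horner_coef; case: (size p) => [|n].
    by rewrite !big_ord0 subrr normc0; apply: mulr_ge0 => //; apply: mulr_ge0.
  rewrite !big_ord_recl !expr0 opprD addrACA subrr add0r -sumrB.
  apply: le_trans (normc_sum _ _ _) _.
  apply: (@le_trans _ _ (\sum_(k < n) 2 * (M + e / 4) * (r / rho) * (r / rho) ^+ k)).
    apply: ler_sum => k _; apply: le_trans (le_normcD _ _) _; rewrite normcN.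
    apply: le_trans (lerD (coefr _ z1 h1) (coefr _ z2 h2)) _.
    by rewrite /= /bump /= add1n exprS; rewrite le_eqVlt; apply/orP; left; apply/eqP; ring.
  apply: le_trans (sum_geo_le _ _ _) _; [by apply: mulr_ge0 => //; apply: mulr_ge0|by apply/andP|].
  by rewrite le_eqVlt; apply/orP; left; apply/eqP; ring.
have rr : r <= rho by lra.
have := Hp z1 (le_trans h1 rr); have := Hp z2 (le_trans h2 rr).
have -> : f z1 - f z2 = (f z1 - p.[z1]) + (p.[z1] - p.[z2]) - (f z2 - p.[z2]) by ring.
have t1 := le_normcD (f z1 - p.[z1] + (p.[z1] - p.[z2])) (- (f z2 - p.[z2])).
have t2 := le_normcD (f z1 - p.[z1]) (p.[z1] - p.[z2]).
rewrite normcN in t1; nra.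
Qed.

Definition ent f : Prop := forall rho, apx rho f.

Lemma ent_continuous f z : ent f -> (f w : R[i]^o) @[w --> (z : R[i]^o)] --> (f z : R[i]^o).
Proof.
move=> Hf; apply/cvgc_atP => e e0; have e3 : 0 < e / 3 by rewrite divr_gt0.
have [p Hp] := Hf (normc z + 1) _ e3.
have : root (p - p.[z]%:P) z by rewrite rootE hornerD hornerN hornerC subrr.
move=> /factor_theorem[q Hq]; have [B B0 HB] := poly_bounded q (normc z + 1).
exists (Num.min 1 (e / 3 / (B + 1))).
  by rewrite lt_min ltr01 divr_gt0 // ltr_wpDl.
move=> w; rewrite lt_min => /andP[w1 wB].
have wz : normc w <= normc z + 1 by rewrite -[w](subrK z); apply: le_trans (le_normcD _ _) _; lra.
have zz : normc z <= normc z + 1 by rewrite lerDl.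
have E : p.[w] - p.[z] = q.[w] * (w - z).
  by have := congr1 (horner^~ w) Hq; rewrite hornerD hornerN hornerC hornerM hornerXsubC.
have h1 := Hp w wz; have h2 := Hp z zz.
have h3 : normc (p.[w] - p.[z]) < e / 3.
  rewrite E normcM; move: wB; rewrite ltr_pdivlMr ?ltr_wpDl // => wB.
  apply: le_lt_trans wB; rewrite mulrC; apply: ler_wpM2l; rewrite ?normc_ge0 //.
  by have := HB w wz; lra.
have -> : f w - f z = (f w - p.[w]) + (p.[w] - p.[z]) - (f z - p.[z]) by ring.
have t1 := le_normcD (f w - p.[w] + (p.[w] - p.[z])) (- (f z - p.[z])).
have t2 := le_normcD (f w - p.[w]) (p.[w] - p.[z]).
rewrite normcN in t1; lra.
Qed.

Arguments ent_continuous : clear implicits.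

(** In place of the maximum principle: Cauchy's estimates on the circle of radius 2 sum to a
    geometric series on the unit disc, at the price of a factor 2. *)
Lemma poly_disc_bound p l (E : R) : (forall w, normc w = 2 -> normc p.[l + w] <= E) ->
  forall w, normc w <= 1 -> normc p.[l + w] <= 2 * E.
Proof.
move=> Hp w w1; pose q := p \Po ('X + l%:P).
have qE v : q.[v] = p.[l + v] by rewrite horner_comp hornerD hornerX hornerC addrC.
have Hc k : normc q`_k * 2 ^+ k <= E.
  by apply: poly_coef_bound => // v v2; rewrite qE Hp.
have E0 : 0 <= E by apply: le_trans (Hc 0%N); rewrite mulr_ge0 ?normc_ge0 ?exprn_ge0.
rewrite -qE horner_coef; apply: le_trans (normc_sum _ _ _) _.
apply: (@le_trans _ _ (\sum_(k < size q) E * 2^-1 ^+ k)).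
  apply: ler_sum => k _; rewrite normcM normcX exprVn ler_pdivlMr ?exprn_gt0 //.
  apply: le_trans (Hc k); rewrite -mulrA ler_wpM2l ?normc_ge0 // ler_piMl ?exprn_ge0 //.
  by rewrite exprn_ile1 ?normc_ge0.
by apply: sum_geo_le => //; apply/andP; split; lra.
Qed.

(** The approximating polynomials, corrected to vanish at [l], are divided by z - l. The quotients
    are uniformly Cauchy: at distance more than 1 from [l] by division, near [l] by
    [poly_disc_bound]. Their limit at [l] is the missing value of the quotient. *)
Lemma ent_div f l : ent f -> f l = 0 -> exists2 g, ent g & forall z, f z = (z - l) * g z.
Proof.
move=> Hf fl0; pose e n : R := 2^-1 ^+ n; have e0 n : 0 < e n by rewrite exprn_gt0 // invr_gt0.
have eS m n : (m < n)%N -> e n <= e m / 2.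
  move=> mn; rewrite /e -[in leLHS](subnKC mn) exprD exprSr ler_piMr ?mulr_ge0 ?exprn_ge0 //.
  by rewrite exprn_ile1 // invf_le1 // ler1n.
have emono m n : (m <= n)%N -> e n <= e m.
  by rewrite leq_eqVlt => /predU1P[->//|/eS]; have := e0 m; lra.
pose rho n : R := n%:R + normc l + 2.
have /choice[p Hp] n : exists p : {poly C}, forall z, normc z <= rho n -> normc (f z - p.[z]) <= e n.
  exact: (Hf (rho n)).
have pr n : root (p n - (p n).[l]%:P) l by rewrite rootE hornerD hornerN hornerC subrr.
have /choice[q Hq] n : exists q : {poly C}, p n - (p n).[l]%:P = q * ('X - l%:P).
  by have /factor_theorem[q] := pr n; exists q.
have qE n z : (q n).[z] * (z - l) = (p n).[z] - (p n).[l].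
  by have := congr1 (horner^~ z) (Hq n); rewrite hornerD hornerN hornerC hornerM hornerXsubC.
have lr n : normc l <= rho n by rewrite /rho; have := ler0n R n; lra.
have fq n z : normc z <= rho n -> normc (f z - (q n).[z] * (z - l)) <= 2 * e n.
  move=> zr; rewrite qE; have h1 := Hp n z zr; have := Hp n l (lr n); rewrite fl0 sub0r normcN => h2.
  have -> : f z - ((p n).[z] - (p n).[l]) = (f z - (p n).[z]) + (p n).[l] by ring.
  by apply: le_trans (le_normcD _ _) _; lra.
have qq m n z : (m <= n)%N -> normc z <= rho m -> normc ((q n).[z] - (q m).[z]) <= 6 * e m.
  move=> mn zr; have em := emono _ _ mn; have e0m := e0 m.
  have key v : normc v <= rho m -> normc ((q n).[v] - (q m).[v]) * normc (v - l) <= 4 * e m.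
    move=> vr; rewrite -normcM.
    have vr' : normc v <= rho n by apply: le_trans vr _; rewrite /rho !lerD2r ler_nat.
    have -> : ((q n).[v] - (q m).[v]) * (v - l) =
      (f v - (q m).[v] * (v - l)) - (f v - (q n).[v] * (v - l)) by ring.
    apply: le_trans (le_normcD _ _) _; rewrite normcN.
    by have := fq m v vr; have := fq n v vr'; lra.
  have [z1|z1] := leP (normc (z - l)) 1; last first.
    have := key z zr; have := normc_ge0 ((q n).[z] - (q m).[z]); nra.
  have := @poly_disc_bound (q n - q m) l (2 * e m) _ (z - l) z1.
  rewrite [l + _]addrC subrK hornerD hornerN => H; apply: le_trans (H _) _; last by lra.
  move=> w w2; rewrite hornerD hornerN.
  have lw : normc (l + w) <= rho m.
    apply: le_trans (le_normcD _ _) _; rewrite w2 /rho; have := ler0n R m; lra.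
  by have := key _ lw; rewrite addrAC subrr add0r w2; lra.
(* Because e n <= e m / 2 for m < n, the increment 6 e m is dominated by that of the nondecreasing
   sequence - 16 e n. *)
have cauchy : forall m n, (m <= n)%N -> normc ((q n).[l] - (q m).[l]) <= (- (16 * e n)) - (- (16 * e m)).
  move=> m n; rewrite leq_eqVlt => /predU1P[->|mn]; first by rewrite !subrr normc0.
  by have := qq m n l (ltnW mn) (lr m); have := eS _ _ mn; have := e0 m; lra.
have [|L HL] := dominated_cvgc (B := 0) cauchy.
  by move=> n; have := e0 n; lra.
pose g z := if z == l then L else f z / (z - l).
have qg z : ((q n).[z] : R[i]^o) @[n --> \oo] --> (g z : R[i]^o).
  rewrite /g; have [->//|zl] := eqVneq z l.
  have zl0 : 0 < normc (z - l) by rewrite normc_gt0 subr_eq0.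
  apply: (@cvgc_squeeze _ _ _ _ _ _ (fun n => (2 / normc (z - l)) * e n)).
    near=> n; have zr : normc z <= rho n.
      apply: le_trans (_ : n%:R <= _); last by rewrite /rho; have := normc_ge0 l; lra.
      by near: n; exact: nbhs_infty_ger.
    have -> : (q n).[z] - f z / (z - l) = - ((f z - (q n).[z] * (z - l)) / (z - l)).
      by field; rewrite subr_eq0.
    rewrite normcN normcM normcV mulrAC ler_wpM2r ?invr_ge0 ?(ltW zl0) //; exact: fq.
  rewrite -[X in _ --> X](mulr0 (2 / normc (z - l))); apply: cvgM; first exact: cvg_cst.
  by apply: cvg_expr; rewrite ger0_norm // invf_lt1 // ltr1n.
exists g => [r d d0|z].
  have [n nr nd] : exists2 n : nat, r <= n%:R & 6 * e n <= d.
    have : (fun n => e n) @ \oo --> (0 : R).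
      by apply: cvg_expr; rewrite ger0_norm // invf_lt1 // ltr1n.
    move/cvgrPdist_le => /(_ (d / 6) ltac:(by rewrite divr_gt0)) [n1 _ Hn1].
    pose n2 := (Num.truncn `|r|).+1; exists (maxn n1 n2).
      apply: le_trans (ler_norm r) _; apply: (@le_trans _ _ n2%:R).
        by apply/ltW; exact: truncnS_gt.
      by rewrite ler_nat leq_maxr.
    have := Hn1 (maxn n1 n2) (leq_maxl _ _); rewrite sub0r normrN ger0_norm ?(ltW (e0 _)) //.
    by rewrite ler_pdivlMr // mulrC.
  exists (q n) => z zr.
  apply: le_trans nd; apply: (normc_cvg_le _ (cvgcB (qg z) (cvgc_cst (q n).[z]))).
  near=> m; apply: qq; first by near: m; exact: nbhs_infty_ge.
  by apply: le_trans zr _; rewrite /rho; have := normc_ge0 l; lra.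
rewrite /g; have [->|zl] := eqVneq z l; first by rewrite subrr mul0r.
by rewrite mulrC divfK // subr_eq0.
Unshelve. all: by end_near.
Qed.

(** A zero of order at least m, expressed by growth so that it passes to quotients by linear
    factors. *)
Definition vanish f l (m : nat) : Prop := exists K d : R, 0 < d /\
  forall w, w != l -> normc (w - l) < d -> normc (f w) <= K * normc (w - l) ^+ m.

Lemma vanish_eq0 f l m : ent f -> vanish f l m.+1 -> f l = 0.
Proof.
move=> Hf [K [d [d0 HK]]]; apply: (@punctured_unique R f l) => e e0.
  have /cvgc_atP H := ent_continuous f l Hf; have [r r0 Hr] := H e e0.
  by exists r => // w _ /Hr /ltW.
exists (Num.min (Num.min 1 d) (e / (`|K| + 1))).
  by rewrite !lt_min ltr01 d0 divr_gt0 // ltr_wpDl.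
move=> w wl; rewrite !lt_min -andbA => /and3P[w1 wd]; rewrite ltr_pdivlMr ?ltr_wpDl // => we.
rewrite subr0; apply: le_trans (HK w wl wd) _; have n0 := normc_ge0 (w - l).
have x1 : normc (w - l) ^+ m <= 1 by rewrite exprn_ile1 // ltW.
have x0 : 0 <= normc (w - l) ^+ m by rewrite exprn_ge0.
apply: le_trans (ler_wpM2r (exprn_ge0 _ n0) (ler_norm K)) _.
rewrite exprS mulrCA; apply: le_trans (ltW we); rewrite ler_wpM2l //.
by have := normr_ge0 K; nra.
Qed.

(** Dividing by the factor of a listed point lowers the order there by one, and near any other point
    that factor is bounded away from 0. *)
Lemma ent_div_list (s : seq C) f : ent f -> (forall l, vanish f l (count_mem l s)) ->
  exists2 g, ent g & forall z, f z = \prod_(l <- s) (z - l) * g z.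
Proof.
elim: s f => [|a s IH] f Hf Hv; first by exists f => // z; rewrite big_nil mul1r.
have fa0 : f a = 0.
  by have := Hv a; rewrite /= eqxx add1n; exact: vanish_eq0.
have [g Hg fg] := ent_div Hf fa0.
have [|h Hh gh] := IH g Hg; last first.
  by exists h => // z; rewrite fg gh big_cons mulrA.
move=> l; have [K [d [d0 HK]]] := Hv l; have [al|al] := eqVneq a l.
  subst a; exists K, d; split=> // w wl wd; have := HK w wl wd.
  rewrite /= eqxx add1n fg normcM exprS mulrCA ler_pM2l //.
  by rewrite normc_gt0 subr_eq0.
have la : 0 < normc (l - a) by rewrite normc_gt0 subr_eq0 eq_sym.
exists (K * (2 / normc (l - a))), (Num.min d (normc (l - a) / 2)); split.
  by rewrite lt_min d0 divr_gt0.
move=> w wl; rewrite lt_min => /andP[wd wa]; have := HK w wl wd.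
rewrite /= (negbTE al) add0n fg normcM => H.
have wa2 : normc (l - a) / 2 <= normc (w - a).
  have := le_normcD (w - a) (l - w); rewrite addrC addrA subrK normcB => h.
  by have := normcB l w; lra.
rewrite mulrAC -ler_pdivrMr ?divr_gt0 // invf_div; apply: le_trans H.
by rewrite mulrC ler_wpM2r ?normc_ge0.
Qed.

Lemma taylor_family_ent (D : nat -> C -> C) : taylor_family D -> ent (D 0).
Proof.
move=> HD rho e e0; have [B HB] := HD 0 0.
have [n0 Hn0] := fact_small (pi * `|rho|) (e := e / (`|B| * expR (pi * `|rho|) + 1))
  ltac:(by rewrite divr_gt0 // ltr_wpDl // mulr_ge0 ?expR_ge0).
exists (\poly_(j < n0) (D j 0 / j`!%:R)) => z zr; rewrite horner_poly.
have := HB n0 z; rewrite addr0 => /le_trans; apply.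
have := Hn0 n0 (leqnn _); rewrite ler_pdivlMr ?ltr_wpDl ?mulr_ge0 ?expR_ge0 //.
apply: le_trans; have pi0 := pi_ge0 R.
have zr' : pi * normc z <= pi * `|rho| by rewrite ler_wpM2l // (le_trans zr) // ler_norm.
have z0 : 0 <= pi * normc z by rewrite mulr_ge0 ?normc_ge0.
have f0 : (0 : R) < n0`!%:R by rewrite ltr0n fact_gt0.
apply: (@le_trans _ _ (`|B| * ((pi * `|rho|) ^+ n0 / n0`!%:R * expR (pi * `|rho|)))).
  apply: le_trans (ler_wpM2r _ (ler_norm B)) _.
    by rewrite mulr_ge0 ?expR_ge0 // divr_ge0 ?exprn_ge0.
  rewrite ler_wpM2l //; apply: ler_pM; rewrite ?expR_ge0 ?divr_ge0 ?exprn_ge0 ?ler_expR //.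
  by apply: ler_wpM2r; [rewrite invr_ge0 ltW|apply: lerXn2r; rewrite ?nnegrE // (le_trans z0)].
rewrite mulrCA mulrDr mulr1 lerDl divr_ge0 ?exprn_ge0 ?mulr_ge0 //.
Qed.

End PolynomialApproximation.
Arguments ent_continuous {R} f z _.

(** * Lower bounds for the sine *)

Section HadamardUniqueness.
Context {R : realType}.
Local Notation C := R[i].
Local Notation mu := (@lebesgue_measure R).
Implicit Types (z w l : C).

Lemma normc_csin_ge_sin (u v : R) : `|sin u| <= normc (csin (u%:C + 'i * v%:C)).
Proof.
apply: le_trans (le_Re_normc _).
have -> : complex.Re (csin (u%:C + 'i * v%:C)) = sin u * ((expR v + expR (- v)) / 2).
  have i0 : 'i != 0 :> C by rewrite neq0Ci.
  have E1 : cexp ('i * (u%:C + 'i * v%:C)) = (expR (- v))%:C * (cos u +i* sin u).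
    have -> : 'i * (u%:C + 'i * v%:C) = 'i * u%:C + (- v)%:C :> C.
      by rewrite mulrDr mulrA -expr2 sqrCi mulN1r rmorphN.
    by rewrite cexpD cexp_i mulrC /cexp /= cos0 sin0 mulr1.
  have E2 : cexp (- ('i * (u%:C + 'i * v%:C))) = (expR v)%:C * (cos u +i* - sin u).
    have -> : - ('i * (u%:C + 'i * v%:C)) = - ('i * u%:C) + v%:C :> C.
      by rewrite mulrDr mulrA -expr2 sqrCi mulN1r opprD opprK.
    by rewrite cexpD cexp_iN mulrC /cexp /= cos0 sin0 mulr1.
  rewrite /csin E1 E2.
  have -> : (2 * 'i : C)^-1 = 0 +i* - 2^-1.
    apply: (mulfI (mulf_neq0 (_ : 2 != 0 :> C) i0)); rewrite ?pnatr_eq0 // divff ?mulf_neq0 ?pnatr_eq0 //.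
    by rewrite -complexiE; apply/eqP; rewrite eq_complex /=; apply/andP; split; apply/eqP; field.
  by rewrite ReM /=; field.
rewrite normrM ler_peMr // ger0_norm; last by rewrite divr_ge0 // addr_ge0 ?expR_ge0.
rewrite ler_pdivlMr // mul1r; have e0 := expR_gt0 v.
rewrite expRN; have : 0 <= (expR v - 1) ^+ 2 / expR v by rewrite divr_ge0 ?sqr_ge0 // ltW.
have -> : (expR v - 1) ^+ 2 / expR v = expR v + (expR v)^-1 - 2 by field; rewrite gt_eqF.
lra.
Qed.

Lemma normc_csin_ge_exp z : (expR `|complex.Im z| - expR (- `|complex.Im z|)) / 2 <= normc (csin z).
Proof.
have n2 : normc (2 * 'i : C) = 2 by rewrite normcM normc_i mulr1 (normc_nat 2).
have n20 : 0 < normc (2 * 'i : C) by rewrite n2.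
rewrite ler_pdivrMr // -n2 mulrC -normcM csinE.
have h1 : normc (cexp ('i * z)) = expR (- complex.Im z).
  by rewrite normc_cexp; congr expR; case: (z) => a b /=; ring.
have h2 : normc (cexp (- ('i * z))) = expR (complex.Im z).
  by rewrite normc_cexp; congr expR; case: (z) => a b /=; ring.
have k1 := ler_normcB (cexp ('i * z)) (cexp (- ('i * z))).
have k2 := ler_normcB (cexp (- ('i * z))) (cexp ('i * z)).
rewrite [normc (_ - cexp ('i * z))]normcB in k2; rewrite h1 h2 in k1 k2.
have [y0|y0] := leP 0 (complex.Im z); first by rewrite ger0_norm.
by rewrite ltr0_norm // opprK.
Qed.

(** An integer shift changes exp (i pi z) at most by a sign, as its square has period 1; the sign
    leaves the modulus unchanged. *)
Lemma csinDint z (n : int) : normc (csin ((z - n%:~R) * pi%:C)) = normc (csin (z * pi%:C)).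
Proof.
have H (s : bool) : cexp ('i * (z - n%:~R) * pi%:C) ^+ 2 = cexp ('i * z * pi%:C) ^+ 2.
  rewrite -!cexpMn.
  have -> : 2%:R * ('i * (z - n%:~R) * pi%:C) = 2%:R * ('i * z * pi%:C) - pi%:C * (2 * 'i * n%:~R) :> C by ring.
  by rewrite [cexp (_ - _)]cexpD [cexp (- (pi%:C * _))]cexpN cexp_2pi_int invr1 mulr1.
have /eqP := H true; rewrite eqf_sqr => /orP[]/eqP E; rewrite /csin !mulrA !cexpN !E //.
by rewrite invrN -opprD mulNr normcN.
Qed.

(** Away from the real axis one exponential dominates. Otherwise exp (2 v) < 2 forces |Im z| <= 1/4,
    so Re z is at least 2/5 away from the nearest integer and the real sine is bounded below by
    [sin_ge_half]. *)
Lemma csin_lower z : (forall m : int, 2^-1 <= normc (m%:~R - z)) ->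
  expR (pi * `|complex.Im z|) / 4 <= normc (csin (z * pi%:C)).
Proof.
move=> Hz; have pi0 := pi_gt0 R; pose v := pi * `|complex.Im z|.
have v0 : 0 <= v by rewrite mulr_ge0 // ltW.
have [E2|E2] := leP 2 (expR v ^+ 2).
  have := normc_csin_ge_exp (z * pi%:C).
  have -> : complex.Im (z * pi%:C) = complex.Im z * pi by case: (z) => a b /=; ring.
  rewrite normrM (gtr0_norm pi0) [_ * pi]mulrC -/v; apply: le_trans.
  have e0 := expR_gt0 v; rewrite expRN.
  have h : (expR v)^-1 <= expR v / 2.
    have i0 : 0 <= (expR v)^-1 by rewrite invr_ge0 ltW.
    by have := ler_wpM2r i0 E2; rewrite expr2 mulfK ?gt_eqF // => h; lra.
  by rewrite -/v; lra.
have vs : v < 2^-1.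
  have : 1 + v *+ 2 <= expR v ^+ 2 by rewrite -expRM_natl; apply: le_trans (expR_ge1Dx _); rewrite -mulr_natl.
  by lra.
pose n := Num.floor (complex.Re z + 2^-1).
have /andP[n1 n2] := floor_itv (complex.Re z + 2^-1); rewrite -/n intrD in n1 n2.
pose u : R := complex.Re z - n%:~R; have u1 : `|u| <= 2^-1 by rewrite ler_norml /u; apply/andP; split; lra.
have zE : (z - n%:~R) * pi%:C = (u * pi)%:C + 'i * (complex.Im z * pi)%:C.
  rewrite -complexiE -(rmorph_int (real_complex R)); rewrite /u; move: n%:~R => k; case: (z) => a b /=.
  by apply/eqP; rewrite eq_complex /=; apply/andP; split; apply/eqP; ring.
have y3 : `|complex.Im z| <= 4^-1.
  have : v < pi * 4^-1 by have := pi_ge2 R; lra.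
  by rewrite /v ltr_pM2l // => /ltW.
have u4 : 2 / 5 <= `|u|.
  have := Hz n; rewrite -(ler_sqr (_ : 2^-1 \is Num.nneg)) ?nnegrE ?normc_ge0 // normcB normc_sqr.
  have -> : complex.Re (z - n%:~R) = u by rewrite ReD ReN -(rmorph_int (real_complex R)).
  have -> : complex.Im (z - n%:~R) = complex.Im z.
    by rewrite ImD ImN -(rmorph_int (real_complex R)) /= oppr0 addr0.
  rewrite -(real_normK (num_real u)) -(real_normK (num_real (complex.Im z))).
  have := normr_ge0 u; have := normr_ge0 (complex.Im z).
  move: (`|complex.Im z|) (`|u|) y3 => y w y3 y0 w0 H.
  rewrite leNgt; apply/negP => w25; nra.
rewrite -(csinDint z n) zE; apply: le_trans (normc_csin_ge_sin _ _).
have -> : `|sin (u * pi)| = sin (`|u| * pi).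
  case: (leP 0 u) => u0.
    by rewrite !ger0_norm // sin_ge0_pi // mulr_ge0 ?(ltW pi0) //=; move: u1; rewrite ger0_norm //; nra.
  rewrite (ltr0_norm u0) mulNr sinN ler0_norm // -oppr_ge0 -sinN -mulNr.
  apply: sin_ge0_pi; move: u1; rewrite ltr0_norm // => u1; apply/andP; split; nra.
have h : `|u| * pi / 2 <= sin (`|u| * pi).
  by apply: sin_ge_half; [rewrite mulr_ge0 // ltW|nra].
have E3 : expR v <= 3 / 2 by rewrite leNgt; apply/negP => h3; have := expR_gt0 v; nra.
have up : 2 / 5 * 2 <= `|u| * pi by apply: ler_pM => //; exact: pi_ge2.
by apply: le_trans h; rewrite -/v; lra.
Qed.

Lemma card_uniq_le (X : set int) (t : seq int) m : (X #= `I_m)%card -> uniq t ->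
  (forall n, n \in t -> X n) -> (size t <= m)%N.
Proof.
move=> /card_set_bijP[f [ff fi _]] ut tX; rewrite -(size_iota 0 m) -(size_map f).
apply: uniq_leq_size.
  by rewrite map_inj_in_uniq // => x y /tX Xx /tX Xy; apply: fi; exact: mem_set.
by move=> _ /mapP[x /tX Xx ->]; rewrite mem_iota; apply: ff.
Qed.

(** * Uniqueness: a characteristic function equals the canonical product of its zeros *)

Section Setup.
Variables (kap lam : int -> C) (A : R).
Hypothesis HA : forall n, \sum_(j < n) normc (kap (zn j)) ^+ 2 <= A.
Hypothesis lamE : forall n, lam n = n%:~R + kap n.

Lemma tail_prod_near1 rho : exists M0 : nat, forall M z, (M0 <= M)%N -> normc z <= rho ->
  normc (tail_prod lam M z - 1) <= 2^-1 /\
  forall n, normc (\prod_(j < n) (1 + pair_dev lam (M + j) z) - 1) <= 2^-1.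
Proof.
have Wnd : {homo (fun n => \sum_(j < n) pair_bound kap A rho j) : m n / (m <= n)%N >-> m <= n}.
  move=> m n mn; rewrite -[n in leRHS](subnKC mn) big_split_ord /= lerDl.
  by apply: sumr_ge0 => j _; apply: pair_bound_ge0.
have q4 : (0 : R) < 4^-1 by [].
have [M0 HM] := ndbounded_tail Wnd (sum_pair_bound HA rho) q4.
have e4 : expR (4^-1) - 1 <= 2^-1 :> R.
  have := expR_ge1Dx (- 4^-1 : R); rewrite expRN; have := expR_gt0 (4^-1 : R).
  move: (expR _) => x x0 H; have := ler_wpM2l (ltW x0) H; rewrite (mulfV (lt0r_neq0 x0)).
  lra.
exists M0 => M z MM zr.
have fin n : normc (\prod_(j < n) (1 + pair_dev lam (M + j) z) - 1) <= 2^-1.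
  apply: le_trans (prod_near1 (u := fun j => pair_dev lam (M + j) z) (B := 4^-1) _) e4.
  apply: (@le_trans _ _ (\sum_(j < n) pair_bound kap A rho (M + j)%N)).
    by apply: ler_sum => j _; apply: pair_dev_bound.
  by have := HM (M + n)%N; rewrite big_split_ord /=; have := Wnd _ _ MM; lra.
split=> //; apply: (normc_cvg_le _ (cvgcB (tail_prod_cvg HA lamE M z) (cvgc_cst 1))).
exact: nearW.
Qed.

Lemma near1_lb (x : C) : normc (x - 1) <= 2^-1 -> 2^-1 <= normc x.
Proof. by move=> h; have := ler_normcB 1 (1 - x); rewrite subKr normcB normc1; lra. Qed.

Lemma lam_large n (rho : R) : rho + 1 + A < `|n|%:R -> rho < normc (lam n).
Proof.
move=> h; rewrite lamE; have := ler_normcB n%:~R (- kap n); rewrite normcN opprK normc_int.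
have := kap_bound HA n; rewrite -[`|n|%:~R]/(`|n|%:R) => h1 h2; lra.
Qed.

(** For large M all zeros of the tail lie outside the disc. Its reciprocal is the uniform limit of
    products of reciprocals of linear factors, and those are sums of geometric series on the
    disc. *)
Lemma apx_inv_tail rho : 0 <= rho -> exists M0 : nat, forall M, (M0 <= M)%N ->
  (forall z, normc z <= rho -> tail_prod lam M z != 0) /\
  apx rho (fun z => (tail_prod lam M z)^-1).
Proof.
move=> r0; have [M1 H1] := tail_prod_near1 rho.
pose M2 := (Num.truncn `|rho + 1 + A|).+1; exists (maxn M1 M2) => M; rewrite geq_max => /andP[MM1 MM2].
have lb z : normc z <= rho -> 2^-1 <= normc (tail_prod lam M z).
  by move=> zr; apply: near1_lb; case: (H1 M z MM1 zr).
split=> [z zr|]; first by rewrite -normc_gt0; apply: lt_le_trans (lb z zr).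
apply: apx_lim => e e0; have e4 : 0 < e / 4 by rewrite divr_gt0.
have [m Hm] := tail_prod_near HA lamE M rho e4.
exists (fun z => \prod_(j < m) (1 + pair_dev lam (M + j) z)^-1).
  apply: (apx_prod (u := fun j z => (1 + pair_dev lam (M + j) z)^-1)) => j.
  pose a := lam (M + j).+1%:Z; pose b := lam (- (M + j).+1%:Z).
  have big : rho + 1 + A < (M + j).+1%:R.
    apply: le_lt_trans (ler_norm _) _; apply: lt_le_trans (truncnS_gt _) _.
    by rewrite ler_nat; apply: leq_trans MM2 _; apply: leqW; exact: leq_addr.
  have Ha : apx rho (fun z => (a - z)^-1) by apply: apx_inv_linear => //; apply: lam_large; rewrite absz_nat.
  have Hb : apx rho (fun z => (b - z)^-1) by apply: apx_inv_linear => //; apply: lam_large; rewrite abszN absz_nat.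
  apply: apx_eq (apxM (apx_poly (- ((M + j).+1%:R ^+ 2))%:P rho) (apxM Ha Hb)) => z zr.
  by rewrite hornerC /pair_dev -/a -/b [1 + _]addrC subrK invfM invrK invfM mulrC.
move=> z zr; have t2 := lb z zr; have [_ /(_ m)/near1_lb p2] := H1 M z MM1 zr.
rewrite prodfV; have := Hm z zr; move: t2 p2.
move: (tail_prod _ _ _) (\prod_(_ < _) _) => x y x2 y2 xy.
have x0 : 0 < normc x by apply: lt_le_trans x2.
have y0 : 0 < normc y by apply: lt_le_trans y2.
have xn : x != 0 by rewrite -normc_gt0.
have yn : y != 0 by rewrite -normc_gt0.
have -> : x^-1 - y^-1 = (y - x) / (x * y) by field; rewrite xn yn.
rewrite normcM normcV normcM ler_pdivrMr ?mulr_gt0 // normcB; apply: le_trans xy _.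
have : 4^-1 <= normc x * normc y by rewrite (_ : 4^-1 = 2^-1 * 2^-1) ?ler_pM //; field.
nra.
Qed.

Lemma Delta11_factor_neq0 M : - pi%:C * \prod_(j < M) (- (j.+1%:R ^+ 2))^-1 != 0 :> C.
Proof.
rewrite mulf_neq0 ?oppr_eq0 //; first by rewrite -normc_gt0 normcR gtr0_norm ?pi_gt0.
by apply/prodf_neq0 => j _; rewrite invr_eq0 oppr_eq0 expf_eq0 /= pnatr_eq0.
Qed.

Lemma Delta11_factor M z : Delta11 lam z = - pi%:C * \prod_(j < M) (- (j.+1%:R ^+ 2))^-1 *
  (\prod_(j <- iota 0 M.*2.+1) (z - lam (zn j)) * tail_prod lam M z).
Proof.
rewrite (Delta11E HA lamE) (tail_prodS HA lamE M).
have -> : \prod_(j <- iota 0 M.*2.+1) (z - lam (zn j)) =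
    (z - lam 0) * \prod_(j < M) ((lam j.+1%:Z - z) * (lam (- j.+1%:Z) - z)).
  rewrite -[iota 0 _]/(index_iota 0 M.*2.+1) big_mkord (big_zn _ (fun n => z - lam n)) /=; congr (_ * _).
  rewrite big_add1 big_mkord; apply: eq_bigr => j _; ring.
have -> : \prod_(j < M) (1 + pair_dev lam j z) =
    \prod_(j < M) ((lam j.+1%:Z - z) * (lam (- j.+1%:Z) - z)) * \prod_(j < M) (- (j.+1%:R ^+ 2))^-1.
  by rewrite -big_split; apply: eq_bigr => j _; rewrite /pair_dev [1 + _]addrC subrK.
by ring.
Qed.

(** [D] stands for a characteristic function with its derivatives. As r < pi, at distance 1/2 from
    the integers the transform of [W] is smaller than the sine by a factor of order exp ((r - pi)
    |Im z|). *)
Variables (D : nat -> C -> C) (W : R -> C) (r : R).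
Hypothesis HD : taylor_family D.
Hypothesis LW : cL1 mu W.
Hypothesis bW : band W r.
Hypothesis rpi : r < pi.
Hypothesis DE : forall z, D 0 z = - csin (z * pi%:C) + FT W z.
Hypothesis Dz : forall z, exists m : nat,
  ((forall k, (k < m)%N -> D k z = 0) /\ D m z != 0) /\ ([set n : int | lam n = z] #= `I_m)%card.

Lemma vanish_count M l :
  vanish (D 0) l (count_mem l [seq lam (zn j) | j <- iota 0 M]).
Proof.
have [m [[Dm _] Xm]] := Dz l; have [K K0 HK] := taylor_family_bound HD Dm.
exists K, 1; split=> // w wl w1; have [H _] := HK w (ltW w1).
apply: le_trans H _; rewrite ler_wpM2l //; apply: ler_wiXn2l; rewrite ?normc_ge0 ?(ltW w1) //.
rewrite count_map -size_filter -(size_map zn); apply: (card_uniq_le Xm).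
  by rewrite map_inj_uniq ?filter_uniq ?iota_uniq //; exact: zn_inj.
by move=> n /mapP[j]; rewrite mem_filter /= => /andP[/eqP h _] ->.
Qed.

(** On the disc the zeros of the canonical product belong to a finite polynomial, which divides
    [D 0] because the multiplicities match; the remaining tail is invertible there. *)
Lemma quotient_apx rho : 0 <= rho -> exists2 h : C -> C, apx rho h &
  forall z, normc z <= rho -> D 0 z = Delta11 lam z * h z.
Proof.
move=> r0; have [M HM] := apx_inv_tail r0; have [tn Ht] := HM M (leqnn M).
pose s := [seq lam (zn j) | j <- iota 0 M.*2.+1].
have [g Hg Dg] := ent_div_list (taylor_family_ent HD) (vanish_count M.*2.+1).
pose c : C := - pi%:C * \prod_(j < M) (- (j.+1%:R ^+ 2))^-1.
have c0 : c != 0 by exact: Delta11_factor_neq0.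
exists (fun z => c^-1 * g z * (tail_prod lam M z)^-1).
  apply: apxM Ht; apply: apx_eq (apxM (apx_poly (c^-1)%:P rho) (Hg rho)) => z _.
  by rewrite hornerC.
move=> z zr; rewrite Dg (Delta11_factor M) big_map.
move: (\prod_(_ <- _) _) (tn z zr) c0 => P t0 c0; rewrite -/c; field.
by rewrite t0.
Qed.

Lemma Delta11_near_sin (e : R) : 0 < e -> exists N0 : R, forall z, N0 <= normc z ->
  (forall m : int, 2^-1 <= normc (m%:~R - z)) ->
  exists2 P : C, Delta11 lam z = - csin (z * pi%:C) * P & normc (P - 1) <= e.
Proof.
move=> e0; pose d := e / (1 + e).
have d0 : 0 < d by rewrite divr_gt0 // addr_gt0.
have [N0 H] := sum_kap_small HA d0; exists N0 => z zN zZ.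
have nz (n : int) : n%:~R != z.
  by rewrite -subr_eq0 -normc_gt0; apply: lt_le_trans (zZ n).
pose u j := kap (zn j) / ((zn j)%:~R - z).
have [P HP] := @prod_cvgc R u d (H z zN zZ).
exists P; first exact: (Delta11_sin HA lamE nz HP).
apply: (normc_cvg_le _ (cvgcB HP (cvgc_cst 1))); apply: nearW => n.
apply: le_trans (prod_near1 (u := u) (H z zN zZ n)) _.
have : expR (- d) >= 1 - d by rewrite expR_ge1Dx.
have d1 : 1 - d = (1 + e)^-1 by rewrite /d; field; rewrite gt_eqF // addr_gt0.
rewrite d1 expRN lef_pV2 ?posrE ?expR_gt0 ?addr_gt0 //; lra.
Qed.

(** Points where the product does not vanish are compared first, by [apx_diff] on large circles; the
    constant quotient is then evaluated on the imaginary axis, and the zeros of the product are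
    treated last. *)
Theorem Delta11_unique z : D 0 z = Delta11 lam z.
Proof.
have [K K0 sinE] : exists2 K : R, 0 <= K & forall w, (forall m : int, 2^-1 <= normc (m%:~R - w)) ->
    normc (FT W w) <= 4 * K * expR ((r - pi) * `|complex.Im w|) * normc (csin (w * pi%:C)).
  exists (nI mu W) => [|w Hw]; first exact: nI_ge0.
  apply: le_trans (FT_bound _ LW bW) _; move: (nI mu W) (nI_ge0 mu W) => K K0.
  have h := csin_lower Hw; rewrite mulrBl expRD expRN.
  have e0 := expR_gt0 (pi * `|complex.Im w|).
  have -> : 4 * K * (expR (r * `|complex.Im w|) / expR (pi * `|complex.Im w|)) * normc (csin (w * pi%:C)) =
     K * expR (r * `|complex.Im w|) * (4 * normc (csin (w * pi%:C)) / expR (pi * `|complex.Im w|)) by ring.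
  by rewrite ler_peMr ?mulr_ge0 ?expR_ge0 // ler_pdivlMr // mul1r; lra.
have e1 w : expR ((r - pi) * `|complex.Im w|) <= 1.
  by rewrite -expR0 ler_expR mulr_le0_ge0 // subr_le0 ltW.
have csin_gt w : (forall m : int, 2^-1 <= normc (m%:~R - w)) -> 0 < normc (csin (w * pi%:C)).
  by move=> Hw; apply: lt_le_trans (csin_lower Hw); rewrite divr_gt0 // expR_gt0.
(* A circle of radius N + 1/2 keeps distance 1/2 from all integers, so that [csin_lower] applies on
   it. *)
have circ N w : normc w = N%:R + 2^-1 -> forall m : int, 2^-1 <= normc (m%:~R - w).
  move=> wN m; have := ler_normc_dist m%:~R w; rewrite normc_int wN; apply: le_trans.
  have [mN|mN] := leqP `|m|%N N.
    have : (`|m|%:~R : R) <= N%:R by rewrite -[`|m|%:~R]/(`|m|%:R) ler_nat.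
    by rewrite ler_normr => ?; apply/orP; right; lra.
  have : N%:R + 1 <= (`|m|%:~R : R) by rewrite -[`|m|%:~R]/(`|m|%:R) natr1 ler_nat.
  by rewrite ler_normr => ?; apply/orP; left; lra.
have const z1 z2 : Delta11 lam z1 != 0 -> Delta11 lam z2 != 0 ->
    D 0 z1 / Delta11 lam z1 = D 0 z2 / Delta11 lam z2.
  move=> L1 L2; set G1 := D 0 z1 / _; set G2 := D 0 z2 / _.
  have h2 : (0 : R) < 2^-1 by [].
  have [N0 HN] := Delta11_near_sin h2.
  pose r0 := normc z1 + normc z2; have r00 : 0 <= r0 by rewrite addr_ge0 ?normc_ge0.
  (* On these circles |D 0| is at most (1 + 4 K) |sin| and the product is at least |sin| / 2. *)
  pose B := 2 * (1 + 4 * K); have B0 : 0 <= B by rewrite /B; lra.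
  apply/eqP; rewrite -subr_eq0 -normc_eq0 eq_le normc_ge0 andbT; apply/ler_addgt0Pr => e e0; rewrite add0r.
  pose N := (Num.truncn (`|N0| + 2 * r0 + 4 * B * r0 / e)).+1.
  have Br : 0 <= 4 * B * r0 / e by rewrite divr_ge0 ?(ltW e0) // mulr_ge0 // mulr_ge0.
  have NN : `|N0| + 2 * r0 + 4 * B * r0 / e < N%:R by exact: truncnS_gt.
  have N00 := normr_ge0 N0; have N01 := ler_norm N0.
  pose rho : R := N%:R + 2^-1; have rho0 : 0 < rho by rewrite /rho; have := ler0n R N; lra.
  have [h Hh hE] := quotient_apx (ltW rho0).
  have hG w : Delta11 lam w != 0 -> normc w <= r0 -> D 0 w / Delta11 lam w = h w.
    by move=> Lw wr; rewrite hE ?[_ * h w]mulrC ?mulfK //; rewrite /rho; lra.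
  have n1 : normc z1 <= r0 by rewrite lerDl normc_ge0.
  have n2 : normc z2 <= r0 by rewrite lerDr normc_ge0.
  rewrite /G1 /G2 (hG z1) // (hG z2) //.
  apply: le_trans (apx_diff (r := r0) (M := B) r00 rho0 _ Hh _ n1 n2) _.
  - by rewrite /rho; lra.
  - move=> w wr; have wZ := circ N w wr.
    have [P LP P1] := HN w ltac:(rewrite wr /rho; lra) wZ; have P2 := near1_lb P1.
    have s0 := csin_gt w wZ.
    have La : normc (Delta11 lam w) = normc (csin (w * pi%:C)) * normc P by rewrite LP normcM normcN.
    have : normc (D 0 w) <= normc (csin (w * pi%:C)) * (1 + 4 * K).
      rewrite DE; apply: le_trans (le_normcD _ _) _; rewrite normcN.
      have k1 := sinE w wZ; have k2 := e1 w.
      have k3 : 4 * K * expR ((r - pi) * `|complex.Im w|) <= 4 * K.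
        by rewrite ler_piMr // mulr_ge0.
      by have := ler_wpM2r (ltW s0) k3; lra.
    rewrite hE ?wr // [normc (Delta11 _ _ * _)]normcM La => H.
    have H2 : normc (csin (w * pi%:C)) * (normc P * normc (h w)) <= normc (csin (w * pi%:C)) * (1 + 4 * K).
      by rewrite mulrA.
    rewrite ler_pM2l // in H2.
    have H3 : 2^-1 * normc (h w) <= normc P * normc (h w) by rewrite ler_wpM2r ?normc_ge0.
    by rewrite /B; lra.
  - rewrite mulrA ler_pdivrMr // mulrC -ler_pdivrMl // mulrC.
    by rewrite /rho; lra.
have ratio w : Delta11 lam w != 0 -> D 0 w / Delta11 lam w = 1.
  move=> Lw; set k := D 0 w / _.
  apply/eqP; rewrite -subr_eq0 -normc_eq0 eq_le normc_ge0 andbT; apply/ler_addgt0Pr => e e0; rewrite add0r.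
  have k1 : 0 < 1 + normc k by rewrite ltr_wpDr // normc_ge0.
  pose d := Num.min 2^-1 (e / (1 + normc k)).
  have d0 : 0 < d by rewrite lt_min invr_gt0 ltr0n divr_gt0.
  have [N0 HN] := Delta11_near_sin d0; have pr : 0 < pi - r by rewrite subr_gt0.
  (* The height is such that d (1 + (pi - r) y) >= 4 K; then exp x >= 1 + x brings the relative size
     of the transform below d. *)
  pose y : R := `|N0| + 1 + 4 * K / (d * (pi - r)).
  have q0 : 0 <= 4 * K / (d * (pi - r)) by rewrite divr_ge0 ?mulr_ge0 ?(ltW d0) ?(ltW pr).
  have N00 := normr_ge0 N0; have N01 := ler_norm N0.
  have y0 : 0 < y by rewrite /y; lra.
  pose u : C := 'i * y%:C.
  have nu : normc u = y by rewrite normcM normc_i mul1r normcR gtr0_norm.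
  have Iu : complex.Im u = y by rewrite /u -complexiE /=; ring.
  have uZ (m : int) : 2^-1 <= normc (m%:~R - u).
    apply: le_trans (le_Im_normc _); rewrite ImD ImN Iu -(rmorph_int (real_complex R)) /= add0r normrN gtr0_norm //.
    by rewrite /y; lra.
  have [P LP P1] := HN u ltac:(rewrite nu /y; lra) uZ.
  have s0 := csin_gt u uZ; have sn0 : csin (u * pi%:C) != 0 by rewrite -normc_gt0.
  have P2 : 2^-1 <= normc P by apply: near1_lb; apply: le_trans P1 _; rewrite ge_min lexx.
  have Pn0 : P != 0 by rewrite -normc_gt0; apply: lt_le_trans P2.
  have Lu : Delta11 lam u != 0 by rewrite LP mulf_neq0 ?oppr_eq0.
  have Ek : D 0 u = k * Delta11 lam u by rewrite /k (const w u) // divfK.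
  have FE : FT W u = csin (u * pi%:C) * (1 - k * P).
    have : FT W u = D 0 u + csin (u * pi%:C) by rewrite DE; ring.
    by rewrite Ek LP => ->; ring.
  have kP : normc (1 - k * P) <= d.
    have := sinE u uZ; rewrite FE [normc (csin _ * _)]normcM mulrC ler_pM2r // => H; apply: le_trans H _.
    rewrite Iu gtr0_norm // (_ : (r - pi) * y = - ((pi - r) * y)); last by ring.
    have X0 : 0 < 1 + (pi - r) * y by rewrite ltr_wpDr // mulr_ge0 // ltW.
    rewrite expRN ler_pdivrMr ?expR_gt0 //; apply: le_trans (_ : d * (1 + (pi - r) * y) <= _); last first.
      by rewrite ler_wpM2l ?(ltW d0) // expR_ge1Dx.
    have : 4 * K <= d * ((pi - r) * y).
      rewrite mulrA -ler_pdivrMl ?mulr_gt0 // mulrC /y; lra.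
    lra.
  have -> : k - 1 = - (1 - k * P) - k * (P - 1) by ring.
  apply: le_trans (le_normcD _ _) _; rewrite !normcN normcM.
  have : d * (1 + normc k) <= e by rewrite -ler_pdivlMr // ge_min lexx orbT.
  have := ler_wpM2l (normc_ge0 k) P1; lra.
(* At a zero of the product some [lam n] equals z, so its multiplicity is positive and [D 0]
   vanishes there as well. *)
have [Lz|Lz] := eqVneq (Delta11 lam z) 0; last first.
  by have := ratio z Lz => H; rewrite -[LHS](divfK Lz) H mul1r.
have [n zn] := Delta11_eq0 HA lamE Lz; rewrite Lz.
have [m [[Dm _] /card_set_bijP[f [ff _ _]]]] := Dz z.
by apply: Dm; apply: leq_ltn_trans (leq0n _) (ff n (esym zn)).
Qed.

End Setup.

End HadamardUniqueness.

(** * Absolutely continuous functions *)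

Section AbsoluteContinuity.
Context {R : realType}.
Local Notation C := R[i].
Local Notation mu := (@lebesgue_measure R).
Local Notation rmeas := (@cmeas R _ (measurableTypeR R)).
Implicit Types (a b : R) (F G f : R -> C).

Lemma ac_sub a b c d F : a <= c -> d <= b -> absolutely_continuous a b F ->
  absolutely_continuous c d F.
Proof.
move=> ac db H e /H[r r0 Hr]; exists r => // n u v uv; apply: Hr => i.
by have [h1 [h2 h3]] := uv i; split; [exact: le_trans h1|split=> //; exact: le_trans h3 db].
Qed.

(** One increment estimate serves sums, multiples and products alike. *)
Lemma ac_combine a b F G (H : R -> C) (K L : R) : 0 <= K -> 0 <= L ->
  absolutely_continuous a b F -> absolutely_continuous a b G ->
  (forall u v, a <= u -> u <= v -> v <= b ->
    normc (H v - H u) <= K * normc (F v - F u) + L * normc (G v - G u)) ->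
  absolutely_continuous a b H.
Proof.
move=> K0 L0 HF HG HH e e0.
have d0 : 0 < e / (K + L + 1) by rewrite divr_gt0 // ltr_wpDl // addr_ge0.
have [d1 d10 h1] := HF _ d0; have [d2 d20 h2] := HG _ d0.
exists (Num.min d1 d2) => [|n u v uv tr]; first by rewrite lt_min d10.
rewrite lt_min => /andP[s1 s2]; have k1 := h1 n u v uv tr s1; have k2 := h2 n u v uv tr s2.
apply: (@le_lt_trans _ _ (K * \sum_(i < n) normc (F (v i) - F (u i)) + L * \sum_(i < n) normc (G (v i) - G (u i)))).
  rewrite !mulr_sumr -big_split; apply: ler_sum => i _.
  by have [x1 [x2 x3]] := uv i; exact: HH.
move: k1 k2; set S1 := \sum_(i < n) _; set S2 := \sum_(i < n) _ => k1 k2.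
have KL : 0 < K + L + 1 by rewrite ltr_wpDl // addr_ge0.
have E : (K + L + 1) * (e / (K + L + 1)) = e by rewrite mulrC divfK ?gt_eqF.
rewrite -[X in _ < X]E; move: k1 k2 d0; set q := e / _ => k1 k2 d0.
have := ler_wpM2l K0 (ltW k1); have := ler_wpM2l L0 (ltW k2); lra.
Qed.

Lemma acD a b F G : absolutely_continuous a b F -> absolutely_continuous a b G ->
  absolutely_continuous a b (fun x => F x + G x).
Proof.
move=> HF HG; apply: (ac_combine ler01 ler01 HF HG) => u v _ _ _.
by rewrite !mul1r (_ : _ - _ = (F v - F u) + (G v - G u)) ?le_normcD //; ring.
Qed.

Lemma acZ a b (c : C) F : absolutely_continuous a b F -> absolutely_continuous a b (fun x => c * F x).
Proof.
move=> HF; apply: (ac_combine (normc_ge0 c) (lexx 0) HF HF) => u v _ _ _.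
by rewrite mul0r addr0 -mulrBr normcM.
Qed.

Lemma acB a b F G : absolutely_continuous a b F -> absolutely_continuous a b G ->
  absolutely_continuous a b (fun x => F x - G x).
Proof.
move=> HF HG; have := acD HF (acZ (- 1) HG); congr absolutely_continuous.
by apply/funext => x; rewrite mulN1r.
Qed.

Lemma ac_lip a b F (L : R) : (forall u v, a <= u -> u <= v -> v <= b -> normc (F v - F u) <= L * (v - u)) ->
  absolutely_continuous a b F.
Proof.
move=> HL e e0; have L0 : 0 < `|L| + 1 by rewrite ltr_wpDl.
exists (e / (`|L| + 1)) => [|n u v uv tr]; first by rewrite divr_gt0.
rewrite ltr_pdivlMr // mulrC; apply: le_lt_trans; rewrite mulr_sumr; apply: ler_sum => i _.
have [x1 [x2 x3]] := uv i; apply: le_trans (HL _ _ x1 x2 x3) _.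
by rewrite ler_wpM2r ?subr_ge0 //; have := ler_norm L; lra.
Qed.

Lemma ac_near a b F e : absolutely_continuous a b F -> 0 < e -> exists2 d : R, 0 < d &
  forall u v, a <= u -> u <= v -> v <= b -> v - u < d -> normc (F v - F u) < e.
Proof.
move=> HF e0; have [d d0 H] := HF e e0; exists d => // u v au uv vb uvd.
have := H 1%N (fun=> u) (fun=> v); rewrite !big_ord1; apply=> //.
by apply/trivIsetP => i j _ _; rewrite !ord1 eqxx.
Qed.

(** A walk from [a] in steps of length d / 2 changes the value by less than 1 at each step. *)
Lemma ac_bounded a b F : absolutely_continuous a b F ->
  exists2 B : R, 0 <= B & forall x, a <= x <= b -> normc (F x) <= B.
Proof.
move=> HF; have [d d0 H] := ac_near HF ltr01.
have step n x : a <= x <= b -> x - a <= n%:R * (d / 2) -> normc (F x - F a) <= n%:R.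
  elim: n x => [|n IH] x /andP[ax xb].
    rewrite mul0r subr_le0 => xa; have -> : x = a by apply/eqP; rewrite eq_le xa.
    by rewrite subrr normc0.
  rewrite -natr1 => xn; pose y := Num.max a (x - d / 2).
  have ay : a <= y by rewrite le_max lexx.
  have yx : y <= x by rewrite ge_max ax /=; lra.
  have yd : x - y < d by rewrite /y maxEle; case: ifP => h; lra.
  have yn : y - a <= n%:R * (d / 2).
    rewrite /y maxEle; case: ifP => h; last by rewrite subrr mulr_ge0 // divr_ge0 // ltW.
    by lra.
  have := IH y ltac:(by rewrite ay (le_trans yx)) yn; have := H y x ay yx xb yd.
  have := le_normcD (F x - F y) (F y - F a); rewrite addrA subrK; lra.
pose N := (Num.truncn `|(b - a) / (d / 2)|).+1.
exists (normc (F a) + N%:R) => [|x xab]; first by rewrite addr_ge0 ?normc_ge0.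
have := step N x xab; have := le_normcD (F a) (F x - F a); rewrite addrC subrK.
have : (b - a) / (d / 2) <= N%:R.
  by apply: le_trans (ler_norm _) _; apply/ltW; exact: truncnS_gt.
rewrite ler_pdivrMr ?divr_gt0 // => h1 h2 h3; case/andP: xab => ax xb.
by have := h3 ltac:(lra); lra.
Qed.

Lemma acM a b F G : absolutely_continuous a b F -> absolutely_continuous a b G ->
  absolutely_continuous a b (fun x => F x * G x).
Proof.
move=> HF HG; have [B B0 FB] := ac_bounded HF; have [K K0 GK] := ac_bounded HG.
apply: (ac_combine K0 B0 HF HG) => u v au uv vb.
rewrite (_ : _ - _ = G v * (F v - F u) + F u * (G v - G u)); last by ring.
apply: le_trans (le_normcD _ _) _; rewrite !normcM; apply: lerD; rewrite ler_wpM2r ?normc_ge0 //.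
- by apply: GK; rewrite vb (le_trans au).
- by apply: FB; rewrite au (le_trans uv).
Qed.

Lemma ac_cexp a b (w : C) : absolutely_continuous a b (fun x => cexp (x%:C * w)).
Proof.
pose M := normc w * expR ((`|a| + `|b|) * normc w).
apply: (@ac_lip _ _ _ M) => u v au uv vb.
have dg (t : R) : is_derive t (1 : R) (fun s => M * s) M.
  by apply: is_derive_eq; rewrite /GRing.scale /= mulr1 ?mulr0 ?addr0 ?add0r.
have := cder_mvt uv (cder_cexp w) dg _; rewrite -mulrBr; apply=> t /andP[ut tv].
rewrite normcM ler_wpM2l ?normc_ge0 // [normc (cexp _)]normc_cexp ler_expR.
apply: le_trans (ler_norm _) _; apply: le_trans (le_Re_normc _) _.
rewrite normcM normcR ler_wpM2r ?normc_ge0 // ler_norml.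
have := ler_norm b; have := ler_norm (- a); rewrite normrN; have := normr_ge0 a; have := normr_ge0 b.
by move=> *; apply/andP; split; lra.
Qed.

Lemma cder_lin F (c : R) (e : R) : cder F c 0 -> 0 < e -> exists2 d : R, 0 < d &
  forall x, `|x - c| < d -> normc (F x - F c) <= e * `|x - c|.
Proof.
move=> [HR HI] e0.
have key (g : R -> R) : is_derive c (1 : R) g 0 -> exists2 d : R, 0 < d &
    forall x, `|x - c| < d -> `|g x - g c| <= e / 2 * `|x - c|.
  move=> [dg g0]; have : h^-1 *: (g (h *: 1 + c) - g c) @[h --> 0^'] --> (0 : R).
    by rewrite -[X in _ --> X]g0; exact: dg.
  move=> /cvgrPdist_le /(_ (e / 2) ltac:(by rewrite divr_gt0)).
  move=> /nbhs_ballP[d /= d0 H]; exists d => // x xd.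
  have [->|xc] := eqVneq x c; first by rewrite !subrr normr0 mulr0.
  have h0 : x - c != 0 by rewrite subr_eq0.
  have := H (x - c); rewrite /ball /= sub0r normrN => /(_ xd h0).
  rewrite sub0r normrN /GRing.scale /= mulr1 subrK normrM normrV ?unitfE //.
  by rewrite mulrC ler_pdivrMr // normr_gt0.
have [d1 d10 h1] := key _ HR; have [d2 d20 h2] := key _ HI.
exists (Num.min d1 d2) => [|x]; first by rewrite lt_min d10.
rewrite lt_min => /andP[/h1 k1 /h2 k2]; apply: le_trans (normc_le_ReIm _) _.
rewrite ReD ReN ImD ImN; lra.
Qed.

Lemma null_cover (N : set R) (e : R) : 0 < e -> measurable N -> mu N = 0%E ->
  exists U : set R, [/\ open U, N `<=` U & (mu U < e%:E)%E].
Proof.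
move=> e0 mN N0; have Nf : (mu N < +oo)%E by rewrite N0.
have [U [oU NU Ue]] := lebesgue_regularity_outer mN Nf e0.
exists U; split=> //; rewrite -(setDUK NU).
apply: le_lt_trans (measureU2 _ _ _) _ => //.
  by apply: measurableD => //; exact: open_measurable.
by rewrite [X in (X + _)%E]N0 add0e.
Qed.

Lemma disjoint_length (U : set R) n (u v : 'I_n -> R) : measurable U ->
  (forall i, u i <= v i) -> (forall i x, u i < x < v i -> U x) ->
  trivIset [set: 'I_n] (fun i => `]u i, v i[%classic) ->
  ((\sum_(i < n) (v i - u i))%:E <= mu U)%E.
Proof.
move=> mU uv uU tr.
have -> : (\sum_(i < n) (v i - u i))%:E = (\sum_(i < n) mu `]u i, v i[%classic)%E.
  rewrite -sumEFin; apply: eq_bigr => i _; rewrite lebesgue_measure_itv /= lte_fin.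
  case: ltP => // vu; have -> : v i = u i by apply/eqP; rewrite eq_le vu uv.
  by rewrite subrr.
rewrite -measure_bigsetU_ord //; apply: le_measure; rewrite ?inE //.
  by apply: bigsetU_measurable => i _; exact: measurable_itv.
elim/big_ind: _ => // [A B HA HB x []|i _ x /=]; [exact: HA|exact: HB|].
by rewrite in_itv /=; exact: uU.
Qed.

(* A chain of small steps leads from a to b: near a point where F' vanishes the
   increment of F is at most e times the length of the step, and the remaining steps
   lie in an open set of small measure, so absolute continuity bounds their total. *)
Theorem ac_constant a b F : a <= b -> absolutely_continuous a b F ->
  {ae mu, forall x, x \in `]a, b[ -> cder F x 0} -> F b = F a.
Proof.
move=> ab HF [N [mN N0 HN]].
apply/eqP; rewrite -subr_eq0 -normc_eq0 eq_le normc_ge0 andbT; apply/ler_addgt0Pr => e' e'0; rewrite add0r.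
pose e := e' / (b - a + 1).
have ba : 0 < b - a + 1 by lra.
have e0 : 0 < e by rewrite divr_gt0.
have [d d0 Hd] := HF e e0.
(* The derivative is only prescribed in the open interval, so both endpoints are added to the
   exceptional set and covered by [U]. *)
pose N' := N `|` [set a] `|` [set b].
have mN' : measurable N' by apply: measurableU => //; apply: measurableU.
have N'0 : mu N' = 0%E.
  have mNa : measurable (N `|` [set a]) by exact: measurableU.
  have Nb0 : mu [set b] = 0%E by exact: lebesgue_measure_set1.
  have Na0 : mu [set a] = 0%E by exact: lebesgue_measure_set1.
  by rewrite /N' (measureU0 _ _ Nb0) // (measureU0 _ _ Na0).
have [U [oU NU Ud]] := null_cover d0 mN' N'0.
(* The list [s] records the steps inside [U], the latest one at the head; all other steps are paid
   for by e (x - a). *)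
pose P x := exists s : seq (R * R), [/\ pairwise (fun p q => q.2 <= p.1) s,
  (forall p, p \in s -> [/\ a <= p.1, p.1 <= p.2, p.2 <= x & forall t, p.1 < t < p.2 -> U t]) &
  normc (F x - F a) <= e * (x - a) + \sum_(p <- s) normc (F p.2 - F p.1)].
have Pa : P a by exists [::]; split=> //; rewrite !subrr normc0 mulr0 big_nil addr0.
have Pstep x y : a <= x -> x <= y -> y <= b -> P x ->
    normc (F y - F x) <= e * (y - x) \/ (forall t, x < t < y -> U t) -> P y.
  move=> ax xy yb [s [sp sU Fs]] [H|H].
    exists s; split=> // [p /sU[p1 p2 p3 p4]|]; first by split=> //; exact: le_trans p3 xy.
    by have := le_normcD (F y - F x) (F x - F a); rewrite addrA subrK; lra.
  exists ((x, y) :: s); split=> [/=|p|].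
  - by rewrite sp andbT; apply/allP => p /sU[].
  - rewrite inE => /predU1P[->//|/sU[p1 p2 p3 p4]]; split=> //; exact: le_trans p3 xy.
  - rewrite big_cons /=; have := le_normcD (F y - F x) (F x - F a); rewrite addrA subrK.
    have h : e * (x - a) <= e * (y - a) by rewrite ler_pM2l // lerD2r.
    by lra.
have local c : a <= c <= b -> exists2 r : R, 0 < r & forall x y, c - r < x -> x <= c -> c <= y -> y < c + r ->
    normc (F y - F x) <= e * (y - x) \/ (forall t, x < t < y -> U t).
  move=> cab; have [Nc|Nc] := pselect (N' c).
    have : nbhs c U by apply: open_nbhs_nbhs; split=> //; exact: NU.
    move=> /nbhs_ballP[r /= r0 Hr]; exists r => // x y xc xc' cy' cy; right=> t /andP[xt ty].
    by apply: Hr; rewrite /ball /= ltr_norml; apply/andP; split; lra.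
  have cN : ~ N c by move=> h; apply: Nc; left; left.
  have ca : c != a by apply: contra_notN Nc => /eqP ->; left; right.
  have cb : c != b by apply: contra_notN Nc => /eqP ->; right.
  have cI : c \in `]a, b[.
    by rewrite in_itv /= !lt_neqAle [a == _]eq_sym ca cb /=.
  have dc : cder F c 0 by apply: contrapT => h; apply: cN; apply: HN => /= /(_ cI).
  have [r r0 Hr] := cder_lin dc e0; exists r => // x y xc xc' cy' cy; left.
  have := Hr x ltac:(by rewrite ltr_norml; apply/andP; split; lra).
  have := Hr y ltac:(by rewrite ltr_norml; apply/andP; split; lra).
  rewrite (ger0_norm (_ : 0 <= y - c)) ?subr_ge0 // (ler0_norm (_ : x - c <= 0)) ?subr_le0 //.
  by have := le_normcD (F y - F c) (F c - F x); rewrite addrA subrK [normc (F c - F x)]normcB; nra.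
(* Supremum argument: a chain reaching a point close below the supremum can be continued past it,
   unless the supremum is b. *)
have Pb : P b.
  pose S := [set x | a <= x <= b /\ P x].
  have Sa : S a by split=> //; rewrite lexx.
  have supS : has_sup S by split; [exists a|exists b => x [/andP[]]].
  pose c := sup S; have ac : a <= c by apply: sup_upper_bound.
  have cb : c <= b by apply: ge_sup; [exists a|move=> x [/andP[]]].
  have [r r0 Hr] := local c ltac:(by rewrite ac).
  have [x [/andP[ax xb] Px] xc] := sup_adherent r0 supS.
  have xc' : x <= c by apply: sup_upper_bound => //; split=> //; rewrite ax.
  pose y := Num.min b (c + r / 2).
  have yb : y <= b by rewrite ge_min lexx.
  have cy : c <= y by rewrite le_min cb /=; lra.
  have yr : y < c + r by rewrite /y minEle; case: ifP => h; lra.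
  have Py : P y by apply: (Pstep x y ax (le_trans xc' cy) yb Px); apply: Hr.
  have Sy : S y by split=> //; rewrite yb andbT (le_trans ac).
  have yc : y <= c by apply: sup_upper_bound.
  have [yE|yE] := eqVneq y b; first by rewrite -yE.
  have : y = c + r / 2 by move: yE; rewrite /y minEle; case: ifP => //; rewrite eqxx.
  by lra.
have [s [sp sU Fs]] := Pb.
pose u (i : 'I_(size s)) := (nth (0, 0) s i).1; pose v (i : 'I_(size s)) := (nth (0, 0) s i).2.
have uv i : [/\ a <= u i, u i <= v i, v i <= b & forall t, u i < t < v i -> U t].
  by apply: sU; exact: mem_nth.
have tr : trivIset [set: 'I_(size s)] (fun i => `]u i, v i[%classic).
  have dis (i j : 'I_(size s)) : (i < j)%N -> `]u i, v i[%classic `&` `]u j, v j[%classic = set0.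
    move=> ij; apply/seteqP; split=> // t []; rewrite /= !in_itv /= => /andP[ut _] /andP[_ tv].
    have /(pairwiseP (0, 0)) H := sp; have := H i j (ltn_ord i) (ltn_ord j) ij; rewrite -/(u i) -/(v j).
    by move=> h; have := lt_trans ut tv; rewrite ltNge h.
  apply/trivIsetP => i j _ _ ij; have [h|h|h] := ltngtP i j; first exact: dis.
    by rewrite setIC; exact: dis.
  by case/eqP: ij; apply/val_inj.
have len : \sum_(i < size s) (v i - u i) < d.
  rewrite -lte_fin; apply: le_lt_trans Ud; apply: disjoint_length tr; last first.
  - by move=> i x; case: (uv i) => _ _ _; exact.
  - by move=> i; case: (uv i).
  - exact: open_measurable.
have := Hd (size s) u v ltac:(by move=> i; case: (uv i)) tr len.
have -> : \sum_(i < size s) normc (F (v i) - F (u i)) = \sum_(p <- s) normc (F p.2 - F p.1).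
  by rewrite (big_nth (0, 0)) big_mkord.
move=> He; apply: le_trans Fs _.
have : e' = e * (b - a) + e by rewrite -[X in _ + X]mulr1 -mulrDr /e divfK ?gt_eqF.
lra.
Qed.

Lemma prim_diff f u v : cL1 mu f -> u <= v -> prim f v - prim f u = cI mu (cut `]u, v[%classic f).
Proof.
move=> Hf uv; rewrite /prim -cIB; [|exact: cL1_cut|exact: cL1_cut].
apply: cI_ae.
- by apply: cmeasB; apply: cmeas_cut => //; case: Hf.
- by apply: cmeas_cut => //; case: Hf.
- exists [set v]; split; [exact: measurable_set1|exact: lebesgue_measure_set1|] => t /= H.
  apply: contrapT => tv; apply: H; rewrite !cutE !mem_setE !in_itv /=.
  have -> : (t < v) = (t <= v) by rewrite lt_neqAle; case: eqP.
  rewrite ltNge; have [tu|tu] := leP t u; first by rewrite (le_trans tu uv) subrr.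
  by rewrite subr0.
Qed.

Lemma cI_sum_ord n (F : 'I_n -> R -> C) : (forall i, cL1 mu (F i)) ->
  cL1 mu (fun t => \sum_(i < n) F i t) /\ cI mu (fun t => \sum_(i < n) F i t) = \sum_(i < n) cI mu (F i).
Proof.
move=> HF; pose X (k : nat) (t : measurableTypeR R) : C := if insub k is Some i then F i t else 0.
have E (i : 'I_n) : X i = F i by apply/funext => t; rewrite /X valK.
have LX k : cL1 mu (X k).
  case: (ltnP k n) => kn; first by rewrite (E (Ordinal kn)).
  by rewrite /X insubN -?leqNgt //; exact: cL1_0.
have ES : (fun t => \sum_(i < n) F i t) = (fun t => \sum_(i < n) X i t).
  by apply/funext => t; apply: eq_bigr => i _; rewrite E.
rewrite ES; split; first exact: cL1_sum.
by rewrite cI_sum //; apply: eq_bigr => i _; rewrite E.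
Qed.

Lemma cI_ge0_real (g : R -> R) : (forall t, 0 <= g t) -> cI mu (fun t => (g t)%:C) = (nI mu (fun t => (g t)%:C))%:C.
Proof.
move=> g0; rewrite cI_real; congr (_%:C); congr fine; apply: eq_integral => t _.
by rewrite normcR ger0_norm.
Qed.

(** The excess of |f| over n has integral below e / 2 for some n, by dominated convergence; the
    truncated part contributes at most n times the total length of the disjoint intervals. *)
Lemma prim_ac a b f : cL1 mu f -> absolutely_continuous a b (prim f).
Proof.
move=> Hf e e0; have e2 : 0 < e / 2 by rewrite divr_gt0.
pose g (n : nat) (t : R) : R := Num.max 0 (normc (f t) - n%:R).
have g0 n t : 0 <= g n t by rewrite le_max lexx.
have mf : measurable_fun setT (fun t => normc (f t)) by apply: cmeas_norm; case: Hf.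
have mg n : rmeas (fun t => (g n t)%:C).
  by apply: cmeas_real; apply: measurable_maxr => //; apply: measurable_funB.
have gf n t : normc ((g n t)%:C : C) <= normc (f t).
  rewrite normcR ger0_norm // /g maxEle; case: ifP => _; rewrite ?normc_ge0 //.
  by rewrite lerBlDr lerDl.
have Lg n : cL1 mu (fun t => (g n t)%:C) by apply: cL1_dom (mg n) (cL1_norm Hf) (gf n).
have [n gn] : exists n, nI mu (fun t => (g n t)%:C) < e / 2.
  have H : (cI mu (fun t => (g n t)%:C) : R[i]^o) @[n --> \oo] --> (cI mu (fun=> 0) : R[i]^o).
    apply: (@cI_dct _ _ _ mu (fun n t => (g n t)%:C) _ (fun t => normc (f t))).
    - exact: mg.
    - exact: cmeas_cst.
    - exact: cL1_norm.
    - exact: gf.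
    - apply/aeW => t; apply/cvgcP => d d0; near=> n.
      have nf : normc (f t) <= n%:R by near: n; exact: nbhs_infty_ger.
      by rewrite subr0 normcR /g max_l ?normr0 // subr_le0.
  rewrite cI0 in H; move/cvgcP: H => /(_ _ e2) [n _ Hn]; exists n.
  have : normc (cI mu (fun t => (g n t)%:C) - 0) < e / 2 by exact: (Hn n (leqnn n)).
  by rewrite subr0 cI_ge0_real // normcR ger0_norm ?nI_ge0.
exists (e / 2 / n.+1%:R) => [|k u v uv tr]; first by rewrite divr_gt0.
rewrite ltr_pdivlMr ?ltr0n // => len.
pose A i : set R := `]u i, v i[%classic.
have [L1 E1] := cI_sum_ord (fun i => cL1_cut (measurable_itv _ : measurable (A i)) (Lg n)).
have S1 t : \sum_(i < k) (\1_(A i) t : R) <= 1.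
  have [[i Ait]|nA] := pselect (exists i, A i t); last first.
    by rewrite big1 // => i _; rewrite indicE memNset // => h; apply: nA; exists i.
  rewrite (bigD1 i) //= indicE mem_set //= big1 ?addr0 // => j ji.
  rewrite indicE memNset // => Ajt; case/eqP: ji; apply: (tr j i) => //; by exists t.
have Sg : \sum_(i < k) nI mu (cut (A i) (fun t => (g n t)%:C)) <= nI mu (fun t => (g n t)%:C).
  have cE i : cut (A i) (fun t => (g n t)%:C) = fun t => (\1_(A i) t * g n t)%:C.
    by apply/funext => t; rewrite /cut rmorphM.
  have : normc (cI mu (fun t => \sum_(i < k) cut (A i) (fun t => (g n t)%:C) t)) <= nI mu (fun t => (g n t)%:C).
    apply: le_trans (cI_norm L1) _; apply: nI_le => //; first exact: cL1_norm (Lg n).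
    move=> t; under eq_bigr do rewrite cE; rewrite -rmorph_sum !normcR ger0_norm ?(ger0_norm (g0 _ _)) -?mulr_suml.
      by rewrite ler_piMl.
    by apply: mulr_ge0 => //; apply: sumr_ge0.
  rewrite E1; have -> : \sum_(i < k) cI mu (cut (A i) (fun t => (g n t)%:C)) =
      (\sum_(i < k) nI mu (cut (A i) (fun t => (g n t)%:C)))%:C.
    rewrite rmorph_sum; apply: eq_bigr => i _; rewrite cE cI_ge0_real // => t.
    by apply: mulr_ge0.
  by rewrite normcR ger0_norm // sumr_ge0 // => i _; exact: nI_ge0.
apply: (@le_lt_trans _ _ (\sum_(i < k) (n%:R * (v i - u i) + nI mu (cut (A i) (fun t => (g n t)%:C))))).
  apply: ler_sum => i _; have [_ [uvi _]] := uv i; rewrite prim_diff //.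
  have LA := cL1_cut (measurable_itv _ : measurable (A i)) Hf.
  apply: le_trans (cI_norm LA) _.
  have IA : mu.-integrable setT (fun t => (\1_(A i) t)%:E) by exact: integrable_indic_itv.
  have LgA := cL1_norm (cL1_cut (measurable_itv _ : measurable (A i)) (Lg n)).
  apply: le_trans (nI_le LA (integrable_realD (integrable_realZ n%:R IA) LgA) _) _.
    move=> t; rewrite !cutE indicE; case: (t \in _); last by rewrite !normc0 mulr0 addr0.
    by rewrite mulr1 normcR ger0_norm // /g -lerBlDl le_max lexx orbT.
  rewrite RintegralD //; last exact: integrable_realZ.
  rewrite lerD2r RintegralZl // ler_wpM2l //.
  rewrite /Rintegral integral_indic //; last exact: measurable_itv.
  have -> : A i `&` setT = A i by apply/seteqP; split=> [x []|x].
  suff : fine (@lebesgue_measure R `]u i, v i[%classic) <= v i - u i by [].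
  rewrite lebesgue_measure_itv /= lte_fin.
  by case: ifP => // _; rewrite /= subr_ge0.
rewrite big_split -mulr_sumr /=.
have := ler_wpM2r (ler0n R 1) Sg; move: len Sg gn; rewrite -natr1.
set S := \sum_(i < k) (v i - u i); set T := \sum_(i < k) nI _ _; set G := nI _ _.
have S0 : 0 <= S by apply: sumr_ge0 => i _; have [_ [h _]] := uv i; rewrite subr_ge0.
move: S T G S0 => S T G S0 len TG gn _; nra.
Unshelve. all: by end_near.
Qed.

End AbsoluteContinuity.

(** * The diagonalised delay system *)

Section DelaySystem.
Context {R : realType}.
Local Notation C := R[i].
Local Notation mu := (@lebesgue_measure R).
Local Notation rmeas := (@cmeas R _ (measurableTypeR R)).
Implicit Types (z w c : C) (f g h F : R -> C).

Lemma prim_rmeas f : cL1 mu f -> rmeas (prim f).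
Proof.
move=> Hf.
have key x e : 0 < e -> exists2 d : R, 0 < d & forall y, `|x - y| < d -> normc (prim f x - prim f y) < e.
  move=> e0; have [d d0 H] := ac_near (prim_ac (x - 1) (x + 1) Hf) e0.
  exists (Num.min 1 d) => [|y]; first by rewrite lt_min ltr01.
  rewrite lt_min ltr_norml => /andP[/andP[y1 y2]]; rewrite ltr_norml => /andP[y3 y4].
  have [xy|xy] := leP x y; first by rewrite normcB; apply: H; lra.
  by apply: H; lra.
split; apply: continuous_measurable_fun => x; apply/cvgrPdist_lt => e e0;
  have [d d0 H] := key x e e0; apply/nbhs_ballP; exists d => // y /H Hxy.
- by apply: le_lt_trans Hxy; rewrite -ReN -ReD le_Re_normc.
- by apply: le_lt_trans Hxy; rewrite -ImN -ImD le_Im_normc.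
Qed.

Lemma prim_le f x : cL1 mu f -> normc (prim f x) <= nI mu f.
Proof.
move=> Hf; have LC := cL1_cut (measurable_itv `]-oo, x]) Hf.
apply: le_trans (cI_norm LC) _; apply: nI_le => //; first exact: cL1_norm.
by move=> t; exact: normc_cut_le.
Qed.

Lemma prim_eq f g x : (forall t, t <= x -> f t = g t) -> prim f x = prim g x.
Proof.
move=> fg; congr cI; apply/funext => t; rewrite !cutE; case: ifPn => // /set_mem /=.
by rewrite in_itv /= => /fg.
Qed.

Lemma prim_eq0 f x : (forall t, t <= x -> f t = 0) -> prim f x = 0.
Proof.
move=> f0; rewrite (@prim_eq f (fun=> 0)) // /prim -[RHS](cI0 mu); congr cI; apply/funext => t.
by rewrite cutE if_same.
Qed.

Lemma prim_full f x : (forall t, x < t -> f t = 0) -> prim f x = cI mu f.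
Proof.
move=> f0; congr cI; apply/funext => t; rewrite cutE mem_setE in_itv /=.
by case: leP => // /f0.
Qed.

Lemma cder_eq F x d e : cder F x d -> d = e -> cder F x e. Proof. by move=> H <-. Qed.

(** The integrating factor exp (- w t) makes the product absolutely continuous with derivative zero
    almost everywhere. *)
Lemma ac_linear_ode F w x : absolutely_continuous 0 pi F -> 0 <= x -> x <= pi ->
  {ae mu, forall t, t \in `]0, x[ -> cder F t (w * F t)} -> F 0 = 0 -> F x = 0.
Proof.
move=> HF x0 xp Hd F0.
have : cexp (x%:C * - w) * F x = cexp (0%:C * - w) * F 0.
  apply: (@ac_constant R 0 x (fun t => cexp (t%:C * - w) * F t)) => //.
    by apply: acM; [exact: ac_cexp|exact: ac_sub HF].
  apply: aeS Hd => t Ht /Ht H; apply: (cder_eq (cderM (cder_cexp (- w) t) H)).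
  by move: (cexp _) => e; ring.
by rewrite F0 mulr0 => /eqP; rewrite mulf_eq0 (negbTE (cexp_neq0 _)) => /eqP.
Qed.

Variable a : R.
Hypothesis a0 : 0 < a.

Definition dirac z f h (Ep Em : R -> C) : Prop :=
  [/\ absolutely_continuous 0 pi Ep, absolutely_continuous 0 pi Em &
      {ae mu, forall x, x \in `]0, pi[ ->
        cder Ep x (- ('i * z) * Ep x - f x * Em (x - a)) /\
        cder Em x ('i * z * Em x - h x * Ep (x - a))}].

(** The method of steps: on an interval of length a the delayed terms are known to vanish from the
    preceding one, which leaves two decoupled linear equations. *)
Lemma dirac_zero z f h Ep Em : dirac z f h Ep Em ->
  {ae mu, forall x, x \in `]0, a[ -> f x = 0 /\ h x = 0} -> Ep 0 = 0 -> Em 0 = 0 ->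
  forall x, 0 <= x -> x <= pi -> Ep x = 0 /\ Em x = 0.
Proof.
move=> [Ap Am Hd] fh0 Ep0 Em0.
have key n (x : R) : 0 <= x -> x <= pi -> x <= n%:R * a -> Ep x = 0 /\ Em x = 0.
  elim: n x => [|n IH] x x0 xp.
    by rewrite mul0r => xn; have -> : x = 0 by apply/eqP; rewrite eq_le xn.
  rewrite -natr1 mulrDl mul1r => xn.
  have Z (t : R) : t \in `]0, x[ -> a <= t -> Ep (t - a) = 0 /\ Em (t - a) = 0.
    rewrite in_itv /= => /andP[t0 tx] ta; apply: IH; rewrite ?subr_ge0 // lerBlDr.
      by apply: le_trans (ltW tx) (le_trans xp _); rewrite lerDl ltW.
    exact: le_trans (ltW tx) xn.
  have ae2 := aeI Hd fh0.
  have sub (t : R) : t \in `]0, x[ -> t \in `]0, pi[.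
    by rewrite !in_itv /= => /andP[-> tx]; exact: lt_le_trans xp.
  split.
  - apply: (ac_linear_ode (w := - ('i * z)) Ap x0 xp _ Ep0); apply: aeS ae2 => t [Ht ft] tx.
    apply: (cder_eq (Ht (sub t tx)).1).
    have [ta|ta] := leP a t; first by rewrite (Z t tx ta).2 mulr0 subr0.
    by rewrite (ft _).1 ?mul0r ?subr0 // in_itv /= ta andbT; move: tx; rewrite in_itv /= => /andP[].
  - apply: (ac_linear_ode (w := 'i * z) Am x0 xp _ Em0); apply: aeS ae2 => t [Ht ft] tx.
    apply: (cder_eq (Ht (sub t tx)).2).
    have [ta|ta] := leP a t; first by rewrite (Z t tx ta).1 mulr0 subr0.
    by rewrite (ft _).2 ?mul0r ?subr0 // in_itv /= ta andbT; move: tx; rewrite in_itv /= => /andP[].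
move=> x x0 xp; pose n := (Num.truncn `|pi / a|).+1; apply: (key n) => //; apply: le_trans xp _.
by rewrite -ler_pdivrMr //; apply: le_trans (ler_norm _) _; apply/ltW; exact: truncnS_gt.
Qed.

(** Variation of constants for E' = - i z E - g with E 0 = c, when g vanishes on the negative
    axis. *)
Definition step z c g (x : R) : C :=
  cexp (x%:C * - ('i * z)) * (c - prim (fun t => cexp (t%:C * ('i * z)) * g t) x).

Lemma step_sol z c g : cL1 mu (fun t => cexp (t%:C * ('i * z)) * g t) ->
  absolutely_continuous 0 pi (step z c g) /\
  {ae mu, forall x, cder (step z c g) x (- ('i * z) * step z c g x - g x)}.
Proof.
move=> Lg; split.
  apply: acM; first exact: ac_cexp.
  apply: acB; last exact: prim_ac.
  by apply: (@ac_lip _ _ _ _ 0) => u v _ _ _; rewrite subrr normc0 mul0r.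
apply: aeS (prim_cder_ae Lg) => x Hx.
have := cderM (cder_cexp (- ('i * z)) x) (cderD (cder_cst c x) (cderM (cder_cst (- 1) x) Hx)).
rewrite (_ : (fun s : R => _) = step z c g); last first.
  by apply/funext => s; rewrite /step mulN1r.
move=> H; apply: (cder_eq H); rewrite /step.
have E : cexp (x%:C * - ('i * z)) * cexp (x%:C * ('i * z)) = 1.
  by rewrite -cexpD mulrN addrC subrr cexp0.
move: E; set e1 := cexp (x%:C * - _); set e2 := cexp (x%:C * ('i * z)); set P := prim _ _.
move: e1 e2 P => e1 e2 P E.
transitivity (- ('i * z) * (e1 * (c - P)) - e1 * e2 * g x); first by ring.
by rewrite E mul1r.
Qed.

(** Successive approximations of E+, where c and d are the values of E+ and E- at 0. Those of E-
    arise by exchanging the potentials and the initial values and replacing z by - z; one definition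
    covers both. *)
Definition sol0 z c (x : R) : C := cexp (x%:C * - ('i * z)) * c.
Definition sol1 z f c d : R -> C := step z c (fun t => f t * sol0 (- z) d (t - a)).
Definition sol2 z f h c d : R -> C := step z c (fun t => f t * sol1 (- z) h d c (t - a)).

(* The potentials vanish outside ]a, pi[, so that on [0, pi], where pi <= 3 a,
   two iterations from the free solution already give the solution. *)
Definition supported f : Prop := forall t, t \notin `]a, pi[ -> f t = 0.

Lemma supported_le f t : supported f -> t <= a -> f t = 0.
Proof. by move=> sf ta; apply: sf; rewrite in_itv /= negb_and -leNgt ta. Qed.

Lemma supported_ge f t : supported f -> pi <= t -> f t = 0.
Proof. by move=> sf ta; apply: sf; rewrite in_itv /= negb_and -!leNgt ta orbT. Qed.

Lemma supported_band f : supported f -> band f pi.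
Proof.
move=> sf; apply: band_supp => x xn; apply: sf; apply: contra xn; rewrite !in_itv /=.
by move=> /andP[ax xp]; rewrite (ltW xp) andbT (le_trans (ltW a0)) // ltW.
Qed.

Lemma supported_cL1 f : cL2 f -> supported f -> cL1 mu f.
Proof.
move=> Lf sf; apply: (cL2_cL1 Lf (a := 0) (b := pi)) => x xn; apply: sf; apply: contra xn.
rewrite !in_itv /= => /andP[ax xp].
by rewrite (ltW xp) andbT (le_trans (ltW a0)) // ltW.
Qed.

Lemma cexp_bound w (t r : R) : `|t| <= r -> normc (cexp (t%:C * w)) <= expR (r * normc w).
Proof.
move=> tr; rewrite normc_cexp ler_expR; apply: le_trans (ler_norm _) _; apply: le_trans (le_Re_normc _) _.
by rewrite normcM normcR ler_wpM2r ?normc_ge0.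
Qed.

Lemma supp_L1 w f (X : R -> C) (B : R) : cL1 mu f -> supported f -> rmeas X ->
  (forall t, `|2 * t - pi| <= pi -> normc (X t) <= B) ->
  cL1 mu (fun t => cexp (t%:C * w) * (f t * X t)).
Proof.
move=> Lf sf mX XB.
rewrite (_ : (fun t => _) = fun t => f t * (cexp (t%:C * w) * X t)); last first.
  by apply/funext => t; rewrite mulrCA.
apply: (band_L1 (B := expR (pi * normc w) * B) Lf (supported_band sf) _ _).1.
  by apply: cmeasM => //; exact: rmeas_cexp.
move=> t ht; rewrite normcM; apply: ler_pM; rewrite ?normc_ge0 ?XB // cexp_bound //.
by move: ht; rewrite !ler_norml => /andP[t0 tp]; apply/andP; split; lra.
Qed.

Lemma shift_bound (t : R) : `|2 * t - pi| <= pi -> `|t - a| <= pi + a.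
Proof.
have p0 : 0 <= pi :> R := pi_ge0 R; have a1 := a0.
by rewrite !ler_norml => /andP[t0 tp]; apply/andP; split; lra.
Qed.

Lemma rmeas_shift (X : R -> C) : rmeas X -> rmeas (fun t => X (t - a)).
Proof.
by move=> mX; have := @cmeas_aff R 1 (- a) X mX; under eq_fun do rewrite mul1r.
Qed.

Lemma sol0_L1 z w f d : cL1 mu f -> supported f ->
  cL1 mu (fun t => cexp (t%:C * w) * (f t * sol0 z d (t - a))).
Proof.
move=> Lf sf.
apply: (@supp_L1 w f (fun t => sol0 z d (t - a)) (expR ((pi + a) * normc (- ('i * z))) * normc d)) => //.
  apply: (@rmeas_shift (sol0 z d)); apply: cmeasM; [exact: rmeas_cexp|exact: cmeas_cst].
by move=> t /shift_bound ht; rewrite normcM ler_wpM2r ?normc_ge0 // cexp_bound.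
Qed.

Lemma sol1_L1 z w f h c d : cL1 mu f -> supported f -> cL1 mu h -> supported h ->
  cL1 mu (fun t => cexp (t%:C * w) * (f t * sol1 z h c d (t - a))).
Proof.
move=> Lf sf Lh sh; pose g t := cexp (t%:C * ('i * z)) * (h t * sol0 (- z) d (t - a)).
have Lg : cL1 mu g by apply: sol0_L1.
apply: (@supp_L1 w f (fun t => sol1 z h c d (t - a))
  (expR ((pi + a) * normc (- ('i * z))) * (normc c + nI mu g))) => //.
  apply: (@rmeas_shift (sol1 z h c d)); apply: cmeasM; first exact: rmeas_cexp.
  by apply: cmeasB; [exact: cmeas_cst|exact: prim_rmeas].
move=> t /shift_bound ht; rewrite /sol1 /step [normc (_ * (c - _))]normcM.
apply: ler_pM; rewrite ?normc_ge0 ?cexp_bound //.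
by apply: le_trans (le_normcD _ _) _; rewrite normcN lerD2l; exact: prim_le.
Qed.

Lemma sol1_sol0 z f c d x : supported f -> x <= a -> sol1 z f c d x = sol0 z c x.
Proof.
move=> sf xa; rewrite /sol1 /step prim_eq0 ?subr0 // => t tx.
by rewrite (supported_le sf) ?mul0r ?mulr0 // (le_trans tx).
Qed.

Lemma sol2_sol1 z f h c d x : supported h -> x <= 2 * a -> sol2 z f h c d x = sol1 z f c d x.
Proof.
move=> sh xa; rewrite /sol2 [sol1 z f c d x]/sol1 /step; congr (_ * (_ - _)); apply: prim_eq => t tx.
by rewrite sol1_sol0 //; lra.
Qed.

Lemma sol2_0 z f h c d : supported f -> sol2 z f h c d 0 = c.
Proof.
move=> sf; rewrite /sol2 /step mul0r cexp0 mul1r prim_eq0 ?subr0 // => t t0.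
by rewrite (supported_le sf) ?mul0r ?mulr0 // (le_trans t0) // ltW.
Qed.

(** For x <= pi the delayed argument x - a is at most 2 a, where the first and the second iterate
    coincide; the second iterate therefore satisfies the system itself. *)
Lemma sol2_dirac z f h c d : pi <= 3 * a -> cL1 mu f -> supported f -> cL1 mu h -> supported h ->
  dirac z f h (sol2 z f h c d) (sol2 (- z) h f d c).
Proof.
move=> pa Lf sf Lh sh.
have [A1 D1] := step_sol c (sol1_L1 (- z) ('i * z) d c Lf sf Lh sh).
have [A2 D2] := step_sol d (sol1_L1 (- - z) ('i * - z) c d Lh sh Lf sf).
split; [exact: A1|exact: A2|]; apply: aeS (aeI D1 D2) => x [H1 H2]; rewrite in_itv /= => /andP[x0 xp].
have xa : x - a <= 2 * a by lra.
split.
- by apply: (cder_eq H1); rewrite -/(sol2 z f h c d) [sol2 (- z) h f d c (x - a)]sol2_sol1.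
- by apply: (cder_eq H2); rewrite -/(sol2 (- z) h f d c) [sol2 z f h c d (x - a)]sol2_sol1 // opprK mulrN opprK.
Qed.

Definition corr f h (t : R) : C := cI mu (fun s => f (t + s) * h s).

Lemma sol2_pi z f h : cL1 mu f -> supported f -> cL1 mu h -> supported h ->
  let X t := cI mu (fun s => cut `]-oo, (t - a)]%classic (fun s => h s * kern z (t - s)) s) in
  [/\ cL1 mu (fun t => f t * kern z (t - a / 2)), cL1 mu (fun t => f t * X t) &
  sol2 z f h 1 1 pi = cexp (- ('i * pi%:C * z)) -
    cI mu (fun t => f t * kern z (t - a / 2)) + cI mu (fun t => f t * X t)].
Proof.
move=> Lf sf Lh sh X; pose e : C := cexp (- ('i * pi%:C * z)).
have e0 : e != 0 by exact: cexp_neq0.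
have L0 := cL1Z e (sol0_L1 (- z) ('i * z) 1 Lf sf).
have L1 := cL1Z e (sol1_L1 (- z) ('i * z) 1 1 Lf sf Lh sh).
(* The phase collected by a wave that meets the potential at t: the frequencies - pi, t and t - a
   add up to 2 (t - a / 2) - pi. *)
have K t : kern z (t - a / 2) = e * cexp (t%:C * ('i * z)) * cexp ((t - a)%:C * - ('i * - z)).
  rewrite /kern /e -!cexpD; congr cexp; rewrite /freq (_ : 2 * (t - a / 2) - pi = t + (t - a) - pi); last by field.
  by rewrite rmorphB rmorphD; ring.
have K2 t s : kern z (t - s) =
    kern z (t - a / 2) * (cexp (s%:C * ('i * - z)) * cexp ((s - a)%:C * - ('i * - - z))).
  rewrite (K t) /kern /e -!cexpD; congr cexp.
  rewrite /freq (_ : 2 * (t - s) - pi = t + t - s - s - pi); last by ring.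
  by rewrite !rmorphB rmorphD; ring.
have E0 t : e * (cexp (t%:C * ('i * z)) * (f t * sol0 (- z) 1 (t - a))) = f t * kern z (t - a / 2).
  by rewrite (K t) /sol0 mulr1 mulrCA [RHS]mulrC; ring.
have E1 t : e * (cexp (t%:C * ('i * z)) * (f t * sol1 (- z) h 1 1 (t - a))) =
    f t * kern z (t - a / 2) - f t * X t.
  pose G s := cexp (s%:C * ('i * - z)) * (h s * sol0 (- - z) 1 (s - a)).
  have LG : cL1 mu (cut `]-oo, (t - a)]%classic G).
    by apply: cL1_cut; [exact: measurable_itv|apply: sol0_L1].
  have -> : X t = kern z (t - a / 2) * prim G (t - a).
    rewrite /prim -cIZ //; congr cI; apply/funext => s; rewrite !cutE; case: (s \in _); last by rewrite mulr0.
    by rewrite /G /sol0 mulr1 (K2 t s); ring.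
  have -> : sol1 (- z) h 1 1 (t - a) = cexp ((t - a)%:C * - ('i * - z)) * (1 - prim G (t - a)) by [].
  by rewrite (K t); ring.
have L0' : cL1 mu (fun t => f t * kern z (t - a / 2)).
  by move: L0; under eq_fun do rewrite E0.
have L1' : cL1 mu (fun t => f t * kern z (t - a / 2) - f t * X t).
  by move: L1; under eq_fun do rewrite E1.
have LX : cL1 mu (fun t => f t * X t).
  by have := cL1B L0' L1'; under eq_fun do rewrite subKr.
split=> //; rewrite /sol2 /step prim_full; last first.
  by move=> t /ltW tp; rewrite (supported_ge sf tp) mul0r mulr0.
have -> : pi%:C * - ('i * z) = - ('i * pi%:C * z) by ring.
rewrite -/e mulrBr mulr1 -addrA; congr (_ + _); rewrite -cIZ; last exact: sol1_L1.
rewrite (_ : (fun t => e * _) = fun t => f t * kern z (t - a / 2) - f t * X t); last exact/funext/E1.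
by rewrite cIB // opprB addrC.
Qed.

Local Notation TR := (measurableTypeR R).

Lemma cfubini_bound (F : TR * TR -> C) (G : R -> R) : cmeas F ->
  (forall x, cL1 mu (fun y => F (x, y))) -> (forall y, cL1 mu (fun x => F (x, y))) ->
  mu.-integrable setT (fun x => (G x)%:E) -> (forall x, nI mu (fun y => F (x, y)) <= G x) ->
  cL1 mu (fun y => cI mu (fun x => F (x, y))) /\
  cI mu (fun x => cI mu (fun y => F (x, y))) = cI mu (fun y => cI mu (fun x => F (x, y))).
Proof.
move=> mF H1 H2 IG FG.
have lt : (\int[mu]_x \int[mu]_y (normc (F (x, y)))%:E < +oo)%E.
  apply: (@le_lt_trans _ _ (\int[mu]_x (G x)%:E)%E); last first.
    by have := integrable_fin_num measurableT IG; rewrite fin_numE => /andP[_]; rewrite -ltey.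
  apply: ge0_le_integral => //.
  - by move=> x _; apply: integral_ge0 => y _; rewrite lee_fin normc_ge0.
  - apply: (@measurable_fun_fubini_tonelli_F _ _ _ _ _ mu (fun p => (normc (F p))%:E)).
      by apply/measurable_EFinP; exact: cmeas_norm.
    by move=> p; rewrite lee_fin normc_ge0.
  - exact: measurable_int IG.
  - move=> x _; rewrite -(@fineK _ (\int[mu]_y (normc (F (x, y)))%:E)%E) ?lee_fin //; first exact: FG.
    exact: (integrable_fin_num measurableT (cL1_norm (H1 x))).
by have [_ _ h1 h2] := cfubini mF H1 H2 lt.
Qed.

Lemma cmeas_comp d (T : measurableType d) (f : R -> C) (g : T -> TR) :
  rmeas f -> measurable_fun setT g -> cmeas (fun x => f (g x)).
Proof. by move=> [m1 m2] mg; split; [exact: (measurableT_comp m1)|exact: (measurableT_comp m2)]. Qed.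

(** The order of integration is exchanged twice, with the translation t to t + s in between; [F1]
    and [F2] are the integrands before and after it. *)
Lemma corr_fubini f h (Phi : R -> C) (M : R) : cL2 f -> cL2 h -> supported f -> supported h ->
  rmeas Phi -> (forall t, normc (Phi t) <= M) ->
  cL1 mu (fun t => Phi t * corr f h t) /\
  cI mu (fun t => f t * cI mu (fun s => h s * Phi (t - s))) = cI mu (fun t => Phi t * corr f h t).
Proof.
move=> Lf Lh sf sh mP PM.
have Lf1 := supported_cL1 Lf sf; have Lh1 := supported_cL1 Lh sh.
have mf := cL1_meas Lf1; have mh := cL1_meas Lh1.
have M0 : 0 <= M by apply: le_trans (normc_ge0 _) (PM 0).
have m1 : measurable_fun setT (fun p : TR * TR => p.1) by exact: measurable_fst.
have m2 : measurable_fun setT (fun p : TR * TR => p.2) by exact: measurable_snd.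
have mB (c : R) : measurable_fun setT (fun s : TR => c - s : TR) by apply: measurable_funB.
have mB' (c : R) : measurable_fun setT (fun s : TR => s - c : TR) by apply: measurable_funB.
have shift (g : R -> C) (c : R) : cL1 mu g -> cL1 mu (fun s => g (s + c)) /\ nI mu (fun s => g (s + c)) = nI mu g.
  move=> Lg; have H := @cL1_aff R 1 c (or_introl (erefl 1)) g Lg.
  have H2 := (@integral_aff R 1 c (or_introl (erefl 1)) _ (cL1_norm Lg)).2.
  by split; [move: H; under eq_fun do rewrite mul1r|move: H2; under eq_Rintegral do rewrite mul1r].
have dom (k X : R -> C) (B : R) : cL1 mu k -> rmeas X -> (forall t, normc (X t) <= B * normc (k t)) ->
    cL1 mu X /\ nI mu X <= B * nI mu k.
  move=> Lk mX XB; have Ig := integrable_realZ B (cL1_norm Lk).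
  have LX : cL1 mu X by apply: cL1_dom mX Ig XB.
  split=> //; apply: le_trans (nI_le LX Ig XB) _.
  by rewrite RintegralZl //; exact: cL1_norm.
pose F1 (p : TR * TR) : C := f p.1 * h p.2 * Phi (p.1 - p.2).
pose F2 (p : TR * TR) : C := f (p.2 + p.1) * h p.1 * Phi p.2.
have mF1 : cmeas F1.
  apply: cmeasM; first by apply: cmeasM; [exact: (cmeas_comp mf m1)|exact: (cmeas_comp mh m2)].
  by apply: (cmeas_comp mP); apply: measurable_funB.
have mF2 : cmeas F2.
  apply: cmeasM; last exact: (cmeas_comp mP m2).
  apply: cmeasM; last exact: (cmeas_comp mh m1).
  by apply: (cmeas_comp mf); apply: measurable_funD.
have S1 t : cL1 mu (fun s => F1 (t, s)) /\ nI mu (fun s => F1 (t, s)) <= normc (f t) * M * nI mu h.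
  apply: (dom h) => // [|s].
    apply: cmeasM; first by apply: cmeasM; [exact: (@cmeas_cst _ _ TR (f t))|exact: mh].
    exact: (cmeas_comp mP (mB t)).
  by rewrite /F1 /= !normcM mulrAC ler_wpM2r ?normc_ge0 // ler_wpM2l ?normc_ge0.
have S1' s : cL1 mu (fun t => F1 (t, s)).
  apply: (dom f _ (normc (h s) * M) _ _ _).1 => // [|t].
    apply: cmeasM; first by apply: cmeasM; [exact: mf|exact: (@cmeas_cst _ _ TR (h s))].
    exact: (cmeas_comp mP (mB' s)).
  rewrite /F1 /= !normcM -mulrA mulrC ler_wpM2r ?normc_ge0 // ler_wpM2l ?normc_ge0 //.
have S2 s : cL1 mu (fun t => F2 (s, t)) /\ nI mu (fun t => F2 (s, t)) <= normc (h s) * M * nI mu f.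
  have [L1s nIs] := shift f s Lf1; rewrite -nIs; apply: (dom _ _ _ L1s) => [|t].
    apply: cmeasM; last exact: mP.
    by apply: cmeasM; [exact: (cL1_meas L1s)|exact: (@cmeas_cst _ _ TR (h s))].
  by rewrite /F2 /= !normcM -mulrA mulrC ler_wpM2r ?normc_ge0 // ler_wpM2l ?normc_ge0.
have S2' t : cL1 mu (fun s => F2 (s, t)).
  have Lt : cL2 (fun s => f (t + s)).
    have := @cL2_aff R 1 t f (or_introl (erefl 1)) Lf.
    by under eq_fun do rewrite mul1r addrC.
  by have := cL1Z (Phi t) (cL2_prod Lt Lh).1; under eq_fun do rewrite mulrC.
have IG1 : mu.-integrable setT (fun t => (normc (f t) * M * nI mu h)%:E).
  have := integrable_realZ (M * nI mu h) (cL1_norm Lf1).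
  by apply: eq_integrable => // t _; rewrite mulrC mulrA.
have IG2 : mu.-integrable setT (fun t => (normc (h t) * M * nI mu f)%:E).
  have := integrable_realZ (M * nI mu f) (cL1_norm Lh1).
  by apply: eq_integrable => // t _; rewrite mulrC mulrA.
have [_ EA] := cfubini_bound mF1 (fun t => (S1 t).1) S1' IG1 (fun t => (S1 t).2).
have [LB EB] := cfubini_bound mF2 (fun t => (S2 t).1) S2' IG2 (fun t => (S2 t).2).
have corrE t : cI mu (fun s => F2 (s, t)) = Phi t * corr f h t.
  have Lt : cL2 (fun s => f (t + s)).
    have := @cL2_aff R 1 t f (or_introl (erefl 1)) Lf.
    by under eq_fun do rewrite mul1r addrC.
  rewrite /corr -cIZ; last exact: (cL2_prod Lt Lh).1.
  by congr cI; apply/funext => s; rewrite /F2 /= mulrC.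
split.
  by move: LB; under eq_fun do rewrite corrE.
have -> : (fun t => f t * cI mu (fun s => h s * Phi (t - s))) = (fun t => cI mu (fun s => F1 (t, s))).
  apply/funext => t; rewrite -cIZ.
    by congr cI; apply/funext => s; rewrite /F1 /= mulrA.
  have mX : rmeas (fun s => h s * Phi (t - s)).
    by apply: cmeasM; [exact: mh|exact: (cmeas_comp mP (mB t))].
  have XB s : normc (h s * Phi (t - s)) <= M * normc (h s) by rewrite normcM mulrC ler_wpM2r ?normc_ge0.
  exact: (dom h _ M Lh1 mX XB).1.
rewrite EA; have -> : (fun s => cI mu (fun t => F1 (t, s))) = (fun s => cI mu (fun t => F2 (s, t))).
  apply/funext => s; rewrite -(@cI_aff R 1 s (or_introl (erefl 1)) _ (S1' s)).
  by congr cI; apply/funext => t; rewrite /F1 /F2 /= mul1r addrK.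
by rewrite EB; congr cI; apply/funext => t; rewrite corrE.
Qed.

(* Both E+ (pi) and, after exchanging the potentials and replacing z by - z,
   E- (pi) are of this form, with a density supported in [a / 2, pi - a / 2]. *)
Definition Wfun f h (t : R) : C := cut `[a, pi]%classic (corr f h) t - f (t + a / 2).

Lemma sol2_FT z f h : cL2 f -> cL2 h -> supported f -> supported h ->
  [/\ cL1 mu (Wfun f h), band (Wfun f h) (pi - a) &
  sol2 z f h 1 1 pi = cexp (- ('i * pi%:C * z)) + FT (Wfun f h) z].
Proof.
move=> Lf Lh sf sh; have pi0 := pi_gt0 R; have a1 := a0.
have Lf1 := supported_cL1 Lf sf; have Lh1 := supported_cL1 Lh sh.
have Ls : cL1 mu (fun t => f (t + a / 2)).
  by have := @cL1_aff R 1 (a / 2) (or_introl (erefl 1)) f Lf1; under eq_fun do rewrite mul1r.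
pose D : set R := `[a, pi]%classic.
have LC : cL1 mu (cut D (corr f h)).
  have := (@corr_fubini f h (fun t => (\1_D t)%:C) 1 Lf Lh sf sh _ _).1; apply.
    by apply: cmeas_indic; exact: measurable_itv.
  exact: normc_indic_le1.
have LW : cL1 mu (Wfun f h) by apply: cL1B.
have bW : band (Wfun f h) (pi - a).
  move=> t; rewrite /Wfun => Wt; rewrite ler_norml.
  have [ft|ft] := eqVneq (f (t + a / 2)) 0; last first.
    have : t + a / 2 \in `]a, pi[ by apply: contraNT ft => /sf ->.
    by rewrite in_itv /= => /andP[h1 h2]; apply/andP; split; lra.
  move: Wt; rewrite ft subr0 cutE; case: ifPn => [|_]; last by rewrite eqxx.
  rewrite mem_setE in_itv /= => /andP[at' tp] ct.
  have [tpa|tpa] := leP t (pi - a); first by apply/andP; split; lra.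
  (* For t > pi - a the correlation is empty: h requires s > a, and then t + s exceeds pi. *)
  case/eqP: ct; rewrite /corr -[RHS](cI0 mu); congr cI; apply/funext => s.
  have [sa|sa] := leP s a; first by rewrite (supported_le sh sa) mulr0.
  by rewrite (supported_ge sf) ?mul0r //; lra.
split=> //; have [L0 LX ->] := sol2_pi z Lf1 sf Lh1 sh.
rewrite -addrA; congr (_ + _).
(* Cutting the kernel at t - s >= a reproduces the limit s <= t - a of the inner integral and bounds
   the kernel. *)
pose Phi := cut D (kern z); pose M := expR (pi * `|complex.Im z|).
have mP : rmeas Phi by apply: cmeas_cut; [exact: measurable_itv|exact: rmeas_kern].
have PM t : normc (Phi t) <= M.
  rewrite /Phi cutE; case: ifPn => [|_]; last by rewrite normc0 expR_ge0.
  rewrite mem_setE in_itv /= => /andP[at' tp]; apply: normc_kern.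
  by rewrite ler_norml; apply/andP; split; lra.
have [LP EP] := corr_fubini Lf Lh sf sh mP PM.
have -> : (fun t => f t * cI mu (fun s => cut `]-oo, (t - a)]%classic (fun s => h s * kern z (t - s)) s)) =
    (fun t => f t * cI mu (fun s => h s * Phi (t - s))).
  apply/funext => t; have [ft|ft] := eqVneq (f t) 0; first by rewrite ft !mul0r.
  have tp : t < pi by rewrite ltNge; apply: contra ft => /(supported_ge sf) ->.
  congr (_ * _); congr cI; apply/funext => s.
  have [hs|hs] := eqVneq (h s) 0.
    by rewrite cutE hs !mul0r if_same.
  have sa : a < s by rewrite ltNge; apply: contra hs => /(supported_le sh) ->.
  rewrite cutE /Phi cutE !mem_setE !in_itv /=.
  have -> : (t - s <= pi) = true by lra.
  have -> : (a <= t - s) = (s <= t - a) by apply/idP/idP => ?; lra.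
  by rewrite andbT; case: ifP; rewrite ?mulr0.
rewrite EP.
have -> : cI mu (fun t => f t * kern z (t - a / 2)) = cI mu (fun t => f (t + a / 2) * kern z t).
  rewrite -(@cI_aff R 1 (a / 2) (or_introl (erefl 1)) _ L0); congr cI; apply/funext => t.
  by rewrite mul1r addrK.
have L2 := (band_L1 Ls (r := pi) (B := M) (X := kern z) _ (rmeas_kern z) (fun t tp => normc_kern z tp)).1.
have EW t : Phi t * corr f h t - f (t + a / 2) * kern z t = Wfun f h t * kern z t.
  rewrite /Wfun [RHS]mulrBl; congr (_ - _); rewrite /Phi !cutE; case: (t \in D); first exact: mulrC.
  by rewrite !mul0r.
have Lk : cL1 mu (fun t => f (t + a / 2) * kern z t).
  apply: L2 => t ft; have : t + a / 2 \in `]a, pi[ by apply: contraNT ft => /sf ->.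
  by rewrite in_itv /= ler_norml => /andP[h1 h2]; apply/andP; split; lra.
rewrite addrC -(cIB LP Lk) /FT; congr cI; apply/funext => t; exact: EW.
Qed.

End DelaySystem.

(** * Multiplicities of zeros *)

Section ZeroOrders.
Context {R : realType}.
Local Notation C := R[i].
Local Notation mu := (@lebesgue_measure R).
Local Notation rmeas := (@cmeas R _ (measurableTypeR R)).
Implicit Types (z w : C) (D : nat -> C -> C).

(** Multiplicities expressed through an explicit family of derivatives; for a Taylor family this
    agrees with [zeros_with_multiplicity]. *)
Definition orders D (lam : int -> C) : Prop := forall z, exists m : nat,
  ((forall k, (k < m)%N -> D k z = 0) /\ D m z != 0) /\ ([set n : int | lam n = z] #= `I_m)%card.

Lemma orders_zeros D lam : taylor_family D ->
  zeros_with_multiplicity (D 0) lam <-> orders D lam.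
Proof.
move=> HD; split=> H z; have [m Hm] := H z; exists m; move: Hm.
- move=> [[h1 h2] h3]; split=> //; split; last by rewrite -(taylor_family_derive1n m z HD).
  by move=> k km; rewrite -(taylor_family_derive1n k z HD) h1.
- move=> [[h1 h2] h3]; split=> //; split; last by rewrite (taylor_family_derive1n m z HD).
  by move=> k km; rewrite (taylor_family_derive1n k z HD) h1.
Qed.

Lemma taylor_family_shift D (c s : C) : taylor_family D -> taylor_family (fun k z => c * D k (z + s)).
Proof.
move=> HD; apply: (taylor_familyZ c (D := fun k z => D k (z + s))) => k z.
by have [B HB] := HD k (z + s); exists B => n h; rewrite -addrA.
Qed.

Lemma orders_shift D lam (c s : C) : c != 0 -> orders D lam ->
  orders (fun k z => c * D k (z + s)) (fun n => lam n - s).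
Proof.
move=> c0 H z; have [m [[h1 h2] h3]] := H (z + s); exists m; split; first split.
- by move=> k /h1 ->; rewrite mulr0.
- by rewrite mulf_neq0.
- rewrite (_ : [set n | lam n - s = z] = [set n | lam n = z + s]) //.
  by apply/seteqP; split=> n /=; [move=> <-; rewrite subrK|move=> ->; rewrite addrK].
Qed.

Section Delta11Orders.
Variables (kap lam : int -> C) (A : R).
Hypothesis HA : forall n, \sum_(j < n) normc (kap (zn j)) ^+ 2 <= A.
Hypothesis lamE : forall n, lam n = n%:~R + kap n.

Lemma card_seq_set (X : set int) (t : seq int) : uniq t -> (forall n, X n <-> n \in t) ->
  (X #= `I_(size t))%card.
Proof.
move=> ut Xt; apply/card_set_bijP; exists (fun n => index n t); split.
- by move=> n /Xt nt /=; rewrite index_mem.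
- move=> i j /set_mem/Xt it /set_mem/Xt jt ij.
  by rewrite -(nth_index 0 it) ij nth_index.
- move=> i /= it; exists (nth 0 t i); last exact: index_uniq.
  by apply/Xt; exact: mem_nth.
Qed.

(** Near z the product is (w - z) to the number of indices with lam n = z, times a continuous
    function that is nonzero at z; [taylor_family_order] reads off the order. *)
Lemma Delta11_orders D : taylor_family D -> (forall z, D 0 z = Delta11 lam z) -> orders D lam.
Proof.
move=> HD DE z.
pose M := (Num.truncn `|normc z + 1 + A|).+1.
have far n : (M <= `|n|)%N -> lam n != z.
  move=> Mn; apply/eqP => nz; have : normc z < normc (lam n).
    apply: (lam_large HA lamE); apply: le_lt_trans (ler_norm _) _; apply: lt_le_trans (truncnS_gt _) _.
    by rewrite ler_nat.
  by rewrite nz ltxx.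
pose t := [seq zn j | j <- iota 0 M.*2.+1 & lam (zn j) == z].
have ut : uniq t by rewrite map_inj_uniq ?filter_uniq ?iota_uniq //; exact: zn_inj.
have Xt n : [set n | lam n = z] n <-> n \in t.
  split=> /= [nz|/mapP[j]]; last by rewrite mem_filter => /andP[/eqP h _] ->.
  have nM : (`|n| < M)%N by rewrite ltnNge; apply/negP => /far; rewrite nz eqxx.
  apply/mapP; exists (znv n); last by rewrite znvK.
  rewrite mem_filter znvK nz eqxx mem_iota /= add0n; move: nM; rewrite /znv.
  by case: n {nz} => [[|k]|k] //=; rewrite -?addnn; lia.
exists (size t); split; last exact: card_seq_set ut Xt.
pose c : C := - pi%:C * \prod_(j < M) (- (j.+1%:R ^+ 2))^-1.
have c0 : c != 0 by exact: Delta11_factor_neq0.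
pose rest w := c * \prod_(j <- iota 0 M.*2.+1 | lam (zn j) != z) (w - lam (zn j)).
have er : ent rest.
  move=> rho; apply: apxM.
    by apply: apx_eq (apx_poly c%:P rho) => w _; rewrite hornerC.
  apply: apx_eq (apx_poly (\prod_(j <- iota 0 M.*2.+1 | lam (zn j) != z) ('X - (lam (zn j))%:P)) rho) => w _.
  by rewrite horner_prod; apply: eq_bigr => j _; rewrite hornerXsubC.
apply: (@taylor_family_order R D z (size t) (fun w => rest w * tail_prod lam M w)
  (rest z * tail_prod lam M z)) => //.
- move=> w; rewrite DE (Delta11_factor HA lamE M) -/c.
  rewrite (bigID (fun j => lam (zn j) == z)) /= /rest.
  have -> : \prod_(j <- iota 0 M.*2.+1 | lam (zn j) == z) (w - lam (zn j)) = (w - z) ^+ size t.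
    rewrite (eq_bigr (fun=> w - z)) => [|j /eqP -> //].
    by rewrite big_const_seq /t size_map size_filter iter_mulr_1.
  ring.
- exact: (cvgcM (ent_continuous rest z er) (tail_prod_continuous HA lamE M z)).
- apply: mulf_neq0.
    apply: mulf_neq0; first exact: c0.
    by rewrite prodf_seq_neq0; apply/allP => j _; apply/implyP; rewrite subr_eq0 eq_sym.
  by apply: (tail_prod_neq0 HA lamE) => k Mk; split; apply: far; rewrite ?abszN absz_nat; exact: ltnW.
Qed.

End Delta11Orders.

Lemma FT_refl (V : R -> C) (z : C) : cL1 mu V -> band V pi ->
  [/\ cL1 mu (fun t => V (pi - t)), band (fun t => V (pi - t)) pi & FT (fun t => V (pi - t)) z = FT V (- z)].
Proof.
move=> LV bV; have E (g : R -> C) : (fun t => g (-1 * t + pi)) = (fun t => g (pi - t)).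
  by apply/funext => t; congr g; ring.
split.
- by have := @cL1_aff R (-1) pi (or_intror (erefl (-1))) V LV; rewrite E.
- by move=> t /bV; rewrite !ler_norml => /andP[h1 h2]; apply/andP; split; lra.
- have Lk := (band_L1 LV bV (rmeas_kern (- z)) (fun t tp => normc_kern (- z) tp)).1.
  rewrite /FT -(@cI_aff R (-1) pi (or_intror (erefl (-1))) _ Lk).
  congr cI; apply/funext => t; rewrite (_ : -1 * t + pi = pi - t); last by ring.
  rewrite /kern /freq (_ : 2 * (pi - t) - pi = - (2 * t - pi)); last by ring.
  by rewrite rmorphN; congr (_ * cexp _); ring.
Qed.

Lemma FT_type (V : R -> C) (r : R) : 0 <= r -> cL1 mu V -> band V r -> (exponential_type (FT V) <= r%:E)%E.
Proof.
move=> r0 LV bV; apply: ereal_inf_lbound; exists r => //; exists (nI mu V) => z.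
apply: le_trans (FT_bound _ LV bV) _; rewrite ler_wpM2l ?nI_ge0 // ler_expR ler_wpM2l //.
exact: le_Im_normc.
Qed.

End ZeroOrders.

(** * Densities of the two characteristic functions *)

Section Characteristic.
Context {R : realType}.
Local Notation C := R[i].
Local Notation mu := (@lebesgue_measure R).
Local Notation rmeas := (@cmeas R _ (measurableTypeR R)).
Variable a : R.
Hypothesis ha : 2 * pi / 5 <= a.

Lemma a_gt0 : 0 < a.
Proof. by apply: lt_le_trans ha; rewrite divr_gt0 // mulr_gt0 // pi_gt0. Qed.

Lemma pi_le3a : pi <= 3 * a.
Proof. by move: ha; have := pi_gt0 R; lra. Qed.

(** Mirrors y_1 = (E+ - E-) / (2 i), and [dens2] mirrors y_2 = (E+ + E-) / 2. Replacing z by - z in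
    E- amounts to reflecting its density at pi / 2. *)
Definition dens1 f h (t : R) : C := (2 * 'i)^-1 * (Wfun a f h t - Wfun a h f (pi - t)).
Definition dens2 f h (t : R) : C := 2^-1 * (Wfun a f h t + Wfun a h f (pi - t)).

Lemma sol2_char f h : cL2 f -> cL2 h -> supported a f -> supported a h ->
  [/\ cL1 mu (dens1 f h), band (dens1 f h) (pi - a), cL1 mu (dens2 f h), band (dens2 f h) (pi - a) &
  forall z, (sol2 a z f h 1 1 pi - sol2 a (- z) h f 1 1 pi) / (2 * 'i) =
      char_like (- (2 * 'i)^-1) (2 * 'i)^-1 (dens1 f h) 0 z /\
    (sol2 a z f h 1 1 pi + sol2 a (- z) h f 1 1 pi) / 2 = char_like 2^-1 2^-1 (dens2 f h) 0 z].
Proof.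
move=> Lf Lh sf sh; have a0 := a_gt0.
have [Lp bp _] := sol2_FT a0 0 Lf Lh sf sh; have [Lm bm _] := sol2_FT a0 0 Lh Lf sh sf.
have pa : pi - a <= pi by rewrite gerBl ltW.
have bm' := band_le pa bm; have bp' := band_le pa bp.
have [Lr br _] := FT_refl 0 Lm bm'.
have brr : band (fun t => Wfun a h f (pi - t)) (pi - a).
  by move=> t /bm; rewrite !ler_norml => /andP[h1 h2]; apply/andP; split; lra.
have or_band (V W : R -> C) (c d : C) : band V (pi - a) -> band W (pi - a) ->
    band (fun t => c * (V t + d * W t)) (pi - a).
  move=> bV bW t; have [Vt|/bV //] := eqVneq (V t) 0.
  by have [Wt|/bW //] := eqVneq (W t) 0; rewrite Vt Wt mulr0 addr0 mulr0 eqxx.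
split.
- exact/cL1Z/cL1B.
- by have := or_band _ _ (2 * 'i)^-1 (-1) bp brr; congr band; apply/funext => t; rewrite mulN1r.
- exact/cL1Z/cL1D.
- by have := or_band _ _ 2^-1 1 bp brr; congr band; apply/funext => t; rewrite mul1r.
- move=> z; have [_ _ ->] := sol2_FT a0 z Lf Lh sf sh; have [_ _ ->] := sol2_FT a0 (- z) Lh Lf sh sf.
  have [_ _ Fr] := FT_refl z Lm bm'; rewrite !char_like0 -Fr.
  have LD := cL1D Lp Lr; have LB := cL1D Lp (cL1Z (-1) Lr).
  have bD : band (fun t => Wfun a f h t + Wfun a h f (pi - t)) pi.
    by apply: band_le pa _; have := or_band _ _ 1 1 bp brr; congr band; apply/funext => t; rewrite !mul1r.
  have bB : band (fun t => Wfun a f h t + -1 * Wfun a h f (pi - t)) pi.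
    by apply: band_le pa _; have := or_band _ _ 1 (-1) bp brr; congr band; apply/funext => t; rewrite !mul1r.
  have bN : band (fun t => -1 * Wfun a h f (pi - t)) pi.
    by move=> t; rewrite mulN1r oppr_eq0; exact: br.
  have F2 : FT (dens2 f h) z = 2^-1 * (FT (Wfun a f h) z + FT (fun t => Wfun a h f (pi - t)) z).
    by rewrite /dens2 (FT_scale _ _ LD bD) FT_add.
  have F1 : FT (dens1 f h) z = (2 * 'i)^-1 * (FT (Wfun a f h) z - FT (fun t => Wfun a h f (pi - t)) z).
    rewrite (_ : dens1 f h = fun t => (2 * 'i)^-1 * (Wfun a f h t + -1 * Wfun a h f (pi - t))).
      by rewrite (FT_scale _ _ LB bB) FT_add ?(FT_scale _ _ Lr br) ?mulN1r //; exact: cL1Z.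
    by apply/funext => t; rewrite mulN1r.
  rewrite F1 F2 mulrN opprK.
  have i0 : 'i != 0 :> C by rewrite neq0Ci.
  have -> : - ('i * pi%:C) * z = - ('i * pi%:C * z) by ring.
  move: (cexp _) (cexp _) (FT _ _) (FT _ _) => e1 e2 x y.
  by split; ring.
Qed.

End Characteristic.

(** * From the matrix system to the diagonalised one *)

Section Solutions.
Context {R : realType}.
Local Notation C := R[i].
Local Notation mu := (@lebesgue_measure R).
Local Notation rmeas := (@cmeas R _ (measurableTypeR R)).
Variable a : R.
Hypothesis ha : 2 * pi / 5 <= a.

Lemma dirac_sub z (f h Ep Em Ep' Em' : R -> C) : dirac a z f h Ep Em -> dirac a z f h Ep' Em' ->
  dirac a z f h (fun x => Ep x - Ep' x) (fun x => Em x - Em' x).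
Proof.
move=> [A1 A2 H] [B1 B2 H']; split; [exact: acB|exact: acB|].
apply: aeS (aeI H H') => x [K K'] xp; have [k1 k2] := K xp; have [k1' k2'] := K' xp.
have sub (F G : R -> C) (d e : C) : cder F x d -> cder G x e -> cder (fun s => F s - G s) x (d - e).
  move=> dF dG; have := cderD dF (cderM (cder_cst (-1) x) dG).
  rewrite (_ : (fun s : R => F s + -1 * G s) = fun s => F s - G s); last by apply/funext => s; rewrite mulN1r.
  by move=> H1; apply: (cder_eq H1); ring.
split.
- by apply: (cder_eq (sub _ _ _ _ k1 k1')); ring.
- by apply: (cder_eq (sub _ _ _ _ k2 k2')); ring.
Qed.

Lemma ord2_cases (k : 'I_2) : k = 0 \/ k = 1.
Proof. by case: k => -[|[|//]] H; [left|right]; apply/val_inj. Qed.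

Lemma inord0 : inord 0 = 0 :> 'I_2. Proof. by apply/val_inj; rewrite /= inordK. Qed.
Lemma inord1 : inord 1 = 1 :> 'I_2. Proof. by apply/val_inj; rewrite /= inordK. Qed.

Lemma dirac_entries (q p : R -> C) (x : R) (X Z W : 'M[C]_2) (z : C) :
  Bmx *m X + Qmx q p x *m Z = z *: W <-> forall l,
  X 1 l + (q x * Z 0 l + p x * Z 1 l) = z * W 0 l /\
  - X 0 l + (p x * Z 0 l - q x * Z 1 l) = z * W 1 l.
Proof.
have e k l : (Bmx *m X + Qmx q p x *m Z) k l =
    (if k == 0 then X 1 l + (q x * Z 0 l + p x * Z 1 l) else - X 0 l + (p x * Z 0 l - q x * Z 1 l)).
  rewrite !mxE !big_ord_recl !big_ord0 !mxE /=.
  have -> : lift ord0 ord0 = 1 :> 'I_2 by apply/val_inj.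
  by case: (ord2_cases k) => ->; rewrite /= ?eqxx; ring.
split=> [H l|H].
  by have h0 := congr1 (fun M : 'M[C]_2 => M 0 l) H; have h1 := congr1 (fun M : 'M[C]_2 => M 1 l) H;
    move: h0 h1; rewrite !e !mxE.
apply/matrixP => k l; rewrite e mxE; have [h0 h1] := H l.
by case: (ord2_cases k) => -> /=.
Qed.

Lemma cder_derive (y : R -> C) x : derivable_cplx y x -> cder y x (derive_cplx y x).
Proof.
by move=> [h1 h2]; split; rewrite /derive_cplx /= derive1E; [exact: (DeriveDef h1)|exact: (DeriveDef h2)].
Qed.

Lemma fundamental_dirac (q p : R -> C) Y z l : fundamental_solution a q p Y ->
  dirac a z (fun x => p x + 'i * q x) (fun x => p x - 'i * q x)
    (fun x => Y z x 1 l + 'i * Y z x 0 l) (fun x => Y z x 1 l - 'i * Y z x 0 l).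
Proof.
move=> /(_ z)[AC Y0 H]; have ii : 'i * 'i = -1 :> C by rewrite -expr2 sqrCi.
split; [by apply: acD => //; exact: acZ|by apply: acB => //; exact: acZ|].
apply: aeS H => x Hx xp; have [dY E] := Hx xp; have [E0 E1] := (dirac_entries _ _ _ _ _ _ _).1 E l.
rewrite !mxE in E0 E1.
have d0 := cder_derive (dY 0 l); have d1 := cder_derive (dY 1 l).
set y0 := derive_cplx _ x in E1 d0; set y1 := derive_cplx _ x in E0 d1.
have e1 : y1 = z * Y z x 0 l - (q x * Y z (x - a) 0 l + p x * Y z (x - a) 1 l) by rewrite -E0 addrK.
have e0 : y0 = p x * Y z (x - a) 0 l - q x * Y z (x - a) 1 l - z * Y z x 1 l by rewrite -E1; ring.
have dp := cderD d1 (cderM (cder_cst 'i x) d0).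
have dm := cderD d1 (cderM (cder_cst (- 'i) x) d0).
split.
- apply: (cder_eq dp); rewrite e0 e1 mul0r add0r.
  move: (Y z x 0 l) (Y z x 1 l) (Y z (x - a) 0 l) (Y z (x - a) 1 l) => u v s t.
  (* The intermediate expression isolates the products of 'i with itself, so that the relation i ^ 2
     = -1 can be applied between two ring identities. *)
  transitivity (z * u - 'i * z * v + ('i * p x) * s - 'i * q x * t - q x * s - p x * t); first by ring.
  transitivity (- ('i * z) * v - ('i * 'i) * (z * u) - (p x * t - 'i * p x * s + 'i * q x * t - ('i * 'i) * q x * s)).
    by rewrite ii; ring.
  by ring.
- rewrite (_ : (fun x0 : R => _ - _) = fun s => Y z s 1 l + - 'i * Y z s 0 l); last by apply/funext => s; rewrite mulNr.
  apply: (cder_eq dm); rewrite e0 e1 mul0r add0r.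
  move: (Y z x 0 l) (Y z x 1 l) (Y z (x - a) 0 l) (Y z (x - a) 1 l) => u v s t.
  transitivity (z * u + 'i * z * v - ('i * p x) * s + 'i * q x * t - q x * s - p x * t); first by ring.
  transitivity ('i * z * v - ('i * 'i) * (z * u) - (p x * t + 'i * p x * s - 'i * q x * t - ('i * 'i) * q x * s)).
    by rewrite ii; ring.
  by ring.
Qed.

(** Chooses representatives that vanish everywhere outside ]a, pi[, so that later support arguments
    hold pointwise. *)
Lemma potential_split (q p : R -> C) : potential a q p ->
  exists f h, [/\ cL2 f /\ cL2 h, supported a f /\ supported a h &
    {ae mu, forall x, x \in `]0, pi[ -> p x + 'i * q x = f x /\ p x - 'i * q x = h x}].
Proof.
move=> [Lq Lp H]; have a0 := a_gt0 ha.
pose D : set R := `]a, pi[%classic.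
have mD : measurable D by exact: measurable_itv.
have L c : cL2 (cut D (fun x => p x + c * q x)).
  have -> : cut D (fun x => p x + c * q x) =
      cut D (fun x => cut `]0, pi[%classic p x + c * cut `]0, pi[%classic q x).
    apply/funext => x; rewrite !cutE; case: ifPn => //; rewrite !mem_setE !in_itv /= => /andP[ax xp].
    by rewrite xp (lt_trans a0 ax).
  by apply: cL2_cut => //; apply: cL2D; [exact: in_L2_cL2|apply: cL2Z; exact: in_L2_cL2].
exists (cut D (fun x => p x + 'i * q x)), (cut D (fun x => p x + - 'i * q x)); split.
- by split.
- by split=> t tD; rewrite cutE mem_setE (negbTE tD).
(* The potential vanishes almost everywhere on the open interval ]0, a[, so the point a needs its
   own null set. *)
- have ne : {ae mu, forall x, x != a}.
    exists [set a]; split; [exact: measurable_set1|exact: lebesgue_measure_set1|].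
    by move=> x /= /negP/negPn/eqP.
  apply: aeS (aeI H ne) => x [Hx xa] xp; rewrite !cutE !mem_setE mulNr.
  case: ifPn => // xD; have xin : x \in `]0, a[.
    move: xD xp; rewrite !in_itv /= negb_and -!leNgt => /orP[h|h] /andP[x0 xp].
      by rewrite x0 lt_neqAle xa.
    by move: h; rewrite leNgt xp.
  have := Hx xin => /matrixP E; have := E 0 0; have := E 0 1; rewrite !mxE /= => -> ->.
  by rewrite mulr0 addr0 subr0.
Qed.

(** By uniqueness the second column of any fundamental matrix, with y_1 (0) = 0 and y_2 (0) = 1, is
    the explicit solution with c = d = 1. *)
Theorem char_fun_form (q p : R -> C) Y : potential a q p -> fundamental_solution a q p Y ->
  exists V1 V2 : R -> C, [/\ cL1 mu V1, band V1 (pi - a), cL1 mu V2, band V2 (pi - a) & forall z,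
    char_fun Y 1 1 z = char_like (- (2 * 'i)^-1) (2 * 'i)^-1 V1 0 z /\
    char_fun Y 1 2 z = char_like 2^-1 2^-1 V2 0 z].
Proof.
move=> Hp HY; have a0 := a_gt0 ha; have [f [h [[Lf Lh] [sf sh] fh]]] := potential_split Hp.
have [L1 b1 L2 b2 E] := sol2_char ha Lf Lh sf sh.
exists (dens1 a f h), (dens2 a f h); split=> // z.
have Lf1 := supported_cL1 a0 Lf sf; have Lh1 := supported_cL1 a0 Lh sh.
have [E1 E2] := E z; rewrite -E1 -E2 /char_fun /=.
have [AC Y0 _] := HY z.
pose Ep x := Y z x 1 1 + 'i * Y z x 0 1; pose Em x := Y z x 1 1 - 'i * Y z x 0 1.
have DY : dirac a z f h Ep Em.
  have [B1 B2 H] := fundamental_dirac z 1 HY; split=> //.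
  by apply: aeS (aeI H fh) => x [Hx fx] xp; have [<- <-] := fx xp; exact: Hx.
have DS := sol2_dirac a0 z 1 1 (pi_le3a ha) Lf1 sf Lh1 sh.
have fh0 : {ae mu, forall x, x \in `]0, a[ -> f x = 0 /\ h x = 0}.
  apply/aeW => x; rewrite in_itv /= => /andP[_ xa].
  by rewrite (supported_le sf (ltW xa)) (supported_le sh (ltW xa)).
have i10 : Y z 0 1 1 = 1 by rewrite Y0 mxE eqxx.
have i00 : Y z 0 0 1 = 0 by rewrite Y0 mxE.
have pi0 := pi_ge0 R.
have [e1 e2] : Ep pi - sol2 a z f h 1 1 pi = 0 /\ Em pi - sol2 a (- z) h f 1 1 pi = 0.
  apply: (dirac_zero a0 (dirac_sub DY DS) fh0) => //.
    by rewrite /Ep i10 i00 sol2_0 // mulr0 addr0 subrr.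
  by rewrite /Em i10 i00 sol2_0 // mulr0 subr0 subrr.
have k0 : (inord (1 - 1) : 'I_2) = 0 by exact: inord0.
have k1 : (inord (2 - 1) : 'I_2) = 1 by exact: inord1.
have k2 : (inord (3 - 1 - 1) : 'I_2) = 1 by exact: inord1.
rewrite k0 k1 ?k2; move/eqP: e1; rewrite subr_eq0 => /eqP <-; move/eqP: e2; rewrite subr_eq0 => /eqP <-.
rewrite /Ep /Em; have i0 : 'i != 0 :> C by rewrite neq0Ci.
by split; field; rewrite ?i0.
Qed.

End Solutions.

(** * Necessity of the two conditions *)

Section Necessity.
Context {R : realType}.
Local Notation C := R[i].
Local Notation mu := (@lebesgue_measure R).
Local Notation rmeas := (@cmeas R _ (measurableTypeR R)).
Variable a : R.
Hypothesis ha : 2 * pi / 5 <= a.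
Hypothesis ha' : a < pi / 2.

Lemma asymptotic11 (lam : int -> C) : asymptotic_form 1 1 lam -> exists (kap : int -> C) (A : R),
  (forall n, \sum_(j < n) normc (kap (zn j)) ^+ 2 <= A) /\ forall n, lam n = n%:~R + kap n.
Proof.
move=> [kap Hk E]; have [A _ HA] := l2_partial Hk; exists kap, A; split=> // n.
by rewrite E (_ : 2 - 1%:R - 1%:R = 0) ?mul0r ?addr0 //; ring.
Qed.

Lemma asymptotic12 (lam : int -> C) : asymptotic_form 1 2 lam -> exists (kap : int -> C) (A : R),
  (forall n, \sum_(j < n) normc (kap (zn j)) ^+ 2 <= A) /\ forall n, lam n = n%:~R - 2^-1 + kap n.
Proof.
move=> [kap Hk E]; have [A _ HA] := l2_partial Hk; exists kap, A; split=> // n.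
by rewrite E (_ : 2 - 1%:R - 2%:R = -1) ?mulN1r //; ring.
Qed.

Lemma pia_pi : pi - a < pi.
Proof. by rewrite gtrBl; exact: a_gt0 ha. Qed.

Lemma pia_ge0 : 0 <= pi - a.
Proof. by have := ha'; have := pi_gt0 R; lra. Qed.

(* The shift z = u - 1/2 turns Delta12 into Delta11. *)
Definition shifted (D : nat -> C -> C) (k : nat) (u : C) : C := - 1 * D k (u + - 2^-1).

Lemma shifted_cos (V : R -> C) : cL1 mu V -> band V (pi - a) -> exists W : R -> C,
  [/\ cL1 mu W, band W (pi - a) &
  forall u, shifted (char_like 2^-1 2^-1 V) 0 u = - csin (u * pi%:C) + FT W u].
Proof.
move=> LV bV; exists (fun t => -1 * (V t * kern (- 2^-1) t)).
have bV' : band V pi by apply: band_le bV; rewrite ltW // pia_pi.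
have L w := (band_L1 LV bV' (rmeas_kern w) (fun t tp => normc_kern w tp)).1.
split; first exact: cL1Z.
  by move=> t; have [->|/bV //] := eqVneq (V t) 0; rewrite mul0r mulr0 eqxx.
move=> u; rewrite /shifted char_like_cos mulN1r opprD; congr (- _ + _).
  by rewrite -csin_half subrK.
have Lk : cL1 mu (fun t => V t * kern (u - 2^-1) t) by exact: L.
rewrite /FT -cIN //; congr cI; apply/funext => t.
rewrite kernD (_ : cexp _ = kern u t) //; ring.
Qed.

(** Once each canonical product is identified with its characteristic function, subtracting the
    trigonometric part leaves a transform in the band pi - a. Each spectrum comes with its own
    fundamental matrix and is treated separately. *)
Theorem necessity (q p : R -> C) (lam1 lam2 : int -> C) : potential a q p ->
  is_spectrum a q p 1 1 lam1 -> is_spectrum a q p 1 2 lam2 ->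
  (exponential_type (fun z => Delta11 lam1 z + csin (z * pi%:C))%R <= (pi - a)%R%:E)%E /\
  (exponential_type (fun z => Delta12 lam2 z - ccos (z * pi%:C))%R <= (pi - a)%R%:E)%E.
Proof.
move=> Hp [Y1 HY1 [Z1 /asymptotic11[kap1 [A1 [HA1 lamE1]]]]] [Y2 HY2 [Z2 /asymptotic12[kap2 [A2 [HA2 lamE2]]]]].
split.
- have [V [W [LV bV _ _ E]]] := char_fun_form ha Hp HY1.
  have bV' : band V pi by apply: band_le bV; rewrite ltW // pia_pi.
  have TD := taylor_family_char_like (- (2 * 'i)^-1) (2 * 'i)^-1 LV bV'.
  have OD : orders (char_like (- (2 * 'i)^-1) (2 * 'i)^-1 V) lam1.
    by apply/(orders_zeros _ TD); rewrite -(funext (fun z => (E z).1)).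
  have U := Delta11_unique HA1 lamE1 TD LV bV pia_pi (char_like_sin V) OD.
  rewrite (_ : (fun z => _) = FT V); first exact: FT_type pia_ge0 LV bV.
  by apply/funext => z; rewrite -U char_like_sin addrAC addNr add0r.
- have [U0 [V [_ _ LV bV E]]] := char_fun_form ha Hp HY2.
  have bV' : band V pi by apply: band_le bV; rewrite ltW // pia_pi.
  have TD := taylor_family_char_like 2^-1 2^-1 LV bV'.
  have OD : orders (char_like 2^-1 2^-1 V) lam2.
    by apply/(orders_zeros _ TD); rewrite -(funext (fun z => (E z).2)).
  have [W [LW bW EW]] := shifted_cos LV bV.
  have OS : orders (shifted (char_like 2^-1 2^-1 V)) (fun n => lam2 n + 2^-1).
    have c0 : -1 != 0 :> C by rewrite oppr_eq0 oner_eq0.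
    have := orders_shift (- 2^-1) c0 OD.
    by congr orders; apply/funext => n; rewrite opprK.
  have lamE n : lam2 n + 2^-1 = n%:~R + kap2 n by rewrite lamE2; ring.
  have U := Delta11_unique HA2 lamE (taylor_family_shift (-1) (- 2^-1) TD) LW bW pia_pi EW OS.
  rewrite (_ : (fun z => _) = FT V); first exact: FT_type pia_ge0 LV bV.
  apply/funext => z; rewrite (Delta12_shift z HA2 lamE2) -U addrK mulN1r opprK char_like_cos.
  by rewrite addrAC subrr add0r.
Qed.

End Necessity.

(** * Recovery of the potentials from their densities *)

Section InversePotential.
Context {R : realType}.
Local Notation C := R[i].
Local Notation mu := (@lebesgue_measure R).
Local Notation rmeas := (@cmeas R _ (measurableTypeR R)).
Local Notation TR := (measurableTypeR R).
Variable a : R.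
Hypothesis ha : 2 * pi / 5 <= a.
Hypothesis ha' : a < pi / 2.

Lemma corr_bounded (f h : R -> C) : cL2 f -> cL2 h -> exists B, forall t, normc (corr f h t) <= B.
Proof.
move=> Lf Lh; exists (\int[mu]_x (normc (f x) ^+ 2) + \int[mu]_x (normc (h x) ^+ 2)) => t.
have Lt : cL2 (fun s => f (t + s)).
  by have := @cL2_aff R 1 t f (or_introl (erefl 1)) Lf; under eq_fun do rewrite mul1r addrC.
have [LP nP] := cL2_prod Lt Lh; apply: le_trans (cI_norm LP) (le_trans nP _).
have := (@integral_aff R 1 t (or_introl (erefl 1)) _ Lf.2).2.
by under eq_Rintegral do rewrite mul1r addrC; move=> ->.
Qed.

Lemma corr_eq (f h f' h' : R -> C) t :
  (forall s, f (t + s) * h s = f' (t + s) * h' s) -> corr f h t = corr f' h' t.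
Proof. by move=> H; congr cI; apply/funext. Qed.

(** [base] solves the linear part f (t + a / 2) = - V t, and [mid] adds the correlation of the two
    base solutions, shifted by a / 2. This is exact because the correlation of the corrected
    potentials equals that of the base solutions. *)
Lemma inverse_potential (Vp Vm : R -> C) : cL2 Vp -> cL2 Vm ->
  (forall t, t \notin `]a / 2, pi - a / 2[ -> Vp t = 0) ->
  (forall t, t \notin `]a / 2, pi - a / 2[ -> Vm t = 0) ->
  exists f h, [/\ cL2 f, cL2 h, supported a f, supported a h &
    Wfun a f h = Vp /\ Wfun a h f = Vm].
Proof.
move=> Lp Lm Zp Zm; have a0 := a_gt0 ha; have pi0 := pi_gt0 R; have a1 := ha; have a2 := ha'.
pose shift (V : R -> C) (t : R) := V (t - a / 2).
pose base V := cut `]a, pi[%classic (fun t => -1 * shift V t).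
pose mid f h := cut `[3 * a / 2, pi - a / 2[%classic (shift (corr f h)).
pose full V W t := base V t + mid (base V) (base W) t.
have Ls V : cL2 V -> cL2 (shift V).
  by move=> LV; have := @cL2_aff R 1 (- (a / 2)) V (or_introl (erefl 1)) LV; under eq_fun do rewrite mul1r.
have Lb V : cL2 V -> cL2 (base V).
  by move=> LV; apply: cL2_cut; [exact: measurable_itv|exact/cL2Z/Ls].
have sb V : supported a (base V) by move=> t tD; rewrite /base cutE mem_setE (negbTE tD).
have Lm' f h : cL2 f -> cL2 h -> supported a f -> supported a h -> cL2 (mid f h).
  move=> Lf Lh sf sh; have [B HB] := corr_bounded Lf Lh.
  have mc : rmeas (corr f h).
    have := (@corr_fubini R a a0 f h (fun=> 1) 1 Lf Lh sf sh (@cmeas_cst _ _ TR 1) _).1.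
    by under eq_fun do rewrite mul1r; move=> H; apply/cL1_meas/H => t; rewrite normc1.
  rewrite (_ : mid f h = cut `[3 * a / 2, pi - a / 2[%classic (cut `[0, pi]%classic (shift (corr f h)))).
    apply: cL2_cut; first exact: measurable_itv.
    apply: (@cL2_bounded R 0 pi B); first by apply: rmeas_shift.
    by move=> t; exact: HB.
  apply/funext => t; rewrite /mid !cutE !mem_setE; case: ifP => //; rewrite !in_itv /= => /andP[h1 h2].
  by rewrite (_ : (0 <= t <= pi)) //; apply/andP; split; lra.
have sf V W : supported a (full V W).
  move=> t tD; rewrite /full sb // add0r /mid cutE mem_setE; case: ifP => //.
  by move: tD; rewrite !in_itv /= negb_and -!leNgt => /orP[h|h] /andP[h1 h2]; exfalso; lra.
have Lf V W : cL2 V -> cL2 W -> cL2 (full V W).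
  by move=> LV LW; apply: cL2D; [exact: Lb|apply: Lm' => //; exact: Lb].
have corrE V W t : a <= t -> corr (full V W) (full W V) t =
    cut `[a, pi - a[%classic (corr (base V) (base W)) t.
  move=> ta; have [tp|tp] := ltP t (pi - a); rewrite cutE mem_setE in_itv /= ta /= ?tp ?ltNge ?tp /=.
  - apply: corr_eq => s.
    have [sa|sa] := leP s a; first by rewrite (supported_le (sf W V) sa) (supported_le (sb W) sa) !mulr0.
    have [ts|ts] := leP pi (t + s).
      by rewrite (supported_ge (sf V W) ts) (supported_ge (sb V) ts) !mul0r.
    rewrite /full /mid !cutE !mem_setE !in_itv /=.
    (* The correction lives on [3 a / 2, pi - a / 2[. Here t + s > 2 a >= pi - a / 2, and s < pi - t
       <= pi - a <= 3 a / 2, so neither argument meets it; both bounds are 5 a >= 2 pi. *)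
    have -> : (t + s < pi - a / 2) = false by lra.
    have -> : (3 * a / 2 <= s) = false by lra.
    by rewrite andbF /= !addr0.
  - rewrite /corr -[RHS](cI0 mu); congr cI; apply/funext => s.
    have [sa|sa] := leP s a; first by rewrite (supported_le (sf W V) sa) mulr0.
    by rewrite (supported_ge (sf V W)) ?mul0r //; lra.
have WE V W : (forall t, t \notin `]a / 2, pi - a / 2[ -> V t = 0) -> Wfun a (full V W) (full W V) = V.
  move=> ZV; apply/funext => t; rewrite /Wfun /full -/(full V W) -/(full W V).
  have -> : base V (t + a / 2) = - V t.
    rewrite /base cutE mem_setE /shift addrK mulN1r; case: ifPn => // tn.
    rewrite ZV ?oppr0 //; apply: contra tn; rewrite !in_itv /= => /andP[h1 h2].
    by apply/andP; split; lra.
  suff -> : cut `[a, pi]%classic (corr (full V W) (full W V)) t = mid (base V) (base W) (t + a / 2).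
    by rewrite opprD opprK addrCA subrr addr0.
  rewrite /mid [RHS]cutE mem_setE in_itv /= /shift addrK.
  have -> : (3 * a / 2 <= t + a / 2) = (a <= t) by apply/idP/idP => ?; lra.
  have -> : (t + a / 2 < pi - a / 2) = (t < pi - a) by apply/idP/idP => ?; lra.
  rewrite [LHS]cutE mem_setE in_itv /=.
  have [ta|ta] /= := leP a t; last by [].
  rewrite corrE // cutE mem_setE in_itv /= ta /=.
  by case: (ltP t (pi - a)) => tpa; [rewrite ifT //; lra|rewrite if_same].
exists (full Vp Vm), (full Vm Vp); split; [exact: Lf|exact: Lf|exact: sf|exact: sf|].
by split; apply: WE.
Qed.

End InversePotential.

(** * Sufficiency of the two conditions *)

Section Sufficiency.
Context {R : realType}.
Local Notation C := R[i].
Local Notation mu := (@lebesgue_measure R).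
Local Notation rmeas := (@cmeas R _ (measurableTypeR R)).
Variable a : R.
Hypothesis ha : 2 * pi / 5 <= a.
Hypothesis ha' : a < pi / 2.

Lemma derive_cder (y : R -> C) x d : cder y x d -> derivable_cplx y x /\ derive_cplx y x = d.
Proof.
move=> [h1 h2]; split; first by split; exact: ex_derive.
by rewrite /derive_cplx !derive1E !derive_val; case: d {h1 h2}.
Qed.

(** * The potentials and the fundamental matrix belonging to f and h *)

Section Realization.
Variables f h : R -> C.
Hypotheses (Lf : cL2 f) (Lh : cL2 h) (sf : supported a f) (sh : supported a h).

Definition pot_p x : C := 2^-1 * (f x + h x).
Definition pot_q x : C := 2^-1 * 'i * (h x - f x).

Lemma pot_potential : potential a pot_q pot_p.
Proof.
split.
- apply: cL2_in_L2; apply: cL2Z; have := cL2D Lh (cL2Z (-1) Lf).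
  by congr cL2; apply/funext => x; rewrite mulN1r.
- by apply: cL2_in_L2; apply: cL2Z; exact: cL2D.
- apply/aeW => x; rewrite in_itv /= => /andP[_ xa]; apply/matrixP => k l.
  rewrite !mxE /pot_q /pot_p (supported_le sf (ltW xa)) (supported_le sh (ltW xa)) subrr addr0 !mulr0 oppr0.
  by rewrite !if_same.
Qed.

Definition sys1 z c d x : C := 2^-1 * 'i * (sol2 a (- z) h f d c x - sol2 a z f h c d x).
Definition sys2 z c d x : C := 2^-1 * (sol2 a z f h c d x + sol2 a (- z) h f d c x).

Lemma sys_solution z c d :
  [/\ absolutely_continuous 0 pi (sys1 z c d), absolutely_continuous 0 pi (sys2 z c d) &
  {ae mu, forall x, x \in `]0, pi[ ->
    [/\ derivable_cplx (sys1 z c d) x, derivable_cplx (sys2 z c d) x,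
     derive_cplx (sys2 z c d) x + (pot_q x * sys1 z c d (x - a) + pot_p x * sys2 z c d (x - a)) = z * sys1 z c d x &
     - derive_cplx (sys1 z c d) x + (pot_p x * sys1 z c d (x - a) - pot_q x * sys2 z c d (x - a)) = z * sys2 z c d x]}].
Proof.
have a0 := a_gt0 ha; have ii : 'i * 'i + 1 = 0 :> C by rewrite -expr2 sqrCi addNr.
have Lf1 := supported_cL1 a0 Lf sf; have Lh1 := supported_cL1 a0 Lh sh.
have [A1 A2 H] := sol2_dirac a0 z c d (pi_le3a ha) Lf1 sf Lh1 sh.
split; [by apply: acZ; exact: acB|by apply: acZ; exact: acD|].
apply: aeS H => x Hx xp; have [dp dm] := Hx xp.
have d2 := cderM (cder_cst 2^-1 x) (cderD dp dm).
have d1 := cderM (cder_cst (2^-1 * 'i) x) (cderD dm (cderM (cder_cst (-1) x) dp)).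
have e1 : (fun s => 2^-1 * 'i * (sol2 a (- z) h f d c s + -1 * sol2 a z f h c d s)) = sys1 z c d.
  by apply/funext => s; rewrite mulN1r.
rewrite e1 in d1; have [D1 ->] := derive_cder d1; have [D2 ->] := derive_cder d2.
split=> //; rewrite /sys1 /sys2 /pot_p /pot_q.
  move: (f x) (h x) (sol2 a z _ _ _ _ x) (sol2 a (- z) _ _ _ _ x) (sol2 a z _ _ _ _ (x - a))
    (sol2 a (- z) _ _ _ _ (x - a)) => F H u v s t.
  apply/eqP; rewrite -subr_eq0; apply/eqP.
  (* The two sides differ by a multiple of i ^ 2 + 1, displayed here as an explicit factor. *)
  by transitivity (('i * 'i + 1) * (4^-1 * (H - F) * (t - s))); [field|rewrite ii mul0r].
move: (f x) (h x) (sol2 a z _ _ _ _ x) (sol2 a (- z) _ _ _ _ x) (sol2 a z _ _ _ _ (x - a))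
  (sol2 a (- z) _ _ _ _ (x - a)) => F H u v s t.
apply/eqP; rewrite -subr_eq0; apply/eqP.
by transitivity (('i * 'i + 1) * (- 2^-1 * z * (u + v))); [field|rewrite ii mul0r].
Qed.

(** The initial columns (1, 0) and (0, 1) correspond to (E+, E-) = (i, - i) and (1, 1) at 0. *)
Definition sysY z x : 'M[C]_2 :=
  mx2 (sys1 z 'i (- 'i) x) (sys1 z 1 1 x) (sys2 z 'i (- 'i) x) (sys2 z 1 1 x).

Lemma sysY_fundamental : fundamental_solution a pot_q pot_p sysY.
Proof.
move=> z; have ii : 'i * 'i = -1 :> C by rewrite -expr2 sqrCi.
have [A1 A2 H1] := sys_solution z 'i (- 'i); have [B1 B2 H2] := sys_solution z 1 1.
have en (k l : 'I_2) : (fun x => sysY z x k l) =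
    (if k == 0 then (if l == 0 then sys1 z 'i (- 'i) else sys1 z 1 1)
     else (if l == 0 then sys2 z 'i (- 'i) else sys2 z 1 1)).
  by apply/funext => x; rewrite mxE; do 2 case: ifP.
split.
- by move=> k l; rewrite en; do 2 case: ifP.
- apply/matrixP => k l; rewrite !mxE /sys1 /sys2 !sol2_0 //; try exact: a_gt0 ha.
  case: (ord2_cases k) => ->; case: (ord2_cases l) => ->; rewrite /=; try ring.
    by transitivity (- ('i * 'i) : C); [field|rewrite ii opprK].
  by field.
- apply: aeS (aeI H1 H2) => x [K1 K2] xp; have [k1 k2 k3 k4] := K1 xp; have [l1 l2 l3 l4] := K2 xp.
  split; first by move=> k l; rewrite en; do 2 case: ifP.
  have vE t k l : sysY z t k l = (if k == 0 then (if l == 0 then sys1 z 'i (- 'i) t else sys1 z 1 1 t)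
      else (if l == 0 then sys2 z 'i (- 'i) t else sys2 z 1 1 t)) by rewrite mxE.
  have dE k l : Defs.derive_mx (sysY z) x k l = derive_cplx (fun t => sysY z t k l) x by rewrite mxE.
  apply/dirac_entries => l; rewrite !dE !en !vE /=.
  by case: (ord2_cases l) => -> /=; [exact: conj k3 k4|exact: conj l3 l4].
Qed.

Lemma sysY_char z : char_fun sysY 1 1 z = char_like (- (2 * 'i)^-1) (2 * 'i)^-1 (dens1 a f h) 0 z /\
  char_fun sysY 1 2 z = char_like 2^-1 2^-1 (dens2 a f h) 0 z.
Proof.
have [_ _ _ _ /(_ z)[E1 E2]] := sol2_char ha Lf Lh sf sh.
rewrite -E1 -E2 /char_fun /=.
have -> : (inord (1 - 1) : 'I_2) = 0 by exact: inord0.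
have -> : (inord (2 - 1) : 'I_2) = 1 by exact: inord1.
rewrite !mxE /= /sys1 /sys2 invfM invCi; move: (sol2 _ _ _ _ _ _ _) (sol2 _ _ _ _ _ _ _) => u v.
by split; ring.
Qed.

End Realization.

(** The type condition makes V vanish almost everywhere outside the closed interval; the cut uses
    the open one, which the shift by a / 2 carries into the support ]a, pi[ of the potentials. *)
Lemma truncated_density (V : R -> C) : cL2 V -> (forall x, x \notin `[0, pi] -> V x = 0) ->
  (exponential_type (FT V) <= (pi - a)%R%:E)%E ->
  exists W : R -> C, [/\ cL2 W, (forall t, t \notin `]a / 2, pi - a / 2[ -> W t = 0) & forall z, FT W z = FT V z].
Proof.
move=> LV V0 ET; pose W := cut `]a / 2, pi - a / 2[%classic V.
have LW : cL2 W by apply: cL2_cut LV; exact: measurable_itv.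
have W0 t : t \notin `]a / 2, pi - a / 2[ -> W t = 0 by move=> tn; rewrite /W cutE mem_setE (negbTE tn).
exists W; split=> // z; have V1 := cL2_cL1 LV V0.
apply: FT_ae => //; first by apply: cL1_cut V1; exact: measurable_itv.
have PW := paley_wiener V1 V0 (pia_ge0 ha') ET.
have ne (e : R) : {ae mu, forall x, x != e}.
  exists [set e]; split; [exact: measurable_set1|exact: lebesgue_measure_set1|].
  by move=> x /= /negP/negPn/eqP.
apply: aeS (aeI PW (aeI (ne (a / 2)) (ne (pi - a / 2)))) => t [Ht [t1 t2]].
rewrite /W cutE mem_setE; case: ifPn => // tn; rewrite Ht // ltNge; apply: contra tn.
rewrite ler_norml in_itv /= => /andP[h1 h2]; rewrite !lt_neqAle t2 eq_sym t1 /=.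
by apply/andP; split; lra.
Qed.

Theorem sufficiency (lam1 lam2 : int -> C) : asymptotic_form 1 1 lam1 -> asymptotic_form 1 2 lam2 ->
  (exponential_type (fun z => Delta11 lam1 z + csin (z * pi%:C))%R <= (pi - a)%R%:E)%E ->
  (exponential_type (fun z => Delta12 lam2 z - ccos (z * pi%:C))%R <= (pi - a)%R%:E)%E ->
  exists q p : R -> C, potential a q p /\ is_spectrum a q p 1 1 lam1 /\ is_spectrum a q p 1 2 lam2.
Proof.
move=> Hl1 Hl2 ET1 ET2.
have [kap1 [A1 [HA1 lamE1]]] := asymptotic11 Hl1; have [kap2 [A2 [HA2 lamE2]]] := asymptotic12 Hl2.
have [U1 [LU1 U10 E1]] := Delta11_FT HA1 lamE1; have [U2 [LU2 U20 E2]] := Delta12_FT HA2 lamE2.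
have ET1' : (exponential_type (FT U1) <= (pi - a)%R%:E)%E.
  by move: ET1; congr (exponential_type _ <= _)%E; apply/funext => z; rewrite E1 char_like_sin addrAC addNr add0r.
have ET2' : (exponential_type (FT U2) <= (pi - a)%R%:E)%E.
  by move: ET2; congr (exponential_type _ <= _)%E; apply/funext => z; rewrite E2 char_like_cos addrAC subrr add0r.
have [V1 [LV1 V10 F1]] := truncated_density LU1 U10 ET1'.
have [V2 [LV2 V20 F2]] := truncated_density LU2 U20 ET2'.
have refl (V : R -> C) : cL2 V -> cL2 (fun t => V (pi - t)).
  have E : (fun t => V (pi - t)) = fun t => V (-1 * t + pi) by apply/funext => t; congr V; ring.
  by rewrite E; apply: cL2_aff; right.
have reflI (t : R) : t \notin `]a / 2, pi - a / 2[ -> pi - t \notin `]a / 2, pi - a / 2[.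
  by apply: contra; rewrite !in_itv /= => /andP[h1 h2]; apply/andP; split; lra.
(* These two densities invert [dens1] and [dens2]: W+ = V2 + i V1, and W- is the reflection of V2 -
   i V1. *)
have [||||f [h [Lf Lh sf sh [Wp Wm]]]] := @inverse_potential R a ha ha' (fun t => V2 t + 'i * V1 t)
    (fun t => V2 (pi - t) + - 'i * V1 (pi - t)).
- by apply: cL2D => //; exact: cL2Z.
- by apply: cL2D; [exact: (refl V2 LV2)|apply: cL2Z; exact: (refl V1 LV1)].
- by move=> t tn; rewrite V10 // V20 // mulr0 addr0.
- by move=> t /reflI tn; rewrite V10 // V20 // mulr0 addr0.
have i0 : 'i != 0 :> C by rewrite neq0Ci.
have d1 : dens1 a f h = V1.
  by apply/funext => t; rewrite /dens1 Wp Wm subKr; field; rewrite i0.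
have d2 : dens2 a f h = V2.
  by apply/funext => t; rewrite /dens2 Wp Wm subKr; field.
have [L1 b1 L2 b2 _] := sol2_char ha Lf Lh sf sh; rewrite d1 d2 in L1 b1 L2 b2.
have bp (V : R -> C) : band V (pi - a) -> band V pi by apply: band_le; rewrite ltW // (pia_pi ha).
exists (pot_q f h), (pot_p f h); split; first exact: pot_potential.
have HY := sysY_fundamental Lf Lh sf sh.
split; exists (sysY f h) => //; split=> //.
- have -> : char_fun (sysY f h) 1 1 = char_like (- (2 * 'i)^-1) (2 * 'i)^-1 V1 0.
    by apply/funext => z; rewrite (sysY_char Lf Lh sf sh z).1 d1.
  have TD := taylor_family_char_like (- (2 * 'i)^-1) (2 * 'i)^-1 L1 (bp _ b1).
  apply/(orders_zeros _ TD)/(Delta11_orders HA1 lamE1 TD) => z.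
  by rewrite E1 !char_like_sin F1.
- have -> : char_fun (sysY f h) 1 2 = char_like 2^-1 2^-1 V2 0.
    by apply/funext => z; rewrite (sysY_char Lf Lh sf sh z).2 d2.
  (* The multiplicities are established for [Delta11] after the half shift and carried back by the
     opposite shift. *)
  set D := char_like 2^-1 2^-1 V2.
  have TD : taylor_family D := taylor_family_char_like 2^-1 2^-1 L2 (bp _ b2).
  have lamE n : lam2 n + 2^-1 = n%:~R + kap2 n by rewrite lamE2; ring.
  have O : orders (shifted D) (fun n => lam2 n + 2^-1).
    apply: (Delta11_orders HA2 lamE); first exact: taylor_family_shift.
    move=> u; have := Delta12_shift (u - 2^-1) HA2 lamE2; rewrite subrK /shifted mulN1r.
    by rewrite E2 => K; apply: oppr_inj; rewrite opprK -K /D !char_like_cos F2.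
  apply/(orders_zeros _ TD).
  have c0 : -1 != 0 :> C by rewrite oppr_eq0 oner_eq0.
  have := orders_shift 2^-1 c0 O.
  have -> : (fun n => lam2 n + 2^-1 - 2^-1) = lam2 by apply/funext => n; rewrite addrK.
  by congr orders; apply/funext => k; apply/funext => z; rewrite /shifted addrK !mulN1r opprK.
Qed.

End Sufficiency.

Local Open Scope ring_scope.
Local Open Scope complex_scope.

Theorem theorem4p1 (R : realType) (a : R) (ha : 2 * pi / 5 <= a)
    (ha' : a < pi / 2) (lam1 lam2 : int -> R[i]) :
  (exists q p : R -> R[i],
     potential a q p /\
     is_spectrum a q p 1 1 lam1 /\ is_spectrum a q p 1 2 lam2)
  <->
  (asymptotic_form 1 1 lam1 /\ asymptotic_form 1 2 lam2) /\
  ((exponential_type (fun z => Delta11 lam1 z + csin (z * pi%:C))%R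
      <= (pi - a)%R%:E)%E /\
   (exponential_type (fun z => Delta12 lam2 z - ccos (z * pi%:C))%R
      <= (pi - a)%R%:E)%E).
Proof.
split=> [[q [p [Hp [H1 H2]]]]|[[H1 H2] [E1 E2]]]; last exact: sufficiency.
split; last exact: necessity Hp H1 H2.
by move: H1 H2 => [Y1 _ [_ A1]] [Y2 _ [_ A2]].
Qed.
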